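(* Assume that $\overline{\mathbf F}$ and $\overline{\mathbf G}$ are regularly varying at infinity with tail indices $\gamma_1>0$ and $\gamma_2>0$, i.e. for every $x>0$, $\overline{\mathbf F}(xz)/\overline{\mathbf F}(z)\to x^{-1/\gamma_1}$ and $\overline{\mathbf G}(xz)/\overline{\mathbf G}(z)\to x^{-1/\gamma_2}$ as $z\to\infty$, with $\gamma_1<\gamma_2$. Let $k=k_n$ be an integer sequence satisfying $1<k<n$, $k\to\infty$ and $k/n\to0$ as $n\to\infty$. Assume that both second-order conditions hold: for every $x>0$, $$\lim_{t\to\infty}\frac{\mathbb{U}_{\mathbf F}(tx)/\mathbb{U}_{\mathbf F}(t)-x^{\gamma_1}}{\mathbf{A}_{\mathbf F}(t)}=x^{\gamma_1}\frac{x^{\tau_1}-1}{\tau_1},\qquad \lim_{t\to\infty}\frac{\mathbb{U}_{\mathbf G}(tx)/\mathbb{U}_{\mathbf G}(t)-x^{\gamma_2}}{\mathbf{A}_{\mathbf G}(t)}=x^{\gamma_2}\frac{x^{\tau_2}-1}{\tau_2},$$ where $\tau_1,\tau_2<0$ and $\mathbf{A}_{\mathbf F},\mathbf{A}_{\mathbf G}$ are functions tending to zero and not changing sign near infinity, whose absolute values are regularly varying at infinity with indices $\tau_1,\tau_2$ respectively. Then there exists a function $\mathbf A_0$ with $\mathbf{A}_0(t)\sim\mathbf{A}_{\mathbf F}\bigl(1/\overline{\mathbf F}(\mathbb{U}_F(t))\bigr)$ as $t\to\infty$ such that, if $\sqrt k\,\mathbf A_0(n/k)\to\lambda$ for some $\lambda\in\mathbb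 R$, then $$\sqrt k\left(\widehat\gamma_1-\gamma_1\right)\overset{\mathcal D}{\longrightarrow}\mathcal N\left(\frac{\lambda}{1-\tau_1},\sigma^2\right)\quad\text{as } n\to\infty,$$ where $$\sigma^2:=\frac{\gamma^2\left(1+\gamma_1/\gamma_2\right)\left(1+(\gamma_1/\gamma_2)^2\right)}{\left(1-\gamma_1/\gamma_2\right)^3}.$$
   Context: Random right-truncation model. Let $(\mathbf X_i,\mathbf Y_i)$, $1\le i\le N$, be i.i.d. copies of a pair $(\mathbf X,\mathbf Y)$ of independent nonnegative random variables on a probability space $(\Omega,\mathcal A,\mathbf P)$, with continuous distribution functions $\mathbf F$ and $\mathbf G$ respectively. The pair $(\mathbf X_i,\mathbf Y_i)$ is observed only when $\mathbf X_i\le\mathbf Y_i$. The observed pairs are denoted $(X_i,Y_i)$, $i=1,\dots,n$, where $n=n_N$ is the (random) number of observed pairs; $n/N\to p:=\mathbf P(\mathbf X\le\mathbf Y)$ in probability. Asymptotics are as $N\to\infty$, so $n\to\infty$ in probability; convergence of $n$ and of quantities depending on it through $k=k_n$ (for instance $k\to\infty$, $k/n\to0$) is understood in probability. Write $\overline K:=1-K$ for any distribution function $K$, and $\mathbb U_K(t):=K^{\leftarrow}(1-1/t)$, $t>1$, for its tail quantile function ($K^{\leftarrow}$ is the generalized inverse). Set $\gamma:=\gamma_1\gamma_2/(\gamma_1+\gamma_2)$. The distribution function of an observed $X$ is (non-bold) $F(x):=\mathbf P(\mathbf X\le x\mid\mathbf X\le\mathbf Y)=p^{-1}\int_0^x\overline{\mathbf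 G}(z)\,d\mathbf F(z)$. Let $C_n(x):=n^{-1}\sum_{i=1}^n\mathbf 1(X_i\le x\le Y_i)$. The product-limit estimator of $\mathbf F$ is $$\mathbf F_n(x):=\prod_{i:\,X_i>x}\exp\left\{-\frac{1}{nC_n(X_i)}\right\},\qquad \overline{\mathbf F}_n:=1-\mathbf F_n.$$ Let $X_{1:n}\le\dots\le X_{n:n}$ be the order statistics of $X_1,\dots,X_n$. The estimator of $\gamma_1$ is $$\widehat\gamma_1:=\frac{1}{\overline{\mathbf F}_n(X_{n-k:n})}\int_{X_{n-k:n}}^\infty\log\frac{x}{X_{n-k:n}}\,d\mathbf F_n(x).$$ $\overset{\mathcal D}{\longrightarrow}$ denotes convergence in distribution and $\mathcal N(m,\sigma^2)$ the normal law with mean $m$ and variance $\sigma^2$. *)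

(* Defs.v *)
From HB Require Import structures.
From mathcomp Require Import all_boot all_order all_algebra finmap.
From mathcomp Require Import all_classical all_reals all_analysis.
Set Implicit Arguments.
Unset Strict Implicit.
Unset Printing Implicit Defensive.
Import Order.TTheory GRing.Theory Num.Theory.
Import numFieldNormedType.Exports.
Local Open Scope classical_set_scope.
Local Open Scope ring_scope.

Section probability_notions.
Context {d : measure_display} {T : measurableType d} {R : realType}.
Variable P : probability T R.

Definition independent_RV (X Y : {RV P >-> R}) : Prop :=
  forall A B : set R, measurable A -> measurable B ->
    P (X @^-1` A `&` Y @^-1` B) = (P (X @^-1` A) * P (Y @^-1` B))%E.

(* [Z] is a sequence of random elements of a measurable type; measurability of
   each [Z i] is not part of the definition. *)
Definition mutually_independent {d' : measure_display}
    {T' : measurableType d'} (Z : nat -> T -> T') : Prop :=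
  forall (J : {fset nat}) (B : nat -> set T'), (forall i, measurable (B i)) ->
    P (\bigcap_(i in [set` J]) Z i @^-1` B i) =
    (\big[*%E/1%E]_(i <- J) P (Z i @^-1` B i))%E.

Definition same_law {d' : measure_display} {T' : measurableType d'}
    (Z Z' : T -> T') : Prop :=
  forall B : set T', measurable B -> P (Z @^-1` B) = P (Z' @^-1` B).

Definition real_cdf (X : {RV P >-> R}) (x : R) : R := fine (cdf X x).

Definition cvg_in_probability (Z : nat -> T -> R) (l : R) : Prop :=
  forall e : R, 0 < e ->
    P [set w | e <= `|Z N w - l|] @[N --> \oo] --> 0%E.

Definition dvg_in_probability (Z : nat -> T -> nat) : Prop :=
  forall m : nat, P [set w | (Z N w <= m)%N] @[N --> \oo] --> 0%E.

(* Pointwise convergence of the distribution functions at the continuity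
   points of the limit. *)
Definition cvg_in_distribution (Z : nat -> T -> R)
    (mu : set R -> \bar R) : Prop :=
  (forall N, measurable_fun setT (Z N)) /\
  forall x : R, {for x, continuous (fun y => mu `]-oo, y]%classic)} ->
    P [set w | Z N w <= x] @[N --> \oo] --> mu `]-oo, x]%classic.

End probability_notions.

Section tails.
Context {R : realType}.
Implicit Types (K f U A : R -> R) (rho gamma tau : R).

Definition survival K (x : R) : R := 1 - K x.

(* K^<-(1 - 1/t), with K^<-(s) = inf {x | s <= K x}; meaningful for 1 < t. *)
Definition tail_quantile K (t : R) : R := inf [set x | 1 - t^-1 <= K x].

Definition regularly_varying f rho : Prop :=
  forall x, 0 < x -> f (x * z) / f z @[z --> +oo] --> x `^ rho.

Definition asymp_equiv f (g : R -> R) : Prop :=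
  f t / g t @[t --> +oo] --> (1 : R).

Definition second_order_auxiliary A tau : Prop :=
  [/\ A t @[t --> +oo] --> 0,
      (\forall t \near +oo, 0 <= A t) \/ (\forall t \near +oo, A t <= 0) &
      regularly_varying (fun t => `|A t|) tau].

Definition second_order_condition U gamma tau A : Prop :=
  forall x, 0 < x ->
    (U (t * x) / U t - x `^ gamma) / A t @[t --> +oo]
      --> x `^ gamma * ((x `^ tau - 1) / tau).

End tails.

Section estimators.
Context {R : realType}.
Implicit Types s : seq (R * R).

(* A sample is the list of the observed pairs (X_i, Y_i), so n = size s. *)

Definition C_n s (x : R) : R :=
  (size s)%:R^-1 * (count (fun z => z.1 <= x <= z.2) s)%:R.

Definition F_n s (x : R) : R :=
  \prod_(z <- s | x < z.1) expR (- ((size s)%:R * C_n s z.1)^-1).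

Lemma C_n_ge0 s x : 0 <= C_n s x.
Proof. by rewrite mulr_ge0// invr_ge0. Qed.

Let factor_itv s (y : R) :
  0 <= expR (- ((size s)%:R * C_n s y)^-1) <= 1.
Proof.
rewrite expR_ge0/= expR_le1 oppr_le0 invr_ge0.
by rewrite mulr_ge0// C_n_ge0.
Qed.

Lemma F_n_nondecreasing s : nondecreasing (F_n s).
Proof.
move=> x y xy; rewrite /F_n big_mkcond/= [leRHS]big_mkcond/=.
apply: ler_prod => z _; have /andP[f0 f1] := factor_itv s z.1.
have [xz|zx] := ltP x z.1; have [yz|zy] := ltP y z.1; rewrite ?f0 ?f1 ?ler01//=.
by have := lt_le_trans yz (le_trans zx xy); rewrite ltxx.
Qed.

Lemma F_n_right_continuous s : right_continuous (F_n s).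
Proof.
move=> x; apply: cvg_near_cst.
have H : \forall y \near x^'+, {in s, forall z : R * R, (y < z.1) = (x < z.1)}.
  elim: s => [|z s IHs]; first exact: filterE.
  have Hz : \forall y \near x^'+, (y < z.1) = (x < z.1).
    have [xz|zx] := ltP x z.1.
      by near=> y; near: y; exact: nbhs_right_lt.
    near=> y; apply/negbTE; rewrite -leNgt (le_trans zx)//.
  apply: filterS2 Hz IHs => y yz ys z'.
  by rewrite inE => /predU1P[->//|/ys].
apply: filterS H => y ys; rewrite /F_n big_seq_cond [RHS]big_seq_cond.
by apply: eq_bigl => z; case: (boolP (z \in s)) => //= /ys.
Unshelve. all: by end_near. Qed.

HB.instance Definition _ s := isCumulative.Build R _ R (F_n s)
  (@F_n_nondecreasing s) (@F_n_right_continuous s).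

(* X_{j:n}, for 1 <= j <= n. *)
Definition order_stat s (j : nat) : R :=
  nth 0 (sort <=%R [seq z.1 | z <- s]) j.-1.

Definition gamma1_hat s (k : nat) : R :=
  let a := order_stat s (size s - k) in
  (survival (F_n s) a)^-1 *
  \int[lebesgue_stieltjes_measure (F_n s)]_(x in `[a, +oo[) ln (x / a).

End estimators.

Section random_truncation.
Context {d : measure_display} {T : measurableType d} {R : realType}.
Variable P : probability T R.

(* The pairs (Xs i, Ys i), i : nat, are i.i.d. copies of (X, Y). *)
Definition truncation_model (X Y : {RV P >-> R}) (Xs Ys : nat -> {RV P >-> R})
    : Prop :=
  [/\ (forall w, 0 <= X w) /\ (forall w, 0 <= Y w),
      independent_RV X Y,
      continuous (real_cdf X) /\ continuous (real_cdf Y),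
      mutually_independent P (fun i w => (Xs i w, Ys i w)) &
      forall i, same_law P (fun w => (Xs i w, Ys i w)) (fun w => (X w, Y w))].

(* The distribution function of X conditionally on X <= Y. *)
Definition observed_cdf (X Y : {RV P >-> R}) (x : R) : R :=
  fine (P [set w | X w <= x /\ X w <= Y w]) / fine (P [set w | X w <= Y w]).

(* The pairs observed among the first N. *)
Definition observed_sample (Xs Ys : nat -> {RV P >-> R}) (N : nat) (w : T)
    : seq (R * R) :=
  [seq (Xs i w, Ys i w) | i <- iota 0 N & Xs i w <= Ys i w].

Definition observed_size (Xs Ys : nat -> {RV P >-> R}) (N : nat) (w : T)
    : nat :=
  size (observed_sample Xs Ys N w).

End random_truncation.

(* Main.v *)
(** A sample of size [N] contains [n] observed pairs with binomial probabilities,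
    and given [n] these pairs are i.i.d. with the conditional law, so it is enough
    to find the limit of the distribution function of the estimator for a
    deterministic sample size [n], in the filter of the sets of sizes whose
    complement has vanishing binomial mass. By Mecke's formula the threshold
    [X_{n-k:n}] is a distinguished sample point [a] above which there are exactly [k]
    other points, and given [a] these are i.i.d. with the law of an observed [X]
    above [a]. The event [gamma1_hat <= th] is that a weighted sum of
    [ln (x / a) - th] over these points is nonpositive. Up to an error bounded in
    mean, the weights are proportional to [1 / survival G], which turns the event
    into one about a sum of i.i.d. scores. Its limit is given by a Lindeberg
    central limit theorem proved by Stein's method; the mean and the variance of a
    score come from the second-order condition and Potter's bounds, dominated
    thanks to [gamma1 < gamma2]. *)

Require Import Defs.
From HB Require Import structures.
From mathcomp Require Import all_boot all_order all_algebra finmap.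
From mathcomp Require Import all_classical all_reals all_analysis.
From mathcomp Require Import measurable_realfun ring lra zify.
Set Implicit Arguments.
Unset Strict Implicit.
Unset Printing Implicit Defensive.
Import Order.TTheory GRing.Theory Num.Theory.
Import numFieldNormedType.Exports.
Local Open Scope classical_set_scope.
Local Open Scope ring_scope.

(** Two obstacles shape the proof. The weight of a point above the threshold is a jump of [F_n],
    which depends on the whole sample through [C_n]; it has to be replaced by a function of the
    point alone, at a total cost of smaller order than [sqrt k]. No empirical process is
    approximated: by Mecke's formula the number at risk seen from one point is binomial, and
    explicit negative moments give the cost. The threshold is random, so the central limit theorem
    is needed uniformly over its likely values; the filter [size_pairs], of sizes paired with
    levels, turns this uniformity into an ordinary limit. Integrals over a tail are brought to the
    fixed interval []0, 1[] by the substitution [x = U (t / u)]. With [r = gamma1 / gamma2], the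
    density of an observed exceedance behaves there like u^r and the weight like u^(-r), so the
    second moment of the score requires u^(-r) times a squared logarithm to be integrable: this is
    where [gamma1 < gamma2] enters. The mean of the score has slope [1 + r] in [th], up to sign, and
    this slope relates its variance to [sigma2]. *)

Local Notation leb := (@lebesgue_measure _).

(** * Limits of real functions along a filter *)

Section limits.
Context {R : realType} {T : Type} {F : set_system T} {FF : Filter F}.
Implicit Types (f g : T -> R) (a b c : R).

Lemma lim_eq f g a : (\forall t \near F, f t = g t) ->
  f t @[t --> F] --> a -> g t @[t --> F] --> a.
Proof.
by move=> fg; apply: cvg_trans; apply: near_eq_cvg; apply: filterS fg => t.
Qed.

Lemma lim_add f g a b : f t @[t --> F] --> a -> g t @[t --> F] --> b ->
  (f t + g t) @[t --> F] --> a + b.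
Proof. exact: cvgD. Qed.

Lemma lim_sub f g a b : f t @[t --> F] --> a -> g t @[t --> F] --> b ->
  (f t - g t) @[t --> F] --> a - b.
Proof. exact: cvgB. Qed.

Lemma lim_mul f g a b : f t @[t --> F] --> a -> g t @[t --> F] --> b ->
  (f t * g t) @[t --> F] --> a * b.
Proof. exact: cvgM. Qed.

Lemma lim_scale c f a : f t @[t --> F] --> a -> (c * f t) @[t --> F] --> c * a.
Proof. by move=> fa; apply: lim_mul => //; exact: cvg_cst. Qed.

Lemma lim_inv f a : a != 0 -> f t @[t --> F] --> a -> (f t)^-1 @[t --> F] --> a^-1.
Proof. by move=> a0 fa; exact: cvgV. Qed.

Lemma lim_div f g a b : b != 0 -> f t @[t --> F] --> a -> g t @[t --> F] --> b ->
  (f t / g t) @[t --> F] --> a / b.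
Proof. by move=> b0 fa gb; apply: lim_mul => //; exact: lim_inv. Qed.

Lemma lim_norm0 f g : (\forall t \near F, `|f t| <= g t) ->
  g t @[t --> F] --> (0 : R) -> f t @[t --> F] --> (0 : R).
Proof.
move=> fg g0; apply/cvgr0Pnorm_le => e e0.
have /cvgr0Pnorm_le/(_ _ e0) := g0; apply: filterS2 fg => t fg.
by apply: le_trans; rewrite (le_trans fg)// ler_norm.
Qed.

Lemma lim_abs f a : f t @[t --> F] --> a -> `|f t| @[t --> F] --> `|a|.
Proof. exact: cvg_norm. Qed.

End limits.

Arguments lim_scale {R T F FF} c {f a}.

(** * Integrability of real-valued functions *)

Section real_integrals.
Context d (T : measurableType d) (R : realType).
Variables (mu : {measure set T -> \bar R}) (D : set T).
Hypothesis mD : measurable D.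

Lemma integrableDR (F G : T -> R) : mu.-integrable D (EFin \o F) ->
  mu.-integrable D (EFin \o G) -> mu.-integrable D (EFin \o (fun z => F z + G z)).
Proof. by move=> iF iG; exact: (integrableD mD iF iG). Qed.

Lemma integrableBR (F G : T -> R) : mu.-integrable D (EFin \o F) ->
  mu.-integrable D (EFin \o G) -> mu.-integrable D (EFin \o (fun z => F z - G z)).
Proof. by move=> iF iG; exact: (integrableB mD iF iG). Qed.

Lemma integrableZR (c : R) (F : T -> R) : mu.-integrable D (EFin \o F) ->
  mu.-integrable D (EFin \o (fun z => c * F z)).
Proof. by move=> iF; exact: (integrableZl mD c iF). Qed.

End real_integrals.

Lemma integrable_le d (T : measurableType d) (R : realType)
    (mu : {measure set T -> \bar R}) (D : set T) (f g : T -> R) : measurable D ->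
  measurable_fun D f -> mu.-integrable D (EFin \o g) ->
  (forall x, D x -> `|f x| <= g x) -> mu.-integrable D (EFin \o f).
Proof.
move=> mD mf ig fg; apply: le_integrable ig => //; first exact/measurable_EFinP.
by move=> x Dx /=; rewrite lee_fin (le_trans (fg x Dx))// ler_norm.
Qed.

(** * Iterated integrals over lists *)

Section iterated_integral.
Context d (E : measurableType d) (R : realType).
Variable mu : {sigma_finite_measure set E -> \bar R}.
Implicit Types (D : set E) (f : seq E -> \bar R) (n : nat).
Local Open Scope ereal_scope.

(** Expectations over an i.i.d. sample, with functions defined on lists of any length: thinning a
    sample and singling out one of its points both change the length. The measure is restricted to
    [D] and not normalised, so dividing by [mu D ^+ n] gives an expectation under the conditional
    law on [D]. *)
Fixpoint iter_int D n f : \bar R :=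
  if n is n'.+1 then \int[mu]_(x in D) iter_int D n' (fun l => f (x :: l))
  else f [::].

End iterated_integral.

(** * Measurability of functions of a list *)

Section measurability_on_lists.
Context d (E : measurableType d).

(** Measurability is asked on each length separately, through tuples. The parameter in [S] makes
    inductions on the length possible: the head of the list moves into the parameter. *)
Definition lmeas dS (S : measurableType dS) dU (U : measurableType dU)
    (f : S -> seq E -> U) : Prop :=
  forall n, measurable_fun [set: S * n.-tuple E] (fun st => f st.1 st.2).

Lemma lmeas_cons dS (S : measurableType dS) dU (U : measurableType dU)
    (f : S -> seq E -> U) :
  lmeas f -> lmeas (fun (sx : S * E) l => f sx.1 (sx.2 :: l)).
Proof.
move=> mf n.
have -> : (fun st : S * E * n.-tuple E => f st.1.1 (st.1.2 :: st.2)) =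
  (fun st : S * n.+1.-tuple E => f st.1 st.2) \o
  (fun st : S * E * n.-tuple E => (st.1.1, [the n.+1.-tuple E of st.1.2 :: st.2])).
  by [].
apply: measurableT_comp; first exact: mf.
apply: measurable_fun_pair; first by apply: measurableT_comp => //; exact: measurable_fst.
apply: measurable_cons => //.
by apply: measurableT_comp => //.
Qed.

Lemma lmeas_param dS (S : measurableType dS) dS' (S' : measurableType dS')
    dU (U : measurableType dU) (f : S -> seq E -> U) (g : S' -> S) :
  lmeas f -> measurable_fun setT g -> lmeas (fun s => f (g s)).
Proof.
move=> mf mg n.
have -> : (fun st : S' * n.-tuple E => f (g st.1) st.2) =
  (fun st : S * n.-tuple E => f st.1 st.2) \o
  (fun st : S' * n.-tuple E => (g st.1, st.2)) by [].
apply: measurableT_comp; first exact: mf.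
by apply: measurable_fun_pair => //; exact: measurableT_comp.
Qed.

Lemma lmeas_comp dS (S : measurableType dS) dU (U : measurableType dU)
  dV (V : measurableType dV) (f : S -> seq E -> U) (g : U -> V) :
  lmeas f -> measurable_fun setT g -> lmeas (fun s l => g (f s l)).
Proof. by move=> mf mg n; exact: (measurableT_comp mg (mf n)). Qed.

Lemma lmeasT dS (S : measurableType dS) dU (U : measurableType dU)
    (f : S -> seq E -> U) n (t : n.-tuple E) :
  lmeas f -> measurable_fun setT (fun s => f s t).
Proof.
move=> mf.
have -> : (fun s => f s t) = (fun st : S * n.-tuple E => f st.1 st.2) \o
  (fun s : S => (s, t)) by [].
by apply: measurableT_comp; [exact: mf|exact: measurable_fun_pair].
Qed.

End measurability_on_lists.

(** * Calculus of iterated integrals: thinning and Mecke's formula *)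

Section iterated_integral_theory.
Context d (E : measurableType d) (R : realType).
Variable mu : {sigma_finite_measure set E -> \bar R}.
Local Open Scope ereal_scope.
Local Notation J := (iter_int mu).
Implicit Types D : set E.

Lemma measurable_integral_param dS (S : measurableType dS) D
    (f : S * E -> \bar R) :
  measurable D -> (forall z, 0 <= f z) -> measurable_fun setT f ->
  measurable_fun setT (fun s => \int[mu]_(x in D) f (s, x)).
Proof.
move=> mD f0 mf.
have -> : (fun s => \int[mu]_(x in D) f (s, x)) =
   fubini_F mu (f \_ (setT `*` D)).
  apply/funext => s; rewrite /fubini_F [LHS]integral_mkcond.
  by apply: eq_integral => x _; rewrite !patchE in_setX in_setT.
apply: measurable_fun_fubini_tonelli_F.
  by apply/(measurable_restrictT _ (measurableX measurableT mD))/measurable_funTS.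
by move=> z; rewrite patchE; case: ifP.
Qed.

Lemma iter_int_ge0 D n (f : seq E -> \bar R) :
  (forall l, 0 <= f l) -> 0 <= J D n f.
Proof.
elim: n f => [|n IH] f f0 //=.
by apply: integral_ge0 => x _; apply: IH.
Qed.
Hint Resolve iter_int_ge0 : core.

Lemma measurable_iter_int dS (S : measurableType dS) D n
    (f : S -> seq E -> \bar R) :
  measurable D -> (forall s l, 0 <= f s l) -> lmeas f ->
  measurable_fun setT (fun s => J D n (f s)).
Proof.
move=> mD; elim: n dS S f => [|n IH] dS S f f0 mf /=.
  exact: (lmeasT [tuple] mf).
apply: (@measurable_integral_param _ _ D
   (fun sx => J D n (fun l => f sx.1 (sx.2 :: l)))) => //.
  by move=> z; apply: iter_int_ge0.
apply: IH => //; exact: lmeas_cons.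
Qed.

Definition lmeas1 dU (U : measurableType dU) (f : seq E -> U) :=
  lmeas (fun (_ : unit) l => f l).

Lemma lmeas1_cons dU (U : measurableType dU) (f : seq E -> U) :
  lmeas1 f -> lmeas (fun x l => f (x :: l)).
Proof.
move=> /lmeas_cons/(lmeas_param (g := fun x : E => (tt, x))); apply.
exact: measurable_fun_pair.
Qed.

Lemma lmeas_at dS (S : measurableType dS) dU (U : measurableType dU)
    (f : S -> seq E -> U) s : lmeas f -> lmeas1 (f s).
Proof. by move=> /(lmeas_param (g := fun _ : unit => s)); apply. Qed.
Hint Resolve lmeas1_cons lmeas_at : core.

Lemma measurable_iter_int1 D n (f : seq E -> \bar R) :
  measurable D -> (forall l, 0 <= f l) -> lmeas1 f ->
  measurable_fun setT (fun x => J D n (fun l => f (x :: l))).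
Proof. by move=> mD f0 mf; apply: measurable_iter_int => //; exact: lmeas1_cons. Qed.

Lemma lmeas1_tl dU (U : measurableType dU) (f : seq E -> U) x :
  lmeas1 f -> lmeas1 (fun l => f (x :: l)).
Proof. by move=> mf; exact: (lmeas_at x (lmeas1_cons mf)). Qed.
Hint Resolve lmeas1_tl : core.

Lemma le_iter_int D n (f g : seq E -> \bar R) :
  measurable D -> (forall l, 0 <= f l) -> (forall l, 0 <= g l) ->
  lmeas1 f -> lmeas1 g ->
  (forall l, size l = n -> all (mem D) l -> f l <= g l) -> J D n f <= J D n g.
Proof.
move=> mD; elim: n f g => [|n IH] f g f0 g0 mf mg fg /=; first exact: fg.
apply: ge0_le_integral => //.
- by move=> x _; apply: iter_int_ge0.
- by apply/measurable_funTS/measurable_iter_int1.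
- by apply/measurable_funTS/measurable_iter_int1.
move=> x Dx; apply: IH => //; try exact: lmeas1_tl.
by move=> l ln Dl; apply: fg; rewrite /= ?ln// Dl andbT inE.
Qed.

Lemma eq_iter_int D n (f g : seq E -> \bar R) :
  (forall l, size l = n -> all (mem D) l -> f l = g l) -> J D n f = J D n g.
Proof.
elim: n f g => [|n IH] f g fg /=; first exact: fg.
apply: eq_integral => x; rewrite inE => Dx.
by apply: IH => l ln Dl; apply: fg; rewrite /= ?ln// Dl andbT inE.
Qed.

Lemma iter_intD D n (f g : seq E -> \bar R) :
  measurable D -> (forall l, 0 <= f l) -> (forall l, 0 <= g l) ->
  lmeas1 f -> lmeas1 g -> J D n (fun l => f l + g l) = J D n f + J D n g.
Proof.
move=> mD; elim: n f g => [|n IH] f g f0 g0 mf mg //=.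
rewrite -ge0_integralD//; last 4 first.
- by move=> x _; apply: iter_int_ge0.
- by apply/measurable_funTS/measurable_iter_int1.
- by move=> x _; apply: iter_int_ge0.
- by apply/measurable_funTS/measurable_iter_int1.
by apply: eq_integral => x _; rewrite IH//; exact: lmeas1_tl.
Qed.

Lemma iter_intZ D n (f : seq E -> \bar R) (c : \bar R) :
  measurable D -> (forall l, 0 <= f l) -> 0 <= c ->
  lmeas1 f -> J D n (fun l => c * f l) = c * J D n f.
Proof.
move=> mD; elim: n f => [|n IH] f f0 c0 mf //=.
rewrite -ge0_integralZl//; last 2 first.
- by apply/measurable_funTS/measurable_iter_int1.
- by move=> x _; apply: iter_int_ge0.
by apply: eq_integral => x _; rewrite IH//; exact: lmeas1_tl.
Qed.

Lemma iter_int_cst D n c :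
  measurable D -> 0 <= c -> J D n (fun _ => c) = c * mu D ^+ n.
Proof.
move=> mD c0; elim: n => [|n IH]; first by rewrite /= mule1.
by rewrite expeS [LHS]/= IH integral_cst// -muleA (muleC (mu D)).
Qed.

Lemma lmeas1_cst dU (U : measurableType dU) (c : U) : lmeas1 (fun _ => c).
Proof. by move=> n. Qed.

Lemma lmeasnS n dS (S : measurableType dS) dU (U : measurableType dU)
    (f : S -> seq E -> U) :
  measurable_fun [set: S * E * n.-tuple E]
    (fun st => f st.1.1 (st.1.2 :: st.2)) ->
  measurable_fun [set: S * n.+1.-tuple E] (fun st => f st.1 st.2).
Proof.
move=> fS.
have -> : (fun st : S * n.+1.-tuple E => f st.1 st.2) =
  (fun st : S * E * n.-tuple E => f st.1.1 (st.1.2 :: st.2)) \o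
  (fun st : S * n.+1.-tuple E => ((st.1, thead st.2), [tuple of behead st.2])).
  by apply/funext => -[s t] /=; rewrite [in LHS](tuple_eta t).
apply: measurableT_comp; first exact: fS.
apply: measurable_fun_pair; first apply: measurable_fun_pair => //.
  by apply: (measurableT_comp (measurable_tnth ord0)).
apply: (measurableT_comp (@measurable_behead _ E n)) => //.
Qed.

(** Filtering changes the length, so a fixed length of the result cannot be assumed; the induction
    is on the unfiltered list, a kept head becoming part of the parameter of [f]. *)
Lemma lmeas_filter dS (S : measurableType dS) dU (U : measurableType dU)
    (b : S -> pred E) (f : S -> seq E -> U) :
  measurable_fun setT (fun sx : S * E => b sx.1 sx.2) -> lmeas f ->
  lmeas (fun s l => f s ([seq x <- l | b s x])).
Proof.
move=> mb mf n; elim: n dS S b f mb mf => [|n IH] dS S b f mb mf.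
  have -> : (fun st : S * 0.-tuple E => f st.1 ([seq x <- st.2 | b st.1 x])) =
     (fun s => f s [::]) \o fst by apply/funext => -[s t] /=; rewrite (tuple0 t).
  by apply: measurableT_comp => //; exact: (lmeasT [tuple] mf).
apply: (@lmeasnS n _ S _ U (fun s l => f s ([seq x <- l | b s x]))).
have -> : (fun st : S * E * n.-tuple E =>
     f st.1.1 [seq x <- st.1.2 :: st.2 | b st.1.1 x]) =
   (fun st => if b st.1.1 st.1.2 then f st.1.1 (st.1.2 :: [seq x <- st.2 | b st.1.1 x])
              else f st.1.1 ([seq x <- st.2 | b st.1.1 x])).
  by apply/funext => st /=; case: ifP.
have mb' : measurable_fun setT (fun sx : S * E * E => b sx.1.1 sx.2).
  have -> : (fun sx : S * E * E => b sx.1.1 sx.2) =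
    (fun sx => b sx.1 sx.2) \o (fun sx : S * E * E => (sx.1.1, sx.2)) by [].
  apply: measurableT_comp => //; apply: measurable_fun_pair => //.
  exact: measurableT_comp.
apply: measurable_fun_ifT.
- have -> : (fun t : S * E * n.-tuple E => b t.1.1 t.1.2) =
    (fun sx => b sx.1 sx.2) \o fst by [].
  exact: measurableT_comp.
- exact: (IH _ _ (fun sx => b sx.1) (fun sx l => f sx.1 (sx.2 :: l)) mb'
    (lmeas_cons mf)).
- exact: (IH _ _ (fun sx => b sx.1) (fun sx l => f sx.1 l) mb'
    (lmeas_param mf measurable_fst)).
Qed.

Lemma lmeas1_filter dU (U : measurableType dU) (b : pred E) (f : seq E -> U) :
  measurable_fun setT b -> lmeas1 f -> lmeas1 (fun l => f ([seq x <- l | b x])).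
Proof.
move=> mb mf; apply: (@lmeas_filter _ unit _ U (fun _ => b) (fun _ => f)) => //.
exact: measurableT_comp.
Qed.

(** Binomial thinning: every discarded point contributes the factor [q], and the kept ones range
    over the part of [D] where [b] holds. It serves twice, for the pairs observed among [N] and for
    the observations above a threshold. *)
Lemma iter_int_filter D (b : pred E) N (f : seq E -> \bar R) (q : R) :
  measurable D -> measurable_fun setT b ->
  mu (D `&` [set x | ~~ b x]) = q%:E ->
  (forall l, 0 <= f l) -> lmeas1 f ->
  J D N (fun l => f ([seq x <- l | b x])) =
  \sum_(0 <= n < N.+1) ('C(N, n)%:R * q ^+ (N - n))%:E *
     J (D `&` [set x | b x]) n f.
Proof.
move=> mD mb Dq.
have mB : measurable [set x | b x].
  by have := mb measurableT [set true] I; rewrite setTI.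
have mBC : measurable [set x | ~~ b x].
  have := measurableC mB; congr measurable.
  by apply/seteqP; split => x /=; [move/negP|move/negP].
have mDB : measurable (D `&` [set x | b x]) by exact: measurableI.
have mDBC : measurable (D `&` [set x | ~~ b x]) by exact: measurableI.
have q0 : (0 <= q)%R by rewrite -lee_fin -Dq.
have c0 m n : 0 <= ('C(m, n)%:R * q ^+ (m - n))%:E.
  by rewrite lee_fin mulr_ge0// exprn_ge0.
elim: N f => [|N IH] f f0 mf.
  by rewrite big_nat1 /= bin0 expr0 mulr1 mul1e.
have D_split : D = (D `&` [set x | b x]) `|` (D `&` [set x | ~~ b x]).
  rewrite -setIUr; apply/seteqP; split => x /=; last by case.
  by move=> Dx; split => //; case: (b x); [left|right].
have -> : J D N.+1 (fun l => f [seq x <- l | b x]) =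
    \int[mu]_(x in D `&` [set x | b x])
      J D N (fun l => f (if b x then x :: [seq x <- l | b x] else [seq x <- l | b x])) +
    \int[mu]_(x in D `&` [set x | ~~ b x])
      J D N (fun l => f (if b x then x :: [seq x <- l | b x] else [seq x <- l | b x])).
  have := @ge0_integral_setU _ _ _ mu _ _ mDB mDBC (fun x => J D N (fun l =>
    f (if b x then x :: [seq x <- l | b x] else [seq x <- l | b x]))).
  rewrite -D_split; apply.
  - apply/measurable_funTS/(measurable_iter_int1 N mD
      (fun l => f0 [seq x <- l | b x])).
    exact: lmeas1_filter.
  - by move=> x _; exact: iter_int_ge0.
  - by apply/disj_set2P/seteqP; split => // x /= [[_ bx] [_]]; rewrite bx.
have -> : \int[mu]_(x in D `&` [set x | b x])
    J D N (fun l => f (if b x then x :: [seq x <- l | b x] else [seq x <- l | b x])) =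
  \sum_(0 <= n < N.+1) ('C(N, n)%:R * q ^+ (N - n))%:E *
     J (D `&` [set x | b x]) n.+1 f.
  under eq_integral => x.
    rewrite inE => -[Dx /= ->].
    rewrite (IH (fun l => f (x :: l)))//; last exact: lmeas1_tl.
    over.
  rewrite ge0_integral_sum//; last 2 first.
  - move=> n; apply/measurable_funTS/measurable_funeM.
    exact: measurable_iter_int1.
  - by move=> n x _; rewrite mule_ge0//; exact: iter_int_ge0.
  apply: eq_bigr => n _; rewrite ge0_integralZl//.
  - by apply/measurable_funTS/measurable_iter_int1.
  - by move=> x _; exact: iter_int_ge0.
have -> : \int[mu]_(x in D `&` [set x | ~~ b x])
    J D N (fun l => f (if b x then x :: [seq x <- l | b x] else [seq x <- l | b x])) =
  \sum_(0 <= n < N.+1) ('C(N, n)%:R * q ^+ (N.+1 - n))%:E *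
     J (D `&` [set x | b x]) n f.
  under eq_integral => x.
    rewrite inE => -[Dx /= /negbTE ->].
    rewrite IH//.
    over.
  rewrite integral_cst//= Dq ge0_sume_distrl; last first.
    by move=> n _; rewrite mule_ge0//; exact: iter_int_ge0.
  rewrite !big_nat; apply: eq_bigr => n /andP[_ nN].
  by rewrite subSn// exprSr mulrA [in RHS]EFinM muleAC.
set a := fun n => J (D `&` [set x | b x]) n f.
have a0 n : 0 <= a n by exact: iter_int_ge0.
(* Keeping or discarding the first point gives two sums, which Pascal's rule combines. The term
   added below to align their ranges carries the coefficient ['C(N, N.+1)], which is 0. *)
rewrite [in RHS]big_nat_recl// bin0 subn0.
rewrite [X in _ + X = _]big_nat_recl// bin0 subn0.
rewrite addeCA; congr (_ + _).
have -> : \sum_(0 <= n < N) ('C(N, n.+1)%:R * q ^+ (N.+1 - n.+1))%:E * a n.+1 =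
    \sum_(0 <= n < N.+1) ('C(N, n.+1)%:R * q ^+ (N.+1 - n.+1))%:E * a n.+1.
  by rewrite [RHS]big_nat_recr//= bin_small// mul0r mul0e adde0.
rewrite -big_split; apply: eq_bigr => n _.
rewrite [LHS]addeC binS subSS -/(a n.+1) -ge0_muleDl//; last first.
  by rewrite lee_fin mulr_ge0// exprn_ge0.
by rewrite -EFinD natrD mulrDl.
Qed.

(** The sum of Mecke's formula: each entry is paired with the list of the others. The entries
    already passed are carried by the function argument, so that the recursion matches that of
    [iter_int]. *)
Fixpoint msum (g : E -> seq E -> \bar R) (l : seq E) : \bar R :=
  if l is x :: l' then g x l' + msum (fun y m => g y (x :: m)) l' else 0.

Lemma msum_ge0 g l : (forall x m, 0 <= g x m) -> 0 <= msum g l.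
Proof.
by elim: l g => [|x l IH] g g0 //=; rewrite adde_ge0// IH.
Qed.

(** For a symmetric [G] it does not matter that the distinguished entry has been moved to the
    front. *)
Lemma msum_perm (G : E -> seq E -> \bar R) l :
  (forall x m m', perm_eq m m' -> G x m = G x m') ->
  msum (fun x m => G x (x :: m)) l = \sum_(x <- l) G x l.
Proof.
elim: l G => [|x l IH] G Gp; first by rewrite big_nil.
rewrite big_cons /=; congr (_ + _).
rewrite -(IH (fun y m => G y (x :: m))); last first.
  by move=> y m m' mm'; apply: Gp; rewrite perm_cons.
have : forall g g', (forall y m, g y m = g' y m) -> msum g l = msum g' l.
  by elim: l {IH} => [|z l IH] g g' gg' //=; rewrite gg'; congr (_ + _); apply: IH.
apply => y m; apply: Gp.
by rewrite -[X in perm_eq X _]/([:: y] ++ [:: x] ++ m) perm_catCA.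
Qed.

Lemma lmeas_msum dS (S : measurableType dS) (g : S * E -> seq E -> \bar R) :
  lmeas g -> lmeas (fun s l => msum (fun y => g (s, y)) l).
Proof.
move=> mg n; elim: n dS S g mg => [|n IH] dS S g mg.
  have -> : (fun st : S * 0.-tuple E => msum (fun y => g (st.1, y)) st.2) =
     (fun _ => 0) by apply/funext => -[s t] /=; rewrite (tuple0 t).
  exact: measurable_cst.
apply: (@lmeasnS n _ S _ _ (fun s l => msum (fun y => g (s, y)) l)) => /=.
apply: emeasurable_funD.
  have -> : (fun st : S * E * n.-tuple E => g (st.1.1, st.1.2) st.2) =
    (fun st => g st.1 st.2) by apply/funext => -[[]].
  exact: mg.
apply: (IH _ _ (fun sy m => g (sy.1.1, sy.2) (sy.1.2 :: m))).
apply: (@lmeas_param _ _ _ _ _ _ _ _ _ (fun sy : S * E * E => ((sy.1.1, sy.2), sy.1.2))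
  (lmeas_cons mg)).
apply: measurable_fun_pair; first apply: measurable_fun_pair => //.
  by apply: (measurableT_comp measurable_fst).
by apply: (measurableT_comp measurable_snd).
Qed.

Lemma lmeas1_msum (g : E -> seq E -> \bar R) : lmeas g -> lmeas1 (msum g).
Proof.
move=> mg; apply: (@lmeas_msum _ unit (fun sy => g sy.2)).
exact: lmeas_param.
Qed.

(* Mecke's formula. *)
Lemma iter_int_msum D n (g : E -> seq E -> \bar R) :
  measurable D -> (forall x l, 0 <= g x l) -> lmeas g ->
  J D n.+1 (msum g) = n.+1%:R%:E * \int[mu]_(x in D) J D n (g x).
Proof.
move=> mD; elim: n g => [|n IH] g g0 mg.
  by rewrite mul1e /=; apply: eq_integral => x _; rewrite adde0.
have mJ : measurable_fun setT
    (fun xy : E * E => J D n (fun m => g xy.2 (xy.1 :: m))).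
  apply: (@measurable_iter_int _ _ D n (fun (xy : E * E) m => g xy.2 (xy.1 :: m))) => //.
  apply: (@lmeas_param _ _ _ _ _ _ _ _ _ (fun xy : E * E => (xy.2, xy.1)) (lmeas_cons mg)).
  exact: measurable_fun_pair.
have mgx x : lmeas (fun y m => g y (x :: m)).
  apply: (@lmeas_param _ _ _ _ _ _ _ _ _ (fun y => (y, x)) (lmeas_cons mg)).
  exact: measurable_fun_pair.
have J0 x y : 0 <= J D n (fun m => g y (x :: m)) by exact: iter_int_ge0.
have -> : J D n.+2 (msum g) = \int[mu]_(x in D) (J D n.+1 (g x) +
    n.+1%:R%:E * \int[mu]_(y in D) J D n (fun m => g y (x :: m))).
  rewrite [LHS]/=; apply: eq_integral => x _.
  rewrite -(IH (fun y m => g y (x :: m)))// -iter_intD//.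
  - by move=> l; apply: msum_ge0.
  - exact: lmeas_at mg.
  - by apply: lmeas1_msum.
have mI : measurable_fun setT
    (fun x => \int[mu]_(y in D) J D n (fun m => g y (x :: m))).
  exact: (@measurable_integral_param _ _ D (fun xy => J D n (fun m => g xy.2 (xy.1 :: m)))).
have mJ1 : measurable_fun setT (fun x => J D n.+1 (g x)).
  by apply: measurable_iter_int.
rewrite ge0_integralD//; last 4 first.
- by move=> x _; apply: (@iter_int_ge0 D n.+1).
- exact: measurable_funTS.
- by move=> x _; rewrite mule_ge0//; exact: integral_ge0.
- by apply/measurable_funTS/measurable_funeM.
rewrite ge0_integralZl//; last 2 first.
- exact: measurable_funTS.
- by move=> x _; exact: integral_ge0.
(* By Tonelli the distinguished point [y] becomes the outer variable and [x] rejoins the list. The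
   domain is first turned into a restriction of the integrand, since the exchange is made over the
   whole space. *)
have -> : \int[mu]_(x in D) \int[mu]_(y in D) J D n (fun m => g y (x :: m)) =
    \int[mu]_(x in D) J D n.+1 (g x).
  rewrite [LHS]integral_mkcond [RHS]integral_mkcond.
  have := @fubini_tonelli _ _ _ _ _ mu mu
    ((fun xy => J D n (fun m => g xy.2 (xy.1 :: m))) \_ (D `*` D)).
  set F := _ \_ _ => /(_ _ _)/wrap[].
    by apply/(measurable_restrictT _ (measurableX mD mD))/measurable_funTS.
    by move=> z; rewrite /F patchE; case: ifP.
  have HL x y : F (x, y) = ((fun x => ((fun y => J D n (fun m => g y (x :: m))) \_ D) y) \_ D) x.
    rewrite /F !patchE in_setX /=.
    by case: (x \in D); case: (y \in D).
  move=> H; transitivity (\int[mu]_x \int[mu]_y F (x, y)).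
    apply: eq_integral => x _; rewrite patchE; case: ifPn => xD.
      rewrite integral_mkcond; apply: eq_integral => y _.
      by rewrite HL [RHS]patchE xD.
    by under eq_integral do rewrite HL patchE (negbTE xD); rewrite integral0.
  rewrite H; apply: eq_integral => y _; rewrite patchE; case: ifPn => yD.
    rewrite [RHS]/= [RHS]integral_mkcond; apply: eq_integral => x _.
    by rewrite HL !patchE yD.
  under eq_integral do rewrite HL !patchE (negbTE yD) if_same.
  by rewrite integral0.
by rewrite -{1}[X in X + _]mul1e -ge0_muleDl ?lee_fin// -EFinD -natr1 addrC natr1.
Qed.

End iterated_integral_theory.

(** * Finite measures on tuples are determined on cylinders *)

Section tuple_cylinders.
Context d (E : measurableType d) (n : nat).

Definition cylinder : set (set (n.-tuple E)) :=
  [set B | exists2 C : 'I_n -> set E, forall i, measurable (C i) &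
           B = \bigcap_i [set t | C i (tnth t i)]].

Lemma measurable_cylinder B : cylinder B -> measurable B.
Proof.
move=> [C mC ->]; apply: fin_bigcap_measurable => // i _.
by have := @measurable_tnth _ E n i measurableT _ (mC i); rewrite setTI.
Qed.

Lemma cylinderT : cylinder setT.
Proof.
exists (fun _ => setT) => //.
by apply/seteqP; split.
Qed.

Lemma measurable_tupleE :
  (measurable : set (set (n.-tuple E))) = <<s cylinder >>.
Proof.
apply/seteqP; split => [A|A].
  apply: smallest_sub; first exact: smallest_sigma_algebra.
  move=> B; rewrite -bigcup_seq => -[i /= _ [C mC <-]].
  apply: sub_sigma_algebra.
  exists (fun j => if j == i then C else setT).
    by move=> j; case: ifP.
  apply/seteqP; split => [t [_ /= Ct] j _ /=|t /= /(_ i I) /=].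
    by case: eqP => // ->.
  by rewrite eqxx.
apply: smallest_sub; first exact: sigma_algebra_measurable.
exact: measurable_cylinder.
Qed.

Lemma setI_closed_cylinder : setI_closed cylinder.
Proof.
move=> _ _ [C mC ->] [D mD ->]; exists (fun i => C i `&` D i).
  by move=> i; exact: measurableI.
apply/seteqP; split => t /=; first by move=> [Ct Dt] i _ /=; split; [exact: Ct|exact: Dt].
by move=> CDt; split => i _ /=; have [] := CDt i I.
Qed.

Lemma measure_tuple_unique (R : realType)
    (m1 m2 : {measure set (n.-tuple E) -> \bar R}) :
  (m1 setT < +oo)%E -> (forall B, cylinder B -> m1 B = m2 B) ->
  forall B, measurable B -> m1 B = m2 B.
Proof.
move=> m1oo m12; apply: (measure_unique cylinder (fun=> setT)) => //.
- exact: measurable_tupleE.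
- exact: setI_closed_cylinder.
- by move=> _; exact: cylinderT.
- by rewrite bigcup_const.
Qed.

End tuple_cylinders.

(** * The law of an i.i.d. sample as an iterated integral *)

Section law_of_sample.
Context d (T : measurableType d) (R : realType) (P : probability T R).
Context dE (E : measurableType dE) (mu : probability E R).
Variable Z : nat -> T -> E.
Hypothesis mZ : forall i, measurable_fun setT (Z i).
Hypothesis indepZ : mutually_independent P Z.
Hypothesis lawZ : forall i B, measurable B -> P (Z i @^-1` B) = mu B.
Local Open Scope ereal_scope.

Let V m n (w : T) : n.-tuple E := map_tuple (Z^~ w) (iota_tuple n m).

Let tnth_V m n w (i : 'I_n) : tnth (V m n w) i = Z (m + i) w.
Proof. by rewrite tnth_map (tnth_nth 0%N)/= nth_iota. Qed.

Let mV m n : measurable_fun setT (V m n).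
Proof.
apply/measurable_fun_tnthP => i.
rewrite (_ : _ \o _ = Z (m + i))//.
by apply/funext => w /=; exact: tnth_V.
Qed.

Let V_cylinder m n (C : 'I_n -> set E) :
  V m n @^-1` (\bigcap_i [set t | C i (tnth t i)]) =
  \bigcap_(j in [set` [fset x in iota m n]%fset])
     Z j @^-1` (if insub (j - m)%N is Some i then C i else setT).
Proof.
apply/seteqP; split => w /= Cw.
  move=> j /=; rewrite !inE mem_iota => /andP[mj jmn].
  case: insubP => [i _ iE|//].
  by have := Cw i I; rewrite /= tnth_V iE subnKC.
move=> i _ /=; rewrite tnth_V.
have := Cw (m + i)%N; rewrite /= !inE mem_iota leq_addr ltn_add2l ltn_ord.
by rewrite addKn => /(_ isT); rewrite valK.
Qed.

Let indep_head m n A (C : 'I_n -> set E) : measurable A ->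
  (forall i, measurable (C i)) ->
  P (Z m @^-1` A `&` V m.+1 n @^-1` (\bigcap_i [set t | C i (tnth t i)])) =
  mu A * P (V m.+1 n @^-1` (\bigcap_i [set t | C i (tnth t i)])).
Proof.
move=> mA mC.
pose B j := if j == m then A else if insub (j - m.+1)%N is Some i then C i else setT.
have mB j : measurable (B j).
  by rewrite /B; case: ifP => // _; case: insub.
have BE j : j \in iota m.+1 n ->
    B j = if insub (j - m.+1)%N is Some i then C i else setT.
  rewrite /B mem_iota => /andP[mj _]; case: eqP => // jm.
  by move: mj; rewrite jm ltnn.
have miota : m \notin iota m.+1 n by rewrite mem_iota ltnn.
have -> : Z m @^-1` A `&` V m.+1 n @^-1` (\bigcap_i [set t | C i (tnth t i)]) =
    \bigcap_(j in [set` [fset x in iota m n.+1]%fset]) Z j @^-1` B j.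
  rewrite V_cylinder; apply/seteqP; split => w /=.
    move=> [Aw Cw] j /=; rewrite !inE => /predU1P[->|jm].
      by rewrite /B eqxx.
    by rewrite BE//; apply: Cw => /=; rewrite !inE.
  move=> Bw; split.
    by have := Bw m; rewrite /= !inE eqxx /B eqxx; exact.
  move=> j /=; rewrite !inE => jm; rewrite -BE//; apply: Bw => /=.
  by rewrite !inE jm orbT.
rewrite V_cylinder.
have -> : \bigcap_(j in [set` [fset x in iota m.+1 n]%fset])
     Z j @^-1` (if insub (j - m.+1)%N is Some i then C i else setT) =
    \bigcap_(j in [set` [fset x in iota m.+1 n]%fset]) Z j @^-1` B j.
  by apply: eq_bigcapr => j /=; rewrite !inE => jm; rewrite BE.
rewrite !indepZ//.
have permI k : perm_eq [fset x in iota m k]%fset (iota m k).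
  by apply: uniq_perm; [exact: fset_uniq|exact: iota_uniq|move=> x; rewrite inE].
have permI1 k : perm_eq [fset x in iota m.+1 k]%fset (iota m.+1 k).
  by apply: uniq_perm; [exact: fset_uniq|exact: iota_uniq|move=> x; rewrite inE].
rewrite (perm_big _ (permI n.+1)) (perm_big _ (permI1 n)) /= big_cons.
by rewrite lawZ// /B eqxx.
Qed.

(** The first variable and the tuple of the following ones are independent, so their joint law is a
    product measure and Tonelli's theorem peels off the first integral. The starting index [m] moves
    along the induction. *)
Lemma integral_sample m n (f : seq E -> \bar R) :
  (forall l, 0 <= f l) -> lmeas1 f ->
  \int[P]_w f [seq Z i w | i <- iota m n] = iter_int mu setT n f.
Proof.
elim: n m f => [|n IH] m f f0 mf.
  by rewrite [RHS]/= -[RHS]mule1 -(probability_setT P) -integral_cst.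
pose VV : {mfun T >-> n.-tuple E} := HB.pack (V m.+1 n)
  (isMeasurableFun.Build _ _ _ _ _ (@mV m.+1 n)).
pose phi w := (Z m w, V m.+1 n w).
have mphi : measurable_fun setT phi.
  by apply: measurable_fun_pair; [exact: mZ|exact: mV].
pose PH : {mfun T >-> (E * n.-tuple E)%type} := HB.pack phi
  (isMeasurableFun.Build _ _ _ _ _ mphi).
pose F (z : E * n.-tuple E) := f (z.1 :: z.2).
have mF : measurable_fun setT F by exact: (lmeas1_cons mf).
(* For a fixed [A], both sides are finite measures in the second factor; they are compared on
   cylinders, where mutual independence gives the product. *)
have prodE X : measurable X -> (mu \x distribution P VV) X = distribution P PH X.
  apply: product_measure_unique => A B mA mB.
  have mZA : measurable (Z m @^-1` A).
    by rewrite -[X in measurable X]setTI; exact: mZ.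
  pose m1' : {measure set (n.-tuple E) -> \bar R} :=
    [the {measure set _ -> \bar R} of pushforward (mrestr P mZA) VV].
  pose m1 := m1' (@mV m.+1 n).
  have muA : (mu A \is a fin_num) by exact: fin_num_measure.
  pose m2 : {measure set (n.-tuple E) -> \bar R} :=
    mscale (NngNum (fine_ge0 (measure_ge0 mu A))) (distribution P VV).
  have H : forall B, measurable B -> m1 B = m2 B.
    apply: measure_tuple_unique.
      rewrite /m1 /m1' /= /pushforward /mrestr preimage_setT setTI.
      by rewrite (le_lt_trans (probability_le1 _ _))// ltry.
    move=> _ [C mC ->]; rewrite /m1 /m1' /m2 /= /mscale /pushforward /mrestr /=.
    by rewrite fineK// setIC /distribution /pushforward; exact: indep_head.
  have := H _ mB; rewrite /m1 /m1' /m2 /= /mscale /pushforward /mrestr /= fineK//.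
  by rewrite /distribution /pushforward /= setIC => <-.
transitivity (\int[distribution P PH]_z F z).
  by rewrite (ge0_integral_distribution PH mF)// => z; exact: f0.
rewrite (eq_measure_integral (mu \x distribution P VV)); last first.
  by move=> A mA _; exact/esym/prodE.
rewrite (fubini_tonelli1 F mF (fun z => f0 _)) /fubini_F [RHS]/=.
apply: eq_integral => x _.
have mFx : measurable_fun setT (fun t : n.-tuple E => F (x, t)).
  have -> : (fun t : n.-tuple E => F (x, t)) =
    (fun st : unit * n.-tuple E => f (x :: st.2)) \o pair tt by [].
  by apply: measurableT_comp; [exact: (lmeas1_tl x mf)|exact: measurable_fun_pair].
rewrite ge0_integral_distribution//; last by move=> y; exact: f0.
by rewrite -(IH m.+1 (fun l => f (x :: l)))//; exact: lmeas1_tl.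
Qed.

End law_of_sample.

Lemma mem_set_itv (R : realType) (i : interval R) x : (x \in [set` i]) = (x \in i).
Proof. by apply/idP/idP => [/set_mem//|xi]; exact: mem_set. Qed.

Lemma measurable_invr (R : realType) : measurable_fun setT (@GRing.inv R).
Proof.
(* The inverse is not continuous at 0. Writing it with a power of the square avoids a case
   distinction: for [x = 0] the factor [x] gives the default value 0. *)
rewrite (_ : GRing.inv = fun x : R => x * (x ^+ 2) `^ (-1)).
  apply: measurable_funM => //.
  have m2 : measurable_fun setT (fun x : R => x ^+ 2) by exact: measurable_funX.
  exact: (measurableT_comp (measurable_powR (-1)) m2).
apply/funext => x; have [->|x0] := eqVneq x 0; first by rewrite invr0 mul0r.
by rewrite powR_inv1 ?sqr_ge0// expr2 invfM mulrA divff ?mul1r.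
Qed.

(** * Products of factors as step functions, and their Stieltjes measure *)

Section product_limit.
Context {R : realType}.
Implicit Types (e phi : R -> R) (v : seq R).

(* The integral of [phi] against the jumps of
   [fun u => \prod_(x <- v | u < x) e x], for [v] nonincreasing. *)
Fixpoint jump_sum e phi v : R :=
  if v is x :: v' then (1 - e x) * phi x + e x * jump_sum e phi v' else 0.

Lemma eq_jump_sum e phi psi v : {in v, phi =1 psi} ->
  jump_sum e phi v = jump_sum e psi v.
Proof.
elim: v => //= x v IHv H; rewrite H ?mem_head// IHv// => y yv.
by rewrite H// inE yv orbT.
Qed.

Lemma jump_sumB e phi psi v :
  jump_sum e (fun x => phi x - psi x) v = jump_sum e phi v - jump_sum e psi v.
Proof. by elim: v => /= [|x v ->]; [rewrite subrr|ring]. Qed.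

Lemma jump_sumZ e (c : R) phi v :
  jump_sum e (fun x => c * phi x) v = c * jump_sum e phi v.
Proof. by elim: v => /= [|x v ->]; [rewrite mulr0|ring]. Qed.

(** The product telescopes into its jumps. Sortedness ensures that once a point is not above [u], no
    later one is. *)
Lemma jump_sum_tail e v u : sorted >=%R v ->
  \prod_(x <- v | u < x) e x = 1 - jump_sum e (fun x => (u < x)%R%:R) v.
Proof.
elim: v => [|x v IHv] vs; first by rewrite big_nil subr0.
rewrite big_cons IHv ?(path_sorted vs)//=; have [ux|ux] := ltP u x.
  by rewrite mulr1; ring.
rewrite mulr0 add0r (@eq_jump_sum _ _ (fun _ => 0 * 0)).
  by rewrite jump_sumZ; ring.
move=> y yv; rewrite mulr0.
have : y <= x.
  move: vs => /= /order_path_min; move=> /(_ _)/wrap[]; last by move=> /allP/(_ y yv).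
  by move=> a b c /= ab bc; exact: le_trans bc ab.
by move=> yx; rewrite ltNge (le_trans yx)// leNgt.
Qed.

Lemma jump_sum_sum e phi v : sorted >%R v ->
  jump_sum e phi v = \sum_(x <- v) (\prod_(y <- v | x < y) e y) * (1 - e x) * phi x.
Proof.
elim: v => [|x v IHv] vs; first by rewrite big_nil.
have xv y : y \in v -> y < x.
  move: vs => /= /order_path_min; move=> /(_ _)/wrap[]; last by move=> /allP; apply.
  by move=> a b c /= ab bc; exact: lt_trans bc ab.
rewrite big_cons big_cons ltxx /= IHv ?(path_sorted vs)//.
congr (_ + _).
  rewrite big_seq_cond big1 ?mul1r// => y /andP[/xv yx xy].
  by have := lt_trans yx xy; rewrite ltxx.
rewrite mulr_sumr big_seq_cond [RHS]big_seq_cond; apply: eq_bigr => y /andP[yv _].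
by rewrite big_cons xv// !mulrA.
Qed.

(** The recursion of [jump_sum] read as a mixture: a Dirac mass of weight [1 - e x], and the measure
    of the remaining points with weight [e x]. Ties among the points are allowed. *)
Lemma jump_measure e v : (forall x, 0 <= e x <= 1) ->
  exists m : {measure set (measurableTypeR R) -> \bar R},
  forall phi : measurableTypeR R -> R, (forall x, 0 <= phi x) -> measurable_fun setT phi ->
    (\int[m]_x (phi x)%:E = (jump_sum e phi v)%:E)%E.
Proof.
move=> e01; elim: v => [|x v [m IHm]].
  by exists mzero => phi phi0 mphi; rewrite integral_measure_zero.
have /andP[e0 e1] := e01 x; have e1' : 0 <= 1 - e x by rewrite subr_ge0.
exists (measure_add (mscale (NngNum e1') (\d_(x : measurableTypeR R))) (mscale (NngNum e0) m)).
move=> phi phi0 mphi.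
have mE : measurable_fun setT (EFin \o phi) by exact/measurable_EFinP.
rewrite ge0_integral_measure_add//; [|by move=> ? _; rewrite lee_fin].
rewrite !ge0_integral_mscale//; try by move=> ? _; rewrite lee_fin.
rewrite IHm// integral_dirac// diracT mul1e /= -!EFinM -EFinD//.
Qed.

(** The discrete measure gives half-open intervals the increments of [f], so by uniqueness it is the
    Lebesgue-Stieltjes measure, and integrals against [f] are finite sums. *)
Lemma jump_lebesgue_stieltjes (f : cumulative R R) e v : (forall x, 0 <= e x <= 1) ->
  (forall u, f u = 1 - jump_sum e (fun x => (u < x)%R%:R) v) ->
  forall (phi : R -> R), (forall x, 0 <= phi x) -> measurable_fun setT phi ->
  (\int[lebesgue_stieltjes_measure f]_x (phi x)%:E = (jump_sum e phi v)%:E)%E.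
Proof.
move=> e01 fE phi phi0 mphi; have [m Hm] := jump_measure v e01.
rewrite -Hm//; apply: eq_measure_integral => A mA _.
apply: lebesgue_stieltjes_measure_unique mA => X /ocitvP[->|[[a b] /= ab ->]].
  by rewrite !measure0.
rewrite /lebesgue_stieltjes_measure /measure_extension measurable_mu_extE/=; last exact: is_ocitv.
rewrite wlength_itv/= lte_fin ab.
have -> : m `]a, b]%classic = (\int[m]_x (\1_(`]a, b]%classic) x : R)%:E)%E.
  by rewrite integral_indic// setIT.
have mi : measurable_fun setT (\1_(`]a, b]%classic) : R -> R) by exact: measurable_indic.
rewrite Hm//.
rewrite -EFinB !fE; congr _%:E.
set ja := jump_sum _ (fun x => (a < x)%R%:R) _.
set jb := jump_sum _ (fun x => (b < x)%R%:R) _.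
rewrite (_ : 1 - jb - (1 - ja) = ja - jb); last by ring.
rewrite -jump_sumB.
apply: eq_jump_sum => x _; rewrite indicE.
have -> : (x \in `]a, b]%classic) = (a < x <= b) by rewrite mem_set_itv in_itv.
have [ax|ax] := ltP a x; have [bx|bx] := ltP b x; rewrite /= ?subrr ?subr0//.
by have := lt_trans ab bx; rewrite ltNge ax.
Qed.

End product_limit.

(** * The estimator as a ratio of finite sums *)

Section gamma_hat.
Context {R : realType}.
Implicit Types (s : seq (R * R)).

Definition step_factor s (x : R) := expR (- ((size s)%:R * C_n s x)^-1).
Definition desc_values s : seq R := rev (sort <=%R [seq z.1 | z <- s]).

Lemma step_factor01 s x : 0 <= step_factor s x <= 1.
Proof.
rewrite expR_ge0/= expR_le1 oppr_le0 invr_ge0.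
by rewrite mulr_ge0// C_n_ge0.
Qed.

Lemma desc_values_sorted s : sorted >=%R (desc_values s).
Proof. by rewrite rev_sorted sort_sorted//; exact: le_total. Qed.

Lemma perm_desc_values s : perm_eq (desc_values s) [seq z.1 | z <- s].
Proof. by rewrite perm_rev perm_sort. Qed.

Lemma F_nE s u : F_n s u = 1 - jump_sum (step_factor s) (fun x => (u < x)%R%:R) (desc_values s).
Proof.
rewrite -jump_sum_tail ?desc_values_sorted// (perm_big _ (perm_desc_values s)).
by rewrite big_map.
Qed.

(** Stated without any condition on signs or ties, so that it also gives the measurability of the
    estimator on all samples. *)
Lemma gamma1_hatE s k : let a := order_stat s (size s - k) in
  gamma1_hat s k =
  (jump_sum (step_factor s) (fun x => (a < x)%R%:R) (desc_values s))^-1 *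
  jump_sum (step_factor s) (fun x => (a < x)%R%:R * ln (x / a)) (desc_values s).
Proof.
move=> a; rewrite /gamma1_hat -/a; congr (_^-1 * _).
  by rewrite /survival F_nE opprB addrC subrK.
(* The end point of the ray contributes nothing: [ln (a / a)] is 0, also for [a = 0], where [a / a]
   is 0 and [ln 0] is 0. *)
have -> : jump_sum (step_factor s) (fun x => (a < x)%R%:R * ln (x / a)) (desc_values s) =
   jump_sum (step_factor s) (fun x => (a <= x)%R%:R * ln (x / a)) (desc_values s).
  apply: eq_jump_sum => x _; rewrite le_eqVlt.
  have [<-|//] := eqVneq a x; rewrite ltxx mul0r mul1r.
  have [->|an] := eqVneq a 0; first by rewrite invr0 mulr0 ln0.
  by rewrite divff// ln1.
rewrite /Rintegral integral_mkcond.
rewrite (_ : _ \_ _ = fun x => ((a <= x)%R%:R * ln (x / a))%:E); last first.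
  apply/funext => x; rewrite patchE.
  have -> : (x \in `[a, +oo[%classic) = (a <= x) by rewrite mem_set_itv in_itv/= andbT.
  by case: ifP => _; rewrite ?mul1r ?mul0r.
have mphi : measurable_fun setT (fun x : R => (a <= x)%R%:R * ln (x / a)).
  apply: measurable_funM.
    have -> : (fun x : R => (a <= x)%R%:R) = \1_(`[a, +oo[%classic) :> (R -> R).
      apply/funext => x; rewrite indicE.
      by have -> : (x \in `[a, +oo[%classic) = (a <= x) by rewrite mem_set_itv in_itv/= andbT.
    exact: measurable_indic.
  apply: measurableT_comp; first exact: measurable_ln.
  exact: measurable_funM.
have [a0|a0] := leP 0 a.
  rewrite (jump_lebesgue_stieltjes (step_factor01 s) (F_nE s))//.
  move=> x; have [ax|] := leP a x; last by rewrite mul0r.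
  rewrite mul1r; move: a0; rewrite le_eqVlt => /predU1P[<-|a0].
    by rewrite invr0 mulr0 ln0.
  by rewrite ln_ge0// ler_pdivlMr// mul1r.
(* for [a < 0] the integrand is nonpositive, [ln] being [0] on nonpositive numbers *)
have phi0 x : 0 <= - ((a <= x)%R%:R * ln (x / a)).
  have [ax|] := leP a x; last by rewrite mul0r oppr0.
  rewrite mul1r oppr_ge0; have [xa0|xa0] := leP (x / a) 0; first by rewrite ln0.
  by rewrite ln_le0// ler_ndivrMr// mul1r.
have -> : (fun x => ((a <= x)%R%:R * ln (x / a))%:E) =
    fun x => (- (- ((a <= x)%R%:R * ln (x / a)))%:E)%E.
  by apply/funext => x; rewrite EFinN oppeK.
rewrite integral_ge0N; last by move=> x _; rewrite lee_fin.
rewrite (jump_lebesgue_stieltjes (step_factor01 s) (F_nE s) phi0)//; last exact: measurableT_comp.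
rewrite /= -[RHS]opprK; congr (- _).
rewrite -mulN1r -jump_sumZ; apply: eq_jump_sum => x _; by rewrite mulN1r.
Qed.

Section tie_free.
Variables (s : seq (R * R)) (k : nat).
Hypothesis s_uniq : uniq [seq z.1 | z <- s].
Hypothesis k_lt : (0 < k < size s)%N.
Hypothesis s_obs : all (fun z => z.1 <= z.2) s.
Hypothesis s_ge0 : all (fun z => 0 <= z.1) s.
Let a := order_stat s (size s - k).

Lemma order_stat_mem : a \in [seq z.1 | z <- s].
Proof.
rewrite -(mem_sort <=%R) mem_nth// size_sort size_map.
by move: k_lt; lia.
Qed.

(** Without ties the sorted values increase strictly, so exactly those after the rank [n - k] exceed
    [a]; ranks start at 1 and positions in the sorted list at 0. *)
Lemma count_gt_order_stat : count (fun z => a < z.1) s = k.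
Proof.
have /andP[k0 ks] := k_lt.
pose w := sort <=%R [seq z.1 | z <- s].
have ws : sorted <%R w.
  by rewrite lt_sorted_uniq_le sort_uniq s_uniq sort_sorted//; exact: le_total.
have sw : size w = size s by rewrite size_sort size_map.
pose j := (size s - k).-1.
have js : (j < size w)%N by rewrite sw /j; lia.
have -> : count (fun z => a < z.1) s = count (fun x => a < x) w.
  by rewrite (permP (_ : perm_eq w [seq z.1 | z <- s])) ?perm_sort// count_map.
have cE := count_le_nth 0 ws js.
have := count_predC (<= a) w; rewrite cE sw => E.
have -> : count (fun x => a < x) w = count (predC (<= a)) w.
  by apply: eq_count => x; rewrite /= ltNge.
by move: E; rewrite /j; lia.
Qed.

(** The estimator is a weighted mean of [ln (x / a)] whose weights are the jumps of [F_n], with a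
    positive total; multiplying by the total turns the event into the sign of a linear statistic.
    The total is positive because some point lies above [a] and each point is at risk at its own
    value. *)
Lemma gamma1_hat_le theta : (gamma1_hat s k <= theta) =
  (\sum_(z <- s | a < z.1) F_n s z.1 * (1 - step_factor s z.1) * (ln (z.1 / a) - theta) <= 0).
Proof.
have vs : sorted >%R (desc_values s).
  rewrite rev_sorted lt_sorted_uniq_le sort_uniq s_uniq sort_sorted//.
  exact: le_total.
have jE (phi : R -> R) : jump_sum (step_factor s) (fun x => (a < x)%R%:R * phi x) (desc_values s) =
    \sum_(z <- s | a < z.1) F_n s z.1 * (1 - step_factor s z.1) * phi z.1.
  rewrite jump_sum_sum// (perm_big _ (perm_desc_values s)) big_map [RHS]big_mkcond/=.
  apply: eq_bigr => z _; rewrite (perm_big _ (perm_desc_values s)) big_map.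
  by case: ifP => _; rewrite ?mul0r ?mulr0// mul1r.
rewrite gamma1_hatE -/a.
set d := jump_sum _ (fun x => (a < x)%R%:R) _.
have dE : d = \sum_(z <- s | a < z.1) F_n s z.1 * (1 - step_factor s z.1).
  rewrite /d (eq_jump_sum _ (psi := fun x => (a < x)%R%:R * 1)); last by move=> x _; rewrite mulr1.
  by rewrite jE; apply: eq_bigr => z _; rewrite mulr1.
have d0 : 0 < d.
  have Fn0 x : 0 < F_n s x by rewrite /F_n prodr_gt0// => z _; exact: expR_gt0.
  have e1 z : z \in s -> 0 < F_n s z.1 * (1 - step_factor s z.1).
    move=> zs; rewrite mulr_gt0// subr_gt0 /step_factor -[X in _ < X]expR0 ltr_expR oppr_lt0.
    rewrite invr_gt0 /C_n mulrA divff ?mul1r; last first.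
      by rewrite pnatr_eq0 -lt0n; move: k_lt; lia.
    rewrite ltr0n -has_count.
    by apply/hasP; exists z; rewrite // lexx (allP s_obs z zs).
  rewrite dE lt_neqAle sumr_ge0 ?andbT; last first.
    by move=> z _; rewrite mulr_ge0 ?(ltW (Fn0 _))// subr_ge0; case/andP: (step_factor01 s z.1).
  have [z zs az] : exists2 z, z \in s & a < z.1.
    by apply/hasP; rewrite has_count count_gt_order_stat; case/andP: k_lt.
  rewrite eq_sym psumr_neq0; last first.
    by move=> y _; rewrite mulr_ge0 ?(ltW (Fn0 _))// subr_ge0; case/andP: (step_factor01 s y.1).
  by apply/hasP; exists z; rewrite // az e1.
rewrite mulrC ler_pdivrMr// -subr_le0.
rewrite -jump_sumZ -jump_sumB.
rewrite (eq_jump_sum _ (psi := fun x => (a < x)%R%:R * (ln (x / a) - theta))); last first.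
  by move=> x _; ring.
by rewrite jE.
Qed.

End tie_free.
End gamma_hat.

(** * Measurability of the estimator *)

Section gamma_hat_measurable.
Context {R : realType}.
Local Notation E := (R * R)%type.
Implicit Types (s : seq E).

Lemma lmeas1_subst d (T : measurableType d) dS (S : measurableType dS)
    dU (U : measurableType dU) (f : S -> seq T -> U) (h : seq T -> S) :
  lmeas f -> lmeas1 h -> lmeas1 (fun l => f (h l) l).
Proof.
move=> mf mh n.
pose g (st : unit * n.-tuple T) := (h st.2, st.2).
have mg : measurable_fun setT g by apply: measurable_fun_pair => //; exact: mh.
exact: (measurableT_comp (mf n) mg).
Qed.

Lemma lmeas_count d (T : measurableType d) dS (S : measurableType dS) (b : S -> pred T) :
  measurable_fun setT (fun sx : S * T => b sx.1 sx.2) ->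
  lmeas (fun (x : S) (l : seq T) => (count (b x) l)%:R : R).
Proof.
move=> mb n; elim: n => [|n IHn].
  rewrite (_ : (fun _ => _) = cst 0); first exact: measurable_cst.
  by apply/funext => -[x t]; rewrite /= tuple0.
apply: (@lmeasnS _ _ _ _ _ _ _ (fun (x : S) (l : seq T) => (count (b x) l)%:R : R)).
rewrite (_ : (fun _ => _) = fun st : S * T * n.-tuple T =>
   (b st.1.1 st.1.2)%:R + (count (b st.1.1) st.2)%:R); last first.
  by apply/funext => -[[x y] t]; rewrite /= natrD.
apply: measurable_funD.
  have mh : measurable_fun setT (fun c : bool => c%:R : R) by [].
  apply: (measurableT_comp mh).
  by have := measurableT_comp mb (@measurable_fst _ _ (S * T)%type (n.-tuple T)); apply.
have mg : measurable_fun setT (fun st : S * T * n.-tuple T => (st.1.1, st.2)).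
  apply: measurable_fun_pair => //.
  exact: (measurableT_comp measurable_fst measurable_fst).
exact: (measurableT_comp IHn mg).
Qed.

(** Reduces the measurability of an order statistic to that of a count. *)
Lemma nth_sort_le (v : seq R) i c : (i < size v)%N ->
  (c <= nth 0 (sort <=%R v) i) = (count (< c) v <= i)%N.
Proof.
move=> iv; have ss : sorted <=%O (sort <=%R v) by rewrite sort_sorted//; exact: le_total.
have cE : count (< c) (sort <=%R v) = count (< c) v by apply/permP; rewrite perm_sort.
apply/idP/idP => [ci|ci].
  rewrite leqNgt; apply/negP; rewrite -cE => /(nth_count_lt 0 ss).
  by rewrite ltNge ci.
by apply: nth_count_ge => //; rewrite cE ci size_sort.
Qed.

Lemma lmeas_nth_sort i : lmeas1 (fun s => nth 0 (sort <=%R [seq z.1 | z <- s]) i).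
Proof.
move=> n; have [ni|ni] := leqP n i.
  rewrite (_ : (fun _ => _) = cst 0); first exact: measurable_cst.
  apply/funext => -[x t] /=; rewrite nth_default//.
  by rewrite size_sort size_map size_tuple.
apply: (measurability (@RGenCInfty.G R)) => [|/= _ [_] [c] -> <-].
  exact: RGenCInfty.measurableE.
rewrite setTI.
have mc := @lmeas_count _ _ _ _ (fun _ : unit => fun z : E => z.1 < c).
have {}mc : measurable_fun setT (fun st : unit * n.-tuple E => (count (fun z : E => z.1 < c) st.2)%:R : R).
  apply: mc.
  apply: measurable_fun_ltr => //.
  exact: (measurableT_comp measurable_fst measurable_snd).
have := mc measurableT _ (measurable_itv (`]-oo, i%:R] : interval R)).
rewrite setTI; congr measurable.
apply/seteqP; split => -[x t] /=; rewrite !in_itv/= andbT nth_sort_le ?size_map ?size_tuple//;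
  by rewrite count_map ler_nat.
Qed.

Lemma lmeas_jump_sum (e phi : seq E -> R -> R) (I : seq nat) (o : nat -> seq E -> R) :
  (forall i, lmeas1 (fun l => e l (o i l))) -> (forall i, lmeas1 (fun l => phi l (o i l))) ->
  lmeas1 (fun l => jump_sum (e l) (phi l) [seq o i l | i <- I]).
Proof.
move=> me mphi; elim: I => [|i I IHI] /=; first exact: lmeas1_cst.
move=> n; have me' := me i n; have mp' := mphi i n; have mI := IHI n.
apply: measurable_funD; apply: measurable_funM => //.
exact: measurable_funB.
Qed.

Definition gamma1_hat_formula (k : nat) s : R :=
  let a := order_stat s (size s - k) in
  (jump_sum (step_factor s) (fun x => (a < x)%R%:R) (desc_values s))^-1 *
  jump_sum (step_factor s) (fun x => (a < x)%R%:R * ln (x / a)) (desc_values s).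

Lemma lmeas_gamma1_hat_formula (k : nat -> nat) :
  lmeas1 (fun s => gamma1_hat_formula (k (size s)) s).
Proof.
move=> n.
pose o i s := nth 0 (sort <=%R [seq z.1 | z <- s]) (n - i.+1) : R.
pose a s := nth 0 (sort <=%R [seq z.1 | z <- s]) (n - k n).-1 : R.
have mo i : lmeas1 (o i) by exact: lmeas_nth_sort.
have ma : lmeas1 a by exact: lmeas_nth_sort.
pose e s (x : R) : R := expR (- ((count (fun z : E => z.1 <= x <= z.2) s)%:R : R)^-1).
have me i : lmeas1 (fun s => e s (o i s)).
  apply: (@lmeas1_subst _ _ _ _ _ _ (fun x s => e s x)) => //.
  apply: (@lmeas_comp _ _ _ _ _ _ _ _ _ (fun c : R => expR (- c^-1))).
    apply: lmeas_count; apply: measurable_and.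
      apply: measurable_fun_ler => //; exact: (measurableT_comp measurable_fst measurable_snd).
    apply: measurable_fun_ler => //; exact: (measurableT_comp measurable_snd measurable_snd).
  apply: measurableT_comp; first exact: measurable_expR.
  by apply: measurable_funN; exact: measurable_invr.
have mlt i : lmeas1 (fun s => (a s < o i s)%R%:R : R).
  move=> m; have h1 := ma m; have h2 := mo i m.
  have mh : measurable_fun setT (fun c : bool => c%:R : R) by [].
  by apply: (measurableT_comp mh); exact: measurable_fun_ltr.
have mln i : lmeas1 (fun s => (a s < o i s)%R%:R * ln (o i s / a s)).
  move=> m; have h1 := ma m; have h2 := mo i m.
  apply: measurable_funM; first exact: mlt.
  apply: measurableT_comp; first exact: measurable_ln.
  apply: measurable_funM => //; apply: measurableT_comp => //; exact: measurable_invr.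
have m1 := @lmeas_jump_sum e (fun s x => (a s < x)%R%:R) (iota 0 n) o me mlt.
have m2 := @lmeas_jump_sum e (fun s x => (a s < x)%R%:R * ln (x / a s)) (iota 0 n) o me mln.
rewrite (_ : (fun _ => _) = fun st : unit * n.-tuple E =>
   (jump_sum (e st.2) (fun x => (a st.2 < x)%R%:R) [seq o i st.2 | i <- iota 0 n])^-1 *
   jump_sum (e st.2) (fun x => (a st.2 < x)%R%:R * ln (x / a st.2)) [seq o i st.2 | i <- iota 0 n]).
  apply: measurable_funM; last exact: m2.
  by apply: measurableT_comp; [exact: measurable_invr|exact: m1].
apply/funext => -[x s] /=.
have st : size s = n by rewrite size_tuple.
have -> : [seq o i s | i <- iota 0 n] = desc_values s.
  apply: (@eq_from_nth _ 0); rewrite ?size_map ?size_iota ?size_rev ?size_sort ?size_map ?st// => i it.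
  rewrite (nth_map 0%N) ?size_iota// nth_iota// add0n nth_rev ?size_sort ?size_map ?st//.
have aE : order_stat s (size s - k n) = a s by rewrite /order_stat st.
have eE : step_factor s = e s.
  apply/funext => y; rewrite /step_factor /C_n /e mulrA.
  case: (posnP n) => [n0|n0].
    by rewrite (size0nil (etrans st n0)) /= !mul0r.
  by rewrite divff ?mul1r// st pnatr_eq0 -lt0n.
by rewrite /gamma1_hat_formula st -eE -[in RHS]aE st.
Qed.

End gamma_hat_measurable.

(** * Stein's method through a smoothing operator *)

Section lindeberg_stein_operator.
Context d (E : measurableType d) (R : realType).
Variable mu : {sigma_finite_measure set E -> \bar R}.
Variables (D : set E) (q : R) (xi : E -> R).
Hypothesis mD : measurable D.
Hypothesis muD : mu D = q%:E.
Hypothesis q_gt0 : 0 < q.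
Hypothesis mxi : measurable_fun setT xi.

Definition bounded_lipschitz (g : R -> R) : Prop :=
  exists M : R, (forall x, `|g x| <= M) /\ (forall x y, `|g x - g y| <= M * `|x - y|).

Let muD' : (mu : {measure set E -> \bar R}) D = q%:E. Proof. exact: muD. Qed.

Lemma bounded_lipschitz_continuous g : bounded_lipschitz g -> continuous g.
Proof.
move=> [M [_ gL]] x; apply/cvgrPdist_le => e e0.
have M0 : 0 <= M by have := gL 1 0; rewrite subr0 normr1 mulr1; apply: le_trans.
near=> y; rewrite (le_trans (gL _ _))//.
have : `|x - y| <= e / (M + 1).
  by near: y; apply: cvgr_dist_le => //; rewrite divr_gt0// ltr_wpDl.
rewrite ler_pdivlMr ?ltr_wpDl//; apply: le_trans; rewrite mulrC.
by rewrite ler_wpM2l// lerDl.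
Unshelve. all: by end_near. Qed.

Lemma bounded_lipschitz_measurable g :
  bounded_lipschitz g -> measurable_fun setT g.
Proof. by move=> /bounded_lipschitz_continuous/continuous_measurable_fun. Qed.

Lemma integrable_bounded (F : E -> R) M :
  measurable_fun setT F -> (forall z, `|F z| <= M) ->
  mu.-integrable D (EFin \o F).
Proof.
move=> mF FM.
apply/integrableP; split; first exact/measurable_EFinP/measurable_funTS.
apply: (@le_lt_trans _ _ (\int[mu]_(z in D) M%:E)%E).
  apply: ge0_le_integral => //.
  - apply: measurableT_comp => //; exact/measurable_EFinP/measurable_funTS.
  - by move=> z _ /=; rewrite lee_fin.
by rewrite integral_cst// muD' -EFinM ltry.
Qed.

Definition mean (F : E -> R) := q^-1 * \int[mu]_(z in D) F z.

Let integ (F : E -> R) := mu.-integrable D (EFin \o F).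

Let integB F G : integ F -> integ G -> integ (fun z => F z - G z).
Proof. by move=> iF iG; exact: (integrableB mD iF iG). Qed.

Let integZ c F : integ F -> integ (fun z => c * F z).
Proof. by move=> iF; exact: (integrableZl mD c iF). Qed.

Lemma mean_cst c : mean (fun _ => c) = c.
Proof. by rewrite /mean Rintegral_cst// muD' /= mulrC mulfK// gt_eqF. Qed.

Lemma meanD F G : integ F -> integ G -> mean (fun z => F z + G z) = mean F + mean G.
Proof. by move=> iF iG; rewrite /mean RintegralD// mulrDr. Qed.

Lemma meanB F G : integ F -> integ G -> mean (fun z => F z - G z) = mean F - mean G.
Proof. by move=> iF iG; rewrite /mean RintegralB// mulrBr. Qed.

Lemma meanZ c F : integ F -> mean (fun z => c * F z) = c * mean F.
Proof. by move=> iF; rewrite /mean RintegralZl// mulrCA. Qed.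

Lemma le_mean F G : integ F -> integ G -> (forall z, F z <= G z) -> mean F <= mean G.
Proof.
move=> iF iG FG; rewrite /mean ler_wpM2l ?invr_ge0 ?(ltW q_gt0)//.
exact: le_Rintegral.
Qed.

Lemma integ_abs F : integ F -> integ (fun z => `|F z|).
Proof. by move=> iF; exact: (integrable_abse iF). Qed.

Lemma ler_norm_mean F : integ F -> `|mean F| <= mean (fun z => `|F z|).
Proof.
move=> iF; rewrite /mean normrM ger0_norm ?invr_ge0 ?(ltW q_gt0)//.
by rewrite ler_wpM2l ?invr_ge0 ?(ltW q_gt0)// le_normr_Rintegral.
Qed.

Lemma eq_mean F G : (forall z, F z = G z) -> mean F = mean G.
Proof. by move=> FG; congr mean; apply/funext. Qed.

(** Adds one independent summand and averages. The [k]-th iterate at [x] is the mean of [g] at [x]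
    plus a sum of [k] copies of [xi], so the method can work with iterates of an operator instead of
    product integrals. *)
Definition smooth (g : R -> R) (x : R) := mean (fun z => g (x + xi z)).

Let comp_xi g x : bounded_lipschitz g -> measurable_fun setT (fun z => g (x + xi z)).
Proof.
move=> /bounded_lipschitz_measurable mg; apply: measurableT_comp => //.
exact: measurable_funD.
Qed.

Let integ_comp g x : bounded_lipschitz g -> integ (fun z => g (x + xi z)).
Proof.
move=> bg; have [M [gM _]] := bg.
exact: (@integrable_bounded _ M (comp_xi x bg)).
Qed.

Lemma smooth_bl g : bounded_lipschitz g -> bounded_lipschitz (smooth g).
Proof.
move=> bg; have [M [gM gL]] := bg; exists M; split => [x|x y].
  rewrite (le_trans (ler_norm_mean (integ_comp x bg)))//.
  rewrite -[leRHS]mean_cst; apply: le_mean => //.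
  - exact: integ_abs (integ_comp x bg).
  - by apply: (@integrable_bounded _ `|M|).
rewrite /smooth -meanB; try exact: integ_comp.
have iB : integ (fun z => g (x + xi z) - g (y + xi z)).
  by apply: integB; exact: integ_comp.
rewrite (le_trans (ler_norm_mean iB))//.
rewrite -[leRHS]mean_cst; apply: le_mean.
- exact: integ_abs iB.
- by apply: (@integrable_bounded _ `|M * `|x - y| |).
move=> z; rewrite (le_trans (gL _ _))// (_ : x + xi z - (y + xi z) = x - y)//.
by rewrite opprD addrACA subrr addr0.
Qed.

Lemma iter_smooth_bl k g : bounded_lipschitz g -> bounded_lipschitz (iter k smooth g).
Proof. by move=> bg; elim: k => // k IH; exact: smooth_bl. Qed.

(** Averaging does not increase the uniform distance; this carries each one-step estimate through
    the remaining summands. *)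
Lemma iter_smooth_close k g h e : bounded_lipschitz g -> bounded_lipschitz h ->
  (forall x, `|g x - h x| <= e) ->
  forall x, `|iter k smooth g x - iter k smooth h x| <= e.
Proof.
move=> bg bh gh; elim: k => // k IH x.
rewrite /= /smooth -meanB; try (apply: integ_comp; exact: iter_smooth_bl).
set F := fun z => _ - _.
have iF : integ F.
  by apply: integB; apply: integ_comp; exact: iter_smooth_bl.
rewrite (le_trans (ler_norm_mean iF))// -[leRHS]mean_cst; apply: le_mean.
- exact: integ_abs iF.
- by apply: (@integrable_bounded _ `|e|).
- by move=> z; exact: IH.
Qed.

Lemma blD g h : bounded_lipschitz g -> bounded_lipschitz h ->
  bounded_lipschitz (fun x => g x + h x).
Proof.
move=> [M [gM gL]] [N [hN hL]]; exists (M + N); split => [x|x y].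
  by rewrite (le_trans (ler_normD _ _))// lerD.
by rewrite mulrDl opprD addrACA (le_trans (ler_normD _ _))// lerD.
Qed.

Lemma blZ c g : bounded_lipschitz g -> bounded_lipschitz (fun x => c * g x).
Proof.
move=> [M [gM gL]]; exists (`|c| * M); split => [x|x y].
  by rewrite normrM ler_wpM2l.
by rewrite -mulrBr normrM -mulrA ler_wpM2l.
Qed.

Lemma bl_cst c : bounded_lipschitz (fun=> c).
Proof.
by exists `|c|; split => // x y; rewrite subrr normr0 mulr_ge0.
Qed.

Lemma eq_bl g h : (forall x, h x = g x) -> bounded_lipschitz g -> bounded_lipschitz h.
Proof. by move=> gh; rewrite (_ : h = g)//; apply/funext. Qed.

Lemma iter_smoothD k g h : bounded_lipschitz g -> bounded_lipschitz h ->
  iter k smooth (fun x => g x + h x) =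
  (fun x => iter k smooth g x + iter k smooth h x).
Proof.
move=> bg bh; elim: k => // k IH; apply/funext => x /=.
rewrite IH /smooth meanD//; apply: integ_comp; exact: iter_smooth_bl.
Qed.

Lemma iter_smoothZ k c g : bounded_lipschitz g ->
  iter k smooth (fun x => c * g x) = (fun x => c * iter k smooth g x).
Proof.
move=> bg; elim: k => // k IH; apply/funext => x /=.
rewrite IH /smooth meanZ//; apply: integ_comp; exact: iter_smooth_bl.
Qed.

Lemma iter_smooth_cst k c : iter k smooth (fun=> c) = fun=> c.
Proof. by elim: k => //= k ->; apply/funext => x; rewrite /smooth mean_cst. Qed.

Lemma iter_int_smooth k (h : R -> R) x : bounded_lipschitz h -> (forall y, 0 <= h y) ->
  iter_int mu D k (fun l => (h (x + \sum_(z <- l) xi z))%:E) =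
  (q ^+ k * iter k smooth h x)%:E.
Proof.
move=> bh h0; elim: k x => [|k IH] x; first by rewrite /= big_nil addr0 mul1r.
rewrite [LHS]/=.
under eq_integral => z _.
  under eq_iter_int do rewrite big_cons addrA.
  rewrite IH; over.
rewrite /= -[LHS]fineK; last first.
  apply: integrable_fin_num => //.
  have := integ_comp x (iter_smooth_bl k bh).
  by move=> /(integrableZl mD (q ^+ k)); apply: eq_integrable.
congr _%:E; rewrite -/(Rintegral _ _ _).
rewrite RintegralZl//; last exact: (integ_comp x (iter_smooth_bl k bh)).
by rewrite /smooth /mean exprSr -mulrA mulVKf// gt_eqF.
Qed.

Section stein_bound.
Variables (f f1 : R -> R) (w : R -> R) (s2 rho : R).
Hypothesis xi_int : integ xi.
Hypothesis xi_mean : mean xi = 0.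
Hypothesis xi2_int : integ (fun z => xi z ^+ 2).
Hypothesis xi2_mean : mean (fun z => xi z ^+ 2) = s2.
Hypothesis mw : measurable_fun setT w.
Hypothesis w0 : forall u, 0 <= w u.
Hypothesis w_int : integ (fun z => xi z ^+ 2 * w (xi z)).
Hypothesis w_mean : mean (fun z => xi z ^+ 2 * w (xi z)) <= rho.

(* [g1] plays the role of the derivative of [g], with modulus of continuity
   [w]; this relation is preserved by [smooth]. *)
Definition taylor1 (g g1 : R -> R) :=
  forall y u, `|g (y + u) - g y - u * g1 y| <= `|u| * w u.

Lemma smooth_taylor1 g g1 : bounded_lipschitz g -> bounded_lipschitz g1 ->
  taylor1 g g1 -> taylor1 (smooth g) (smooth g1).
Proof.
move=> bg bg1 gg1 y u.
rewrite /smooth -meanZ; last exact: integ_comp.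
rewrite -!meanB; try exact: integ_comp; last 2 first.
- by apply: integB; apply: integ_comp.
- by apply: integZ; apply: integ_comp.
set F := fun z => _ - _.
have iF : integ F.
  apply: integB; last by apply: integZ; apply: integ_comp.
  by apply: integB; apply: integ_comp.
rewrite (le_trans (ler_norm_mean iF))// -[leRHS]mean_cst; apply: le_mean.
- exact: integ_abs iF.
- by apply: (@integrable_bounded _ `| `|u| * w u |).
- move=> z; rewrite /F (_ : y + u + xi z = y + xi z + u); first exact: gg1.
  by rewrite addrAC.
Qed.

Definition xi_smooth (g : R -> R) x := mean (fun z => xi z * g (x + xi z)).

Let integ_xi g x : bounded_lipschitz g -> integ (fun z => xi z * g (x + xi z)).
Proof.
move=> bg; have [M [gM _]] := bg.
apply: (le_integrable mD _ _ (integrableZl mD M xi_int)).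
  apply/measurable_EFinP/measurable_funTS/measurable_funM => //.
  exact: comp_xi.
move=> z _; rewrite /= lee_fin !normrM mulrC ler_wpM2r//.
by rewrite (le_trans (gM _))// ler_norm.
Qed.

Lemma xi_smooth_bl g : bounded_lipschitz g -> bounded_lipschitz (xi_smooth g).
Proof.
move=> bg; have [M [gM gL]] := bg.
pose m1 := mean (fun z => `|xi z|).
have ixi := integ_abs xi_int.
exists (M * m1); split => [x|x y].
  rewrite (le_trans (ler_norm_mean (integ_xi x bg)))// -meanZ//.
  apply: le_mean; [exact: integ_abs (integ_xi x bg)|exact: (integZ _ ixi)|].
  by move=> z; rewrite normrM mulrC ler_wpM2r.
rewrite /xi_smooth -meanB; try exact: integ_xi.
set F := fun z => _ - _.
have iF : integ F by apply: integB; apply: integ_xi.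
rewrite (le_trans (ler_norm_mean iF))//.
have -> : M * m1 * `|x - y| = mean (fun z => (`|x - y| * M) * `|xi z|).
  by rewrite meanZ// -/m1; ring.
apply: le_mean; [exact: integ_abs iF|exact: (integZ _ ixi)|].
move=> z; rewrite /F -mulrBr normrM mulrC ler_wpM2r// [leRHS]mulrC.
by rewrite (le_trans (gL _ _))// (_ : x + xi z - (y + xi z) = x - y)// opprD addrACA subrr addr0.
Qed.

(** First-order expansion of [g] under the mean: the constant term vanishes because [xi] is centred,
    the linear one gives the variance, and the remainder is at most [xi ^+ 2 * w xi]. *)
Lemma xi_smooth_approx g g1 x : bounded_lipschitz g -> bounded_lipschitz g1 ->
  taylor1 g g1 -> `|xi_smooth g x - s2 * g1 x| <= rho.
Proof.
move=> bg bg1 gg1.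
have i1 : integ (fun z => g x * xi z) by exact: integZ.
have i2 : integ (fun z => g1 x * xi z ^+ 2) by exact: integZ.
have -> : xi_smooth g x - s2 * g1 x =
    mean (fun z => xi z * g (x + xi z) - g x * xi z - g1 x * xi z ^+ 2).
  rewrite meanB//; last by apply: integB => //; exact: integ_xi.
  rewrite meanB//; last exact: integ_xi.
  by rewrite !meanZ// xi_mean mulr0 subr0 xi2_mean [g1 x * _]mulrC.
set F := fun z => _ - _ - _.
have iF : integ F.
  by apply: integB => //; apply: integB => //; exact: integ_xi.
rewrite (le_trans (ler_norm_mean iF))// (le_trans _ w_mean)//.
apply: le_mean => //; first exact: integ_abs iF.
move=> z; rewrite /F.
have -> : xi z * g (x + xi z) - g x * xi z - g1 x * xi z ^+ 2 =
  xi z * (g (x + xi z) - g x - xi z * g1 x) by ring.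
rewrite normrM (le_trans (ler_wpM2l (normr_ge0 _) (gg1 _ _)))//.
by rewrite mulrA -expr2 real_normK// num_real.
Qed.

(** The approximate Stein identity: for a sum [S] of [k + 1] summands, the mean of [S g(S)] is close
    to [(k + 1) s2] times the mean of [g1] at a sum with one summand fewer. Moving the factor [x]
    through one smoothing step leaves an [xi_smooth] term, and each of the [k + 1] steps costs at
    most [rho]. *)
Lemma iter_smooth_stein g g1 k :
  bounded_lipschitz g -> bounded_lipschitz g1 -> taylor1 g g1 ->
  bounded_lipschitz (fun x => x * g x) -> forall x,
  `|iter k.+1 smooth (fun x => x * g x) x - x * iter k.+1 smooth g x
     - k.+1%:R * (s2 * iter k smooth g1 x)| <= k.+1%:R * rho.
Proof.
elim: k g g1 => [|k IH] g g1 bg bg1 gg1 bxg x.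
  rewrite /= !mul1r -(_ : xi_smooth g x = smooth (fun x => x * g x) x - x * smooth g x).
    exact: xi_smooth_approx.
  rewrite /smooth -meanZ; last exact: integ_comp.
  rewrite -meanB; [|exact: (integ_comp x bxg)|by apply: integZ; exact: integ_comp].
  by apply: eq_mean => z; rewrite mulrDl addrAC subrr add0r.
have smoothE : smooth (fun x => x * g x) = (fun x => x * smooth g x + xi_smooth g x).
  apply/funext => y; rewrite /smooth -meanZ; last exact: integ_comp.
  rewrite -meanD; [|by apply: integZ; exact: integ_comp|exact: integ_xi].
  by apply: eq_mean => z; rewrite mulrDl.
have bS := xi_smooth_bl bg.
have bxT : bounded_lipschitz (fun x => x * smooth g x).
  have := blD (smooth_bl bxg) (blZ (-1) bS); apply: eq_bl.
  by move=> y; rewrite smoothE mulN1r addrK.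
have := IH _ _ (smooth_bl bg) (smooth_bl bg1) (smooth_taylor1 bg bg1 gg1) bxT x.
rewrite [iter k.+2 _ (fun x => x * g x)]iterSr smoothE iter_smoothD//.
rewrite -!iterSr => H.
have := iter_smooth_close k.+1 bS (blZ s2 bg1) (fun y => xi_smooth_approx y bg bg1 gg1) x.
rewrite iter_smoothZ// => H'.
have E2 : k.+2%:R = k.+1%:R + 1 :> R by rewrite natr1.
rewrite E2 [leRHS]mulrDl mul1r (le_trans _ (lerD H H'))//.
rewrite (le_trans _ (ler_normD _ _))//.
by rewrite le_eqVlt; apply/orP; left; apply/eqP; congr `|_|; ring.
Qed.

(* Stein's method: [f1 = x f + h - c] turns the bound above into a bound on
   the mean of [h]. *)
Lemma stein_clt (h : R -> R) c L k : s2 * k.+1%:R = 1 ->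
  bounded_lipschitz f -> bounded_lipschitz f1 -> taylor1 f f1 ->
  (forall x y, `|f1 x - f1 y| <= L * `|x - y|) -> 
  bounded_lipschitz (fun x => x * f x) -> bounded_lipschitz h ->
  (forall x, f1 x = x * f x + h x - c) ->
  `|iter k.+1 smooth h 0 - c| <= L * mean (fun z => `|xi z|) + k.+1%:R * rho.
Proof.
move=> s2k bf bf1 ff1 f1L bxf bh f1E.
have := iter_smooth_stein k bf bf1 ff1 bxf 0.
rewrite mul0r subr0 mulrA [_ * s2]mulrC s2k mul1r => H1.
(* The identity involves [f1] at a sum with one summand fewer than wanted; putting it back costs the
   Lipschitz constant times the mean of the absolute value of [xi]. *)
have H2 x : `|smooth f1 x - f1 x| <= L * mean (fun z => `|xi z|).
  have ixi := integ_abs xi_int.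
  rewrite -[f1 x]mean_cst -meanB; [|exact: integ_comp|by apply: (@integrable_bounded _ `|f1 x|)].
  rewrite (le_trans (ler_norm_mean _))//.
    by apply: integB; [exact: integ_comp|by apply: (@integrable_bounded _ `|f1 x|)].
  rewrite -meanZ//; apply: le_mean.
  - by apply: integ_abs; apply: integB; [exact: integ_comp|by apply: (@integrable_bounded _ `|f1 x|)].
  - exact: integZ.
  - by move=> z; rewrite (le_trans (f1L _ _))// addrAC subrr add0r.
have := iter_smooth_close k (smooth_bl bf1) bf1 H2 0; rewrite -iterSr => H3.
have hE : h = (fun x => f1 x + (- 1 * (x * f x) + c)).
  by apply/funext => x; rewrite f1E; ring.
have -> : iter k.+1 smooth h 0 - c =
    iter k.+1 smooth f1 0 - iter k smooth f1 0 -
    (iter k.+1 smooth (fun x => x * f x) 0 - iter k smooth f1 0).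
  have bx' := blZ (-1) bxf.
  rewrite {1}hE iter_smoothD//; last exact: blD bx' (bl_cst c).
  rewrite (iter_smoothD _ bx' (bl_cst c)) iter_smoothZ// iter_smooth_cst.
  by ring.
by rewrite (le_trans (ler_normB _ _))// lerD.
Qed.

End stein_bound.
End lindeberg_stein_operator.

(** * Mills' ratio and the solution of Stein's equation *)

Section stein_solution.
Context {R : realType}.
Local Notation mu := (@lebesgue_measure R).
Local Notation phi := (@normal_pdf R 0 1).
Local Notation oneR := (1 : R).

Let one_neq0 : (1 : R) != 0. Proof. exact: oner_neq0. Qed.

Lemma std_normal_pdfE x : phi x = normal_peak 1 * expR (- (x ^+ 2 / 2)).
Proof.
by rewrite (normal_pdfE _ one_neq0) /normal_fun subr0 expr1n mulNr.
Qed.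

Lemma std_normal_pdf_gt0 x : 0 < phi x.
Proof. by rewrite std_normal_pdfE mulr_gt0 ?expR_gt0// normal_peak_gt0. Qed.

Lemma is_derive_std_normal_pdf x : is_derive x (1 : R) phi (- x * phi x).
Proof.
have -> : phi = (fun x => normal_peak 1 * expR (- (x ^+ 2 / 2))).
  by apply/funext => y; exact: std_normal_pdfE.
apply: is_derive_eq.
by rewrite /GRing.scale /=; field.
Qed.

Let int_phi (D : set R) : measurable D -> mu.-integrable D (EFin \o phi).
Proof.
by move=> mD; apply: integrableS (integrable_normal_pdf 0 1).
Qed.

Definition normal_tail x := \int[mu]_(y in `[x, +oo[) phi y.

Lemma normal_tail_ge0 x : 0 <= normal_tail x.
Proof. by apply: Rintegral_ge0 => y _; exact: normal_pdf_ge0. Qed.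

Let cvg_phi : phi x @[x --> +oo] --> (0 : R).
Proof.
have -> : phi = (fun x => normal_peak 1 * expR (- (x ^+ 2 / 2))).
  by apply/funext => y; exact: std_normal_pdfE.
rewrite -[X in _ --> X](mulr0 (normal_peak 1)); apply: cvgMr.
apply: (cvg_comp (fun x : R => x ^+ 2 / 2) (fun y => expR (- y))); last exact: cvgr_expR.
apply: gt0_cvgMly => //.
apply/cvgryPge => A; near=> x.
have x1 : 1 <= x by near: x; exact: nbhs_pinfty_ge.
apply: (@le_trans _ _ x); first by near: x; apply: nbhs_pinfty_ge; exact: num_real.
by rewrite expr2 ler_peMl// (le_trans _ x1).
Unshelve. all: by end_near. Qed.

Lemma Rintegral_x_phi x : 0 <= x -> \int[mu]_(y in `[x, +oo[) (y * phi y) = phi x.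
Proof.
move=> x0; rewrite (@Rintegral_ge0_continuous_FTC2y _ _ (fun y => - phi y) _ 0).
- by rewrite sub0r opprK.
- by move=> y xy; rewrite mulr_ge0 ?normal_pdf_ge0// (le_trans x0).
- apply: continuous_subspaceT => y; apply: cvgM; first exact: cvg_id.
  exact: continuous_normal_pdf.
- by rewrite -[X in _ --> X]oppr0; apply: cvgN; exact: cvg_phi.
- by move=> y _; apply: derivableN; exact: (@ex_derive _ _ _ _ _ _ _ (is_derive_std_normal_pdf y)).
- by apply: cvgN; apply: cvg_at_right_filter; exact: continuous_normal_pdf.
- move=> y _; rewrite derive1E.
  have dphi := is_derive_std_normal_pdf y.
  by rewrite deriveN ?derive_val// mulNr opprK.
Qed.

(** On the ray [x phi y] is at most [y phi y], whose primitive is [- phi]. *)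
Lemma normal_tail_le x : 0 < x -> x * normal_tail x <= phi x.
Proof.
move=> x0; rewrite -(Rintegral_x_phi (ltW x0)) /normal_tail -RintegralZl//; last exact: int_phi.
have ixp : mu.-integrable `[x, +oo[ (EFin \o (fun y => y * phi y)).
  apply/integrableP; split.
    apply/measurable_EFinP/measurable_funM => //.
    apply: measurable_funTS; exact: measurable_normal_pdf.
  under eq_integral => y.
    rewrite inE/= in_itv/= andbT => xy.
    rewrite ger0_norm; last by rewrite mulr_ge0 ?normal_pdf_ge0// (le_trans (ltW x0)).
    over.
  rewrite (@ge0_continuous_FTC2y _ _ (fun y => - phi y) _ 0) ?ltry//.
  - by move=> y xy; rewrite mulr_ge0 ?normal_pdf_ge0// (le_trans (ltW x0)).
  - apply: continuous_subspaceT => y; apply: cvgM; first exact: cvg_id.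
    exact: continuous_normal_pdf.
  - by rewrite -[X in _ --> X]oppr0; apply: cvgN; exact: cvg_phi.
  - by move=> y _; apply: derivableN; exact: (@ex_derive _ _ _ _ _ _ _ (is_derive_std_normal_pdf y)).
  - by apply: cvgN; apply: cvg_at_right_filter; exact: continuous_normal_pdf.
  - move=> y _; rewrite derive1E.
    have dphi := is_derive_std_normal_pdf y.
    by rewrite deriveN ?derive_val// mulNr opprK.
apply: le_Rintegral => //.
- by apply: integrableZR => //; exact: int_phi.
- move=> y /=; rewrite in_itv/= andbT => xy.
  by rewrite ler_wpM2r// normal_pdf_ge0.
Qed.

(** [phi y] dominates [F' y], the derivative of [- y / (1 + y^2) phi y]. The condition [1 <= x]
    makes this derivative nonnegative, as the improper fundamental theorem of calculus requires. *)
Lemma normal_tail_ge x : 1 <= x -> x / (1 + x ^+ 2) * phi x <= normal_tail x.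
Proof.
move=> x1.
pose F y : R := - (y / (1 + y ^+ 2) * phi y).
pose F' y := phi y * (1 - 2 / (1 + y ^+ 2) ^+ 2).
have pos y : 0 < 1 + y ^+ 2 :> R by rewrite ltr_pwDl// sqr_ge0.
have dF y : is_derive y (1 : R) F (F' y).
  have dphi := is_derive_std_normal_pdf y.
  have neq : 1 + y ^+ 2 != 0 by rewrite gt_eqF.
  rewrite /F; apply: is_derive_eq.
  by rewrite /F' /GRing.scale /=; field.
have F'_ge0 y : x <= y -> 0 <= F' y.
  move=> xy; rewrite mulr_ge0 ?normal_pdf_ge0// subr_ge0 ler_pdivrMr ?exprn_gt0// mul1r.
  have y1 : 1 <= y by exact: le_trans x1 xy.
  have y2 : 1 <= y ^+ 2 by nra.
  by nra.
have cF' : continuous F'.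
  move=> y; apply: cvgM; first exact: continuous_normal_pdf.
  apply: cvgB; first exact: cvg_cst.
  apply: cvgM; first exact: cvg_cst.
  apply: cvgV; first by rewrite expf_neq0// gt_eqF.
  apply: (cvg_comp (fun y => 1 + y ^+ 2) (fun y => y ^+ 2)); last exact: exprn_continuous.
  by apply: cvgD; [exact: cvg_cst|exact: exprn_continuous].
have cvgF : F y @[y --> +oo] --> (0 : R).
  apply/cvgr0Pnorm_le => e e0.
  have phie : \forall y \near +oo, `|phi y| <= e.
    by have /cvgr0Pnorm_le := cvg_phi; apply.
  apply: filterS2 phie (nbhs_pinfty_ge (num_real (1 : R))) => y ye y1.
  have y0 : 0 <= y by exact: le_trans y1.
  have Q : `|y / (1 + y ^+ 2)| <= 1.
    rewrite ger0_norm; last by rewrite divr_ge0// ltW.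
    by rewrite ler_pdivrMr// mul1r; nra.
  apply: le_trans ye; rewrite normrN normrM.
  exact: ler_piMl.
have E : \int[mu]_(y in `[x, +oo[) F' y = x / (1 + x ^+ 2) * phi x.
  rewrite (@Rintegral_ge0_continuous_FTC2y _ _ F _ 0)//.
  - by rewrite /F sub0r opprK.
  - exact: continuous_subspaceT.
  - apply: cvg_at_right_filter.
    by apply/differentiable_continuous/derivable1_diffP; exact: (@ex_derive _ _ _ _ _ _ _ (dF x)).
  - by move=> y _; rewrite derive1E; have := dF y => H; rewrite derive_val.
rewrite -E /normal_tail; apply: le_Rintegral => //.
- apply: (le_integrable _ _ _ (int_phi _)) => //.
    apply/measurable_EFinP; apply: measurable_funTS; exact: continuous_measurable_fun.
  move=> y /=; rewrite in_itv/= andbT => xy; rewrite lee_fin.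
  rewrite ger0_norm ?F'_ge0// ger0_norm ?normal_pdf_ge0//.
  rewrite /F' ler_piMr ?normal_pdf_ge0// gerBl divr_ge0// exprn_ge0// ltW//.
- exact: int_phi.
- move=> y _; rewrite /F' ler_piMr ?normal_pdf_ge0// gerBl divr_ge0// exprn_ge0// ltW//.
Qed.

Lemma normal_left_tail x : \int[mu]_(y in `]-oo, x]) phi y = normal_tail (- x).
Proof.
rewrite /normal_tail /Rintegral; congr fine.
rewrite -{1}[x]opprK ge0_integration_by_substitutionNy.
- apply: eq_integral => y _ /=; congr _%:E.
  by rewrite !std_normal_pdfE sqrrN.
- by apply: continuous_subspaceT => y; exact: continuous_normal_pdf.
- by move=> y _; exact: normal_pdf_ge0.
Qed.

Lemma derivative_lipschitz (F F' : R -> R) L :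
  (forall x, is_derive x (1 : R) F (F' x)) -> (forall x, `|F' x| <= L) ->
  forall x y, `|F x - F y| <= L * `|x - y|.
Proof.
move=> dF F'L.
have H x y : x < y -> `|F x - F y| <= L * `|x - y|.
  move=> xy.
  have cF : {within `[x, y], continuous F}.
    apply: continuous_subspaceT => z.
    by apply/differentiable_continuous/derivable1_diffP; exact: (@ex_derive _ _ _ _ _ _ _ (dF z)).
  have [z _ E] := MVT xy (fun z _ => dF z) cF.
  by rewrite distrC E normrM (distrC x) ler_wpM2r.
move=> x y; have [xy|yx|->] := ltgtP x y; first exact: H.
  by rewrite distrC [X in _ * X]distrC; exact: H.
by rewrite !subrr !normr0 mulr0.
Qed.

Variables (h : R -> R) (a b : R).
Hypothesis h_bl : bounded_lipschitz h.
Hypothesis h01 : forall x, 0 <= h x <= 1.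
Hypothesis ha : forall x, x <= a -> h x = 1.
Hypothesis hb : forall x, b <= x -> h x = 0.

Let c := \int[mu]_y (h y * phi y).

Let ch : continuous h. Proof. exact: bounded_lipschitz_continuous. Qed.
Let cphi : continuous phi. Proof. exact: continuous_normal_pdf. Qed.

Let int_hphi : mu.-integrable setT (EFin \o (fun y => h y * phi y)).
Proof.
apply: (le_integrable _ _ _ (integrable_normal_pdf 0 1)) => //.
  apply/measurable_EFinP/measurable_funM; first exact: bounded_lipschitz_measurable.
  exact: measurable_normal_pdf.
move=> y _; rewrite /= lee_fin normrM ler_piMl//.
by have /andP[h0 h1] := h01 y; rewrite ger0_norm.
Qed.

Let total_phi : \int[mu]_y phi y = 1.
Proof. by rewrite /Rintegral integral_normal_pdf. Qed.

Lemma normal_mean01 : 0 <= c <= 1.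
Proof.
apply/andP; split.
  by apply: Rintegral_ge0 => y _; have /andP[h0 _] := h01 y; rewrite mulr_ge0// normal_pdf_ge0.
rewrite -total_phi; apply: le_Rintegral => //; first exact: int_phi.
by move=> y _; have /andP[_ h1] := h01 y; rewrite ler_piMl// normal_pdf_ge0.
Qed.

Let kk y := (h y - c) * phi y.

Let int_kk D : measurable D -> mu.-integrable D (EFin \o kk).
Proof.
move=> mD; apply: (@integrableS _ _ _ mu setT) => //.
have -> : kk = (fun y => h y * phi y - c * phi y).
  by apply/funext => y; rewrite /kk mulrBl.
by apply: integrableBR => //; apply: integrableZR => //; exact: int_phi.
Qed.

Let total_kk : \int[mu]_y kk y = 0.
Proof.
rewrite /kk; under eq_Rintegral do rewrite mulrBl.
rewrite RintegralB//; last by apply: integrableZR => //; exact: int_phi.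
by rewrite RintegralZl ?total_phi ?mulr1 ?subrr//; exact: int_phi.
Qed.

Let ckk : continuous kk.
Proof.
move=> y; apply: cvgM; last exact: cphi.
by apply: cvgB; [exact: ch|exact: cvg_cst].
Qed.

Let K x := \int[mu]_(y in `]-oo, x]) kk y.

Let dK x : is_derive x (1 : R) K (kk x).
Proof.
have xx1 : x < x + 1 by rewrite ltrDl.
have [||] := @continuous_FTC1 R kk -oo%O x _ xx1 _ _ (@ckk x); first exact: int_kk.
  by rewrite ltNyr.
by move=> dK <-; rewrite derive1E; exact: derivableP.
Qed.

(** The solution of [f' = x f + h - c] given by the integrating factor [phi]. It stays bounded on
    the right because [kk] has total integral 0, which is how [c] is chosen. *)
Definition stein_fun x := K x / phi x.
Local Notation f := stein_fun.

Lemma is_derive_stein_fun x : is_derive x (1 : R) f (x * f x + h x - c).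
Proof.
have dphi := is_derive_std_normal_pdf x.
have dKx := dK x.
have p0 : phi x != 0 by rewrite gt_eqF// std_normal_pdf_gt0.
rewrite /f; apply: is_derive_eq.
by rewrite /GRing.scale /= /kk; field.
Qed.

(** By [total_kk] the integral defining [K] can be taken from the right, where [h] vanishes; what
    remains is Mills' ratio. *)
Let f_right x : b <= x -> f x = c * (normal_tail x / phi x).
Proof.
move=> bx; rewrite /f.
have -> : K x = c * normal_tail x.
  have := total_kk; have -> : setT = `]-oo, x]%classic `|` `]x, +oo[%classic.
    by rewrite -itv_bndbnd_setU// set_itvNyy.
  rewrite Rintegral_setU//; last 2 first.
  - by apply: int_kk; exact: measurableU.
  - by apply/disj_set2P/seteqP; split => // y /=; rewrite !in_itv/= andbT => -[yx]; rewrite ltNge yx.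
  move=> /eqP; rewrite -/(K x) addr_eq0 => /eqP ->.
  rewrite Rintegral_itv_obnd_cbnd; last exact: int_kk.
  rewrite -[LHS]mulN1r -RintegralZl//; last exact: int_kk.
  rewrite -RintegralZl//; last exact: int_phi.
  apply: eq_Rintegral => y; rewrite inE/= in_itv/= andbT => xy.
  by rewrite /kk hb ?(le_trans bx)//; ring.
by rewrite mulrA.
Qed.

Let f_left x : x <= a -> f x = (1 - c) * (normal_tail (- x) / phi (- x)).
Proof.
move=> xa; rewrite /f.
have -> : phi (- x) = phi x by rewrite !std_normal_pdfE sqrrN.
have -> : K x = (1 - c) * normal_tail (- x).
  rewrite -normal_left_tail -RintegralZl//; last exact: int_phi.
  apply: eq_Rintegral => y; rewrite inE/= in_itv/= => yx.
  by rewrite /kk ha// (le_trans yx).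
by rewrite mulrA.
Qed.

Let B := Num.max 1 (Num.max `|a| `|b|).

(** The last bound controls the derivative of [x f] at infinity: [x f] and [h - c] cancel to first
    order there, and [x] times what is left must remain bounded. *)
Let mills x : 1 <= x -> [/\ 0 <= normal_tail x / phi x, normal_tail x / phi x <= 1,
  x * (normal_tail x / phi x) <= 1 & 0 <= x * (1 - x * (normal_tail x / phi x)) <= 1].
Proof.
move=> x1; have p0 := std_normal_pdf_gt0 x.
have x0 : 0 < x by exact: lt_le_trans x1.
have t0 := normal_tail_ge0 x.
set m := _ / _.
have m0 : 0 <= m by rewrite divr_ge0// ltW.
have m1 : x * m <= 1 by rewrite /m mulrA ler_pdivrMr// mul1r normal_tail_le.
have m2 : x / (1 + x ^+ 2) <= m by rewrite /m ler_pdivlMr// normal_tail_ge.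
have q0 : 0 < 1 + x ^+ 2 :> R by rewrite ltr_pwDl// sqr_ge0.
split => //; first by nra.
apply/andP; split; first by rewrite mulr_ge0// ?subr_ge0// ltW.
have : x * (1 - x * (x / (1 + x ^+ 2))) <= 1.
  have -> : x * (1 - x * (x / (1 + x ^+ 2))) = x / (1 + x ^+ 2).
    by field; rewrite gt_eqF.
  by rewrite ler_pdivrMr// mul1r; nra.
apply: le_trans; rewrite ler_wpM2l ?(ltW x0)// lerB// ler_wpM2l ?(ltW x0)//.
Qed.

Let bounds_far x : B <= `|x| ->
  [/\ `|f x| <= 1, `|x * f x| <= 1 & `|f x + x * (x * f x + h x - c)| <= 2].
Proof.
have /andP[c0 c1] := normal_mean01.
have cu (e u : R) : 0 <= e -> e <= 1 -> 0 <= u -> u <= 1 -> 0 <= e * u <= 1.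
  by move=> e0 e1 u0 u1; rewrite mulr_ge0//= (le_trans (ler_piMl _ _) u1).
have cu' (e u : R) : 0 <= e -> e <= 1 -> 0 <= u -> u <= 1 -> `|e * u| <= 1.
  by move=> e0 e1 u0 u1; rewrite ger0_norm ?mulr_ge0//; have /andP[] := cu e u e0 e1 u0 u1.
rewrite /B !ge_max => /and3P[x1 xa xb].
have [x0|x0] := leP 0 x.
  have xE : `|x| = x by rewrite ger0_norm.
  rewrite xE in x1 xa xb.
  have bx : b <= x by rewrite (le_trans (ler_norm b)).
  rewrite f_right// hb//; have [m0 m1 m2 /andP[m3 m4]] := mills x1.
  set m := _ / _ in m0 m1 m2 m3 m4 *.
  split.
  - exact: cu'.
  - by rewrite mulrCA; apply: cu' => //; rewrite mulr_ge0.
  - rewrite addr0 (_ : c * m + _ = c * m - c * (x * (1 - x * m))); last by ring.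
    have : 0 <= c * m <= 1 by apply: cu.
    have : 0 <= c * (x * (1 - x * m)) <= 1 by apply: cu.
    by move=> /andP[? ?] /andP[? ?]; rewrite ler_norml; lra.
have xE : `|x| = - x by rewrite ltr0_norm.
rewrite xE in x1 xa xb.
have ax : x <= a.
  by rewrite lerNr in xa; rewrite (le_trans xa)// lerNl -normrN ler_norm.
rewrite f_left// ha//; have [m0 m1 m2 /andP[m3 m4]] := mills x1.
set m := _ / _ in m0 m1 m2 m3 m4 *.
have c0' : 0 <= 1 - c by rewrite subr_ge0.
have c1' : 1 - c <= 1 by rewrite gerBl.
split.
- exact: cu'.
- rewrite -normrN -mulNr mulrCA; apply: cu' => //; rewrite mulr_ge0//; exact: le_trans x1.
- rewrite (_ : (1 - c) * m + _ = (1 - c) * m - (1 - c) * (- x * (1 - - x * m))); last by ring.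
  have : 0 <= (1 - c) * m <= 1 by apply: cu.
  have : 0 <= (1 - c) * (- x * (1 - - x * m)) <= 1 by apply: cu.
  by move=> /andP[? ?] /andP[? ?]; rewrite ler_norml; lra.
Qed.

(** Outside [[-B, B]] the bounds come from Mills' ratio, inside from continuity on a compact
    interval. The constants depend on [h], which stays fixed while the number of summands grows. As
    [f1] is both bounded and Lipschitz, the Taylor remainder has a modulus [C min(1, |u|)], the form
    that Lindeberg's condition absorbs. *)
Lemma stein_solution : exists f f1 C, [/\ 0 < C, bounded_lipschitz f,
  bounded_lipschitz f1, bounded_lipschitz (fun x => x * f x) &
  [/\ forall x y, `|f1 x - f1 y| <= C * `|x - y|,
      forall x, f1 x = x * f x + h x - c &
      taylor1 (fun u => C * Num.min 1 `|u|) f f1]].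
Proof.
have /andP[c0 c1] := normal_mean01.
have B1 : 1 <= B by rewrite /B le_max lexx.
have B0 : 0 <= B by exact: le_trans B1.
have cf : continuous f.
  move=> x; apply/differentiable_continuous/derivable1_diffP.
  exact: (@ex_derive _ _ _ _ _ _ _ (is_derive_stein_fun x)).
have [M M0 fM] : exists2 M, 0 <= M & forall x, `|x| <= B -> `|f x| <= M.
  have cnf : {within `[- B, B], continuous (fun x => `|f x|)}.
    by apply: continuous_subspaceT => x; apply: cvg_norm; exact: cf.
  have BB : - B <= B by lra.
  have [z _ zM] := EVT_max BB cnf.
  exists `|f z| => // x; rewrite ler_norml => xB.
  by apply: zM; rewrite in_itv.
pose M1 := B * (M + 2).
have M_le : M <= M1 by rewrite /M1; nra.
have BM_le : B * M <= M1 by rewrite /M1; nra.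
have M1_2 : 2 <= M1 by rewrite /M1; nra.
have f_bd x : `|f x| <= M1.
  have [xB|/ltW xB] := leP `|x| B; first by rewrite (le_trans (fM _ xB)).
  by have [H _ _] := bounds_far xB; lra.
have xf_bd x : `|x * f x| <= M1.
  have [xB|/ltW xB] := leP `|x| B.
    by rewrite normrM (le_trans _ BM_le)// ler_pM// fM.
  by have [_ H _] := bounds_far xB; lra.
have hc x : `|h x - c| <= 1.
  by have /andP[h0 h1] := h01 x; rewrite ler_norml; lra.
have f1_bd x : `|x * f x + h x - c| <= M1 + 1.
  by rewrite -addrA (le_trans (ler_normD _ _))// lerD.
pose M2 := M1 + B * (M1 + 1).
have dxf_bd x : `|f x + x * (x * f x + h x - c)| <= M2.
  have [xB|/ltW xB] := leP `|x| B.
    by rewrite (le_trans (ler_normD _ _))// lerD// normrM ler_pM.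
  by have [_ _ H] := bounds_far xB; rewrite /M2; nra.
have M2M1 : M1 + 1 <= M2 by rewrite /M2; nra.
have dxf x : is_derive x (1 : R) (fun x => x * f x) (f x + x * (x * f x + h x - c)).
  have df := is_derive_stein_fun x.
  apply: is_derive_eq; rewrite /GRing.scale /=; ring.
have fL := derivative_lipschitz is_derive_stein_fun f1_bd.
have xfL := derivative_lipschitz dxf dxf_bd.
have bl1 : bounded_lipschitz f.
  exists (M1 + 1); split; last exact: fL.
  by move=> x; rewrite (le_trans (f_bd x))// lerDl.
have bl2 : bounded_lipschitz (fun x => x * f x).
  exists M2; split; last exact: xfL.
  by move=> x; rewrite (le_trans (xf_bd x))//; lra.
have bl3 : bounded_lipschitz (fun x => x * f x + h x - c).
  by apply: blD; [exact: blD|exact: bl_cst].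
have [H [hM hL]] := h_bl.
have H0 : 0 <= H by exact: le_trans (hM 0).
pose C := 2 * (M2 + H + M1 + 1).
have f1L x y : `|(x * f x + h x - c) - (y * f y + h y - c)| <= C * `|x - y|.
  have -> : (x * f x + h x - c) - (y * f y + h y - c) =
    (x * f x - y * f y) + (h x - h y) by ring.
  rewrite (le_trans (ler_normD _ _))// (le_trans (lerD (xfL _ _) (hL _ _)))//.
  by rewrite -mulrDl ler_wpM2r// /C; lra.
exists f, (fun x => x * f x + h x - c), C; split => //; first by rewrite /C; lra.
split => // y u.
have [->|u0] := eqVneq u 0.
  by rewrite addr0 subrr mul0r subrr normr0 mul0r.
have [z yz E] : exists2 z, `|z - y| <= `|u| & f (y + u) - f y = (z * f z + h z - c) * u.
  have cfw (p q : R) : {within `[p, q], continuous f} by exact: continuous_subspaceT.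
  have [u_gt0|u_lt0|uE] := ltgtP 0 u; last by rewrite -uE eqxx in u0.
    have yu : y < y + u by rewrite ltrDl.
    have [z zI E] := MVT yu (fun z _ => is_derive_stein_fun z) (cfw _ _).
    exists z; last by rewrite E; congr (_ * _); ring.
    move: zI; rewrite in_itv/= => /andP[z1 z2].
    by rewrite [leRHS]gtr0_norm// ger0_norm; lra.
  have yu : y + u < y by rewrite gtrDl.
  have [z zI E] := MVT yu (fun z _ => is_derive_stein_fun z) (cfw _ _).
  exists z; last by rewrite -opprB E opprD addrA subrr add0r mulrN opprK.
  move: zI; rewrite in_itv/= => /andP[z1 z2].
  by rewrite [leRHS]ltr0_norm// ler0_norm; lra.
rewrite E mulrC -mulrBr normrM ler_wpM2l//.
rewrite minr_pMr; last by rewrite /C; lra.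
rewrite le_min; apply/andP; split.
  rewrite mulr1 (le_trans (ler_normB _ _))// (le_trans (lerD (f1_bd _) (f1_bd _)))//.
  by rewrite /C; lra.
rewrite (le_trans (f1L _ _))// ler_wpM2l// /C; lra.
Qed.

End stein_solution.

(** * The normal distribution function *)

Section normal_cdf.
Context {R : realType}.
Local Notation phi := (@normal_pdf R 0 1).

Definition normal_cdf (y : R) : R := \int[leb]_(x in `]-oo, y]) phi x.

Let iphi (D : set R) : measurable D -> leb.-integrable D (EFin \o phi).
Proof. by move=> mD; apply: integrableS (integrable_normal_pdf 0 1). Qed.

Lemma normal_cdfE y : (normal_cdf y)%:E = normal_prob (0 : R) 1 `]-oo, y]%classic.
Proof.
rewrite /normal_cdf /Rintegral fineK//.
by apply: integrable_fin_num; [exact: measurable_itv|exact: iphi].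
Qed.

Lemma normal_pdf_le1 x : phi x <= 1.
Proof.
rewrite (le_trans (normal_pdf_ub _ _ (oner_neq0 _)))// /normal_peak expr1n mul1r.
have p1 : 1 <= pi *+ 2 :> R by rewrite mulr2n; have := pi_ge2 R; lra.
rewrite invf_le1; last by rewrite sqrtr_gt0; lra.
by rewrite -[leLHS]sqrtr1 ler_sqrt//; lra.
Qed.

Lemma normal_cdf_lipschitz x y : x <= y ->
  0 <= normal_cdf y - normal_cdf x <= y - x.
Proof.
move=> xy; have mxy : measurable `]x, y]%classic by exact: measurable_itv.
have -> : normal_cdf y - normal_cdf x = \int[leb]_(u in `]x, y]) phi u.
  rewrite /normal_cdf (_ : `]-oo, y]%classic = `]-oo, x]%classic `|` `]x, y]%classic); last first.
    apply/seteqP; split => u /=; rewrite !in_itv/=.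
      by move=> uy; have [ux|ux] := leP u x; [left|right; rewrite uy].
    by case=> [/le_trans->//|/andP[]].
  rewrite Rintegral_setU//; first by rewrite addrAC subrr add0r.
    by apply: iphi; apply: measurableU; exact: measurable_itv.
  rewrite disj_set2E; apply/eqP/seteqP; split => u //=; rewrite !in_itv/= => -[ux /andP[xu _]].
  by move: xu; rewrite ltNge ux.
apply/andP; split; first by apply: Rintegral_ge0 => u _; exact: normal_pdf_ge0.
have leb1 : leb `]x, y]%classic = (y - x)%:E.
  rewrite lebesgue_measure_itv/= lte_fin; move: xy; rewrite le_eqVlt => /predU1P[->|->]//.
  by rewrite ltxx subrr.
rewrite -lee_fin /Rintegral fineK; last by apply: integrable_fin_num => //; exact: iphi.
rewrite -leb1 -[leRHS]mul1e -integral_cst//; apply: ge0_le_integral => //.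
- by move=> u _; rewrite lee_fin normal_pdf_ge0.
- apply/measurable_EFinP; apply: measurable_funTS; exact: measurable_normal_pdf.
- by move=> u _; rewrite lee_fin normal_pdf_le1.
Qed.

Lemma normal_prob_scale (m s x : R) : 0 < s ->
  normal_prob m s `]-oo, x]%classic = (normal_cdf ((x - m) / s))%:E.
Proof.
move=> s0; rewrite normal_cdfE /normal_prob.
have sn : s != 0 by rewrite gt_eqF.
pose F (u : R) := (u - m) / s.
have dF u : is_derive u (1 : R) F s^-1.
  rewrite /F; apply: is_derive_eq; rewrite /GRing.scale/= subr0 mulr1 mulr0 add0r//.
have F' : derive1 F = cst s^-1.
  by apply/funext => u; rewrite derive1E; exact: (@derive_val _ _ _ _ _ _ _ (dF u)).
have Fc : continuous F.
  by move=> u; apply/differentiable_continuous/derivable1_diffP; exact: (@ex_derive _ _ _ _ _ _ _ (dF u)).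
rewrite -/(F x) (increasing_ge0_integration_by_substitutionNy (F := F)); last 8 first.
- by move=> u v _ _ uv; rewrite ltr_pM2r ?invr_gt0// ltrD2r.
- by rewrite F' => u _; exact: cvg_cst.
- by rewrite F'; exact: is_cvg_cst.
- by rewrite F'; exact: cvg_cst.
- split; first by move=> u _; exact: (@ex_derive _ _ _ _ _ _ _ (dF u)).
  exact: (cvg_at_left_filter (Fc x)).
- apply/cvgrNyPle => M; near=> u.
  rewrite ler_pdivrMr// lerBlDr; near: u.
  by apply: nbhs_ninfty_le; exact: num_real.
- by apply: continuous_subspaceT; exact: continuous_normal_pdf.
- by move=> u _; exact: normal_pdf_ge0.
apply: eq_integral => u _; congr _%:E.
rewrite F' /= (normal_pdfE _ sn) (normal_pdfE _ (oner_neq0 _)) /normal_fun /normal_peak.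
rewrite !fctE subr0 expr1n mul1r.
have -> : F u ^+ 2 = (u - m) ^+ 2 / s ^+ 2 by rewrite /F exprMn exprVn.
have -> : - ((u - m) ^+ 2 / s ^+ 2) / (1 *+ 2) = - (u - m) ^+ 2 / (s ^+ 2 *+ 2).
  by rewrite -[s ^+ 2 *+ 2]mulr_natr; field.
rewrite -mulrnAr sqrtrM ?sqr_ge0// sqrtr_sqr gtr0_norm// invfM.
by rewrite [RHS]mulrAC [_ * s^-1]mulrC.
Unshelve. all: by end_near. Qed.

End normal_cdf.

(** * Lipschitz approximations of the indicator of a half-line *)

Section ramp.
Context {R : realType}.

Definition ramp (a b x : R) : R := Num.max 0 (Num.min 1 ((b - x) / (b - a))).

Lemma ramp01 a b x : 0 <= ramp a b x <= 1.
Proof. by rewrite le_max lexx/= ge_max ler01/= ge_min lexx. Qed.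

Lemma ramp_left a b x : a < b -> x <= a -> ramp a b x = 1.
Proof.
move=> ab xa; rewrite /ramp (_ : Num.min _ _ = 1) ?max_r//.
by rewrite min_l// ler_pdivlMr ?subr_gt0// mul1r lerB.
Qed.

Lemma ramp_right a b x : a < b -> b <= x -> ramp a b x = 0.
Proof.
move=> ab bx; rewrite /ramp max_l// ge_min; apply/orP; right.
by rewrite pmulr_lle0 ?invr_gt0 ?subr_gt0// subr_le0.
Qed.

Lemma bounded_lipschitz_ramp a b : a < b -> bounded_lipschitz (ramp a b).
Proof.
move=> ab; have ba : 0 < b - a by rewrite subr_gt0.
have bai : 0 < (b - a)^-1 by rewrite invr_gt0.
exists (Num.max 1 (b - a)^-1); split => [x|x z].
  by have /andP[? ?] := ramp01 a b x; rewrite ger0_norm// le_max; apply/orP; left.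
apply: (@le_trans _ _ ((b - a)^-1 * `|x - z|)); last first.
  by rewrite ler_wpM2r// le_max lexx orbT.
have -> : (b - a)^-1 * `|x - z| = `|(b - x) / (b - a) - (b - z) / (b - a)|.
  rewrite -mulrBl normrM (gtr0_norm bai) mulrC; congr (_ * _).
  by rewrite distrC; congr `|_|; ring.
rewrite /ramp; set u := _ / _; set v := _ / _.
have n1 := ler_norm (u - v).
have n2 : v - u <= `|u - v| by rewrite distrC ler_norm.
have A (p r : R) : p <= r -> 0 <= Num.max 0 (Num.min 1 r) - Num.max 0 (Num.min 1 p) <= r - p.
  move=> pr.
  have [m1 m2] : Num.min 1 p <= Num.min 1 r /\ Num.min 1 r - Num.min 1 p <= r - p.
    by rewrite /Num.min; case: (ltP 1 p); case: (ltP 1 r) => ? ?; split; lra.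
  move: m1 m2; set p' := Num.min 1 p; set r' := Num.min 1 r => m1 m2.
  by rewrite /Num.max; case: (ltP 0 p'); case: (ltP 0 r') => ? ?; apply/andP; split; lra.
have [uv|/ltW vu] := leP u v.
  by have /andP[A1 A2] := A u v uv; rewrite ler0_norm; lra.
by have /andP[A1 A2] := A v u vu; rewrite ger0_norm; lra.
Qed.

End ramp.

Lemma lmeas_rsum d (T : measurableType d) (R : realType) dS (S : measurableType dS)
    (f : S -> T -> R) : measurable_fun setT (fun sx : S * T => f sx.1 sx.2) ->
  lmeas (fun (x : S) (l : seq T) => \sum_(z <- l) f x z).
Proof.
move=> mf n; elim: n => [|n IHn].
  rewrite (_ : (fun _ => _) = cst 0); first exact: measurable_cst.
  by apply/funext => -[x t]; rewrite /= tuple0 big_nil.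
apply: (@lmeasnS _ _ _ _ _ _ _ (fun (x : S) (l : seq T) => \sum_(z <- l) f x z)).
rewrite (_ : (fun _ => _) = fun st : S * T * n.-tuple T =>
   f st.1.1 st.1.2 + \sum_(z <- st.2) f st.1.1 z); last first.
  by apply/funext => -[[x y] t]; rewrite /= big_cons.
apply: measurable_funD.
  by have := measurableT_comp mf (@measurable_fst _ _ (S * T)%type (n.-tuple T)); apply.
have mg : measurable_fun setT (fun st : S * T * n.-tuple T => (st.1.1, st.2)).
  apply: measurable_fun_pair => //.
  exact: (measurableT_comp measurable_fst measurable_fst).
exact: (measurableT_comp IHn mg).
Qed.

Lemma lmeas1_rsum d (T : measurableType d) (R : realType) (f : T -> R) :
  measurable_fun setT f -> lmeas1 (fun l : seq T => \sum_(z <- l) f z).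
Proof.
move=> mf; apply: (@lmeas_rsum _ _ _ _ _ (fun _ : unit => f)).
exact: (measurableT_comp mf measurable_snd).
Qed.

(** * Lindeberg's theorem for triangular arrays along a filter *)

Section triangular_clt.
Context d (E : measurableType d) (R : realType).
Variable mu : {sigma_finite_measure set E -> \bar R}.
Context {I : Type} (FI : set_system I) {FF : ProperFilter FI}.
Variables (D : I -> set E) (q : I -> R) (xi : I -> E -> R) (k : I -> nat) (y : I -> R) (y0 : R).

Hypothesis mD : forall i, measurable (D i).
Hypothesis muD : forall i, mu (D i) = (q i)%:E.
Hypothesis mxi : forall i, measurable_fun setT (xi i).
Hypothesis near_q : \forall i \near FI, 0 < q i.
Hypothesis koo : forall m, \forall i \near FI, (m < k i)%N.
Hypothesis near_xi : \forall i \near FI, [/\ mu.-integrable (D i) (EFin \o xi i),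
  mu.-integrable (D i) (EFin \o (fun z => xi i z ^+ 2)),
  mean mu (D i) (q i) (xi i) = 0 &
  mean mu (D i) (q i) (fun z => xi i z ^+ 2) = (k i)%:R^-1].
Hypothesis lindeberg :
  (k i)%:R * mean mu (D i) (q i) (fun z => xi i z ^+ 2 * Num.min 1 `|xi i z|) @[i --> FI] --> (0 : R).

(** The variance of a summand is [1 / k], so Stein's bound has two parts: the mean absolute value of
    one summand, at most [1 / sqrt k], and Lindeberg's quantity. *)
Lemma cvg_smooth_ramp a b : a < b ->
  iter (k i) (smooth mu (D i) (q i) (xi i)) (ramp a b) 0 @[i --> FI] -->
  \int[leb]_x (ramp a b x * normal_pdf 0 1 x).
Proof.
move=> ab.
have [f [f1 [C [C0 bf bf1 bxf [f1L f1E tf]]]]] :=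
  stein_solution (bounded_lipschitz_ramp ab) (ramp01 a b) (fun x => @ramp_left R a b x ab)
    (fun x => @ramp_right R a b x ab).
set c := Rintegral _ _ _ in f1E *.
have mw : measurable_fun setT (fun u : R => C * Num.min 1 `|u|).
  apply: measurable_funM => //; apply: measurable_minr => //; exact: measurable_normr.
have w0 (u : R) : 0 <= C * Num.min 1 `|u| by rewrite mulr_ge0 ?(ltW C0)// le_min ler01 normr_ge0.
suff H : \forall i \near FI, `|iter (k i) (smooth mu (D i) (q i) (xi i)) (ramp a b) 0 - c| <=
    C * (Num.sqrt (k i)%:R)^-1 +
    C * ((k i)%:R * mean mu (D i) (q i) (fun z => xi i z ^+ 2 * Num.min 1 `|xi i z|)).
  have H0 : iter (k i) (smooth mu (D i) (q i) (xi i)) (ramp a b) 0 - c @[i --> FI] --> (0 : R).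
    apply: lim_norm0 H _.
    suff K : (Num.sqrt (k i)%:R)^-1 @[i --> FI] --> (0 : R).
      by have /(_ _ _) := lim_add (lim_scale C K) (lim_scale C lindeberg); rewrite !mulr0 addr0; exact.
    apply/cvgr0Pnorm_le => e e0; have e20 : 0 < e ^- 2 by rewrite invr_gt0 exprn_gt0.
    apply: filterS (koo (Num.truncn (e ^- 2))) => i ki.
    have : e ^- 2 <= (k i)%:R.
      by rewrite (le_trans (ltW (truncnS_gt _)))// ler_nat.
    move=> H1; have k0 : 0 < (k i)%:R :> R by exact: lt_le_trans H1.
    rewrite ger0_norm ?invr_ge0 ?sqrtr_ge0// -[leRHS]invrK lef_pV2 ?posrE ?invr_gt0 ?sqrtr_gt0//.
    by rewrite -[leLHS]gtr0_norm ?invr_gt0// -sqrtr_sqr exprVn ler_sqrt.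
  have /(_ _ _) := lim_add H0 (cvg_cst c); rewrite add0r; apply: lim_eq.
  by apply: nearW => i; rewrite subrK.
apply: filterS3 near_q near_xi (koo 0) => i qi [ixi ixi2 mxi0 mxi2] ki.
case: (k i) ki mxi2 => // k' _ mxi2.
have k0 : 0 < k'.+1%:R :> R by [].
have iw : mu.-integrable (D i) (EFin \o (fun z => xi i z ^+ 2 * (C * Num.min 1 `|xi i z|))).
  apply: (@integrable_le _ _ _ _ _ _ (fun z => C * xi i z ^+ 2)) => //.
  - apply: measurable_funTS; apply: measurable_funM; first exact: measurable_funX.
    exact: (measurableT_comp mw (mxi i)).
  - exact: integrableZR.
  - move=> z _; have z0 : 0 <= xi i z ^+ 2 * (C * Num.min 1 `|xi i z|).
      by rewrite mulr_ge0 ?sqr_ge0.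
    rewrite (ger0_norm z0) mulrCA ler_pM2l//.
    by rewrite ler_piMr ?sqr_ge0// ge_min lexx.
have s2k : (k'.+1%:R)^-1 * k'.+1%:R = 1 :> R by rewrite mulVf.
set rho := C * mean mu (D i) (q i) (fun z => xi i z ^+ 2 * Num.min 1 `|xi i z|).
have iw' : mu.-integrable (D i) (EFin \o (fun z => xi i z ^+ 2 * Num.min 1 `|xi i z|)).
  have := @integrableZR _ _ _ mu _ (mD i) C^-1 _ iw.
  apply: eq_integrable => // z _ /=.
  by rewrite (mulrCA _ C) mulKf// gt_eqF.
have wm : mean mu (D i) (q i) (fun z => xi i z ^+ 2 * (C * Num.min 1 `|xi i z|)) <= rho.
  rewrite (_ : (fun z => _) = (fun z => C * (xi i z ^+ 2 * Num.min 1 `|xi i z|))).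
    by rewrite /rho /mean RintegralZl// mulrCA.
  by apply/funext => z; rewrite mulrCA.
have := @stein_clt _ _ _ mu (D i) (q i) (xi i) (mD i) (muD i) qi (mxi i) f f1
   (fun u => C * Num.min 1 `|u|) k'.+1%:R^-1 rho ixi mxi0 ixi2 mxi2 iw wm
   (ramp a b) c C k' s2k bf bf1 tf f1L bxf (bounded_lipschitz_ramp ab) f1E.
move=> /le_trans; apply; apply: lerD; last by rewrite /rho mulrCA.
rewrite ler_pM2l//.
set sk := Num.sqrt k'.+1%:R.
have sk0 : 0 < sk by rewrite sqrtr_gt0.
have sk2 : sk ^+ 2 = k'.+1%:R by rewrite sqr_sqrtr// ltW.
have ik : mu.-integrable (D i) (EFin \o (fun _ : E => sk^-1)).
  by apply: (@integrable_bounded _ _ _ mu (D i) (q i) (mD i) (muD i) _ `|sk^-1|).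
have i2 := integrableZR (mD i) sk ixi2.
have i3 := integrableZR (mD i) 2^-1 (integrableDR (mD i) i2 ik).
(* AM-GM instead of the Cauchy-Schwarz inequality; with [sk] the square root of [k] both terms have
   mean [1 / sk]. *)
apply: (@le_trans _ _ (mean mu (D i) (q i) (fun z => 2^-1 * (sk * xi i z ^+ 2 + sk^-1)))).
  apply: (le_mean (mD i) qi) => //.
  - by have := integrable_norm ixi; apply: eq_integrable.
  - move=> z; rewrite -subr_ge0.
    have -> : 2^-1 * (sk * xi i z ^+ 2 + sk^-1) - `|xi i z| = 2^-1 * sk^-1 * (sk * `|xi i z| - 1) ^+ 2.
      by rewrite -[xi i z ^+ 2]real_normK ?num_real//; field; rewrite gt_eqF.
    by rewrite mulr_ge0 ?sqr_ge0// mulr_ge0// invr_ge0 ltW.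
rewrite /mean RintegralZl//; last exact: integrableDR.
rewrite RintegralD// RintegralZl// Rintegral_cst//.
move: mxi2; rewrite /mean => mxi2.
have -> : \int[mu]_(x in D i) (xi i x ^+ 2) = q i * k'.+1%:R^-1.
  by rewrite -mxi2 mulVKf// gt_eqF.
have -> : fine (mu (D i)) = q i by have := muD i => /= ->.
rewrite -sk2.
by rewrite le_eqVlt; apply/orP; left; apply/eqP; field; rewrite !gt_eqF.
Qed.

Lemma ramp_mean (a b : R) : a < b ->
  normal_cdf a <= \int[leb]_x (ramp a b x * normal_pdf 0 1 x) <= normal_cdf b.
Proof.
move=> ab.
have iphi (A : set R) : measurable A -> leb.-integrable A (EFin \o normal_pdf 0 1).
  by move=> mA; apply: integrableS (integrable_normal_pdf 0 1).
have mr : measurable_fun setT (ramp a b).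
  exact: (bounded_lipschitz_measurable (bounded_lipschitz_ramp ab)).
have ir (A : set R) : measurable A -> leb.-integrable A (EFin \o (fun x => ramp a b x * normal_pdf 0 1 x)).
  move=> mA; apply: (@integrable_le _ (measurableTypeR R) R leb A _ (normal_pdf 0 1)) => //.
  - apply: measurable_funTS; apply: measurable_funM => //; exact: measurable_normal_pdf.
  - exact: iphi.
  - move=> x _; have /andP[r0 r1] := ramp01 a b x.
    by rewrite ger0_norm ?mulr_ge0 ?normal_pdf_ge0// ler_piMl ?normal_pdf_ge0.
have r_ge0 x : 0 <= ramp a b x * normal_pdf 0 1 x.
  by rewrite mulr_ge0 ?normal_pdf_ge0//; have /andP[] := ramp01 a b x.
have fin (A : set R) (f : R -> R) : measurable A -> leb.-integrable A (EFin \o f) ->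
   (\int[leb]_(x in A) f x)%:E = (\int[leb]_(x in A) (f x)%:E)%E.
  by move=> mA iA; rewrite /Rintegral fineK//; exact: integrable_fin_num.
rewrite -!lee_fin /normal_cdf !fin//; [|exact: iphi|exact: ir|exact: iphi].
apply/andP; split.
  apply: (@le_trans _ _ (\int[leb]_(x in `]-oo, a]) (ramp a b x * normal_pdf 0 1 x)%:E)%E).
    rewrite le_eqVlt; apply/orP; left; apply/eqP; apply: eq_integral => x.
    by rewrite inE/= in_itv/= => xa; rewrite ramp_left// mul1r.
  apply: ge0_subset_integral => //.
    by apply/measurable_EFinP; apply: measurable_funM => //; exact: measurable_normal_pdf.
  by move=> x _; rewrite lee_fin.
rewrite [leRHS]integral_mkcond; apply: ge0_le_integral => //.
- by move=> x _; rewrite lee_fin.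
- by apply/measurable_EFinP; apply: measurable_funM => //; exact: measurable_normal_pdf.
- apply/(measurable_restrictT _ (measurable_itv _)); apply/measurable_EFinP.
  apply: measurable_funTS; exact: measurable_normal_pdf.
- move=> x _; rewrite patchE; case: ifPn => [_|].
    rewrite lee_fin ler_piMl ?normal_pdf_ge0//; by have /andP[] := ramp01 a b x.
  rewrite notin_setE/= in_itv/= => /negP; rewrite -ltNge => bx.
  by rewrite ramp_right ?(ltW bx)// mul0r.
Qed.

(** The indicator is squeezed between two ramps kept at distance [t = e / 8] from [y0], which leaves
    room for [y i] to be only close to [y0]. The normal distribution function being 1-Lipschitz,
    each ramp costs at most [2 * t]. *)
Theorem cvg_iter_int_cdf : y i @[i --> FI] --> y0 ->
  fine (iter_int mu (D i) (k i) (fun l => ((\sum_(z <- l) xi i z <= y i)%R%:R : R)%:E))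
    / q i ^+ k i @[i --> FI] --> normal_cdf y0.
Proof.
move=> yy0; apply/cvgrPdist_le => e e0.
pose t := e / 8; have t0 : 0 < t by rewrite divr_gt0.
have ab1 : y0 - 2 * t < y0 - t by rewrite /t; lra.
have ab2 : y0 + t < y0 + 2 * t by rewrite /t; lra.
have e2 : 0 < e / 2 by rewrite divr_gt0.
have /cvgrPdist_le/(_ _ e2) H1 := cvg_smooth_ramp ab1.
have /cvgrPdist_le/(_ _ e2) H2 := cvg_smooth_ramp ab2.
have /cvgrPdist_le/(_ _ t0) Hy := yy0.
apply: filterS3 (filterI H1 H2) Hy near_q => i [{}H1 {}H2] {}Hy qi.
move: Hy; rewrite distrC ler_norml => /andP[y1 y2].
have qk : 0 < q i ^+ k i by rewrite exprn_gt0.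
set g := fun l : seq E => _.
have bl1 := bounded_lipschitz_ramp ab1; have bl2 := bounded_lipschitz_ramp ab2.
have mS := lmeas1_rsum (mxi i).
have mg : lmeas1 g.
  move=> n; apply/measurable_EFinP.
  have mh : measurable_fun setT (fun c : bool => c%:R : R) by [].
  apply: (measurableT_comp mh); apply: measurable_fun_ler => //; exact: mS.
have mr a b : a < b -> lmeas1 (fun l => (ramp a b (0 + \sum_(z <- l) xi i z))%:E).
  move=> ab n; apply/measurable_EFinP.
  have := measurableT_comp (bounded_lipschitz_measurable (bounded_lipschitz_ramp ab)) (mS n).
  by under [X in _ -> measurable_fun _ X]eq_fun do rewrite add0r.
have r0 a b x : (0 <= (ramp a b x)%:E)%E by rewrite lee_fin; have /andP[] := ramp01 a b x.
have g0 l : (0 <= g l)%E by rewrite lee_fin.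
have S1 : (iter_int mu (D i) (k i) g <= (q i ^+ k i * iter (k i) (smooth mu (D i) (q i) (xi i)) (ramp (y0 + t) (y0 + 2 * t)) 0)%:E)%E.
  rewrite -(iter_int_smooth (mD i) (muD i) qi (mxi i))//; last by move=> x; have /andP[] := ramp01 (y0 + t) (y0 + 2 * t) x.
  apply: le_iter_int => //; first exact: mr.
  move=> l _ _; rewrite add0r lee_fin /g; have /andP[h0 h1] := ramp01 (y0 + t) (y0 + 2 * t) (\sum_(z <- l) xi i z).
  have [Sy|Sy] := leP (\sum_(z <- l) xi i z) (y i); last exact: h0.
  by rewrite ramp_left//; lra.
have S2 : ((q i ^+ k i * iter (k i) (smooth mu (D i) (q i) (xi i)) (ramp (y0 - 2 * t) (y0 - t)) 0)%:E <= iter_int mu (D i) (k i) g)%E.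
  rewrite -(iter_int_smooth (mD i) (muD i) qi (mxi i))//; last by move=> x; have /andP[] := ramp01 (y0 - 2 * t) (y0 - t) x.
  apply: le_iter_int => //; first exact: mr.
  move=> l _ _; rewrite add0r lee_fin /g; have /andP[h0 h1] := ramp01 (y0 - 2 * t) (y0 - t) (\sum_(z <- l) xi i z).
  have [Sy|Sy] := leP (\sum_(z <- l) xi i z) (y i); first exact: h1.
  by rewrite ramp_right//; lra.
have fi : iter_int mu (D i) (k i) g \is a fin_num.
  rewrite ge0_fin_numE ?iter_int_ge0//; exact: le_lt_trans S1 (ltry _).
rewrite -(fineK fi) lee_fin in S1; rewrite -(fineK fi) lee_fin in S2.
move: S1 S2; set P := fine _; rewrite mulrC => S1; rewrite mulrC => S2.
have P1 : P / q i ^+ k i <= iter (k i) (smooth mu (D i) (q i) (xi i)) (ramp (y0 + t) (y0 + 2 * t)) 0.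
  by rewrite ler_pdivrMr.
have P2 : iter (k i) (smooth mu (D i) (q i) (xi i)) (ramp (y0 - 2 * t) (y0 - t)) 0 <= P / q i ^+ k i.
  by rewrite ler_pdivlMr.
have /andP[_ C1] := ramp_mean ab2; have /andP[C2 _] := ramp_mean ab1.
have yt1 : y0 - 2 * t <= y0 by lra.
have yt2 : y0 <= y0 + 2 * t by lra.
have /andP[_ N1] := normal_cdf_lipschitz yt1; have /andP[_ N2] := normal_cdf_lipschitz yt2.
move: H1 H2; rewrite !ler_norml => /andP[? ?] /andP[? ?].
have te : 8 * t = e by rewrite /t; field.
by apply/andP; split; lra.
Qed.

End triangular_clt.

(** * Dominated convergence at infinity and uniform convergence for regular variation *)

Section real_limits.
Context {R : realType}.
Local Notation leb := (@lebesgue_measure R).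

Lemma nonincreasing_in_measurable (D : set R) (f : R -> R) : is_interval D ->
  (forall s t, D s -> D t -> s <= t -> f t <= f s) -> measurable_fun D f.
Proof.
move=> iD f_ni.
apply: (measurability (@RGenCInfty.G R)) => [|/= _ [_] [r] -> <-].
  exact: RGenCInfty.measurableE.
apply: is_interval_measurable => s t /= [Ds fs] [Dt ft] u /andP[su ut].
have Du : D u by apply: (iD _ _ Ds Dt); rewrite su.
by split => //; move: ft; rewrite !in_itv/= !andbT => /le_trans; apply; exact: f_ni.
Qed.

Lemma nondecreasing_in_measurable (D : set R) (f : R -> R) : is_interval D ->
  (forall s t, D s -> D t -> s <= t -> f s <= f t) -> measurable_fun D f.
Proof.
move=> iD f_nd; rewrite -(opprK f); apply/measurable_funN.
by apply: nonincreasing_in_measurable => // s t Ds Dt st; rewrite lerN2 f_nd.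
Qed.

Lemma dominated_cvg_pinfty d (T : measurableType d)
    (mu : {measure set T -> \bar R}) (D : set T) (f : R -> T -> R)
    (l g : T -> R) (t0 : R) : measurable D ->
  (forall t, t0 <= t -> measurable_fun D (f t)) ->
  (forall u, D u -> f t u @[t --> +oo] --> l u) ->
  mu.-integrable D (EFin \o g) ->
  (forall t u, t0 <= t -> D u -> `|f t u| <= g u) ->
  \int[mu]_(u in D) f t u @[t --> +oo] --> \int[mu]_(u in D) l u.
Proof.
move=> mD mf fl ig fg; apply/cvg_pinftyP => s sy.
pose v n := Num.max (s n) t0.
have vy : v n @[n --> \oo] --> +oo.
  apply/cvgryPge => A; move/cvgryPge : sy => /(_ A); apply: filterS => n.
  by rewrite le_max => ->.
have mfv n : measurable_fun D (fun u => (f (v n) u)%:E).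
  by apply/measurable_EFinP/mf; rewrite /v le_max lexx orbT.
have flv u : D u -> (f (v n) u)%:E @[n --> \oo] --> (l u)%:E.
  move=> Du; apply: cvg_EFin; first exact: nearW.
  exact: (cvg_comp _ _ vy (fl u Du)).
have fgv n u : D u -> (`|(f (v n) u)%:E| <= (EFin \o g) u)%E.
  by move=> Du; rewrite /= lee_fin; apply: fg => //; rewrite /v le_max lexx orbT.
have ml : measurable_fun D (EFin \o l) by exact: (emeasurable_fun_cvg _ _ mfv flv).
have [il _] : [/\ mu.-integrable D (EFin \o l), True &
    \int[mu]_(u in D) (f (v n) u)%:E @[n --> \oo] --> \int[mu]_(u in D) (l u)%:E]%E.
  have [] := dominated_convergence mD mfv ml (aeW _ flv) ig (aeW _ (fun x n => fgv n x)).
  by split.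
have fin := integrable_fin_num mD il.
rewrite -[(\int[mu]_(u in D) (l u)%:E)%E](fineK fin) => /fine_cvg.
apply: cvg_trans; apply: near_eq_cvg.
have := sy => /cvgryPge/(_ t0); apply: filterS => n t0s /=.
by rewrite /v (max_idPl t0s).
Qed.

Lemma lebesgue_measure_shift (x : R) (A : set R) : measurable A ->
  leb [set y | A (y + x)] = leb A.
Proof.
move=> mA.
have H : pushforward leb (fun y : measurableTypeR R => (y + x : measurableTypeR R)) A = leb A; last exact: H.
apply/esym/lebesgue_measure_unique => //=; first exact: measurable_funD.
move=> _ _ [[a b]] _ <-.
rewrite /pushforward.
have -> : (fun y : measurableTypeR R => (y + x : measurableTypeR R)) @^-1` `]a, b] = `]a - x, b - x]%classic.
  by apply/seteqP; split => y /=; rewrite !in_itv/= ltrBlDr lerBrDr.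
rewrite !lebesgue_measure_itv/= !lte_fin ltrD2r; case: ifP => // _.
by rewrite -!EFinB; congr _%:E; ring.
Qed.

Lemma ge0_integral_shift (x : R) (A : set R) (f : R -> \bar R) : measurable A ->
  measurable_fun A f -> (forall y, A y -> (0 <= f y)%E) ->
  (\int[leb]_(y in [set y | A (y + x)%R]) f (y + x)%R = \int[leb]_(y in A) f y)%E.
Proof.
move=> mA mf f0.
pose sh (y : measurableTypeR R) : measurableTypeR R := y + x.
have ms : measurable_fun setT sh by exact: measurable_funD.
have := @ge0_integral_pushforward _ _ _ _ _ _ ms leb A f mA mf.
move=> /(_ _)/wrap[]; first by move=> y /set_mem; exact: f0.
move=> <-; apply/esym; apply: eq_measure_integral => B mB _.
exact/esym/lebesgue_measure_shift.
Qed.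

Local Notation I12 := (`[(1 : R), 2]%classic).
Local Notation I02 := (`[(0 : R), 2]%classic).

(* The uniform convergence theorem for regularly varying functions, in
   additive notation. Two sets of nearly full measure, one of them shifted by
   [x], must intersect. *)
Lemma uniform_convergence_rv (l : R -> R) (y0 tau : R) : tau < 0 ->
  measurable_fun `[y0, +oo[ l ->
  (forall x, l (y + x) / l y @[y --> +oo] --> expR (tau * x)) ->
  forall e, 0 < e -> exists Y, forall y x, Y <= y -> 0 <= x <= 1 ->
    `|l (y + x) / l y - expR (tau * x)| <= e.
Proof.
move=> tau0 ml lrv e e0.
have E2 : 0 < expR (tau * 2) by exact: expR_gt0.
(* If two ratios are known up to [dl], their quotient is known up to [2 dl / (expR (tau * 2) - dl)];
   this [dl] makes that bound equal to [e]. *)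
pose dl := e * expR (tau * 2) / (2 + e).
have dl0 : 0 < dl by rewrite divr_gt0 ?mulr_gt0// addr_gt0.
have dlE : dl * (2 + e) = e * expR (tau * 2) by rewrite /dl divfK// gt_eqF// addr_gt0.
pose bad (y x : R) := dl < `|l (y + x) / l y - expR (tau * x)|.
pose f (y x : R) : R := (bad y x)%:R.
have mbad y : y0 <= y -> measurable_fun I02 (f y).
  move=> y0y.
  have mly : measurable_fun I02 (fun x => l (y + x)).
    apply: (measurable_comp (F := `[y0, +oo[%classic)) => //.
      move=> _ /= [z zI <-]; move: zI; rewrite !in_itv/= => /andP[z0 _].
      by rewrite andbT (le_trans y0y)// lerDl.
    exact: measurable_funD.
  rewrite /f /bad.
  have mg : measurable_fun I02 (fun x => `|l (y + x) / l y - expR (tau * x)|).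
    apply: measurableT_comp => //; apply: measurable_funB.
      by apply: measurable_funM.
    by apply: measurable_funTS; apply: measurableT_comp.
  have mB : measurable (I02 `&` [set x | dl < `|l (y + x) / l y - expR (tau * x)|]).
    have := mg (measurable_itv _) `]dl, +oo[%classic (measurable_itv _).
    congr measurable; apply/seteqP; split => x /= [xI H]; split => //; move: H.
      by rewrite in_itv/= andbT.
    by rewrite in_itv/= andbT.
  have := @measurable_indic _ _ R I02 _ mB.
  apply: eq_measurable_fun => x; rewrite inE => xI.
  rewrite indicE; congr (nat_of_bool _)%:R.
  by apply/idP/idP; rewrite inE; [case|move=> ?; split].
have int1 (D : set R) : measurable D -> (leb D < +oo)%E -> leb.-integrable D (EFin \o (fun _ => 1 : R)).
  move=> mD Doo; apply/integrableP; split; first exact: measurable_cst.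
  by under eq_integral do rewrite /= normr1; rewrite integral_cst// mul1e.
have cvgbad : \int[leb]_(x in I02) f y x @[y --> +oo] --> (0 : R).
  have := @dominated_cvg_pinfty _ _ leb I02 f (fun _ => 0) (fun _ => 1) y0.
  rewrite Rintegral_cst// mul0r; apply => //.
  - move=> x _; apply: cvg_near_cst.
    have /cvgrPdist_le/(_ dl dl0) := lrv x.
    apply: filterS => y; rewrite distrC => H.
    by rewrite /f /bad ltNge H.
  - apply: int1 => //; rewrite lebesgue_measure_itv/= lte_fin.
    by case: ifP; rewrite ?ltry.
  - by move=> y x _ _; rewrite /f; case: (bad _ _); rewrite ?normr1 ?normr0.
have q4 : 0 < 4^-1 :> R by rewrite invr_gt0.
have /cvgr0Pnorm_le/(_ _ q4)[Y [_ HY]] := cvgbad.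
exists (Num.max (Y + 1) y0) => y x; rewrite ge_max => /andP[Yy y0y] /andP[x0 x1].
have Yy' : Y < y by rewrite (lt_le_trans _ Yy)// ltrDl.
have Yyx : Y < y + x by rewrite (lt_le_trans Yy')// lerDl.
(* Each bad set has measure at most 1/4, so together they cannot cover [[1, 2]]; the shifted point
   [z - x] stays in [[0, 2]]. Both ratios then have the numerator [l (y + z)], which cancels in
   their quotient. *)
have [z /= zI [z1 z2]] : exists2 z, 1 <= z <= 2 & ~~ bad y z /\ ~~ bad (y + x) (z - x).
  apply: contrapT => H.
  have H' z : 1 <= z <= 2 -> 1 <= f y z + f (y + x) (z - x).
    move=> zI; have /negP : ~ (~~ bad y z && ~~ bad (y + x) (z - x)).
      by move=> /andP[? ?]; apply: H; exists z.
    by rewrite negb_and !negbK /f => /orP[] ->; rewrite ?lerDl ?lerDr// ler0n.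
  have i02 y' : y0 <= y' -> leb.-integrable I02 (EFin \o f y').
    move=> y0y'; apply: (le_integrable _ _ _ (@int1 I02 _ _)) => //.
    - by apply/measurable_EFinP; apply: mbad.
    - by move=> z _; rewrite /= lee_fin /f normr1; case: (bad _ _); rewrite ?normr1 ?normr0.
    - rewrite lebesgue_measure_itv/= lte_fin.
      by case: ifP; rewrite ?ltry.
  have I1 : (\int[leb]_(z in I12) (f y z)%:E <= (4^-1)%:E)%E.
    apply: (@le_trans _ _ (\int[leb]_(z in I02) (f y z)%:E)%E).
      apply: ge0_subset_integral => //.
      - by apply/measurable_EFinP; apply: mbad.
      - by move=> z _; rewrite lee_fin /f ler0n.
      - by apply: subset_itvr; rewrite bnd_simp.
    rewrite -[leLHS]fineK ?lee_fin; last exact: (integrable_fin_num _ (i02 _ y0y)).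
    by have := HY y Yy'; apply: le_trans; exact: ler_norm.
  have mf2 : measurable_fun [set z | I02 (z - x)] (fun z => (f (y + x) (z - x))%:E).
    apply/measurable_EFinP.
    apply: (measurable_comp (F := I02)) => //.
    - by move=> _ [z /= zI <-].
    - by apply: mbad; rewrite (le_trans y0y)// lerDl.
    - exact: measurable_funB.
  have s12 : I12 `<=` [set z | I02 (z - x)].
    by move=> z /=; rewrite !in_itv/= => /andP[? ?]; lra.
  have m12 : measurable [set z | I02 (z - x)].
    have -> : [set z | I02 (z - x)] = `[x, 2 + x]%classic.
      by apply/seteqP; split => z /=; rewrite !in_itv/= subr_ge0 lerBlDr.
    exact: measurable_itv.
  have I2 : (\int[leb]_(z in I12) (f (y + x) (z - x))%:E <= (4^-1)%:E)%E.
    have y0yx : y0 <= y + x by rewrite (le_trans y0y)// lerDl.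
    pose S : set R := [set z | I02 (z - x)].
    apply: (@le_trans _ _ (\int[leb]_(z in S) (f (y + x) (z - x))%:E)%E).
      apply: ge0_subset_integral => //.
      by move=> z _; rewrite lee_fin /f ler0n.
    rewrite (@ge0_integral_shift (- x) I02 (fun z => (f (y + x) z)%:E))//; last 2 first.
      by apply/measurable_EFinP; apply: mbad.
      by move=> z _; rewrite lee_fin /f ler0n.
    rewrite -[leLHS]fineK ?lee_fin; last exact: (integrable_fin_num _ (i02 _ y0yx)).
    by have := HY (y + x) Yyx; apply: le_trans; exact: ler_norm.
  have I3 : (1 <= \int[leb]_(z in I12) ((f y z)%:E + (f (y + x) (z - x))%:E))%E.
    apply: (@le_trans _ _ (\int[leb]_(z in I12) (1 : R)%:E)%E).
      have L12 : leb I12 = 1%E.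
        rewrite lebesgue_measure_itv/= lte_fin ifT ?ltr1n// -EFinB.
        by congr _%:E; ring.
      by rewrite integral_cst// mul1e -[X in (X <= _)%E]L12.
    apply: ge0_le_integral => //.
    - apply: emeasurable_funD; last exact: measurable_funS mf2.
      apply: (measurable_funS (E := I02)) => //; last by apply/measurable_EFinP; apply: mbad.
      by apply: subset_itvr; rewrite bnd_simp.
  move: I3; rewrite ge0_integralD//; last 4 first.
  - by move=> z _; rewrite lee_fin /f ler0n.
  - apply: (measurable_funS (E := I02)) => //; last by apply/measurable_EFinP; apply: mbad.
    by apply: subset_itvr; rewrite bnd_simp.
  - by move=> z _; rewrite lee_fin /f ler0n.
  - exact: measurable_funS mf2.
  apply/negP; rewrite -ltNge (le_lt_trans (leeD I1 I2))// -EFinD lte_fin; lra.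
move: z1 z2; rewrite /bad -!leNgt addrA addrAC addrK.
set ly := l y; set lz := l (y + z); set lx := l (y + x) => z1 z2.
have tx0 : expR (tau * x) <= 1 by rewrite -[leRHS]expR0 ler_expR; nra.
have tx1 : 0 < expR (tau * x) by exact: expR_gt0.
have tzx : expR (tau * 2) <= expR (tau * (z - x)).
  by rewrite ler_expR; case/andP: zI => ? ?; nra.
have EE : expR (tau * z) = expR (tau * (z - x)) * expR (tau * x).
  by rewrite -expRD; congr expR; ring.
have dlE2 : 0 < expR (tau * 2) - dl.
  have : 0 < e * (expR (tau * 2) - dl) by rewrite mulrBr -dlE; nra.
  by rewrite pmulr_rgt0.
have q0 : expR (tau * 2) - dl <= lz / lx.
  by move: z2; rewrite ler_norml => /andP[z2 _]; lra.
have qgt0 : 0 < lz / lx by exact: lt_le_trans q0.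
have lx0 : lx != 0 by apply: contraTneq qgt0 => ->; rewrite invr0 mulr0 ltxx.
have pE : lz / ly = (lz / lx) * (lx / ly) by rewrite mulrA divfK.
rewrite pE EE in z1.
have K1 : (lz / lx) * `|lx / ly - expR (tau * x)| <= 2 * dl.
  rewrite -[X in X * _](ger0_norm (ltW qgt0)) -normrM.
  have -> : lz / lx * (lx / ly - expR (tau * x)) =
    (lz / lx * (lx / ly) - expR (tau * (z - x)) * expR (tau * x)) -
    (lz / lx - expR (tau * (z - x))) * expR (tau * x) by ring.
  rewrite (le_trans (ler_normB _ _))// mulr_natl mulr2n lerD//.
  by rewrite normrM [X in _ * X]gtr0_norm// (le_trans (ler_piMr _ tx0)).
rewrite -(ler_pM2l dlE2) (le_trans (ler_wpM2r (normr_ge0 _) q0))//.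
by rewrite (le_trans K1)// mulrBl [expR _ * e]mulrC -dlE; nra.
Qed.

End real_limits.

(** * The tail quantile function of a continuous distribution function *)

Section quantile.
Context {R : realType}.
Variable F : R -> R.
Hypothesis F_nd : {homo F : x y / x <= y}.
Hypothesis F_cont : continuous F.
Hypothesis F_lt1 : forall x, F x < 1.
Hypothesis F_0 : forall x, x <= 0 -> F x = 0.
Hypothesis F_1 : F x @[x --> +oo] --> (1 : R).
Local Notation U := (tail_quantile F).

Lemma F_ge0 x : 0 <= F x.
Proof.
have [x0|x0] := leP x 0; first by rewrite F_0.
by rewrite -(F_0 (lexx 0)) F_nd// ltW.
Qed.

Lemma one_minus_inv t : 1 < t -> 0 < 1 - t^-1 < (1 : R).
Proof.
move=> t1; have t0 : 0 < t by exact: lt_trans t1.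
by rewrite subr_gt0 invf_lt1// t1 gtrBl invr_gt0.
Qed.

Let S t := [set x | 1 - t^-1 <= F x].

Let S_ne t : 1 < t -> S t !=set0.
Proof.
move=> /one_minus_inv/andP[_ s1].
have e0 : 0 < t^-1 by move: s1; rewrite gtrBl.
have /cvgrPdist_le/(_ _ e0)[M [_ HM]] := F_1.
exists (M + 1); have := HM (M + 1); rewrite ltrDl ltr01 => /(_ isT).
by rewrite ler_norml => /andP[_ H]; rewrite /S /=; lra.
Qed.

Let S_lb t : 1 < t -> lbound (S t) 0.
Proof.
move=> /one_minus_inv/andP[s0 _] x; rewrite /S /= => sx.
rewrite leNgt; apply/negP => x0; move: sx; rewrite F_0 ?(ltW x0)//.
by rewrite leNgt s0.
Qed.

Let S_inf t : 1 < t -> has_inf (S t).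
Proof. by move=> t1; split; [exact: S_ne|exists 0; exact: S_lb]. Qed.

Lemma tail_quantile_ge0 t : 1 < t -> 0 <= U t.
Proof.
by move=> t1; apply: lb_le_inf; [exact: S_ne|exact: S_lb].
Qed.

(** Continuity makes the generalized inverse an exact one: a value of [F] above or below the level
    at the infimum would persist in a neighbourhood. *)
Lemma survival_tail_quantile t : 1 < t -> survival F (U t) = t^-1.
Proof.
move=> t1; rewrite /survival.
suff -> : F (U t) = 1 - t^-1 by rewrite opprB addrC subrK.
apply/eqP; rewrite eq_le; apply/andP; split.
  rewrite leNgt; apply/negP => FU.
  have e0 : 0 < F (U t) - (1 - t^-1) by rewrite subr_gt0.
  have /cvgrPdist_lt/(_ _ e0)/nbhs_ballP[dl /= dl0 H] := @F_cont (U t).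
  have : F (U t - dl / 2) > 1 - t^-1.
    have := H (U t - dl / 2); rewrite /ball/= opprB addrC subrK.
    rewrite gtr0_norm ?divr_gt0//.
    have dl2 : dl / 2 < dl by rewrite ltr_pdivrMr// mulr_natr mulr2n ltrDl.
    by move=> /(_ dl2); rewrite ltr_norml => /andP[_]; lra.
  move=> /ltW H1; have : U t <= U t - dl / 2.
    by apply: ge_inf => //; exists 0; exact: S_lb.
  by rewrite leNgt gtrBl divr_gt0.
rewrite leNgt; apply/negP => FU.
have e0 : 0 < (1 - t^-1) - F (U t) by rewrite subr_gt0.
have /cvgrPdist_lt/(_ _ e0)/nbhs_ballP[dl /= dl0 H] := @F_cont (U t).
have [x Sx xU] := inf_adherent dl0 (S_inf t1).
have Ux : U t <= x by apply: ge_inf => //; exists 0; exact: S_lb.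
have := H x; rewrite /ball/= distrC ger0_norm ?subr_ge0// ltrBlDl => /(_ xU).
rewrite ltr_norml => /andP[+ _].
by move: Sx; rewrite /S /=; lra.
Qed.

Lemma tail_quantile_le t x : 1 < t -> (U t <= x) = (1 - t^-1 <= F x).
Proof.
move=> t1; apply/idP/idP => H.
  have := survival_tail_quantile t1; rewrite /survival => E.
  by rewrite -E opprB addrC subrK F_nd.
by apply: ge_inf => //; exists 0; exact: S_lb.
Qed.

Lemma tail_quantile_gt0 t : 1 < t -> 0 < U t.
Proof.
move=> t1; rewrite lt_neqAle tail_quantile_ge0// andbT eq_sym.
apply/eqP => U0; have := survival_tail_quantile t1.
rewrite U0 /survival F_0// subr0 => /esym/eqP.
by rewrite invr_eq1 => /eqP tE; rewrite tE ltxx in t1.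
Qed.

Lemma tail_quantile_nd s t : 1 < s -> s <= t -> U s <= U t.
Proof.
move=> s1 st; have t1 : 1 < t by exact: lt_le_trans st.
rewrite tail_quantile_le//.
have := survival_tail_quantile t1; rewrite /survival => E.
have -> : F (U t) = 1 - t^-1 by rewrite -E opprB addrC subrK.
rewrite lerB// lef_pV2// posrE; exact: lt_trans ltr01 _.
Qed.

Lemma cvg_tail_quantile : U t @[t --> +oo] --> +oo.
Proof.
apply/cvgryPgt => A; near=> t.
have t1 : 1 < t by near: t; apply: nbhs_pinfty_gt; exact: num_real.
rewrite ltNge tail_quantile_le// -ltNge.
have : (1 - F A)^-1 < t by near: t; apply: nbhs_pinfty_gt; exact: num_real.
have H1 : 0 < 1 - F A by rewrite subr_gt0.
rewrite ltrBrDr -ltrBrDl => H.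
rewrite -[X in _ < X]invrK ltf_pV2// posrE ?invr_gt0//.
Unshelve. all: by end_near. Qed.

End quantile.

(** * Integrals over a tail in uniform coordinates *)

Section tail_law.
Context {R : realType}.
Local Notation leb := (@lebesgue_measure R).
Variable mX : probability (measurableTypeR R) R.

Definition law_cdf (x : R) : R := fine (mX `]-oo, x]%classic).
Local Notation F := law_cdf.
Hypothesis F_cont : continuous F.
Hypothesis F_lt1 : forall x, F x < 1.
Hypothesis F_0 : forall x, x <= 0 -> F x = 0.

Lemma law_cdf_nd : {homo F : x y / x <= y}.
Proof.
move=> x y xy; rewrite /F fine_le ?fin_num_measure//.
by apply: le_measure; rewrite ?inE//; apply: subset_itvl; rewrite bnd_simp.
Qed.

Lemma law_tail x : mX `]x, +oo[%classic = (survival F x)%:E.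
Proof.
have -> : `]x, +oo[%classic = ~` `]-oo, x]%classic by rewrite setCitvl.
by rewrite probability_setC// /survival /F EFinB fineK// fin_num_measure.
Qed.

Hypothesis F_1 : F x @[x --> +oo] --> (1 : R).
Local Notation U := (tail_quantile F).
Local Notation I01 := (`](0 : R), 1[%classic).

Let F_nd := law_cdf_nd.

Lemma measure_rays_unique (m1 m2 : {measure set (measurableTypeR R) -> \bar R}) :
  (forall x, m1 `]x, +oo[%classic < +oo)%E ->
  (forall x, m1 `]x, +oo[%classic = m2 `]x, +oo[%classic) ->
  forall A, measurable A -> m1 A = m2 A.
Proof.
move=> m1oo m12 A mA.
apply: (@measure_unique _ _ (measurableTypeR R) (@RGenOInfty.G R)
  (fun n : nat => `](- n%:R : R), +oo[%classic)) => //.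
- exact: RGenOInfty.measurableE.
- move=> _ _ [x ->] [y ->]; exists (Num.max x y).
  apply/seteqP; split => z /=; rewrite !in_itv/= !andbT gt_max.
    by move=> [-> ->].
  by move=> /andP[].
- by move=> n; exists (- n%:R).
- apply/seteqP; split => // x _; exists (Num.truncn `|x|).+1 => //=.
  rewrite in_itv/= andbT ltrNl (le_lt_trans (ler_norm _))// normrN.
  by rewrite truncnS_gt.
- by move=> _ [x ->].
Qed.

Lemma measurable_tail_quantile t : 1 < t ->
  measurable_fun I01 (fun u => U (t / u)).
Proof.
move=> t1; apply: nonincreasing_in_measurable.
  exact: interval_is_interval.
move=> s u /=; rewrite !in_itv/= => /andP[s0 s1] /andP[u0 u1] su.
have t0 : 0 < t by exact: lt_trans t1.
apply: tail_quantile_nd => //; rewrite ?F_nd//.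
  by rewrite ltr_pdivlMr// mul1r (lt_trans u1).
by rewrite ler_pM2l// lef_pV2.
Qed.

Lemma gt_tail_quantile t u x : 1 < t -> 0 < u <= 1 -> (x < U (t / u)) = (u < t * survival F x).
Proof.
move=> t1 /andP[u0 u1]; have t0 : 0 < t by exact: lt_trans t1.
have tu1 : 1 < t / u by rewrite ltr_pdivlMr// mul1r (le_lt_trans u1).
rewrite ltNge tail_quantile_le// ?F_nd// -ltNge invf_div ltrBrDr -ltrBrDl.
by rewrite ltr_pdivrMr// mulrC.
Qed.

(** Beyond [U t], which has probability [t^-1], the variable is distributed as [U (t / u)] with [u]
    uniform. Both sides are measures of the part beyond [U t], and they agree on rays. *)
Lemma integral_tail_law t (f : R -> \bar R) : 1 < t -> measurable_fun setT f ->
  (forall x, (0 <= f x)%E) ->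
  (\int[mX]_(x in `]U t, +oo[) f x =
   (t^-1)%:E * \int[leb]_(u in I01) f (U (t / u)))%E.
Proof.
move=> t1 mf f0; have t0 : 0 < t by exact: lt_trans t1.
have U0 : 0 <= U t by exact: tail_quantile_ge0.
(* Outside []0, 1[] the map takes the default value 0, which is not in the open ray because [U t] is
   nonnegative. *)
pose q (u : measurableTypeR R) : measurableTypeR R := ((fun u => U (t / u)) \_ I01) u.
have mq : measurable_fun setT q.
  by apply/(measurable_restrictT _ (measurable_itv _)); exact: measurable_tail_quantile.
have ti0 : 0 <= t^-1 by rewrite invr_ge0 ltW.
have mD : measurable (`]U t, +oo[%classic : set (measurableTypeR R)) by exact: measurable_itv.
have qD (A : set R) : A `<=` `]U t, +oo[%classic ->
    q @^-1` A = [set u | I01 u /\ A (U (t / u))].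
  move=> AD; apply/seteqP; split => u /=.
    rewrite /q patchE; case: ifPn => [/set_mem//|_ /AD].
    by rewrite /= in_itv/= andbT ltNge U0.
  by move=> [uI Au]; rewrite /q patchE mem_set.
have Ut : survival F (U t) = t^-1 by exact: survival_tail_quantile.
have qray x : U t <= x -> q @^-1` `]x, +oo[%classic = `]0, t * survival F x[%classic.
  move=> xs; rewrite qD; last by apply: subset_itvr; rewrite bnd_simp.
  have tF1 : t * survival F x <= 1.
    have : survival F x <= t^-1 by rewrite -Ut /survival lerB// F_nd.
    by move=> H; rewrite mulrC -ler_pdivlMr// div1r.
  apply/seteqP; split => u /=; rewrite !in_itv/= andbT.
    by move=> [/andP[u0 u1]]; rewrite gt_tail_quantile// ?u0 ?(ltW u1).
  move=> /andP[u0 ux]; have u1 := lt_le_trans ux tF1.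
  by rewrite u0 u1 gt_tail_quantile// u0 ltW.
have qDE : q @^-1` `]U t, +oo[%classic = I01.
  by rewrite qray// Ut divff// gt_eqF.
have Fs0 x : 0 <= t * survival F x by rewrite mulr_ge0 ?(ltW t0)// subr_ge0 ltW.
have leb0 (x : R) : 0 <= x -> leb `]0, x[%classic = x%:E.
  move=> x0; rewrite lebesgue_measure_itv/= lte_fin sube0.
  move: x0; rewrite le_eqVlt => /predU1P[<-|->//]; by rewrite ltxx.
pose pq : {measure set (measurableTypeR R) -> \bar R} :=
  [the {measure set (measurableTypeR R) -> \bar R} of pushforward leb q].
have key A : measurable A -> A `<=` `]U t, +oo[%classic ->
    mX A = ((t^-1)%:E * leb (q @^-1` A))%E.
  move=> mA AD.
  pose m2 : {measure set (measurableTypeR R) -> \bar R} :=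
    [the {measure set (measurableTypeR R) -> \bar R} of mrestr (mscale (NngNum ti0) (pq mq)) mD].
  pose m1 : {measure set (measurableTypeR R) -> \bar R} :=
    [the {measure set (measurableTypeR R) -> \bar R} of mrestr mX mD].
  have H : m1 A = m2 A.
    apply: measure_rays_unique => // [x|x]; rewrite /m1 /m2 /= /mrestr.
      rewrite (le_lt_trans (probability_le1 _ _)) ?ltry//.
      by apply: measurableI; exact: measurable_itv.
    have -> : (`]x, +oo[%classic `&` `]U t, +oo[%classic : set R) = `]Num.max x (U t), +oo[%classic.
      apply/seteqP; split => z /=; rewrite !in_itv/= !andbT gt_max.
        by move=> [-> ->].
      by move=> /andP[].
    have mU : U t <= Num.max x (U t) by rewrite le_max lexx orbT.
    rewrite /mscale /pq /= /pushforward qray// leb0// law_tail -EFinM mulKf//.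
    by rewrite gt_eqF.
  have : mrestr mX mD A = mrestr (mscale (NngNum ti0) (pq mq)) mD A by exact: H.
  by rewrite /mrestr (setIidl AD).
transitivity (\int[mscale (NngNum ti0) (pq mq)]_(x in `]U t, +oo[) f x)%E.
  apply: eq_measure_integral => A mA AD.
  exact: (key A mA AD).
rewrite ge0_integral_mscale//; last exact: measurable_funTS.
congr (_ * _)%E.
rewrite (ge0_integral_pushforward mq)//; last 1 first.
- exact: measurable_funTS.
rewrite qDE; apply: eq_integral => u uI.
by rewrite /= /q patchE uI.
Qed.

End tail_law.

(** * Second-order regular variation of the tail quantile function *)

Section second_order.
Context {R : realType}.
Variables (U A : R -> R) (gamma tau : R).
Hypothesis tau_lt0 : tau < 0.
Hypothesis U_gt0 : forall t, 1 < t -> 0 < U t.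
Hypothesis U_nd : forall s t, 1 < s -> s <= t -> U s <= U t.
Hypothesis A0 : A t @[t --> +oo] --> (0 : R).
Hypothesis hU : second_order_condition U gamma tau A.

(** The logarithm of the slowly varying factor of [U]; in terms of it the second-order condition
    becomes additive. *)
Definition log_slow t := ln (U t) - gamma * ln t.
Local Notation h := log_slow.

Lemma ln1D_bound (z : R) : `|z| <= 2^-1 -> `|ln (1 + z) - z| <= 2 * z ^+ 2.
Proof.
move=> z2; have z2' : - 2^-1 <= z <= 2^-1 by rewrite -ler_norml.
have /andP[z3 z4] := z2'.
have p0 : 0 < 1 + z by lra.
have H1 : ln (1 + z) <= z by apply: le_ln1Dx; lra.
have H2 : - ln (1 + z) <= (1 + z)^-1 - 1.
  rewrite -lnV ?posrE//.
  have -> : (1 + z)^-1 = 1 + ((1 + z)^-1 - 1) by rewrite subrKC.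
  rewrite (le_trans (le_ln1Dx _))//; last by rewrite addrAC subrr add0r.
  by rewrite ltrBrDr addNr invr_gt0.
have H3 : (1 + z)^-1 - 1 = - z + z ^+ 2 / (1 + z) by field; rewrite gt_eqF.
have H4 : z ^+ 2 / (1 + z) <= 2 * z ^+ 2.
  by rewrite ler_pdivrMr//; nra.
by rewrite ler_norml; apply/andP; split; [nra|nra].
Qed.

Lemma near_pinfty_gt (c : R) : \forall t \near +oo, c < t.
Proof. by apply: nbhs_pinfty_gt; exact: num_real. Qed.

Lemma cvg_mulr_pinfty (x : R) : 0 < x -> t * x @[t --> +oo] --> +oo.
Proof. by move=> x0; apply: (gt0_cvgMly x0); exact: cvg_id. Qed.

Lemma second_order_slope_gt0 : 0 < (2 `^ tau - 1) / tau.
Proof.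
rewrite nmulr_lgt0 ?invr_lt0// subr_lt0.
rewrite /powR ifF ?pnatr_eq0// -[X in _ < X]expR0 ltr_expR.
by rewrite nmulr_rlt0// ln_gt0// ltr1n.
Qed.

(** Division by 0 gives 0, so at a zero of [A] the quotient of the second-order condition vanishes,
    whereas for [x = 2] its limit is positive. *)
Lemma auxiliary_neq0 : \forall t \near +oo, A t != 0.
Proof.
have c0 := second_order_slope_gt0.
have l0 : 0 < 2 `^ gamma * ((2 `^ tau - 1) / tau) by rewrite mulr_gt0// powR_gt0.
have /cvgrPdist_lt/(_ _ l0) := hU (ltr0n R 2).
apply: filterS => t; apply: contraPneq => ->.
by rewrite invr0 mulr0 subr0 gtr0_norm// ltxx.
Qed.

(** The relative increment [z] is of the order of [A], which tends to 0, so replacing [ln (1 + z)]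
    by [z] costs [z ^+ 2], negligible against [A]. *)
Lemma cvg_log_slow x : 0 < x ->
  (h (t * x) - h t) / A t @[t --> +oo] --> (x `^ tau - 1) / tau.
Proof.
move=> x0; have xg0 : 0 < x `^ gamma by exact: powR_gt0.
have c_x := (hU x0).
pose z t := U (t * x) / (U t * x `^ gamma) - 1.
have zA : z t / A t @[t --> +oo] --> (x `^ tau - 1) / tau.
  have -> : (x `^ tau - 1) / tau = (x `^ gamma)^-1 * (x `^ gamma * ((x `^ tau - 1) / tau)).
    by rewrite mulKf// gt_eqF.
  have /(_ _) := cvgMl_tmp (a := (x `^ gamma)^-1) c_x.
  apply: cvg_trans; apply: near_eq_cvg.
  apply: filterS (near_pinfty_gt 1) => t t1.
  rewrite /z mulrA; congr (_ / _); field.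
  by rewrite !gt_eqF// U_gt0.
have zA2 : 2 * (z t / A t) ^+ 2 * `|A t| @[t --> +oo] --> (0 : R).
  rewrite -[X in _ --> X](mulr0 (2 * ((x `^ tau - 1) / tau) ^+ 2)).
  apply: cvgM; last by have /(_ _) := cvg_norm A0; rewrite normr0; exact.
  apply: cvgMl_tmp; exact: (cvgM zA zA).
have z0 : z t @[t --> +oo] --> (0 : R).
  have /(_ _ _) := cvgM zA A0; rewrite mulr0; apply: cvg_trans; apply: near_eq_cvg.
  by apply: filterS auxiliary_neq0 => t At /=; rewrite divfK.
have : (h (t * x) - h t) / A t - z t / A t @[t --> +oo] --> (0 : R).
  apply/cvgr0Pnorm_le => e e0.
  have /cvgr0Pnorm_le/(_ _ e0) := zA2.
  have i2 : 0 < 2^-1 :> R by [].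
  have /cvgr0Pnorm_le/(_ _ i2) := z0.
  have tx1 : \forall t \near +oo, 1 < t * x.
    have /cvgryPgt := cvg_mulr_pinfty x0; apply; exact: num_real.
  apply: filterS3 (filterI auxiliary_neq0 (filterI tx1 (near_pinfty_gt 1))) => t [At [t1x t1]] zt Ht.
  have t0 : 0 < t by exact: lt_trans t1.
  have -> : h (t * x) - h t = ln (1 + z t).
    rewrite /z subrKC /h lnM ?posrE// ln_div ?posrE ?mulr_gt0 ?U_gt0//.
    by rewrite lnM ?posrE ?U_gt0// ln_powR; ring.
  rewrite -mulrBl normrM normfV.
  rewrite (le_trans _ (le_trans (ler_norm _) Ht))//.
  rewrite ler_pdivrMr ?normr_gt0// (le_trans (ln1D_bound zt))//.
  rewrite -[leRHS]mulrA -expr2 real_normK ?num_real//.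
  by rewrite -mulrA -exprMn divfK.
move=> H; have /(_ _ _) := cvgD H zA; rewrite add0r.
by apply: cvg_trans; apply: near_eq_cvg; apply: nearW => t /=; rewrite subrK.
Qed.

(** The increment over a doubling is asymptotically proportional to [A], hence regularly varying
    with index [tau]. It is also measurable, because [U] is monotone, which is not known of [A]; the
    uniform convergence theorem is therefore applied to it. *)
Definition slow_step t := h (t * 2) - h t.
Local Notation a := slow_step.
Let c0 := (2 `^ tau - 1) / tau.

Lemma cvg_slow_step x : 0 < x -> a (t * x) / A t @[t --> +oo] --> x `^ tau * c0.
Proof.
move=> x0; have x2 : 0 < x * 2 by rewrite mulr_gt0.
have /(_ _) := cvgB (cvg_log_slow x2) (cvg_log_slow x0).
have -> : ((x * 2) `^ tau - 1) / tau - (x `^ tau - 1) / tau = x `^ tau * c0.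
  rewrite powRM ?(ltW x0)// /c0; field; exact: ltr0_neq0.
apply: cvg_trans; apply: near_eq_cvg; apply: nearW => t /=.
by rewrite !fctE /a -mulrBl mulrA; congr (_ / _); ring.
Qed.

Lemma cvg_slow_step1 : a t / A t @[t --> +oo] --> c0.
Proof.
have := cvg_slow_step ltr01; rewrite powR1 mul1r.
by under eq_cvg do rewrite mulr1.
Qed.

Lemma slow_step_neq0 : \forall t \near +oo, a t != 0.
Proof.
have l0 := second_order_slope_gt0.
have /cvgrPdist_lt/(_ _ l0) := cvg_slow_step1.
apply: filterS => t; apply: contraPneq => ->.
by rewrite mul0r subr0 gtr0_norm// ltxx.
Qed.

Lemma cvg_slow_step_ratio x : 0 < x -> a (t * x) / a t @[t --> +oo] --> x `^ tau.
Proof.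
move=> x0; have c00 : c0 != 0 by rewrite gt_eqF// second_order_slope_gt0.
have /(_ _ _) := cvgM (cvg_slow_step x0) (cvgV c00 cvg_slow_step1).
rewrite mulfK//; apply: cvg_trans; apply: near_eq_cvg.
apply: filterS2 slow_step_neq0 auxiliary_neq0 => t at0 At0 /=.
by rewrite invf_div mulrA divfK.
Qed.

Lemma cvg_expR_pinfty : expR y @[y --> +oo] --> (+oo : set_system R).
Proof.
apply/cvgryPge => M; near=> y.
have : M <= y by near: y; apply: nbhs_pinfty_ge; exact: num_real.
move=> /le_trans; apply; rewrite (le_trans _ (expR_ge1Dx y))// lerDr.
by [].
Unshelve. all: by end_near. Qed.

Lemma measurable_log_slow_exp : measurable_fun `[(1 : R), +oo[ (fun y => h (expR y)).
Proof.
rewrite /h; apply: measurable_funB.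
  apply: nondecreasing_in_measurable; first exact: interval_is_interval.
  move=> s t /=; rewrite !in_itv/= !andbT => s1 t1 st.
  have es1 : 1 < expR s by rewrite -[X in X < _]expR0 ltr_expR (lt_le_trans ltr01).
  by rewrite ler_ln ?posrE ?U_gt0 ?U_nd ?ler_expR//; rewrite (lt_le_trans es1)// ler_expR.
apply: measurable_funM => //; apply: measurable_funTS.
rewrite (_ : (fun x => _) = id); [exact: measurable_id|by apply/funext => y; rewrite expRK].
Qed.

Lemma slow_step_uniform : forall e, 0 < e -> exists Y, forall t y, Y <= t ->
  0 <= y <= 1 -> `|a (t * expR y) / a t - expR (tau * y)| <= e.
Proof.
move=> e e0.
have mh2 : measurable_fun `[(1 : R), +oo[ (fun y => a (expR y)).
  rewrite /a; apply: measurable_funB; last exact: measurable_log_slow_exp.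
  have -> : (fun y => h (expR y * 2)) = (fun y => h (expR y)) \o (fun y => y + ln 2).
    by apply/funext => y; rewrite /= expRD lnK ?posrE.
  apply: (measurable_comp (F := `[(1 : R), +oo[%classic)) => //.
  - move=> _ /= [y yI <-]; move: yI; rewrite !in_itv/= !andbT => y1.
    by rewrite (le_trans y1)// lerDl ln_ge0// ler1n.
  - exact: measurable_log_slow_exp.
  - exact: measurable_funD.
have rv x : a (expR (y + x)) / a (expR y) @[y --> +oo] --> expR (tau * x).
  have := cvg_comp _ _ cvg_expR_pinfty (cvg_slow_step_ratio (expR_gt0 x)).
  rewrite /powR gt_eqF ?expR_gt0// expRK; apply: cvg_trans.
  by apply: near_eq_cvg; apply: nearW => y /=; rewrite expRD.
have [Y HY] := uniform_convergence_rv tau_lt0 mh2 rv e0.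
exists (expR Y) => t y Yt yI.
have t0 : 0 < t by rewrite (lt_le_trans (expR_gt0 Y)).
have := HY (ln t) y; rewrite expRD lnK ?posrE//; apply => //.
by rewrite -[Y]expRK ler_ln ?posrE ?expR_gt0.
Qed.

Lemma slow_step_regular : exists T rho, [/\ 1 < T, 0 < rho < 1 &
  forall t, T <= t -> [/\ a t != 0, `|a (t * 2)| <= rho * `|a t| &
    forall y, 0 <= y <= 1 -> `|a (t * expR y)| <= 2 * `|a t|]].
Proof.
have c1 : 2 `^ tau < 1 :> R.
  rewrite /powR ifF ?pnatr_eq0// -[X in _ < X]expR0 ltr_expR.
  by rewrite nmulr_rlt0// ln_gt0// ltr1n.
have c2 : 0 < 2 `^ tau :> R by exact: powR_gt0.
pose e := (1 - 2 `^ tau) / 2.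
have e0 : 0 < e by rewrite /e; lra.
have [Y HY] := slow_step_uniform e0.
have [T0 [_ HT0]] := slow_step_neq0.
exists (Num.max (Num.max Y 2) (T0 + 1)), (2 `^ tau + e); split.
- by rewrite !lt_max ltr1n orbT.
- by rewrite /e; apply/andP; split; lra.
move=> t; rewrite !ge_max => /andP[/andP[Yt t2] Tt].
have at0 : a t != 0 by apply: HT0; rewrite (lt_le_trans _ Tt)// ltrDl.
have ap : 0 < `|a t| by rewrite normr_gt0.
have ratio y : 0 <= y <= 1 -> `|a (t * expR y)| <= (expR (tau * y) + e) * `|a t|.
  move=> yI; rewrite -ler_pdivrMr// -normfV -normrM.
  have := HY t y Yt yI; rewrite ler_norml => /andP[H1 H2].
  have := expR_gt0 (tau * y); rewrite ler_norml => ep.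
  by apply/andP; split; lra.
split => //.
  have l2 : 0 <= ln (2 : R) <= 1.
    rewrite ln_ge0 ?ler1n//=; have := @le_ln1Dx R 1; rewrite -[1 + 1]/(2 : R).
    by apply; lra.
  have := ratio _ l2; rewrite lnK ?posrE//.
  by rewrite /powR ifF ?pnatr_eq0.
move=> y yI; rewrite (le_trans (ratio _ yI))// ler_wpM2r//.
have : expR (tau * y) <= 1.
  by rewrite expR_le1 nmulr_rle0//; case/andP: yI.
by rewrite /e; lra.
Qed.

(** Along [t * 2 ^+ j] the steps decrease geometrically, so their sum is controlled by the first.
    For a factor [w] in [[1, 2]] the difference [h (t * w) - h t] is carried along the two dyadic
    chains to [t * 2 ^+ j], where it tends to 0. *)
Lemma log_slow_dyadic : exists T C, [/\ 1 < T, 0 < C & forall t, T <= t -> a t != 0 /\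
  forall x, 1 <= x -> `|h (t * x) - h t| <= C * `|a t|].
Proof.
have [T [rho [T1 /andP[rho0 rho1] HT]]] := slow_step_regular.
have r0 : 0 < 1 - rho by lra.
have T0 : 0 < T by lra.
have le2 t j : T <= t -> T <= t * 2 ^+ j.
  move=> Tt; rewrite (le_trans Tt)// ler_peMr//; first lra.
  by rewrite exprn_ege1// ler1n.
have geo t j : T <= t -> `|a (t * 2 ^+ j)| <= rho ^+ j * `|a t|.
  move=> Tt; elim: j => [|j IHj]; first by rewrite !expr0 mulr1 mul1r.
  have [_ H _] := HT _ (le2 _ j Tt).
  rewrite exprSr mulrA (le_trans H)// exprS -mulrA ler_wpM2l//.
  exact: ltW.
pose C := (1 - rho)^-1; have C0 : 0 < C by rewrite invr_gt0.
have dy t j : T <= t -> `|h (t * 2 ^+ j) - h t| <= C * `|a t|.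
  move=> Tt.
  have : `|h (t * 2 ^+ j) - h t| <= (1 - rho ^+ j) * C * `|a t|.
    elim: j => [|j IHj]; first by rewrite !expr0 mulr1 !subrr normr0 !mul0r.
    have -> : h (t * 2 ^+ j.+1) - h t = a (t * 2 ^+ j) + (h (t * 2 ^+ j) - h t).
      by rewrite /a exprSr mulrA; ring.
    rewrite (le_trans (ler_normD _ _))// (le_trans (lerD (geo t j Tt) IHj))//.
    rewrite -mulrDl ler_wpM2r// le_eqVlt; apply/orP; left; apply/eqP.
    by rewrite /C exprS; field; rewrite gt_eqF.
  move=> /le_trans; apply; rewrite ler_wpM2r// ler_piMl ?(ltW C0)//.
  by rewrite gerBl exprn_ge0// ltW.
have mid w : 1 <= w -> forall t, T <= t -> h (t * 2 ^+ j * w) - h (t * 2 ^+ j) @[j --> \oo] --> (0 : R).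
  move=> w1 t Tt; have w0 : 0 < w by exact: lt_le_trans w1.
  have l2 : t * 2 ^+ j @[j --> \oo] --> +oo.
    apply/cvgryPge => M; exists (Num.truncn `|M|).+1 => // j /= Mj.
    rewrite (le_trans (ler_norm M))// (le_trans (ltW (truncnS_gt _)))//.
    rewrite (@le_trans _ _ (2 ^+ j))//; last by rewrite ler_peMl// ?exprn_ge0//; lra.
    by rewrite -natrX ler_nat (leq_trans Mj)// ltnW// ltn_expl.
  have /(_ _ _) := lim_mul (cvg_log_slow w0) A0; rewrite mulr0 => H.
  have {}H : h (s * w) - h s @[s --> +oo] --> (0 : R).
    by apply: lim_eq H; apply: filterS auxiliary_neq0 => s As; rewrite divfK.
  exact: (cvg_comp _ _ l2 H).
(* [3 * C] for a factor [w] in [[1, 2]], and [2 * C] for the dyadic chain started at [t * w], where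
   the step is at most doubled. *)
exists T, (5 * C); split => // [|t Tt]; first lra.
have [at0 _ _] := HT _ Tt; split => //.
have short w : 1 <= w <= 2 -> `|h (t * w) - h t| <= 3 * C * `|a t|.
  move=> /andP[w1 w2]; have w0 : 0 < w by exact: lt_le_trans w1.
  have Ttw : T <= t * w by rewrite (le_trans Tt)// ler_peMr//; lra.
  have aw : `|a (t * w)| <= 2 * `|a t|.
    have [_ _ /(_ (ln w))] := HT _ Tt; rewrite lnK ?posrE//; apply.
    rewrite ln_ge0//= (le_trans _ (_ : ln 2 <= 1))//; first by rewrite ler_ln ?posrE.
    by have := @le_ln1Dx R 1; rewrite -[1 + 1]/(2 : R); apply; lra.
  apply/ler_addgt0Pr => e e0.
  have /cvgr0Pnorm_le/(_ _ e0)[j _ /(_ j (leqnn j)) Hj] := mid w w1 t Tt.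
  have H1 := dy _ j Ttw; have H2 := dy _ j Tt.
  have -> : h (t * w) - h t = - (h (t * w * 2 ^+ j) - h (t * w)) +
     (h (t * 2 ^+ j * w) - h (t * 2 ^+ j)) + (h (t * 2 ^+ j) - h t).
    by rewrite [t * w * _]mulrAC; ring.
  rewrite (le_trans (ler_normD _ _))// addrC.
  rewrite (le_trans (lerD H2 (ler_normD _ _)))// normrN.
  rewrite (le_trans (lerD (lexx _) (lerD H1 Hj)))//.
  have : C * `|a (t * w)| <= C * (2 * `|a t|) by rewrite ler_wpM2l// ltW.
  by set u := `|a t|; lra.
move=> x x1; have x0 : 0 < x by exact: lt_le_trans x1.
have [j [w [w12 ->]]] : exists j w, 1 <= w <= 2 /\ x = w * 2 ^+ j.
  have [N xN] : exists N, x < 2 ^+ N :> R.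
    exists (Num.truncn x).+1; rewrite (lt_le_trans (truncnS_gt x))//.
    by rewrite -natrX ler_nat ltnW// ltn_expl.
  elim: N x x1 x0 xN => [|N IHN] x x1 x0 xN.
    by move: xN; rewrite expr0 ltNge x1.
  have [x2|x2] := lerP x 2; first by exists 0%N, x; rewrite x1 x2 mulr1.
  have [|||j [w [w12 xw]]] := IHN (x / 2).
  - by rewrite ler_pdivlMr//; lra.
  - by rewrite divr_gt0.
  - by rewrite ltr_pdivrMr// -exprSr.
  by exists j.+1, w; split => //; rewrite exprSr mulrA -xw divfK.
have /andP[w1 w2] := w12.
have Ttw : T <= t * w by rewrite (le_trans Tt)// ler_peMr//; lra.
have aw : `|a (t * w)| <= 2 * `|a t|.
  have w0 : 0 < w by exact: lt_le_trans w1.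
  have [_ _ /(_ (ln w))] := HT _ Tt; rewrite lnK ?posrE//; apply.
  rewrite ln_ge0//= (le_trans _ (_ : ln 2 <= 1))//; first by rewrite ler_ln ?posrE.
  by have := @le_ln1Dx R 1; rewrite -[1 + 1]/(2 : R); apply; lra.
have -> : h (t * (w * 2 ^+ j)) - h t = (h (t * w * 2 ^+ j) - h (t * w)) + (h (t * w) - h t).
  by rewrite mulrA; ring.
rewrite (le_trans (ler_normD _ _))// (le_trans (lerD (dy _ j Ttw) (short w w12)))//.
have : C * `|a (t * w)| <= C * (2 * `|a t|) by rewrite ler_wpM2l// ltW.
by set u := `|a t|; lra.
Qed.

(** The dominating bound for the bias. As [tau] is negative the dyadic increments are summable, so
    the bound is uniform in [x], without any power of [x]. *)
Lemma log_slow_bound : exists C, 0 < C /\ \forall t \near +oo,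
  [/\ 1 < t, A t != 0 & forall x, 1 <= x -> `|h (t * x) - h t| <= C * `|A t|].
Proof.
have [T [C [T1 C0 HT]]] := log_slow_dyadic.
have c00 := second_order_slope_gt0.
exists (C * (2 * c0)); split; first by rewrite mulr_gt0// mulr_gt0.
have /cvgrPdist_le/(_ _ c00) := cvg_slow_step1.
apply: filterS2 (filterI (near_pinfty_gt T) auxiliary_neq0) => t [Tt At0] cA.
split => // [|x x1]; first lra.
have [_ /(_ x x1)] := HT t (ltW Tt); move=> /le_trans; apply.
rewrite -mulrA ler_wpM2l ?(ltW C0)// -ler_pdivrMr ?normr_gt0//.
rewrite -normfV -normrM.
have -> : a t / A t = c0 - (c0 - a t / A t) by ring.
rewrite (_ : 2 * c0 = c0 + c0); last by ring.
by rewrite (le_trans (ler_normB _ _))// (ger0_norm (ltW c00)) lerD2l.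
Qed.

(** Regular variation speaks of a fixed ratio of arguments; here the ratio itself tends to 1, which
    calls for the uniform convergence of [slow_step]. The result transfers [A] from the
    deterministic level of a sample size to any likely threshold. *)
Lemma auxiliary_continuity (I : Type) (FI : set_system I) {FF : Filter FI} (s t : I -> R) :
  t i @[i --> FI] --> +oo -> s i / t i @[i --> FI] --> (1 : R) ->
  A (s i) / A (t i) @[i --> FI] --> (1 : R).
Proof.
move=> too st1.
have c00 : c0 != 0 by rewrite gt_eqF// second_order_slope_gt0.
have soo : s i @[i --> FI] --> +oo.
  apply/cvgryPge => M.
  have H1 : \forall i \near FI, 2^-1 <= s i / t i.
    by apply: cvgr_ge st1 _ _; lra.
  have /cvgryPge/(_ (2 * `|M| + 1)) := too.
  apply: filterS2 H1 => i H1 H2.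
  have t0 : 0 < t i by rewrite (lt_le_trans _ H2)// ltr_wpDl// mulr_ge0.
  move: H1; rewrite ler_pdivlMr// => H1.
  by have := ler_norm M; lra.
have cs := cvg_comp _ _ soo cvg_slow_step1.
have ct := cvg_comp _ _ too cvg_slow_step1.
have Ns : \forall i \near FI, A (s i) != 0 by exact: (soo _ auxiliary_neq0).
have Nt : \forall i \near FI, A (t i) != 0 by exact: (too _ auxiliary_neq0).
have ns' : \forall i \near FI, a (s i) != 0 by exact: (soo _ slow_step_neq0).
have nt' : \forall i \near FI, a (t i) != 0 by exact: (too _ slow_step_neq0).
suff H : a (s i) / a (t i) @[i --> FI] --> (1 : R).
  have /(_ _ _ _) := lim_mul (lim_mul (lim_inv c00 cs) H) ct; rewrite /= mulr1 mulVf//.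
  apply: lim_eq; apply: filterS2 (filterI Ns Nt) (filterI ns' nt') => i [Asi Ati] [asi ati] /=.
  by field; rewrite Asi Ati asi ati.
apply/cvgrPdist_le => e e0.
have d0 : 0 < Num.min e 1 / 4 by rewrite divr_gt0// lt_min e0 ltr01.
set d := Num.min e 1 / 4 in d0.
have de : d <= e / 4 by rewrite ler_pM2r ?invr_gt0// ge_min lexx.
have d1 : d <= 1 / 4 by rewrite ler_pM2r ?invr_gt0// ge_min lexx orbT.
have [Y HY] := slow_step_uniform d0.
have key u v : Y <= u -> 0 < u -> 1 <= v / u <= expR (Num.min 1 (d / - tau)) -> `|a v / a u - 1| <= 2 * d.
  move=> Yu u0 /andP[vu1 vu2]; have v0 : 0 < v / u by lra.
  have yI : 0 <= ln (v / u) <= Num.min 1 (d / - tau).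
    rewrite ln_ge0//= -[leRHS]expRK ler_ln ?posrE// ?expR_gt0//.
  have := HY u (ln (v / u)) Yu.
  rewrite lnK ?posrE// [u * _]mulrC divfK ?gt_eqF//.
  case/andP: yI => y0; rewrite le_min => /andP[y1 y2].
  rewrite y0 y1 => /(_ isT) H.
  have -> : a v / a u - 1 = (a v / a u - expR (tau * ln (v / u))) + (expR (tau * ln (v / u)) - 1) by ring.
  rewrite (_ : 2 * d = d + d); last by ring.
  rewrite (le_trans (ler_normD _ _))// lerD//.
  have ty : - d <= tau * ln (v / u).
    by move: y2; rewrite ler_pdivlMr ?oppr_gt0//; lra.
  have := expR_ge1Dx (tau * ln (v / u)).
  have : expR (tau * ln (v / u)) <= 1 by rewrite expR_le1 nmulr_rle0.
  by move=> e1 e2; rewrite ler0_norm; lra.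
set b := Num.min 1 (d / - tau) in key.
have b0 : 0 < b by rewrite lt_min ltr01 divr_gt0// oppr_gt0.
have eb : 1 < expR b by rewrite -[X in X < _]expR0 ltr_expR.
have H1 : \forall i \near FI, s i / t i <= expR b by apply: cvgr_le st1 _ _.
have H2 : \forall i \near FI, expR (- b) <= s i / t i.
  by apply: cvgr_ge st1 _ _; rewrite -[ltRHS]expR0 ltr_expR oppr_lt0.
have /cvgryPge/(_ (Num.max Y 1)) Ht := too.
have /cvgryPge/(_ (Num.max Y 1)) Hs := soo.
apply: filterS3 (filterI H1 H2) (filterI Ht Hs) (filterI ns' nt') => i [{}H1 {}H2].
rewrite /setI /= !ge_max => -[/andP[Yt t1] /andP[Ys s1]] [as0 at0].
have t0 : 0 < t i by lra.
have s0 : 0 < s i by lra.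
have [st|st] := leP (t i) (s i).
  rewrite distrC (le_trans (key (t i) (s i) _ _ _))//; last lra.
  by rewrite H1 andbT ler_pdivlMr// mul1r.
have := key (s i) (t i) Ys s0; rewrite ler_pdivlMr// mul1r (ltW st)/=.
rewrite -[t i / s i]invf_div -[expR b]invrK -expRN lef_pV2 ?posrE ?expR_gt0 ?divr_gt0//.
move=> /(_ H2) H.
rewrite -[a (s i) / _]invf_div; move: H; set z := a (t i) / a (s i).
have z0 : z != 0 by rewrite mulf_neq0// invr_neq0.
rewrite ler_norml => /andP[z1 z2].
have zp : 2^-1 <= z by lra.
have -> : 1 - z^-1 = (z - 1) / z by field.
have zp' : 0 < z by lra.
rewrite normrM normfV (gtr0_norm zp') ler_pdivrMr//.
by rewrite ler_norml; apply/andP; split; nra.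
Qed.

End second_order.

(** * Integrals of powers and logarithms over the unit interval *)

Section power_log_integrals.
Context {R : realType}.
Local Notation I01 := (`](0 : R), 1[%classic).

Lemma ge0_FTC_oc (f F : R -> R) (l : R) :
  (forall x, 0 < x <= 1 -> 0 <= f x) ->
  (forall x, 0 < x -> {for x, continuous f}) ->
  (forall x : R, 0 < x -> is_derive x 1 F (f x)) ->
  F x @[x --> 0^'+] --> l ->
  (\int[leb]_(x in I01) (f x)%:E = (F 1 - l)%:E)%E.
Proof.
move=> f0 fc dF Fl.
have Fc x : 0 < x -> {for x, continuous F}.
  move=> x0; apply/differentiable_continuous/derivable1_diffP.
  exact: (@ex_derive _ _ _ _ _ _ _ (dF x x0)).
pose S (n : nat) : set R := `[n.+2%:R^-1, 1]%classic.
have n0 (n : nat) : 0 < n.+2%:R^-1 :> R by rewrite invr_gt0.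
have n1 (n : nat) : n.+2%:R^-1 < 1 :> R by rewrite invf_lt1// ltr1n.
have mf1 : measurable_fun `]0 : R, +oo[%classic f.
  apply: open_continuous_measurable_fun; first exact: interval_open.
  by move=> x; rewrite inE/= in_itv/= andbT; exact: fc.
have mf (A : set R) : measurable A -> A `<=` `]0, +oo[ -> measurable_fun A f.
  by move=> mA AS; exact: (measurable_funS (measurable_itv _) AS mf1).
have mf0 : measurable_fun I01 f.
  by apply: mf => // x /=; rewrite !in_itv/= => /andP[->].
have Sn (n : nat) : (\int[leb]_(x in S n) (f x)%:E = (F 1)%:E - (F n.+2%:R^-1)%:E)%E.
  apply: continuous_FTC2 => //.
  - apply: continuous_in_subspaceT => x; rewrite inE/= in_itv/= => /andP[x0 _].
    by apply: fc; exact: lt_le_trans x0.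
  - split.
    + move=> x; rewrite in_itv/= => /andP[x0 _].
      exact: (@ex_derive _ _ _ _ _ _ _ (dF x (lt_trans (n0 n) x0))).
    + exact: (cvg_at_right_filter (Fc _ (n0 n))).
    + exact: (cvg_at_left_filter (Fc _ ltr01)).
  - move=> x; rewrite in_itv/= => /andP[x0 _].
    by rewrite derive1E (@derive_val _ _ _ _ _ _ _ (dF x (lt_trans (n0 n) x0))).
have US : \bigcup_n S n = `]0, 1]%classic.
  apply/seteqP; split => x /=.
    by move=> [n _]; rewrite /S/= !in_itv/= => /andP[nx ->]; rewrite (lt_le_trans (n0 n)).
  rewrite in_itv/= => /andP[x0 x1]; exists (Num.truncn x^-1) => //.
  rewrite /S/= in_itv/= x1 andbT -[leRHS]invrK lef_pV2 ?posrE ?invr_gt0//.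
  by rewrite (le_trans (ltW (truncnS_gt _)))// ler_nat.
have : (\int[leb]_(x in S n) (f x)%:E @[n --> \oo] --> \int[leb]_(x in \bigcup_n S n) (f x)%:E)%E.
  apply: ge0_nondecreasing_set_cvg_integral => //.
  - apply/nondecreasing_seqP => n; rewrite subsetEset => x; rewrite /S/= !in_itv/=.
    by move=> /andP[nx ->]; rewrite andbT (le_trans _ nx)// lef_pV2 ?posrE ?ler_nat.
  - move=> n; exact: measurable_itv.
  - move=> n; apply/measurable_EFinP; apply: (mf _ (measurable_itv _)) => x; rewrite /S/= !in_itv/= andbT.
    by move=> /andP[nx _]; exact: lt_le_trans nx.
  - move=> n x; rewrite /S/= in_itv/= => /andP[nx x1]; rewrite lee_fin f0// x1 andbT.
    exact: lt_le_trans nx.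
rewrite US -integral_itv_bndo_bndc; last exact/measurable_EFinP.
under eq_cvg do rewrite Sn.
move=> H.
suff K : F 1 - F n.+2%:R^-1 @[n --> \oo] --> F 1 - l.
  apply: (cvg_unique _ H) => //.
  have Kc : ((F 1 - F n.+2%:R^-1)%:E @[n --> \oo] --> (F 1 - l)%:E)%E.
    by apply: cvg_EFin => //; exact: nearW.
  exact: Kc.
apply: lim_sub; first exact: cvg_cst.
have Hn : n.+2%:R^-1 @[n --> \oo] --> (0 : R)^'+.
  move=> A [e /= e0 eA].
  have : n.+2%:R^-1 @[n --> \oo] --> (0 : R).
    have : @harmonic R n @[n --> \oo] --> (0 : R) by exact: cvg_harmonic.
    by rewrite -(cvg_shiftn 1)/=; under eq_fun do rewrite addn1.
  move=> /cvgr0Pnorm_lt/(_ _ e0); apply: filterS => n ne.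
  by apply: eA => //=; rewrite sub0r normrN.
exact: (cvg_comp _ _ Hn Fl).
Qed.

Lemma norm_ln_le (c u : R) : 0 < c -> 0 < u <= 1 -> `|ln u| <= c^-1 * u `^ (- c).
Proof.
move=> c0 /andP[u0 u1]; rewrite ler0_norm ?ln_le0//.
rewrite -ler_pdivrMl ?invr_gt0// invrK.
have := @le_ln1Dx R (u `^ (- c) - 1); rewrite subrKC ln_powR.
have p0 : 0 < u `^ (- c) by exact: powR_gt0.
have : -1 < u `^ (- c) - 1 by lra.
by move=> /[swap]/[apply]; lra.
Qed.

Lemma cvg_powR_ln (b : R) (j : nat) : 0 < b ->
  u `^ b * ln u ^+ j @[u --> (0 : R)^'+] --> (0 : R).
Proof.
move=> b0.
(* Each logarithm costs u^(-c), so [j] of them cost less than u^(-b/2) and a positive power of [u]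
   is left. *)
pose c := b / (2 * j.+1%:R).
have c0 : 0 < c by rewrite divr_gt0// mulr_gt0.
have b2 : 0 < b - c * j%:R.
  have -> : b - c * j%:R = b * (j.+2%:R / (2 * j.+1%:R)).
    by rewrite /c -!natr1; field; rewrite natr1 pnatr_eq0.
  by rewrite mulr_gt0// divr_gt0// mulr_gt0.
have := powR_cvg0 b2.
move=> /(lim_scale (c^-1 ^+ j)); rewrite mulr0.
apply: lim_norm0; near=> u.
have u0 : 0 < u by [].
have u1 : u <= 1 by near: u; apply: nbhs_right_le.
have uI : 0 < u <= 1 by rewrite u0.
rewrite normrM ger0_norm ?powR_ge0// normrX.
have : `|ln u| ^+ j <= (c^-1 * u `^ (- c)) ^+ j.
  by rewrite lerXn2r ?nnegrE ?mulr_ge0 ?powR_ge0 ?invr_ge0 ?(ltW c0)//; exact: norm_ln_le.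
move=> /(ler_wpM2l (powR_ge0 u b)) /le_trans; apply.
rewrite exprMn mulrCA ler_wpM2l ?exprn_ge0 ?invr_ge0 ?(ltW c0)//.
rewrite -powR_mulrn ?powR_ge0// -powRrM -powRD; last by rewrite (gt_eqF u0) implybT.
by rewrite mulNr.
Unshelve. all: by end_near. Qed.

Section quadratic.
Variables (b c0 c1 c2 : R).
Hypothesis b_gt0 : 0 < b.
(** The derivative of u^b times [c0 + c1 ln u + c2 ln^2 u], a primitive that vanishes at 0 and
    equals [c0] at 1. One computation thus covers all the moments needed. *)
Let f u := u `^ (b - 1) * (b * c0 + c1 + (b * c1 + 2 * c2) * ln u + b * c2 * ln u ^+ 2).
Hypothesis f_ge0 : forall u, 0 < u <= 1 -> 0 <= f u.

Lemma integral_power_log : (\int[leb]_(u in I01) (f u)%:E = c0%:E)%E.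
Proof.
pose F u := u `^ b * (c0 + c1 * ln u + c2 * ln u ^+ 2).
have <- : F 1 - 0 = c0 by rewrite /F ln1 powR1 mul1r expr0n/= !mulr0 !addr0 subr0.
apply: ge0_FTC_oc => //.
- move=> x x0; rewrite /f.
  have cln : {for x, continuous (@ln R)} by exact: continuous_ln.
  have cp : {for x, continuous (fun u : R => u `^ (b - 1))}.
    apply/differentiable_continuous/derivable1_diffP.
    exact: (@ex_derive _ _ _ _ _ _ _ (is_derive1_powR (b - 1) x0)).
  apply: cvgM => //; apply: cvgD; last first.
    by apply: cvgM; [exact: cvg_cst|exact: (cvgM cln cln)].
  by apply: cvgD; [exact: cvg_cst|apply: cvgM => //; exact: cvg_cst].
- move=> x x0; have d1 := is_derive1_powR b x0; have d2 := is_derive1_ln x0.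
  rewrite /F.
  apply: is_derive_eq.
  rewrite /f /GRing.scale/= powRB; last by rewrite (gt_eqF x0) implybT.
  rewrite !(mulr0, mul0r, add0r, addr0) powRr1 ?(ltW x0)//.
  by field; rewrite gt_eqF.
- have H j := cvg_powR_ln j b_gt0.
  have /(_ _ _ _ _ _) := lim_add (lim_add (lim_scale c0 (H 0%N)) (lim_scale c1 (H 1%N))) (lim_scale c2 (H 2%N)).
  rewrite !mulr0 !addr0; apply: lim_eq; apply: nearW => u.
  by rewrite /F expr0 expr1; ring.
Qed.

Lemma measurable_power_log (D : set R) : measurable D -> measurable_fun D f.
Proof.
move=> mD; apply: measurable_funTS; apply: measurable_funM; first exact: measurable_powR.
have ml := @measurable_ln R.
apply: measurable_funD; last by apply: measurable_funM => //; exact: measurable_funX.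
by apply: measurable_funD => //; exact: measurable_funM.
Qed.

Lemma integrable_power_log : leb.-integrable I01 (EFin \o f).
Proof.
apply/integrableP; split; first by apply/measurable_EFinP; exact: measurable_power_log.
rewrite (_ : (\int[_]_(_ in _) _)%E = c0%:E) ?ltry// -integral_power_log.
apply: eq_integral => u; rewrite inE/= in_itv/= => /andP[u0 u1].
by rewrite /= ger0_norm ?f_ge0// u0 ltW.
Qed.

Lemma Rintegral_power_log : \int[leb]_(u in I01) f u = c0.
Proof. by rewrite /Rintegral integral_power_log. Qed.

End quadratic.
End power_log_integrals.

(** * Monotone regularly varying functions and Potter's bound *)

Section regular_variation.
Context {R : realType}.
Variables (K : R -> R) (alpha : R).
Hypothesis K_ni : forall x y, x <= y -> K y <= K x.
Hypothesis K_ge0 : forall x, 0 <= K x.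
Hypothesis K_rv : regularly_varying K (- alpha).

(** By monotonicity a zero would persist to the right, and the quotients, being 0 by convention,
    could not tend to a positive limit. *)
Lemma regularly_varying_gt0 x : 0 < K x.
Proof.
have H1 : \forall z \near +oo, K (2 * z) / K z != 0.
  have p0 : 0 < 2 `^ (- alpha) :> R by exact: powR_gt0.
  have /cvgrPdist_lt/(_ _ p0) := K_rv (ltr0n R 2).
  apply: filterS => z; apply: contraPneq => ->.
  by rewrite subr0 gtr0_norm// ltxx.
have H2 : \forall z \near +oo, x <= z by apply: nbhs_pinfty_ge; exact: num_real.
have [z [Hz xz]] := filter_ex (filterI H1 H2).
have Kz : K z != 0 by apply: contraNneq Hz => ->; rewrite invr0 mulr0.
by rewrite (lt_le_trans _ (K_ni xz))// lt_neqAle eq_sym Kz K_ge0.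
Qed.

(** Monotonicity replaces uniform convergence: the moving factor is squeezed between two fixed
    ones. *)
Lemma cvg_regularly_varying (I : Type) (FI : set_system I) {FF : Filter FI}
    (v z : I -> R) (v0 : R) : 0 < v0 -> z i @[i --> FI] --> +oo ->
  v i @[i --> FI] --> v0 ->
  K (v i * z i) / K (z i) @[i --> FI] --> v0 `^ (- alpha).
Proof.
move=> v00 zoo vv0; apply/cvgrPdist_le => e e0.
have cp : {for v0, continuous (fun u : R => u `^ (- alpha))}.
  apply/differentiable_continuous/derivable1_diffP.
  exact: (@ex_derive _ _ _ _ _ _ _ (is_derive1_powR (- alpha) v00)).
have e2 : 0 < e / 2 by rewrite divr_gt0.
have /cvgrPdist_le/(_ _ e2)[d /= d0 Hd] := cp.
pose d' := Num.min d v0 / 2.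
have d'0 : 0 < d' by rewrite divr_gt0// lt_min d0.
have d'd : d' < d by rewrite ltr_pdivrMr// (le_lt_trans (_ : _ <= d)) ?ge_min ?lexx//; lra.
have d'v : d' < v0 by rewrite ltr_pdivrMr// (le_lt_trans (_ : _ <= v0)) ?ge_min ?lexx ?orbT//; lra.
have Hm : `|v0 `^ (- alpha) - (v0 - d') `^ (- alpha)| <= e / 2.
  by apply: Hd; rewrite /= opprB addrC subrK gtr0_norm.
have Hp : `|v0 `^ (- alpha) - (v0 + d') `^ (- alpha)| <= e / 2.
  by apply: Hd; rewrite /= opprD addrA subrr sub0r normrN gtr0_norm.
have vm : 0 < v0 - d' by rewrite subr_gt0.
have vp : 0 < v0 + d' by rewrite addr_gt0.
have cm := cvg_comp _ _ zoo (K_rv vm); have cpl := cvg_comp _ _ zoo (K_rv vp).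
move: cm cpl => /cvgrPdist_le/(_ _ e2) cm /cvgrPdist_le/(_ _ e2) cpl.
have /cvgrPdist_le/(_ _ d'0) Hv := vv0.
have /cvgryPgt/(_ 0) Hz := zoo.
apply: filterS3 (filterI cm cpl) Hv Hz => i [] /= {}cm {}cpl {}Hv z0.
move: Hv; rewrite distrC ler_norml => /andP[v1 v2].
have Kz : 0 < K (z i) by exact: regularly_varying_gt0.
have L1 : K (v i * z i) / K (z i) <= K ((v0 - d') * z i) / K (z i).
  by rewrite ler_pM2r ?invr_gt0// K_ni// ler_pM2r//; lra.
have L2 : K ((v0 + d') * z i) / K (z i) <= K (v i * z i) / K (z i).
  by rewrite ler_pM2r ?invr_gt0// K_ni// ler_pM2r//; lra.
move: Hm Hp cm cpl; rewrite !ler_norml => /andP[? ?] /andP[? ?] /andP[? ?] /andP[? ?].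
by apply/andP; split; lra.
Qed.

(** Far enough, one doubling costs at most the factor 2^kap, since [alpha < kap]; doublings are
    iterated, and [C] pays for rounding [v] up to a power of 2. *)
Lemma potter_bound (kap : R) : 0 < kap -> alpha < kap -> exists C z0, [/\ 0 < C, 0 < z0 &
  forall z v, z0 <= z -> 1 <= v -> K z / K (v * z) <= C * v `^ kap].
Proof.
move=> k0 ak.
have H : 2 `^ (- kap) < 2 `^ (- alpha) :> R by rewrite /powR ifF ?pnatr_eq0// ltr_expR ltr_pM2r ?ln_gt0 ?ltr1n// ltrN2.
have := K_rv (ltr0n R 2).
move=> /cvgr_ge/(_ _ H)[z1 [_ Hz1]].
pose z0 := Num.max (z1 + 1) 1.
exists (2 `^ kap), z0; split; [exact: powR_gt0|by rewrite lt_max ltr01 orbT|].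
have step z : z0 <= z -> K z <= 2 `^ kap * K (2 * z).
  move=> zz; have zz1 : z1 < z.
    by rewrite (lt_le_trans _ zz)// lt_max ltrDl ltr01.
  have Kz := regularly_varying_gt0 z.
  have := Hz1 z zz1; rewrite /= ler_pdivlMr// powRN => h.
  by rewrite -ler_pdivrMl ?powR_gt0.
have z0p : 0 < z0 by rewrite lt_max ltr01 orbT.
have steps j z : z0 <= z -> K z <= (2 `^ kap) ^+ j * K (2 ^+ j * z).
  move=> zz; elim: j => [|j IHj]; first by rewrite !expr0 !mul1r.
  rewrite (le_trans IHj)// exprSr -mulrA ler_wpM2l ?exprn_ge0 ?powR_ge0//.
  rewrite exprS -mulrA; apply: step; rewrite (le_trans zz)// ler_peMl//.
    exact: le_trans (ltW z0p) zz.
  by rewrite exprn_ege1// ler1n.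
move=> z v zz v1; have v0 : 0 < v by lra.
have zp : 0 < z by exact: lt_le_trans zz.
have [j [j1 j2]] : exists j, 2 ^+ j <= v /\ v <= 2 ^+ j.+1 :> R.
  have [N vN] : exists N, v <= 2 ^+ N :> R.
    exists (Num.truncn v).+1; rewrite (le_trans (ltW (truncnS_gt v)))//.
    by rewrite -natrX ler_nat ltnW// ltn_expl.
  elim: N vN => [|N IHN] vN.
    by exists 0%N; rewrite expr0 v1 (le_trans vN)// expr0 expr1; lra.
  by have [/IHN//|/ltW NN] := leP v (2 ^+ N); exists N.
rewrite ler_pdivrMr ?regularly_varying_gt0// (le_trans (steps j.+1 z zz))//.
rewrite ler_pM ?exprn_ge0 ?powR_ge0 ?K_ge0//; last by rewrite K_ni// ler_pM2r.
rewrite exprS ler_pM2l ?powR_gt0//.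
rewrite -!powR_mulrn ?powR_ge0// -powRrM mulrC powRrM powR_mulrn//.
by apply: ge0_ler_powR; rewrite ?nnegrE ?(ltW k0) ?exprn_ge0 ?(ltW v0).
Qed.

End regular_variation.

(** * Exceedances and observation probabilities in uniform coordinates *)

Section tail_limits.
Context {R : realType}.
Local Notation I01 := (`](0 : R), 1[%classic).
Variables (U A K : R -> R) (gamma tau alpha : R).
Hypotheses (tau_lt0 : tau < 0) (gamma_gt0 : 0 < gamma) (alpha_gt0 : 0 < alpha).
Hypothesis gamma_alpha : gamma * alpha < 1.
Hypothesis U_gt0 : forall t, 1 < t -> 0 < U t.
Hypothesis U_nd : forall s t, 1 < s -> s <= t -> U s <= U t.
Hypothesis Uoo : U t @[t --> +oo] --> +oo.
Hypothesis A0 : A t @[t --> +oo] --> (0 : R).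
Hypothesis hU : second_order_condition U gamma tau A.
Hypothesis K_ni : forall x y, x <= y -> K y <= K x.
Hypothesis K_ge0 : forall x, 0 <= K x.
Hypothesis K_rv : regularly_varying K (- alpha).

(** For [u] uniform this is the logarithm of an exceedance over [U t] relative to it, with limit
    [- gamma ln u]. [tail_ratio] is the probability of observing that point relative to one at the
    threshold, with limit u^(gamma alpha). *)
Definition log_excess t u := ln (U (t / u) / U t).
Definition tail_ratio t u := K (U (t / u)) / K (U t).
Local Notation L := log_excess.
Local Notation g := tail_ratio.

Let K_gt0 := regularly_varying_gt0 K_ni K_ge0 K_rv.

Let divu (t u : R) : 1 < t -> 0 < u < 1 -> 1 < t / u /\ t <= t / u.
Proof.
move=> t1 /andP[u0 u1]; have t0 : 0 < t by lra.
by rewrite ltr_pdivlMr// ler_pdivlMr// mul1r ler_piMr ?(ltW u1) ?(ltW t0)//; split => //; lra.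
Qed.

Lemma log_excess_ge0 t u : 1 < t -> 0 < u < 1 -> 0 <= L t u.
Proof.
move=> t1 uI; have [tu1 ttu] := divu t1 uI.
by rewrite ln_ge0// ler_pdivlMr ?U_gt0// mul1r U_nd.
Qed.

Lemma log_excessE t u : 1 < t -> 0 < u < 1 ->
  L t u + gamma * ln u = log_slow U gamma (t * u^-1) - log_slow U gamma t.
Proof.
move=> t1 uI; have [tu1 ttu] := divu t1 uI; have /andP[u0 u1] := uI.
rewrite /L /log_slow ln_div ?posrE ?U_gt0// ln_div ?posrE ?(lt_trans _ t1)//.
by ring.
Qed.

Lemma log_excess_bound : exists C, 0 < C /\ \forall t \near +oo,
  [/\ 1 < t, A t != 0 & forall u, 0 < u < 1 ->
    `|L t u + gamma * ln u| <= C * `|A t|].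
Proof.
have [C [C0 HC]] := log_slow_bound tau_lt0 U_gt0 U_nd A0 hU.
exists C; split => //; apply: filterS HC => t [t1 At HC]; split => // u uI.
rewrite log_excessE//; apply: HC; have /andP[u0 u1] := uI.
by rewrite invf_ge1// ltW.
Qed.

Lemma log_excess_near : \forall t \near +oo, 1 < t /\ forall u, 0 < u < 1 ->
  `|L t u + gamma * ln u| <= 1.
Proof.
have [C [C0 HC]] := log_excess_bound.
have C1 : 0 < C^-1 by rewrite invr_gt0.
have /cvgr0Pnorm_le/(_ _ C1) := A0.
apply: filterS2 HC => t [t1 _ HC] At; split => // u uI.
rewrite (le_trans (HC u uI))// -ler_pdivlMl// mulr1//.
Qed.

Lemma cvg_log_excess u : 0 < u < 1 -> L t u @[t --> +oo] --> - (gamma * ln u).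
Proof.
move=> uI; have [C [C0 HC]] := log_excess_bound.
have H : L t u + gamma * ln u @[t --> +oo] --> (0 : R).
  have /(_ _ _) := lim_scale C (lim_abs A0); rewrite normr0 mulr0.
  by apply: lim_norm0; apply: filterS HC => t [_ _]; exact.
have /(_ _ _) := lim_sub H (cvg_cst (gamma * ln u)); rewrite sub0r.
by apply: lim_eq; apply: nearW => t; rewrite addrK.
Qed.

Lemma tail_ratio_gt0 t u : 0 < g t u.
Proof. by rewrite divr_gt0. Qed.

Lemma tail_ratio_le1 t u : 1 < t -> 0 < u < 1 -> g t u <= 1.
Proof.
move=> t1 uI; have [tu1 ttu] := divu t1 uI.
by rewrite ler_pdivrMr// mul1r K_ni// U_nd.
Qed.

Lemma cvg_tail_ratio u : 0 < u < 1 -> g t u @[t --> +oo] --> u `^ (gamma * alpha).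
Proof.
move=> uI; have /andP[u0 u1] := uI.
have cv : expR (L t u) @[t --> +oo] --> expR (- (gamma * ln u)).
  by apply: (cvg_comp _ _ (cvg_log_excess uI)); exact: continuous_expR.
have /(_ _) := cvg_regularly_varying K_ni K_ge0 K_rv (expR_gt0 _) Uoo cv.
have -> : expR (- (gamma * ln u)) `^ (- alpha) = u `^ (gamma * alpha).
  by rewrite /powR !gt_eqF ?expR_gt0// expRK; congr expR; ring.
apply: lim_eq; apply: filterS log_excess_near => t [t1 _].
have [tu1 ttu] := divu t1 uI.
by rewrite /L lnK ?posrE ?divr_gt0 ?U_gt0// divfK// gt_eqF// U_gt0.
Qed.

Lemma tail_ratio_potter : exists C th, [/\ 0 < C, 0 < th < 1 &
  \forall t \near +oo, forall u, 0 < u < 1 -> (g t u)^-1 <= C * u `^ (- th)].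
Proof.
(* [gamma * alpha < 1] leaves room for an exponent strictly between [alpha] and [gamma^-1]; then
   [th = gamma * kap] is below 1 and the bound is integrable at 0. *)
pose kap := (alpha + gamma^-1) / 2.
have ag : alpha < gamma^-1 by rewrite -(ltr_pM2l gamma_gt0) divff ?gt_eqF.
have k0 : 0 < kap by rewrite divr_gt0// addr_gt0// invr_gt0.
have ak : alpha < kap by rewrite /kap; lra.
have kg : kap < gamma^-1 by rewrite /kap; lra.
have [C [z0 [C0 z00 HC]]] := potter_bound K_ni K_ge0 K_rv k0 ak.
exists (C * expR kap), (gamma * kap); split.
- by rewrite mulr_gt0// expR_gt0.
- by rewrite mulr_gt0//= -ltr_pdivlMl// mulr1.
have /cvgryPge/(_ z0) := Uoo.
apply: filterS2 log_excess_near => t [t1 HL] Ut u uI.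
have [tu1 ttu] := divu t1 uI; have /andP[u0 u1] := uI.
rewrite /g invf_div.
have Ut0 := U_gt0 t1.
have v1 : 1 <= U (t / u) / U t by rewrite ler_pdivlMr// mul1r U_nd.
have := HC (U t) (U (t / u) / U t) Ut v1; rewrite divfK ?gt_eqF//.
move=> /le_trans; apply; rewrite -mulrA ler_pM2l//.
rewrite /powR !gt_eqF//; last exact: lt_le_trans v1.
rewrite -expRD ler_expR -/(L t u).
have := HL u uI; rewrite ler_norml => /andP[_ H].
have : kap * (L t u + gamma * ln u) <= kap * 1 by rewrite ler_pM2l.
by lra.
Qed.

Lemma measurable_log_excess t : 1 < t -> measurable_fun I01 (L t).
Proof.
move=> t1; apply: nonincreasing_in_measurable; first exact: interval_is_interval.
move=> s u /=; rewrite !in_itv/= => sI uI su.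
have [ts1 _] := divu t1 sI; have [tu1 _] := divu t1 uI.
move: sI uI => /andP[s0 s1] /andP[u0 u1].
rewrite ler_ln ?posrE ?divr_gt0 ?U_gt0// ler_pM2r ?invr_gt0 ?U_gt0// U_nd//.
by rewrite ler_pM2l ?lef_pV2 ?posrE//; lra.
Qed.

Lemma measurable_tail_ratio t : 1 < t -> measurable_fun I01 (g t).
Proof.
move=> t1; apply: nondecreasing_in_measurable; first exact: interval_is_interval.
move=> s u /=; rewrite !in_itv/= => sI uI su.
have [ts1 _] := divu t1 sI; have [tu1 _] := divu t1 uI.
move: sI uI => /andP[s0 s1] /andP[u0 u1].
rewrite ler_pM2r ?invr_gt0// K_ni// U_nd//.
by rewrite ler_pM2l ?lef_pV2 ?posrE//; lra.
Qed.

Lemma measurable_tail_ratioV t : 1 < t -> measurable_fun I01 (fun u => (g t u)^-1).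
Proof.
move=> t1; apply: nonincreasing_in_measurable; first exact: interval_is_interval.
move=> s u /=; rewrite !in_itv/= => sI uI su.
rewrite lef_pV2 ?posrE ?tail_ratio_gt0//.
have [ts1 _] := divu t1 sI; have [tu1 _] := divu t1 uI.
move: sI uI => /andP[s0 s1] /andP[u0 u1].
rewrite ler_pM2r ?invr_gt0// K_ni// U_nd//.
by rewrite ler_pM2l ?lef_pV2 ?posrE//; lra.
Qed.

Lemma integrable_powR (b : R) : 0 < b ->
  leb.-integrable I01 (EFin \o (fun u => u `^ (b - 1))).
Proof.
move=> b0; have := @integrable_power_log _ b b^-1 0 0 b0.
move=> /(_ _)/wrap[].
  move=> u _; rewrite mulr_ge0 ?powR_ge0// divff ?gt_eqF//.
  by rewrite !(mulr0, mul0r, addr0).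
apply: eq_integrable => // u _ /=.
by rewrite divff ?gt_eqF// !(mulr0, mul0r, addr0) mulr1.
Qed.

Lemma Rintegral_powR (b : R) : 0 < b -> \int[leb]_(u in I01) (u `^ (b - 1)) = b^-1.
Proof.
move=> b0; have := @Rintegral_power_log _ b b^-1 0 0 b0.
move=> /(_ _)/wrap[].
  move=> u _; rewrite mulr_ge0 ?powR_ge0// divff ?gt_eqF//.
  by rewrite !(mulr0, mul0r, addr0).
move=> <-; apply: eq_Rintegral => u _ /=.
by rewrite divff ?gt_eqF// !(mulr0, mul0r, addr0) mulr1.
Qed.

Lemma weight_envelope : exists C b, [/\ 0 < C, 0 < b &
  \forall t \near +oo, 1 < t /\ forall u, 0 < u < 1 ->
    (g t u)^-1 * (1 + L t u) ^+ 2 <= C * u `^ (b - 1)].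
Proof.
have [C [th [C0 /andP[th0 th1] HC]]] := tail_ratio_potter.
(* The squared logarithm costs u^(-2c); with this [c] the total exponent is [(1 - th) / 2 - 1],
   still above -1. *)
pose c := (1 - th) / 4; have c0 : 0 < c by rewrite /c; lra.
have D0 : 0 < 2 + gamma / c by rewrite addr_gt0// divr_gt0.
exists (C * (2 + gamma / c) ^+ 2), ((1 - th) / 2); split.
- by rewrite mulr_gt0// exprn_gt0.
- lra.
apply: filterS2 HC log_excess_near => t HC [t1 HL]; split => // u uI.
have /andP[u0 u1] := uI.
have -> : (1 - th) / 2 - 1 = - th + (- c + - c) by rewrite /c; field.
rewrite !powRD ?(gt_eqF u0) ?implybT//.
have L0 := log_excess_ge0 t1 uI.
have uc : 1 <= u `^ (- c).
  rewrite /powR gt_eqF// -[leLHS]expR0 ler_expR mulNr oppr_ge0.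
  by rewrite pmulr_rle0// ln_le0// ltW.
have HL1 : 1 + L t u <= (2 + gamma / c) * u `^ (- c).
  have := HL u uI; rewrite ler_norml => /andP[_ H1].
  have uI' : 0 < u <= 1 by rewrite u0 ltW.
  have := norm_ln_le c0 uI'; rewrite ler_norml => /andP[H2 _].
  have : gamma * - ln u <= gamma * (c^-1 * u `^ (- c)).
    by rewrite ler_pM2l//; lra.
  by rewrite mulrDl -mulrA; lra.
have -> : C * (2 + gamma / c) ^+ 2 * (u `^ (- th) * (u `^ (- c) * u `^ (- c))) =
  (C * u `^ (- th)) * ((2 + gamma / c) * u `^ (- c)) ^+ 2 by ring.
rewrite ler_pM ?invr_ge0 ?sqr_ge0 ?(ltW (tail_ratio_gt0 _ _)) ?HC//.
by rewrite lerXn2r ?nnegrE//; lra.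
Qed.

End tail_limits.

Lemma dominated_cvg_near d (T : measurableType d) (R : realType)
    (mu : {measure set T -> \bar R}) (D : set T) (f : R -> T -> R)
    (l g : T -> R) : measurable D -> mu.-integrable D (EFin \o g) ->
  (\forall t \near +oo, measurable_fun D (f t) /\ forall u, D u -> `|f t u| <= g u) ->
  (forall u, D u -> f t u @[t --> +oo] --> l u) ->
  \int[mu]_(u in D) f t u @[t --> +oo] --> \int[mu]_(u in D) l u.
Proof.
move=> mD ig [t0 [_ H]] fl.
apply: (@dominated_cvg_pinfty _ _ _ mu D f l g (t0 + 1)) => //.
- by move=> t tt; have [] := H t; rewrite // (lt_le_trans _ tt)// ltrDl.
- move=> t u tt; have tt0 : t0 < t by rewrite (lt_le_trans _ tt)// ltrDl.
  by have [_] := H t tt0; exact.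
Qed.

(** * Limits of the bias and of the weighted moments of the excess *)

Section tail_integrals.
Context {R : realType}.
Local Notation I01 := (`](0 : R), 1[%classic).
Variables (U A K : R -> R) (gamma tau alpha : R).
Hypotheses (tau_lt0 : tau < 0) (gamma_gt0 : 0 < gamma) (alpha_gt0 : 0 < alpha).
Hypothesis gamma_alpha : gamma * alpha < 1.
Hypothesis U_gt0 : forall t, 1 < t -> 0 < U t.
Hypothesis U_nd : forall s t, 1 < s -> s <= t -> U s <= U t.
Hypothesis Uoo : U t @[t --> +oo] --> +oo.
Hypothesis A0 : A t @[t --> +oo] --> (0 : R).
Hypothesis hU : second_order_condition U gamma tau A.
Hypothesis K_ni : forall x y, x <= y -> K y <= K x.
Hypothesis K_ge0 : forall x, 0 <= K x.
Hypothesis K_rv : regularly_varying K (- alpha).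
Local Notation L := (log_excess U).
Local Notation g := (tail_ratio U K).

Let mI01 : measurable I01. Proof. exact: measurable_itv. Qed.
Let icst (c : R) : leb.-integrable I01 (EFin \o (fun=> c)).
Proof.
have := @integrableZR _ (measurableTypeR R) R leb _ mI01 c _ (integrable_powR ltr01).
by apply: eq_integrable => // u _ /=; rewrite subrr powRr0 mulr1.
Qed.

Let Ricst (c : R) : \int[leb]_(u in I01) c = c.
Proof.
rewrite -[RHS]mulr1 -[X in _ * X]invr1 -(Rintegral_powR ltr01).
rewrite -[RHS]RintegralZl//; last exact: integrable_powR.
by apply: eq_Rintegral => u _; rewrite subrr powRr0 mulr1.
Qed.

Let near_L := log_excess_near tau_lt0 U_gt0 U_nd A0 hU.
Let mL t (t1 : 1 < t) := measurable_log_excess U_gt0 U_nd t1.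

Lemma integrable_Nln : leb.-integrable I01 (EFin \o (fun u : R => - ln u)).
Proof.
have := @integrable_power_log R 1 1 (-1) 0 ltr01.
move=> /(_ _)/wrap[].
  move=> u /andP[u0 u1]; rewrite subrr powRr0 !(mulr0, mul0r, addr0, mul1r, mulr1) subrr add0r.
  by rewrite mulN1r oppr_ge0 ln_le0.
apply: eq_integrable => // u _ /=.
by rewrite subrr powRr0 !(mulr0, mul0r, addr0, mul1r, mulr1) subrr add0r mulN1r.
Qed.

Lemma Rintegral_Nln : \int[leb]_(u in I01) (- ln u) = 1 :> R.
Proof.
have := @Rintegral_power_log R 1 1 (-1) 0 ltr01.
move=> /(_ _)/wrap[].
  move=> u /andP[u0 u1]; rewrite subrr powRr0 !(mulr0, mul0r, addr0, mul1r, mulr1) subrr add0r.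
  by rewrite mulN1r oppr_ge0 ln_le0.
move=> E; rewrite -[RHS]E; apply: eq_Rintegral => u _ /=.
by rewrite subrr powRr0 !(mulr0, mul0r, addr0, mul1r, mulr1) subrr add0r mulN1r.
Qed.

Lemma integrable_log_excess : \forall t \near +oo, leb.-integrable I01 (EFin \o L t).
Proof.
apply: filterS near_L => t [t1 HL].
apply: (@integrable_le _ (measurableTypeR R) R leb _ _ (fun u => 1 + gamma * - ln u)) => //.
- exact: mL.
- apply: integrableDR => //; last by apply: integrableZR => //; exact: integrable_Nln.
- move=> u /=; rewrite in_itv/= => uI; have := HL u uI.
  by rewrite [X in _ -> X <= _]ger0_norm ?(log_excess_ge0 U_gt0 U_nd t1)// ler_norml => /andP[_]; lra.
Qed.

(** Since [- ln u] has integral 1, the numerator is the integral of [L + gamma ln u], to which the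
    second-order limit applies under the bound uniform in [u]. This is where the asymptotic mean
    [lambda / (1 - tau1)] comes from. *)
Lemma cvg_bias : (\int[leb]_(u in I01) L t u - gamma) / A t @[t --> +oo] --> (1 - tau)^-1.
Proof.
have [C [C0 HC]] := log_excess_bound tau_lt0 U_gt0 U_nd A0 hU.
have H : \int[leb]_(u in I01) ((L t u + gamma * ln u) / A t) @[t --> +oo]
    --> \int[leb]_(u in I01) ((u `^ (- tau) - 1) / tau).
  apply: (@dominated_cvg_near _ (measurableTypeR R) R leb _ _ _ (fun=> C)); [by []|exact: icst| |].
    apply: filterS HC => t [t1 At HC]; split.
      apply: measurable_funM => //; apply: measurable_funD; first exact: mL.
      by apply: measurable_funM => //; apply: measurable_funTS; exact: measurable_ln.
    move=> u /=; rewrite in_itv/= => uI.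
    by rewrite normrM normfV ler_pdivrMr ?normr_gt0// HC.
  move=> u /=; rewrite in_itv/= => uI; have /andP[u0 u1] := uI.
  have ui : 0 < u^-1 by rewrite invr_gt0.
  have := cvg_log_slow tau_lt0 U_gt0 A0 hU ui.
  have -> : u^-1 `^ tau = u `^ (- tau).
    by rewrite /powR !gt_eqF// lnV// mulrN mulNr.
  apply: lim_eq; apply: filterS HC => t [t1 _ _].
  by rewrite (log_excessE gamma U_gt0 t1 uI).
have E : \int[leb]_(u in I01) ((u `^ (- tau) - 1) / tau) = (1 - tau)^-1.
  have t10 : 0 < 1 - tau by rewrite subr_gt0 (lt_trans tau_lt0).
  have e1 : - tau = (1 - tau) - 1 by ring.
  have ip := integrable_powR t10.
  rewrite -e1 in ip.
  rewrite RintegralZr//; last exact: integrableBR.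
  rewrite RintegralB//= [X in _ - X]Ricst.
  have Rp := Rintegral_powR t10; rewrite -e1 in Rp.
  rewrite [X in X - _]Rp.
  by field; rewrite gt_eqF// lt_eqF.
rewrite E in H; apply: lim_eq H.
have igln : leb.-integrable I01 (EFin \o (fun u => gamma * ln u)).
  have := @integrableZR _ (measurableTypeR R) R leb _ mI01 (- gamma) _ integrable_Nln.
  by apply: eq_integrable => // u _ /=; rewrite mulrNN.
apply: filterS2 integrable_log_excess near_L => t iL [t1 HL].
rewrite RintegralZr//; last exact: integrableDR.
rewrite RintegralD//; congr (_ / _); congr (_ + _).
transitivity (\int[leb]_(u in I01) (- gamma * - ln u)).
  by apply: eq_Rintegral => u _; rewrite mulrNN.
rewrite RintegralZl//; last exact: integrable_Nln.
by have := Rintegral_Nln => /= ->; rewrite mulr1.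
Qed.

Let K_gt0 := regularly_varying_gt0 K_ni K_ge0 K_rv.
Let g_gt0 t u : 0 < g t u := tail_ratio_gt0 U K_ni K_ge0 K_rv t u.
Let envelope := weight_envelope tau_lt0 gamma_gt0 alpha_gt0 gamma_alpha U_gt0 U_nd Uoo A0 hU
  K_ni K_ge0 K_rv.

Lemma cvg_mean_ratio :
  \int[leb]_(u in I01) g t u @[t --> +oo] --> (1 + gamma * alpha)^-1.
Proof.
have ga : 0 < 1 + gamma * alpha by rewrite addr_gt0// mulr_gt0.
rewrite -(Rintegral_powR ga) addrAC subrr add0r.
apply: (@dominated_cvg_near _ (measurableTypeR R) R leb _ _ _ (fun=> 1)).
- by [].
- exact: icst.
- apply: filterS near_L => t [t1 _]; split.
    exact: (measurable_tail_ratio U_nd K_ni K_ge0 K_rv).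
  move=> u /=; rewrite in_itv/= => uI.
  by rewrite gtr0_norm// (tail_ratio_le1 U_nd K_ni K_ge0 K_rv).
- move=> u /=; rewrite in_itv/= => uI.
  exact: (cvg_tail_ratio tau_lt0 U_gt0 U_nd Uoo A0 hU K_ni K_ge0 K_rv uI).
Qed.

Let weight_cvg j u : 0 < u < 1 -> (g t u)^-1 * L t u ^+ j @[t --> +oo] -->
  u `^ (- (gamma * alpha)) * (- (gamma * ln u)) ^+ j.
Proof.
move=> uI; have /andP[u0 u1] := uI.
apply: lim_mul.
  rewrite powRN; apply: lim_inv; first by rewrite gt_eqF// powR_gt0.
  exact: (cvg_tail_ratio tau_lt0 U_gt0 U_nd Uoo A0 hU K_ni K_ge0 K_rv uI).
have HL := cvg_log_excess tau_lt0 U_gt0 U_nd A0 hU uI.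
elim: j => [|j IHj]; first by under eq_fun do rewrite expr0; exact: cvg_cst.
rewrite exprS; have /(_ _ _) := lim_mul HL IHj.
by apply: lim_eq; apply: nearW => t; rewrite exprS.
Qed.

Let weight_meas j t : 1 < t -> measurable_fun I01 (fun u => (g t u)^-1 * L t u ^+ j).
Proof.
move=> t1; apply: measurable_funM; last by apply: measurable_funX; exact: mL.
exact: (measurable_tail_ratioV U_nd K_ni K_ge0 K_rv).
Qed.

Let weight_le C b j t u : (j <= 2)%N -> 0 < u < 1 -> 1 < t ->
  (g t u)^-1 * (1 + L t u) ^+ 2 <= C * u `^ (b - 1) ->
  `|(g t u)^-1 * L t u ^+ j| <= C * u `^ (b - 1).
Proof.
move=> j2 uI t1; apply: le_trans.
have L0 := log_excess_ge0 U_gt0 U_nd t1 uI.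
rewrite normrM gtr0_norm ?invr_gt0// normrX ger0_norm// ler_pM2l ?invr_gt0//.
by case: j j2 => [|[|[|//]]] _; rewrite ?expr0 ?expr1; nra.
Qed.

Lemma integrable_weight (j : nat) : (j <= 2)%N ->
  \forall t \near +oo, leb.-integrable I01 (EFin \o (fun u => (g t u)^-1 * L t u ^+ j)).
Proof.
move=> j2; have [C [b [C0 b0 HC]]] := envelope.
apply: filterS HC => t [t1 HC].
apply: (@integrable_le _ (measurableTypeR R) R leb _ _ (fun u => C * u `^ (b - 1))) => //.
- exact: weight_meas.
- by apply: integrableZR => //; exact: integrable_powR.
- by move=> u /=; rewrite in_itv/= => uI; apply: weight_le => //; exact: HC.
Qed.

Lemma cvg_weight (j : nat) : (j <= 2)%N ->
  \int[leb]_(u in I01) ((g t u)^-1 * L t u ^+ j) @[t --> +oo] -->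
  \int[leb]_(u in I01) (u `^ (- (gamma * alpha)) * (- (gamma * ln u)) ^+ j).
Proof.
move=> j2; have [C [b [C0 b0 HC]]] := envelope.
apply: (@dominated_cvg_near _ (measurableTypeR R) R leb _ _ _ (fun u => C * u `^ (b - 1))).
- by [].
- by apply: integrableZR => //; exact: integrable_powR.
- apply: filterS HC => t [t1 HC]; split; first exact: weight_meas.
  by move=> u /=; rewrite in_itv/= => uI; apply: weight_le => //; exact: HC.
- by move=> u /=; rewrite in_itv/= => uI; exact: weight_cvg.
Qed.

Let r := gamma * alpha.

Let r1 : 0 < 1 - r. Proof. by rewrite subr_gt0. Qed.
Let rE : - r = (1 - r) - 1. Proof. by rewrite addrAC subrr add0r. Qed.

Lemma cvg_weight0 : \int[leb]_(u in I01) (g t u)^-1 @[t --> +oo] --> (1 - r)^-1.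
Proof.
have := cvg_weight (leq0n 2).
rewrite -(Rintegral_powR r1) -rE.
under eq_Rintegral do rewrite expr0 mulr1.
apply: lim_eq; apply: nearW => t.
by apply: eq_Rintegral => u _; rewrite expr0 mulr1.
Qed.

Lemma cvg_weight1 : \int[leb]_(u in I01) ((g t u)^-1 * L t u) @[t --> +oo] -->
  gamma / (1 - r) ^+ 2.
Proof.
have := @cvg_weight 1 isT.
have H u : 0 < u <= 1 -> 0 <= u `^ ((1 - r) - 1) * ((1 - r) * (gamma / (1 - r) ^+ 2) + (- gamma / (1 - r)) +
   ((1 - r) * (- gamma / (1 - r)) + 2 * 0) * ln u + (1 - r) * 0 * ln u ^+ 2).
  move=> /andP[u0 u1]; rewrite mulr_ge0 ?powR_ge0//.
  rewrite (_ : _ + _ = gamma * - ln u); last by field; rewrite gt_eqF.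
  by rewrite mulr_ge0 ?(ltW gamma_gt0)// oppr_ge0 ln_le0.
rewrite -(Rintegral_power_log r1 H) => /(@lim_eq _ _ _ _ _ _ _ _) K1.
have -> : \int[leb]_(u in I01) (u `^ (1 - r - 1) *
    ((1 - r) * (gamma / (1 - r) ^+ 2) + - gamma / (1 - r) +
     ((1 - r) * (- gamma / (1 - r)) + 2 * 0) * ln u + (1 - r) * 0 * ln u ^+ 2)) =
  \int[leb]_(u in I01) (u `^ (- (gamma * alpha)) * (- (gamma * ln u)) ^+ 1).
  apply: eq_Rintegral => u _; rewrite -rE; congr (_ * _).
  by field; rewrite gt_eqF.
by apply: K1; apply: nearW => t; apply: eq_Rintegral => u _; rewrite expr1.
Qed.

(** With [b = 1 - r], the three coefficients passed to [Rintegral_power_log] solve the triangular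
    system for which its integrand is u^(-r) times [(gamma * ln u) ^+ 2]; the value of the integral
    is the first of them. *)
Lemma cvg_weight2 : \int[leb]_(u in I01) ((g t u)^-1 * L t u ^+ 2) @[t --> +oo] -->
  2 * gamma ^+ 2 / (1 - r) ^+ 3.
Proof.
have := @cvg_weight 2 isT.
have H u : 0 < u <= 1 -> 0 <= u `^ ((1 - r) - 1) * ((1 - r) * (2 * gamma ^+ 2 / (1 - r) ^+ 3) +
   (- 2 * gamma ^+ 2 / (1 - r) ^+ 2) +
   ((1 - r) * (- 2 * gamma ^+ 2 / (1 - r) ^+ 2) + 2 * (gamma ^+ 2 / (1 - r))) * ln u
   + (1 - r) * (gamma ^+ 2 / (1 - r)) * ln u ^+ 2).
  move=> /andP[u0 u1]; rewrite mulr_ge0 ?powR_ge0//.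
  rewrite (_ : _ + _ = (gamma * ln u) ^+ 2) ?sqr_ge0//; by field; rewrite gt_eqF.
rewrite -(Rintegral_power_log r1 H) => K1.
set J := (X in _ --> X); rewrite (_ : J = \int[leb]_(u in I01) (u `^ (- (gamma * alpha)) * (- (gamma * ln u)) ^+ 2))//.
apply: eq_Rintegral => u _; rewrite -rE; congr (_ * _).
by field; rewrite gt_eqF.
Qed.

(** Prepares Lindeberg's condition: the scores are dominated by a fixed integrable function, and
    truncating it at a level [M] that tends to infinity makes the integral vanish. *)
Lemma weight_lindeberg : exists C b : R, [/\ 0 < C, 0 < b,
  (\forall t \near +oo, 1 < t /\ forall u, 0 < u < 1 ->
     (g t u)^-1 * (1 + L t u) ^+ 2 <= C * u `^ (b - 1)) &
  \int[leb]_(u in I01) (C * u `^ (b - 1) * Num.min 1 (C * u `^ (b - 1) / M))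
    @[M --> +oo] --> (0 : R)].
Proof.
have [C [b [C0 b0 HC]]] := envelope.
exists C, b; split => //.
pose D u := C * u `^ (b - 1).
have D0 u : 0 <= D u by rewrite mulr_ge0 ?(ltW C0)// powR_ge0.
have mD : measurable_fun I01 D.
  by apply: measurable_funTS; apply: measurable_funM => //; exact: measurable_powR.
rewrite -[X in _ --> X](Ricst 0).
apply: (@dominated_cvg_near _ (measurableTypeR R) R leb _ _ _ D).
- by [].
- by apply: integrableZR => //; exact: integrable_powR.
- apply: filterS (nbhs_pinfty_gt (num_real 0)) => M M0; split.
    apply: measurable_funM => //; apply: measurable_funTS; apply: measurable_minr => //.
    apply: measurable_funM => //; apply: measurable_funM => //; exact: measurable_powR.
  move=> u _; have m0 : 0 <= Num.min 1 (D u / M) by rewrite le_min ler01 divr_ge0// ltW.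
  rewrite -/(D u) ger0_norm; last by rewrite mulr_ge0.
  by rewrite ler_piMr// ge_min lexx.
- move=> u _; rewrite -(mulr0 (D u)) -/(D u); apply: lim_scale.
  have H : D u / M @[M --> +oo] --> (0 : R).
    rewrite -(mulr0 (D u)); apply: lim_scale.
    apply/cvgr0Pnorm_le => e e0; apply: filterS (nbhs_pinfty_gt (num_real e^-1)) => M Me.
    have e0' : 0 < e^-1 by rewrite invr_gt0.
    have M0 : 0 < M by exact: lt_trans Me.
    by rewrite gtr0_norm ?invr_gt0// -[leRHS]invrK lef_pV2 ?posrE// ltW.
  apply: lim_norm0 H; apply: filterS (nbhs_pinfty_gt (num_real 0)) => M M0.
  have d0 : 0 <= D u / M by rewrite divr_ge0// ltW.
  by rewrite ger0_norm ?le_min ?ler01 ?d0// ge_min lexx orbT.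
Qed.

End tail_integrals.

(** * Binomial moments by iterating one trial *)

Section binomial_operator.
Context {R : realFieldType}.
Variables p q : R.
Hypothesis pq : 0 <= q <= p.

(** One Bernoulli trial, not normalised: [iter m binop f j / p ^+ m] is the mean of [f (j + B)] for
    [B] binomial with parameters [m] and [q / p]. *)
Definition binop (f : nat -> R) (j : nat) : R := (p - q) * f j + q * f j.+1.

Lemma iter_binop_le f g m j : (forall i, f i <= g i) ->
  iter m binop f j <= iter m binop g j.
Proof.
move=> fg; have /andP[q0 qp] := pq.
elim: m j => [|m IHm] j //=; rewrite /binop.
by apply: lerD; apply: ler_wpM2l; rewrite ?subr_ge0.
Qed.

Lemma iter_binop_ge0 f m j : (forall i, 0 <= f i) -> 0 <= iter m binop f j.
Proof.
move=> f0; have /andP[q0 qp] := pq.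
elim: m j => [|m IHm] j //=; rewrite /binop.
by rewrite addr_ge0// mulr_ge0// subr_ge0.
Qed.

Lemma iter_binop_cst c m j : iter m binop (fun=> c) j = p ^+ m * c.
Proof.
elim: m j => [|m IHm] j /=; first by rewrite mul1r.
by rewrite /binop !IHm exprS; ring.
Qed.

Lemma iter_binopD f g m j :
  iter m binop (fun i => f i + g i) j = iter m binop f j + iter m binop g j.
Proof. by elim: m j => [|m IHm] j //=; rewrite /binop !IHm; ring. Qed.

Lemma iter_binopZ c f m j : iter m binop (fun i => c * f i) j = c * iter m binop f j.
Proof. by elim: m j => [|m IHm] j //=; rewrite /binop !IHm; ring. Qed.

Lemma eq_iter_binop f g m j : f =1 g -> iter m binop f j = iter m binop g j.
Proof. by move=> fg; elim: m j => [|m IHm] j //=; rewrite /binop !IHm. Qed.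

Lemma iter_binop_shift f m j : iter m binop f j.+1 = iter m binop (fun i => f i.+1) j.
Proof. by elim: m j => [|m IHm] j //=; rewrite /binop !IHm. Qed.

(* [E (B h(B - 1)) = n q E h(B')] for [B ~ Bin(n, q)] and [B' ~ Bin(n - 1, q)]. *)
Lemma iter_binop_size_bias (h : nat -> R) m :
  iter m.+1 binop (fun i => i%:R * h i.-1) 0 = m.+1%:R * q * iter m binop h 0.
Proof.
elim: m h => [|m IHm] h; first by rewrite /= /binop; ring.
rewrite iterS {1}/binop IHm iter_binop_shift.
rewrite (@eq_iter_binop (fun i => i.+1%:R * h i.+1.-1) (fun i => h i + i%:R * h i)); last first.
  by move=> i; rewrite -natr1 /=; ring.
have H2 : iter m.+1 binop (fun i => i%:R * h i) 0 = m.+1%:R * q * iter m binop h 1.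
  rewrite iter_binop_shift -IHm; apply: eq_iter_binop => -[|i] //.
  by rewrite !mul0r.
rewrite iter_binopD H2 [iter m.+1 _ h 0]/= /binop -[m.+2%:R]natr1.
by ring.
Qed.

(** Two size biases turn this negative moment into at most a total mass; the product of consecutive
    integers, rather than a square, is what fits them. *)
Lemma iter_binop_inv2 m : 0 < q ->
  iter m binop (fun i => (i.+1%:R * i.+2%:R)^-1) 0 <= p ^+ m * (p / (m.+1%:R * q)) ^+ 2.
Proof.
move=> q0; have /andP[_ qp] := pq; have p0 : 0 < p by exact: lt_le_trans qp.
have E1 := iter_binop_size_bias (fun i => (i.+1%:R * i.+2%:R)^-1) m.
have E2 := iter_binop_size_bias (fun i => (i.+1%:R)^-1) m.+1.
have L1 : iter m.+1 binop (fun i => i%:R * (i.-1.+1%:R * i.-1.+2%:R)^-1) 0 <=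
    iter m.+1 binop (fun i => (i.+1%:R)^-1) 0.
  apply: iter_binop_le => -[|i] /=; first by rewrite mul0r invr_ge0.
  by rewrite invfM mulrA divff ?mul1r.
have L2 : iter m.+2 binop (fun i => i%:R * (i.-1.+1%:R)^-1) 0 <= p ^+ m.+2.
  rewrite -[leRHS]mulr1 -(iter_binop_cst 1 m.+2 0); apply: iter_binop_le => -[|i] /=.
    by rewrite mul0r.
  by rewrite divff.
rewrite E1 in L1; rewrite E2 in L2.
have m1 : 0 < m.+1%:R :> R by [].
have m2 : m.+1%:R <= m.+2%:R :> R by rewrite ler_nat.
set I2 := iter m _ _ _ in L1 *; set I1 := iter m.+1 _ _ _ in L1 L2.
have I10 : 0 <= I1 by apply: iter_binop_ge0 => i; rewrite invr_ge0.
rewrite expr_div_n mulrA ler_pdivlMr ?exprn_gt0 ?mulr_gt0//.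
have -> : p ^+ m * p ^+ 2 = p ^+ m.+2 by rewrite -exprD addn2.
have -> : I2 * (m.+1%:R * q) ^+ 2 = m.+1%:R * q * (m.+1%:R * q * I2) by ring.
apply: le_trans L2; apply: (@le_trans _ _ (m.+1%:R * q * I1)).
  by rewrite ler_pM2l// mulr_gt0.
by rewrite ler_wpM2r// ler_pM2r.
Qed.

Lemma iter_binop_sqr (c : R) m j : p != 0 ->
  iter m binop (fun i => (c + i%:R) ^+ 2) j =
  p ^+ m * ((c + j%:R + m%:R * (q / p)) ^+ 2 + m%:R * (q / p) * (1 - q / p)).
Proof.
move=> p0; elim: m j => [|m IHm] j /=.
  by rewrite !mul0r !addr0 mul1r.
rewrite /binop !IHm [p ^+ m.+1]exprS -[j.+1%:R]natr1 -[m.+1%:R]natr1.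
by field.
Qed.

(* AM-GM: [|x - lam| / x <= a (x - lam)^2 / 2 + 1 / (2 a x^2)] with [a = sg / lam]. *)
Lemma inv_dist_bound (lam sg : R) (j : nat) : 0 < lam -> 0 < sg ->
  `|j.+1%:R^-1 - lam^-1| <=
  sg / (2 * lam ^+ 2) * (1 - lam + j%:R) ^+ 2 + sg^-1 * (j.+1%:R * j.+2%:R)^-1.
Proof.
move=> l0 s0; set x := j.+1%:R : R.
have x0 : 0 < x by [].
have xE : 1 - lam + j%:R = x - lam by rewrite /x -natr1; ring.
have x2 : (x * j.+2%:R)^-1 >= (2 * x ^+ 2)^-1.
  rewrite lef_pV2 ?posrE ?mulr_gt0 ?exprn_gt0//.
  rewrite expr2 mulrA [2 * x]mulrC -mulrA ler_pM2l// /x -natrM ler_nat; lia.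
rewrite xE; apply: (@le_trans _ _ (sg / (2 * lam ^+ 2) * (x - lam) ^+ 2 + sg^-1 * (2 * x ^+ 2)^-1)); last first.
  by rewrite lerD2l ler_pM2l// invr_gt0.
have -> : x^-1 - lam^-1 = (lam - x) / (x * lam) by field; rewrite !gt_eqF.
rewrite normrM normfV (gtr0_norm (mulr_gt0 x0 l0)) distrC.
set y := `|x - lam|; have y2 : (x - lam) ^+ 2 = y ^+ 2 by rewrite /y real_normK ?num_real.
rewrite y2 -subr_ge0.
have -> : sg / (2 * lam ^+ 2) * y ^+ 2 + sg^-1 * (2 * x ^+ 2)^-1 - y / (x * lam) =
  (2 * sg)^-1 * (sg * y / lam - x^-1) ^+ 2 by field; rewrite !gt_eqF.
by rewrite mulr_ge0 ?sqr_ge0// invr_ge0 mulr_ge0// ltW.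
Qed.

Lemma iter_binop_inv_dist (sg lam : R) m : 0 < q -> 0 < sg -> lam = m.+1%:R * q / p ->
  iter m binop (fun j => `|j.+1%:R^-1 - lam^-1|) 0 <=
  p ^+ m * (sg / 2 * lam^-1 + (sg / 2 + sg^-1) * lam ^- 2).
Proof.
move=> q0 s0 lamE; have /andP[_ qp] := pq; have p0 : 0 < p by exact: lt_le_trans qp.
have l0 : 0 < lam by rewrite lamE divr_gt0// mulr_gt0.
apply: (le_trans (iter_binop_le _ _ (fun j => inv_dist_bound j l0 s0))).
rewrite iter_binopD !iter_binopZ iter_binop_sqr ?gt_eqF//.
have := iter_binop_inv2 m q0.
have -> : p / (m.+1%:R * q) = lam^-1 by rewrite lamE invf_div.
rewrite exprVn => H2.
have pm : 0 < p ^+ m by rewrite exprn_gt0.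
have si : 0 < sg^-1 by rewrite invr_gt0.
apply: (@le_trans _ _ (sg / (2 * lam ^+ 2) * (p ^+ m * (1 + lam)) + sg^-1 * (p ^+ m * lam ^- 2))).
  apply: lerD; last by rewrite ler_pM2l.
  apply: ler_wpM2l; first by rewrite divr_ge0 ?mulr_ge0 ?sqr_ge0// ltW.
  rewrite ler_pM2l// addr0.
  have lE : lam = m%:R * (q / p) + q / p by rewrite lamE -natr1; ring.
  set pi := q / p in lE *.
  have pi0 : 0 <= pi by rewrite divr_ge0// ltW.
  have pi1 : pi <= 1 by rewrite ler_pdivrMr// mul1r.
  have mp : 0 <= m%:R * pi by rewrite mulr_ge0.
  rewrite lE (_ : 1 - _ + _ = 1 - pi); last by ring.
  have : m%:R * pi * (1 - pi) <= m%:R * pi by rewrite ler_piMr// gerBl.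
  by nra.
rewrite le_eqVlt; apply/orP; left; apply/eqP.
by field; rewrite !gt_eqF.
Qed.

End binomial_operator.

(** * Counts and sums over an i.i.d. list *)

Section list_moments.
Context d (E : measurableType d) (R : realType).
Variable mu : {sigma_finite_measure set E -> \bar R}.
Variables (A : set E) (p : R).
Hypothesis mA : measurable A.
Hypothesis muA : mu A = p%:E.

Lemma iter_int_count (b : pred E) (q : R) m (f : nat -> R) (j : nat) :
  measurable_fun setT b -> mu (A `&` [set x | b x]) = q%:E -> 0 <= q <= p ->
  (forall i, 0 <= f i) ->
  iter_int mu A m (fun l => (f (j + count b l)%N)%:E) = (iter m (binop p q) f j)%:E.
Proof.
move=> mb qE pq f0; have mB : measurable [set x | b x].
  by rewrite -[X in measurable X]setTI; exact: (mb measurableT [set true]).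
have mnB : measurable (A `&` ~` [set x | b x]).
  by apply: measurableI => //; exact: measurableC.
have AE : A = (A `&` [set x | b x]) `|` (A `&` ~` [set x | b x]).
  by rewrite -setIUr setUv setIT.
have nqE : mu (A `&` ~` [set x | b x]) = (p - q)%:E.
  have : mu A = (mu (A `&` [set x | b x]) + mu (A `&` ~` [set x | b x]))%E.
    rewrite {1}AE measureU//; first exact: measurableI.
    by rewrite setIACA setICr setI0.
  rewrite muA qE; case: (mu _) => [r||]//=; rewrite -EFinD => -[->].
  by rewrite addrAC subrr add0r.
elim: m j => [|m IHm] j; first by rewrite /= addn0.
rewrite [LHS]/= /binop.
have H x : iter_int mu A m (fun l => (f (j + (b x + count b l))%N)%:E) =
    (iter m (binop p q) f (j + b x)%N)%:E.
  by rewrite -IHm; apply: eq_iter_int => l _ _; rewrite addnA.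
under eq_integral do rewrite H.
rewrite {1}AE integral_setU//; last 3 first.
- exact: measurableI.
- apply/measurable_EFinP; apply: measurable_funTS.
  have mh : measurable_fun setT (fun c : bool => iter m (binop p q) f (j + c)%N) by [].
  exact: (measurableT_comp mh mb).
- by rewrite disj_set2E setIACA setICr setI0.
rewrite EFinD addeC; congr (_ + _)%E.
  rewrite (@eq_integral _ _ _ mu _ (fun=> (iter m (binop p q) f j)%:E)); last first.
    by move=> x; rewrite inE => -[_ /= /negP/negbTE ->]; rewrite addn0.
  rewrite integral_cst// EFinM muleC; congr (_ * _)%E; exact: nqE.
rewrite (@eq_integral _ _ _ mu _ (fun=> (iter m (binop p q) f j.+1)%:E)); last first.
  by move=> x; rewrite inE => -[_ /= ->]; rewrite addn1.
rewrite integral_cst//; last exact: measurableI.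
by rewrite EFinM muleC; congr (_ * _)%E; exact: qE.
Qed.

Lemma iter_int_sum_sqr (f : E -> R) (m1 m2 : R) m (c : R) : measurable_fun setT f ->
  mu.-integrable A (EFin \o f) -> mu.-integrable A (EFin \o (fun z => f z ^+ 2)) ->
  \int[mu]_(z in A) f z = p * m1 -> \int[mu]_(z in A) f z ^+ 2 = p * m2 ->
  iter_int mu A m (fun l => ((c + \sum_(z <- l) f z) ^+ 2)%:E) =
  (p ^+ m * ((c + m%:R * m1) ^+ 2 + m%:R * (m2 - m1 ^+ 2)))%:E.
Proof.
move=> mf i1 i2 E1 E2; elim: m c => [|m IHm] c.
  by rewrite /= big_nil !mul0r !addr0 mul1r.
rewrite [LHS]/=.
have H z : iter_int mu A m (fun l => ((c + \sum_(y <- z :: l) f y) ^+ 2)%:E) =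
   (p ^+ m * ((c + m%:R * m1) ^+ 2 + m%:R * (m2 - m1 ^+ 2)) +
    (p ^+ m * (2 * (c + m%:R * m1)) * f z + p ^+ m * f z ^+ 2))%:E.
  rewrite (eq_iter_int _ (g := fun l => ((c + f z + \sum_(y <- l) f y) ^+ 2)%:E)); last first.
    by move=> l _ _; rewrite big_cons addrA.
  by rewrite IHm; congr _%:E; ring.
under eq_integral do rewrite H.
have ic (a : R) : mu.-integrable A (EFin \o (fun=> a)).
  apply/integrableP; split; first exact: measurable_cst.
  rewrite (eq_integral (fun=> `|a|%:E))// integral_cst//.
  by have := muA => /= ->; rewrite -EFinM ltry.
have j1 := integrableZR mA (p ^+ m * (2 * (c + m%:R * m1))) i1.
have j2 := integrableZR mA (p ^+ m) i2.
have j3 := integrableDR mA j1 j2.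
have j4 := integrableDR mA (ic _) j3.
set a := p ^+ m * (_ + _).
transitivity (\int[mu]_(z in A) (a + (p ^+ m * (2 * (c + m%:R * m1)) * f z + p ^+ m * f z ^+ 2)))%:E.
  by rewrite /Rintegral fineK//; exact: integrable_fin_num (j4 a).
congr _%:E; rewrite RintegralD// RintegralD// !RintegralZl// E1 E2 Rintegral_cst//.
have -> : fine (mu A) = p by have := muA => /= ->.
by rewrite /a [p ^+ m.+1]exprS -natr1; ring.
Qed.

End list_moments.

(** * Product-limit weights against deterministic weights *)

Section product_limit_error.
Context {R : realType}.
Implicit Types (l : seq (R * R)).

Definition at_risk l (x : R) : R := (count (fun z => z.1 <= x <= z.2) l)%:R.

Lemma size_C_n l x : (size l)%:R * C_n l x = at_risk l x.
Proof.
rewrite /C_n /at_risk mulrA; case: (posnP (size l)) => [l0|l0].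
  by rewrite (size0nil l0) /= !mul0r.
by rewrite divff ?mul1r// pnatr_eq0 -lt0n.
Qed.

Lemma F_n_expR l x : F_n l x = expR (- \sum_(z <- l | x < z.1) (at_risk l z.1)^-1).
Proof.
rewrite /F_n -sumrN; apply: (big_rec2 (fun a b => a = expR b)); first by rewrite expR0.
by move=> z a b _ ->; rewrite expRD size_C_n.
Qed.

Lemma expRN_lipschitz (a b : R) : 0 <= a -> 0 <= b -> `|expR (- a) - expR (- b)| <= `|a - b|.
Proof.
have W (u v : R) : 0 <= u -> u <= v -> 0 <= expR (- u) - expR (- v) <= v - u.
  move=> u0 uv; have := expR_ge1Dx (u - v).
  have e1 : expR (- u) <= 1 by rewrite expR_le1 oppr_le0.
  have -> : expR (- v) = expR (- u) * expR (u - v) by rewrite -expRD; congr expR; ring.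
  have e2 : expR (u - v) <= 1 by rewrite expR_le1 subr_le0.
  by have := expR_gt0 (- u); move=> ? ?; apply/andP; split; nra.
move=> a0 b0; have [ab|/ltW ba] := leP a b.
  by have /andP[W1 W2] := W _ _ a0 ab; rewrite ger0_norm// ler0_norm; lra.
by have /andP[W1 W2] := W _ _ b0 ba; rewrite ler0_norm ?ger0_norm; lra.
Qed.

Lemma expRN_taylor (x : R) : 0 <= x -> `|1 - expR (- x) - x| <= x ^+ 2.
Proof.
move=> x0; have H1 := expR_ge1Dx (- x).
have H2 : expR (- x) * (1 + x) <= 1.
  rewrite -[leRHS](expRxMexpNx_1 x) mulrC ler_wpM2r ?expR_ge0//.
  exact: expR_ge1Dx.
have H3 : expR (- x) <= 1 - x + x ^+ 2.
  have : (1 - x + x ^+ 2) * (1 + x) = 1 + x ^+ 3 by ring.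
  have x3 : 0 <= x ^+ 3 by rewrite exprn_ge0.
  have x1 : 0 < 1 + x by lra.
  by rewrite -(ler_pM2r x1); lra.
by rewrite ler_norml; apply/andP; split; lra.
Qed.

Variables (F lam psi : R -> R) (s : R) (l : seq (R * R)).
Hypothesis F01 : forall x, s < x -> 0 < F x <= 1.
Hypothesis lam_gt0 : forall x, s < x -> 0 < lam x.
Hypothesis psi_ge1 : forall x, s < x -> 1 <= psi x.
Hypothesis l_obs : all (fun z => z.1 <= z.2) l.

(** With [lam] in the role of the mean number at risk, the jump of [F_n] is to be replaced by
    [F / lam]. The four sums record the error on the inverse number at risk, the second order of the
    exponential, the size of the weights [1 / lam], and the deviation of their partial sums from
    [- ln F]. *)
Definition inv_risk_error := \sum_(z <- l | s < z.1)
  psi z.1 * `|(at_risk l z.1)^-1 - (lam z.1)^-1|.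
Definition inv_risk_sqr := \sum_(z <- l | s < z.1) psi z.1 * (at_risk l z.1) ^- 2.
Definition inv_mean_risk := \sum_(z <- l | s < z.1) psi z.1 * (lam z.1)^-1.
Definition hazard_error := \sum_(z <- l | s < z.1) psi z.1 * ((lam z.1)^-1 *
  `|\sum_(y <- l | z.1 < y.1) (lam y.1)^-1 - - ln (F z.1)|).

(** Both [F_n] and [F] are exponentials, so their distance is at most that of the exponents. Since
    [psi] is at least 1, [inv_risk_error] bounds the first part of this distance at every point at
    once, whence its product with [inv_mean_risk]. *)
Lemma product_limit_weight_error :
  \sum_(z <- l | s < z.1) psi z.1 *
    `|F_n l z.1 * (1 - step_factor l z.1) - F z.1 / lam z.1| <=
  inv_risk_sqr + inv_risk_error * (1 + inv_mean_risk) + hazard_error.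
Proof.
have D0 : 0 <= inv_risk_error.
  by apply: sumr_ge0 => z sz; rewrite mulr_ge0// (le_trans ler01) ?psi_ge1.
rewrite mulrDr mulr1 /inv_mean_risk mulr_sumr -!big_split/=.
rewrite big_seq_cond [leRHS]big_seq_cond; apply: ler_sum => z /andP[zl sz].
have p1 := psi_ge1 sz; have p0 : 0 <= psi z.1 by rewrite (le_trans ler01).
have l0 := lam_gt0 sz; have li0 : 0 < (lam z.1)^-1 by rewrite invr_gt0.
have M1 : 1 <= at_risk l z.1.
  rewrite ler1n -has_count; apply/hasP; exists z; rewrite // lexx.
  exact: (allP l_obs z zl).
set M := at_risk l z.1 in M1 *; have M0 : 0 < M by lra.
have Mi0 : 0 <= M^-1 by rewrite invr_ge0 ltW.
have -> : step_factor l z.1 = expR (- M^-1) by rewrite /step_factor size_C_n.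
have FnE := F_n_expR l z.1.
set Ln := \sum_(y <- l | z.1 < y.1) (at_risk l y.1)^-1 in FnE.
have Ln0 : 0 <= Ln by apply: sumr_ge0 => y _; rewrite invr_ge0.
have Fn0 : 0 <= F_n l z.1 by rewrite FnE expR_ge0.
have Fn1 : F_n l z.1 <= 1 by rewrite FnE expR_le1 oppr_le0.
have /andP[F0 F1] := F01 sz.
set Lt := \sum_(y <- l | z.1 < y.1) (lam y.1)^-1.
have FF : `|F_n l z.1 - F z.1| <= inv_risk_error + `|Lt - - ln (F z.1)|.
  rewrite FnE -{1}[F z.1]lnK ?posrE// -{1}[ln (F z.1)]opprK.
  rewrite (le_trans (expRN_lipschitz _ _))// ?oppr_ge0 ?ln_le0//.
  rewrite -(subrKA Lt) (le_trans (ler_normD _ _))// lerD2r.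
  rewrite /Ln /Lt -sumrB (le_trans (ler_norm_sum _ _ _))//.
  rewrite /inv_risk_error big_mkcond [leRHS]big_mkcond; apply: ler_sum => y _.
  case: ifPn => zy; last by case: ifPn => // sy; rewrite mulr_ge0// (le_trans ler01) ?psi_ge1.
  by rewrite (lt_trans sz zy) ler_peMl// psi_ge1// (lt_trans sz zy).
have T := expRN_taylor Mi0.
have : `|F_n l z.1 * (1 - expR (- M^-1)) - F z.1 / lam z.1| <=
    M ^- 2 + (`|M^-1 - (lam z.1)^-1| + (lam z.1)^-1 * (inv_risk_error + `|Lt - - ln (F z.1)|)).
  have -> : F_n l z.1 * (1 - expR (- M^-1)) - F z.1 / lam z.1 =
    F_n l z.1 * (1 - expR (- M^-1) - M^-1) + (F_n l z.1 * (M^-1 - (lam z.1)^-1) +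
     (lam z.1)^-1 * (F_n l z.1 - F z.1)) by ring.
  rewrite (le_trans (ler_normD _ _))//; apply: lerD.
    rewrite normrM (ger0_norm Fn0) -exprVn (le_trans _ T)// ler_piMl//.
  rewrite (le_trans (ler_normD _ _))//; apply: lerD.
    by rewrite normrM (ger0_norm Fn0) ler_piMl.
  by rewrite normrM (gtr0_norm li0) ler_pM2l.
move=> /(ler_wpM2l p0) /le_trans; apply.
rewrite le_eqVlt; apply/orP; left; apply/eqP.
by rewrite -/M -/Lt; ring.
Qed.

End product_limit_error.

Lemma measurable_set_pred d (T : measurableType d) (b : pred T) :
  measurable_fun setT b -> measurable [set x | b x].
Proof. by move=> mb; rewrite -[X in measurable X]setTI; exact: (mb measurableT [set true]). Qed.

Lemma inv_sqr_le (R : realFieldType) (j : nat) :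
  j.+1%:R ^- 2 <= 2 * (j.+1%:R * j.+2%:R)^-1 :> R.
Proof.
set x := j.+1%:R; set y := j.+2%:R.
have x0 : 0 < x :> R by []. have y0 : 0 < y :> R by [].
have yx : y <= 2 * x :> R by rewrite /x /y -natrM ler_nat; lia.
have -> : 2 * (x * y)^-1 = (2 * x / y) * x ^- 2 by field; rewrite !gt_eqF.
by rewrite ler_peMl ?invr_ge0 ?exprn_ge0 ?(ltW x0)// ler_pdivlMr// mul1r.
Qed.

(** * Mecke's formula for symmetric functions *)

Section palm.
Context d (E : measurableType d) (R : realType).
Variable mu : {sigma_finite_measure set E -> \bar R}.
Variable A : set E.
Hypothesis mA : measurable A.

Lemma iter_int_palm m (G : E -> seq E -> R) : (forall z l, 0 <= G z l) ->
  (forall z l l', perm_eq l l' -> G z l = G z l') ->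
  lmeas (fun z l => (G z (z :: l))%:E) ->
  iter_int mu A m.+1 (fun l => (\sum_(z <- l) G z l)%:E) =
  (m.+1%:R%:E * \int[mu]_(z in A) iter_int mu A m (fun l => (G z (z :: l))%:E))%E.
Proof.
move=> G0 Gp mG.
rewrite -(@iter_int_msum _ _ _ mu A m (fun z l => (G z (z :: l))%:E))//; last first.
  by move=> z l; rewrite lee_fin.
apply: eq_iter_int => l _ _.
rewrite (@msum_perm _ _ _ (fun z l => (G z l)%:E)); first by rewrite sumEFin.
by move=> z l1 l2 /Gp ->.
Qed.

End palm.

Lemma lmeas1_palm d (T : measurableType d) (R : realType) (G : T -> seq T -> R) :
  (forall z l l', perm_eq l l' -> G z l = G z l') ->
  lmeas (fun z l => (G z (z :: l))%:E) ->
  lmeas1 (fun l => (\sum_(z <- l) G z l)%:E).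
Proof.
move=> Gp mG; have := lmeas1_msum mG.
congr lmeas1; apply/funext => l; rewrite (@msum_perm _ _ _ (fun z l => (G z l)%:E)) ?sumEFin//.
by move=> z l1 l2 /Gp ->.
Qed.

(** * The mean of the weight error *)

Section weight_error_mean.
Context {R : realType}.
Local Notation E := (R * R)%type.
Variable mu : {sigma_finite_measure set E -> \bar R}.
Variable mX : probability (measurableTypeR R) R.
Variables (p : R) (F K psi : R -> R).
Local Notation A := [set z : E | z.1 <= z.2].
Hypothesis p_gt0 : 0 < p.
Hypothesis muA : mu A = p%:E.
Hypothesis mu_fst : forall f : R -> \bar R, (forall x, 0 <= f x)%E -> measurable_fun setT f ->
  (\int[mu]_(z in A) f z.1 = \int[mX]_x (f x * (K x)%:E))%E.
Hypothesis mu_risk : forall x, mu (A `&` [set z | z.1 <= x <= z.2]) = (F x * K x)%:E.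
Hypothesis mF : measurable_fun setT F.
Hypothesis mK : measurable_fun setT K.
Hypothesis mpsi : measurable_fun setT psi.
Variables (m : nat) (s N sg V ta : R).
Hypothesis F_gt0 : forall x, s < x -> 0 < F x.
Hypothesis K_gt0 : forall x, 0 < K x.
Hypothesis psi_ge0 : forall x, s < x -> 0 <= psi x.
Hypotheses (N_ge0 : 0 <= N) (sg_gt0 : 0 < sg) (ta_gt0 : 0 < ta).

Definition risk (x : R) : R := m.+1%:R * (F x * K x) / p.
Local Notation lam := risk.

Hypothesis hazard_var : forall x, s < x ->
  (iter_int mu A m (fun l => ((ln (F x) + \sum_(y <- l) (x < y.1)%R%:R * (lam y.1)^-1) ^+ 2)%:E)
   <= (p ^+ m * V)%:E)%E.

(** One variable for all the errors. The genuine errors are scaled by [N] and the weights [1 / lam]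
    are not, so that the product of sums in [product_limit_weight_error], scaled by [N], is at most
    the square of this variable. *)
Definition weight_error l := \sum_(z <- l | s < z.1) psi z.1 *
  (N * `|(at_risk l z.1)^-1 - (lam z.1)^-1| + N * (at_risk l z.1) ^- 2 +
   N * ((lam z.1)^-1 * `|\sum_(y <- l | z.1 < y.1) (lam y.1)^-1 - - ln (F z.1)|) +
   (lam z.1)^-1).

Definition weight_error_bound (x : R) : R := psi x * K x *
  (N * (sg / 2 * (lam x)^-1 + (sg / 2 + sg^-1) * (lam x) ^- 2) + N * (2 * (lam x) ^- 2) +
   N * ((lam x)^-1 * ((V / ta + ta) / 2)) + (lam x)^-1).

Let mA : measurable A.
Proof.
apply: measurable_set_pred; apply: measurable_fun_ler; [exact: measurable_fst|exact: measurable_snd].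
Qed.

Let mb2R : measurable_fun setT (fun c : bool => c%:R : R). Proof. by []. Qed.

Let mlamV : measurable_fun setT (fun x => (lam x)^-1).
Proof.
apply: measurableT_comp; first exact: measurable_invr.
by apply: measurable_funM => //; apply: measurable_funM => //; exact: measurable_funM.
Qed.

Let lam_gt0 x : s < x -> 0 < lam x.
Proof. by move=> sx; rewrite divr_gt0// mulr_gt0// mulr_gt0// F_gt0. Qed.

Let FK_le x : F x * K x <= p.
Proof.
rewrite -lee_fin -muA -mu_risk; apply: le_measure; rewrite ?inE//.
  by apply: measurableI => //; apply: measurable_set_pred; apply: measurable_and; apply: measurable_fun_ler.
Qed.

Let G (z : E) (l : seq E) : R := (s < z.1)%R%:R * (psi z.1 *
  (N * `|(at_risk l z.1)^-1 - (lam z.1)^-1| + N * (at_risk l z.1) ^- 2 +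
   N * ((lam z.1)^-1 * `|\sum_(y <- l | z.1 < y.1) (lam y.1)^-1 - - ln (F z.1)|) +
   (lam z.1)^-1)).

Let GE l : weight_error l = \sum_(z <- l) G z l.
Proof.
rewrite /weight_error big_mkcond; apply: eq_bigr => z _; rewrite /G.
by case: ifP => _; rewrite ?mul1r ?mul0r.
Qed.

Let G_ge0 z l : 0 <= G z l.
Proof.
rewrite /G; have [sz|_] := ltP s z.1; last by rewrite mul0r.
have li : 0 <= (lam z.1)^-1 by rewrite invr_ge0 ltW ?lam_gt0.
rewrite mul1r mulr_ge0 ?psi_ge0// addr_ge0// !addr_ge0// mulr_ge0//.
  by rewrite invr_ge0 exprn_ge0// ler0n.
by rewrite mulr_ge0.
Qed.

Let G_perm z l l' : perm_eq l l' -> G z l = G z l'.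
Proof.
move=> ll'; rewrite /G /at_risk (permP ll').
have -> : \sum_(y <- l | z.1 < y.1) (lam y.1)^-1 = \sum_(y <- l' | z.1 < y.1) (lam y.1)^-1.
  exact: perm_big.
by [].
Qed.

Let B (z : E) (l : seq E) : R := (count (fun y => y.1 <= z.1 <= y.2) l)%:R.

Let mB : lmeas B.
Proof.
apply: lmeas_count; apply: measurable_and.
  apply: measurable_fun_ler; first exact: (measurableT_comp measurable_fst measurable_snd).
  exact: (measurableT_comp measurable_fst measurable_fst).
apply: measurable_fun_ler; first exact: (measurableT_comp measurable_fst measurable_fst).
exact: (measurableT_comp measurable_snd measurable_snd).
Qed.

Let H (z : E) (l : seq E) : R := ln (F z.1) + \sum_(y <- l) (z.1 < y.1)%R%:R * (lam y.1)^-1.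

Let mH : lmeas H.
Proof.
move=> k; apply: measurable_funD.
  apply: (measurableT_comp (@measurable_ln R)); apply: (measurableT_comp mF).
  exact: (measurableT_comp measurable_fst measurable_fst).
apply: (@lmeas_rsum _ _ _ _ _ (fun z y : E => (z.1 < y.1)%R%:R * (lam y.1)^-1)).
apply: measurable_funM.
  apply: (measurableT_comp mb2R); apply: measurable_fun_ltr.
    exact: (measurableT_comp measurable_fst measurable_fst).
  exact: (measurableT_comp measurable_fst measurable_snd).
apply: (measurableT_comp mlamV).
exact: (measurableT_comp measurable_fst measurable_snd).
Qed.

Let G_cons (z : E) (l : seq E) : G z (z :: l) = (s < z.1)%R%:R * (psi z.1 *
  (N * `|((z.1 <= z.2)%R%:R + B z l)^-1 - (lam z.1)^-1| + N * ((z.1 <= z.2)%R%:R + B z l) ^- 2 +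
   N * ((lam z.1)^-1 * `|H z l|) + (lam z.1)^-1)).
Proof.
have E1 : at_risk (z :: l) z.1 = (z.1 <= z.2)%R%:R + B z l.
  by rewrite /at_risk /= lexx natrD.
have E2 : \sum_(y <- z :: l | z.1 < y.1) (lam y.1)^-1 - - ln (F z.1) = H z l.
  rewrite big_cons ltxx opprK addrC /H; congr (_ + _).
  by rewrite big_mkcond; apply: eq_bigr => y _; case: ifP => _; rewrite ?mul1r ?mul0r.
by rewrite /G E1 E2.
Qed.

Let mG : lmeas (fun z l => (G z (z :: l))%:E).
Proof.
move=> k; apply/measurable_EFinP.
under eq_fun do rewrite G_cons.
have m1 : measurable_fun [set: E * k.-tuple E] (fun st => st.1.1) by exact: (measurableT_comp measurable_fst measurable_fst).
have m2 : measurable_fun [set: E * k.-tuple E] (fun st => st.1.2) by exact: (measurableT_comp measurable_snd measurable_fst).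
have mu1 : measurable_fun [set: E * k.-tuple E] (fun st => (st.1.1 <= st.1.2)%R%:R + B st.1 st.2).
  apply: measurable_funD; last exact: mB.
  by apply: (measurableT_comp mb2R); exact: measurable_fun_ler.
have ml : measurable_fun [set: E * k.-tuple E] (fun st => (lam st.1.1)^-1).
  exact: (measurableT_comp mlamV m1).
have mi : measurable_fun [set: E * k.-tuple E] (fun st => ((st.1.1 <= st.1.2)%R%:R + B st.1 st.2)^-1).
  exact: (measurableT_comp (@measurable_invr R) mu1).
apply: measurable_funM.
  by apply: (measurableT_comp mb2R); exact: measurable_fun_ltr.
apply: measurable_funM; first exact: (measurableT_comp mpsi m1).
apply: measurable_funD => //; apply: measurable_funD; last first.
  apply: measurable_funM => //; apply: measurable_funM => //.
  by apply: measurableT_comp => //; exact: mH.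
apply: measurable_funD; apply: measurable_funM => //.
  by apply: measurableT_comp => //; exact: measurable_funB.
apply: (measurableT_comp (@measurable_invr R)); exact: measurable_funX.
Qed.

Lemma lmeas_weight_error : lmeas1 (fun l => (weight_error l)%:E).
Proof.
rewrite (_ : (fun l => _) = fun l => (\sum_(z <- l) G z l)%:E); last by apply/funext => l; rewrite GE.
exact: lmeas1_palm.
Qed.

(** By Mecke's formula the mean is an integral over one point, independent of the [m] others: the
    number at risk there is 1 plus a binomial variable, and the partial sum of [1 / lam], taken over
    points strictly above, does not involve the point itself. *)
Lemma weight_error_mean : (iter_int mu A m.+1 (fun l => (weight_error l)%:E) <=
  (m.+1%:R * p ^+ m)%:E * \int[mX]_(x in `]s, +oo[) (weight_error_bound x)%:E)%E.
Proof.
rewrite (eq_iter_int _ (g := fun l => (\sum_(z <- l) G z l)%:E)); last by move=> l _ _; rewrite GE.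
rewrite iter_int_palm// EFinM -muleA; apply: lee_wpmul2l; first by rewrite lee_fin.
have mbound : measurable_fun setT (fun x => (s < x)%R%:R * weight_error_bound x).
  apply: measurable_funM.
    by apply: (measurableT_comp mb2R); exact: measurable_fun_ltr.
  have ml2 : measurable_fun setT (fun x => (lam x) ^- 2).
    rewrite (_ : (fun x => _) = fun x => (lam x)^-1 ^+ 2); last by apply/funext => x; rewrite exprVn.
    exact: measurable_funX.
  apply: measurable_funM; first exact: measurable_funM.
  apply: measurable_funD => //; apply: measurable_funD; last first.
    by apply: measurable_funM => //; exact: measurable_funM.
  apply: measurable_funD; apply: measurable_funM => //; last exact: measurable_funM.
  by apply: measurable_funD; exact: measurable_funM.
have li_ge0 x : s < x -> 0 <= (lam x)^-1 by move=> sx; rewrite invr_ge0 ltW ?lam_gt0.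
pose c x := (s < x)%R%:R * (psi x *
  (N * (sg / 2 * (lam x)^-1 + (sg / 2 + sg^-1) * (lam x) ^- 2) + N * (2 * (lam x) ^- 2) +
   N * ((lam x)^-1 * ((V / ta + ta) / 2)) + (lam x)^-1)).
have V_ge0 x : s < x -> 0 <= V.
  move=> sx; have := hazard_var sx.
  have h0 : (0 <= iter_int mu A m (fun l => ((ln (F x) + \sum_(y <- l) (x < y.1)%R%:R * (lam y.1)^-1) ^+ 2)%:E))%E.
    by apply: iter_int_ge0 => l; rewrite lee_fin sqr_ge0.
  by move=> /(le_trans h0); rewrite lee_fin pmulr_rge0// exprn_gt0.
have c_ge0 x : 0 <= c x.
  rewrite /c; have [sx|_] := ltP s x; last by rewrite mul0r.
  have l0 := li_ge0 x sx; have l2 : 0 <= lam x ^- 2 by rewrite -exprVn exprn_ge0.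
  have v0 := V_ge0 x sx.
  rewrite mul1r mulr_ge0 ?psi_ge0//; do 3 ?apply: addr_ge0 => //; rewrite mulr_ge0//.
  - by rewrite addr_ge0// mulr_ge0// ?addr_ge0// ?divr_ge0 ?invr_ge0 ?ltW.
  - by rewrite mulr_ge0.
  - by rewrite mulr_ge0// divr_ge0// addr_ge0 ?divr_ge0// ltW.
have mc : measurable_fun setT c.
  have ml2 : measurable_fun setT (fun x => (lam x) ^- 2).
    rewrite (_ : (fun x => _) = fun x => (lam x)^-1 ^+ 2); last by apply/funext => x; rewrite exprVn.
    exact: measurable_funX.
  apply: measurable_funM; first by apply: (measurableT_comp mb2R); exact: measurable_fun_ltr.
  apply: measurable_funM => //.
  apply: measurable_funD => //; apply: measurable_funD; last first.
    by apply: measurable_funM => //; exact: measurable_funM.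
  apply: measurable_funD; apply: measurable_funM => //; last exact: measurable_funM.
  by apply: measurable_funD; exact: measurable_funM.
have inner z : A z -> (iter_int mu A m (fun l => (G z (z :: l))%:E) <= (p ^+ m * c z.1)%:E)%E.
  move=> zA; have [sz|zs] := ltP s z.1; last first.
    rewrite (eq_iter_int _ (g := fun=> 0%E)); last first.
      by move=> l _ _; rewrite /G ltNge zs mul0r.
    by rewrite iter_int_cst// mul0e lee_fin mulr_ge0 ?exprn_ge0 ?c_ge0 ?(ltW p_gt0).
  have l0 := lam_gt0 sz; have li0 : 0 < (lam z.1)^-1 by rewrite invr_gt0.
  have q0 : 0 < F z.1 * K z.1 by rewrite mulr_gt0 ?F_gt0.
  have pq : 0 <= F z.1 * K z.1 <= p by rewrite (ltW q0) FK_le.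
  have ps0 := psi_ge0 sz.
  pose f3 (j : nat) := psi z.1 * N * `|j.+1%:R^-1 - (lam z.1)^-1| +
     (psi z.1 * N * 2 * (j.+1%:R * j.+2%:R)^-1 + psi z.1 * (N * ((lam z.1)^-1 * (ta / 2)) + (lam z.1)^-1)).
  pose C := psi z.1 * (N * ((lam z.1)^-1 * (ta^-1 / 2))).
  have C0 : 0 <= C by rewrite mulr_ge0// mulr_ge0// mulr_ge0 ?(ltW li0)// divr_ge0 ?invr_ge0 ?ltW.
  have f30 j : 0 <= f3 j.
    rewrite /f3 addr_ge0//; first by rewrite mulr_ge0// mulr_ge0.
    rewrite addr_ge0//; first by rewrite mulr_ge0 ?invr_ge0 ?mulr_ge0.
    by rewrite mulr_ge0// addr_ge0 ?(ltW li0)// mulr_ge0// mulr_ge0 ?(ltW li0)// divr_ge0// ltW.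
  pose b : pred E := fun y => y.1 <= z.1 <= y.2.
  have mb : measurable_fun setT b.
    by apply: measurable_and; apply: measurable_fun_ler.
  have mBz : lmeas1 (B z) by exact: lmeas_at.
  have mHz : lmeas1 (H z) by exact: lmeas_at.
  have mf3 : lmeas1 (fun l => (f3 (0 + count b l)%N)%:E).
    move=> k; apply/measurable_EFinP.
    pose u (r : R) := psi z.1 * N * `|(r + 1)^-1 - (lam z.1)^-1| +
     (psi z.1 * N * 2 * ((r + 1) * (r + 2))^-1 + psi z.1 * (N * ((lam z.1)^-1 * (ta / 2)) + (lam z.1)^-1)).
    rewrite (_ : (fun st => _) = fun st : unit * k.-tuple E => u (B z st.2)); last first.
      apply/funext => -[x t]; rewrite /u /f3 /B/= add0n.
      rewrite -/b; have -> : (count b t).+2%:R = (count b t)%:R + 2 :> R by rewrite -addn2 natrD.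
      by rewrite natr1.
    suff mu' : measurable_fun setT u by exact: (measurableT_comp mu' (mBz k)).
    have m1 : measurable_fun setT (fun r : R => r + 1) by exact: measurable_funD.
    have m2 : measurable_fun setT (fun r : R => r + 2) by exact: measurable_funD.
    have mi := measurableT_comp (@measurable_invr R) m1.
    have mii := measurableT_comp (@measurable_invr R) (measurable_funM m1 m2).
    apply: measurable_funD.
      apply: measurable_funM => //; apply: measurableT_comp => //; exact: measurable_funB.
    by apply: measurable_funD => //; exact: measurable_funM.
  have mH2 : lmeas1 (fun l => (H z l ^+ 2)%:E).
    move=> k; apply/measurable_EFinP; apply: measurable_funX; exact: (mHz k).
  have mCH : lmeas1 (fun l => (C%:E * (H z l ^+ 2)%:E)%E).
    by move=> k; apply: measurable_funeM; exact: mH2.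
  have S1 : (iter_int mu A m (fun l => (G z (z :: l))%:E) <=
     iter_int mu A m (fun l => ((f3 (0 + count b l)%N)%:E + C%:E * (H z l ^+ 2)%:E)%E))%E.
    apply: le_iter_int => //.
    - by move=> l; rewrite lee_fin.
    - by move=> l; rewrite -EFinM -EFinD lee_fin addr_ge0 ?f30// mulr_ge0// sqr_ge0.
    - exact: (@lmeas_at _ _ _ _ _ _ (fun z l => (G z (z :: l))%:E)).
    - by move=> k; apply: emeasurable_funD; [exact: mf3|exact: mCH].
    - move=> l _ _; rewrite G_cons sz mul1r -EFinM -EFinD lee_fin.
      have -> : (z.1 <= z.2)%R = true by exact: zA.
      rewrite add0n /f3 /C /B -/b; set j := count _ _.
      have jE : 1 + j%:R = j.+1%:R :> R by rewrite -natr1 addrC.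
      rewrite jE; set a1 := `|_ - _|; set h := H z l.
      have I2 : j.+1%:R ^- 2 <= 2 * (j.+1%:R * j.+2%:R)^-1 :> R.
        exact: inv_sqr_le.
      have I3 : `|h| <= ta^-1 / 2 * h ^+ 2 + ta / 2.
        rewrite -subr_ge0.
        have -> : ta^-1 / 2 * h ^+ 2 + ta / 2 - `|h| = (2 * ta)^-1 * (`|h| - ta) ^+ 2.
          by rewrite -[h ^+ 2]real_normK ?num_real//; field; rewrite gt_eqF.
        by rewrite mulr_ge0 ?sqr_ge0// invr_ge0 mulr_ge0 ?(ltW ta_gt0).
      have : psi z.1 * (N * a1 + N * (2 * (j.+1%:R * j.+2%:R)^-1) + N * ((lam z.1)^-1 * (ta^-1 / 2 * h ^+ 2 + ta / 2)) + (lam z.1)^-1) =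
        psi z.1 * N * a1 + (psi z.1 * N * 2 / (j.+1%:R * j.+2%:R) + psi z.1 * (N * ((lam z.1)^-1 * (ta / 2)) + (lam z.1)^-1)) +
         psi z.1 * (N * ((lam z.1)^-1 * (ta^-1 / 2))) * h ^+ 2 by ring.
      move=> <-; apply: ler_wpM2l => //; rewrite lerD2r.
      apply: lerD; first by rewrite lerD2l ler_wpM2l.
      by apply: ler_wpM2l => //; rewrite ler_pM2l.
  apply: (le_trans S1); rewrite iter_intD//; last 2 first.
  - by move=> l; rewrite lee_fin f30.
  - by move=> l; rewrite -EFinM lee_fin mulr_ge0// sqr_ge0.
  have -> := @iter_int_count _ _ _ mu A p mA muA b (F z.1 * K z.1) m f3 0 mb (mu_risk z.1) pq f30.
  rewrite iter_intZ//; last by move=> l; rewrite lee_fin sqr_ge0.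
  have HV := hazard_var sz.
  apply: (@le_trans _ _ ((iter m (binop p (F z.1 * K z.1)) f3 0)%:E + C%:E * (p ^+ m * V)%:E)%E).
    by rewrite leeD2l// lee_wpmul2l.
  rewrite -EFinM -EFinD lee_fin /f3 !iter_binopD !iter_binopZ iter_binop_cst.
  have lamE : lam z.1 = m.+1%:R * (F z.1 * K z.1) / p by [].
  have B1 := iter_binop_inv_dist pq q0 sg_gt0 lamE.
  have B2 := iter_binop_inv2 pq m q0.
  have lE : p / (m.+1%:R * (F z.1 * K z.1)) = (lam z.1)^-1 by rewrite lamE invf_div.
  rewrite lE exprVn in B2.
  move: B1 B2; set b1 := iter m _ _ _; set b2 := iter m _ _ _ => B1 B2.
  have pN : 0 <= psi z.1 * N by rewrite mulr_ge0.
  have K1 := ler_wpM2l pN B1; have K2 := ler_wpM2l pN B2.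
  rewrite /c sz mul1r /C -subr_ge0.
  set v1 := (X in 0 <= X); have -> : v1 =
   (psi z.1 * N * (p ^+ m * (sg / 2 / lam z.1 + (sg / 2 + sg^-1) / lam z.1 ^+ 2)) - psi z.1 * N * b1) +
   2 * (psi z.1 * N * (p ^+ m / lam z.1 ^+ 2) - psi z.1 * N * b2).
    by rewrite /v1; field; rewrite !gt_eqF.
  by rewrite addr_ge0 ?mulr_ge0 ?subr_ge0.
apply: (@le_trans _ _ (\int[mu]_(z in A) (fun x => (p ^+ m * c x)%:E) z.1)%E).
  apply: ge0_le_integral => //.
  - by move=> z _; apply: iter_int_ge0 => l; rewrite lee_fin.
  - by apply: measurable_funTS; apply: measurable_iter_int => // z l; rewrite lee_fin.
  - apply: measurable_funTS; apply/measurable_EFinP; apply: measurable_funM => //.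
    exact: (measurableT_comp mc measurable_fst).
rewrite (@mu_fst (fun x => (p ^+ m * c x)%:E)); last 2 first.
- by move=> x; rewrite lee_fin mulr_ge0 ?c_ge0 ?exprn_ge0 ?(ltW p_gt0).
- by apply/measurable_EFinP; exact: measurable_funM.
have wb_ge0 x : 0 <= (s < x)%R%:R * weight_error_bound x.
  have -> : (s < x)%R%:R * weight_error_bound x = c x * K x by rewrite /weight_error_bound /c; ring.
  by rewrite mulr_ge0// ltW.
have E0 : (fun x => (weight_error_bound x)%:E) \_ `]s, +oo[ =
    fun x => ((s < x)%R%:R * weight_error_bound x)%:E.
  apply/funext => x; rewrite patchE mem_set_itv in_itv/= andbT.
  by case: ifP => _; rewrite ?mul1r ?mul0r.
rewrite [in leRHS]integral_mkcond E0 -ge0_integralZl//; last 3 first.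
- exact/measurable_EFinP.
- by move=> x _; rewrite lee_fin.
- by rewrite lee_fin exprn_ge0 ?(ltW p_gt0).
rewrite le_eqVlt; apply/orP; left; apply/eqP; apply: eq_integral => x _.
by rewrite -!EFinM /weight_error_bound /c; congr _%:E; ring.
Qed.

End weight_error_mean.

(** * The cumulative reversed hazard of a continuous law *)

Section cumulative_hazard.
Context {R : realType}.
Variable mX : probability (measurableTypeR R) R.
Local Notation F := (law_cdf mX).
Hypothesis F_cont : continuous F.
Hypothesis F_lt1 : forall x, F x < 1.
Hypothesis F_0 : forall x, x <= 0 -> F x = 0.
Hypothesis F_1 : F x @[x --> +oo] --> (1 : R).
Local Notation U := (tail_quantile F).
Local Notation I01 := (`](0 : R), 1[%classic).

Lemma measure_itv_oc x y : x <= y -> mX `]x, y]%classic = (F y - F x)%:E.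
Proof.
move=> xy.
have E : `]-oo, y]%classic = `]-oo, x]%classic `|` `]x, y]%classic.
  apply/seteqP; split => z /=; rewrite !in_itv/=.
    by move=> zy; have [zx|xz] := leP z x; [left|right].
  by case=> [/le_trans|/andP[]//]; exact.
have := measureU mX (measurable_itv `]-oo, x]) (measurable_itv `]x, y]).
rewrite -E => /(_ _)/wrap[].
  by apply/seteqP; split => z //=; rewrite !in_itv/= => -[zx /andP[]]; rewrite ltNge zx.
move=> H; rewrite EFinB !fineK ?fin_num_measure// H addeAC subee ?add0e//.
by rewrite fin_num_measure.
Qed.

Lemma integral_tail_shift x y (f : R -> \bar R) : x <= y -> F x = F y ->
  measurable_fun setT f -> (forall z, (0 <= f z)%E) ->
  (\int[mX]_(z in `]x, +oo[) f z = \int[mX]_(z in `]y, +oo[) f z)%E.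
Proof.
move=> xy Fxy mf f0.
have -> : `]x, +oo[%classic = `]x, y]%classic `|` `]y, +oo[%classic.
  apply/seteqP; split => z /=; rewrite !in_itv/= ?andbT.
    by move=> xz; have [zy|yz] := leP z y; [left; rewrite xz|right].
  by case=> [/andP[]//|]; exact: le_lt_trans.
have mxy : measurable (`]x, y]%classic : set (measurableTypeR R)) by exact: measurable_itv.
have my : measurable (`]y, +oo[%classic : set (measurableTypeR R)) by exact: measurable_itv.
rewrite ge0_integral_setU//; last 2 first.
- exact: measurable_funTS.
- rewrite disj_set2E; apply/eqP/seteqP; split => z //=; rewrite !in_itv/= andbT => -[/andP[_ zy]].
  by rewrite ltNge zy.
have n0 : mX `]x, y]%classic = 0%E by rewrite measure_itv_oc// Fxy subrr.
rewrite null_set_integral ?add0e//; exact: measurable_funTS.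
Qed.

Definition tail_time x : R := (1 - F x)^-1.

Lemma tail_time_gt1 x : 0 < F x -> 1 < tail_time x.
Proof.
move=> F0; have F1 := F_lt1 x.
by rewrite /tail_time invf_gt1 ?subr_gt0// ltrBlDr ltrDl.
Qed.

Lemma tail_timeK x : 0 < F x -> U (tail_time x) <= x /\ F (U (tail_time x)) = F x.
Proof.
move=> F0; have t1 := tail_time_gt1 F0.
split; first by rewrite tail_quantile_le ?invrK ?subKr//; exact: law_cdf_nd.
have := survival_tail_quantile F_cont F_0 F_1 t1.
by rewrite /survival /tail_time invrK => H; apply: oppr_inj; apply: (addrI 1).
Qed.

Lemma law_cdf_tail_quantile t u : 1 < t -> 0 < u < 1 -> F (U (t / u)) = 1 - u / t.
Proof.
move=> t1 /andP[u0 u1]; have t0 : 0 < t by exact: lt_trans t1.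
have tu1 : 1 < t / u by rewrite ltr_pdivlMr// mul1r (lt_trans u1).
have := survival_tail_quantile F_cont F_0 F_1 tu1.
by rewrite /survival invf_div => <-; rewrite subKr.
Qed.

Lemma integral_hazard t : 1 < t ->
  (\int[@lebesgue_measure R]_(u in I01) ((1 - u / t)^-1)%:E = (- (t * ln (1 - t^-1)))%:E)%E.
Proof.
move=> t1; have t0 : 0 < t by exact: lt_trans t1.
have pos u : u <= 1 -> 0 < 1 - u / t.
  by move=> u1; rewrite subr_gt0 ltr_pdivrMr// mul1r (le_lt_trans u1).
have ct (u : R) : {for u, continuous (fun u : R => 1 - u / t)}.
  apply: cvgB; first exact: cvg_cst.
  by apply: cvgMl; exact: cvg_id.
have cf u : u <= 1 -> {for u, continuous (fun u : R => (1 - u / t)^-1)}.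
  by move=> u1; apply: cvgV; [rewrite gt_eqF// pos|exact: ct].
have dF (u : R) : u <= 1 -> is_derive u (1:R) (fun u : R => - (t * ln (1 - u / t))) (1 - u / t)^-1.
  move=> u1.
  have dl : is_derive (1 - u / t) (1:R) (@ln R) (1 - u / t)^-1 by exact: is_derive1_ln (pos _ u1).
  have da : is_derive u (1:R) (fun u : R => 1 - u / t) (- t^-1).
    have := is_deriveD (is_derive_cst (1 : R) u 1) (is_deriveZ (- t^-1) (is_derive_id u (1 : R))).
    rewrite /GRing.scale/= mulr1 add0r.
    have -> : (fun u : R => 1 - u / t) = cst 1 + (- t^-1) \*: id; last by [].
    by apply/funext => v; change (1 - v / t = 1 + (- t^-1) * v); rewrite mulNr mulrC.
  have dc := is_derive1_comp (f := @ln R) (g := fun u : R => 1 - u / t).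
  have := @is_deriveN _ _ _ _ _ _ _ (@is_deriveZ _ _ _ _ t _ _ _ (dc _ _ _ dl da)).
  have -> : - (t *: ((1 - u / t)^-1 * - t^-1)) = (1 - u / t)^-1.
    by rewrite /GRing.scale/= mulrN mulrN opprK mulrCA divff ?mulr1// gt_eqF.
  by [].
have cF (u : R) : u <= 1 -> {for u, continuous (fun u : R => - (t * ln (1 - u / t)))}.
  move=> u1; apply/differentiable_continuous/derivable1_diffP.
  by have := dF u u1; case.
have mf : measurable_fun I01 (fun u : R => ((1 - u / t)^-1)%:E).
  apply/measurable_EFinP; apply: (measurableT_comp (@measurable_invr R)).
  apply: measurable_funB => //; exact: measurable_funM.
rewrite -(integral_itv_bndoo true false mf).
rewrite (@continuous_FTC2 _ _ (fun u : R => - (t * ln (1 - u / t)))) ?ltr01//.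
- by rewrite mul0r subr0 ln1 mulr0 oppr0 sube0 mul1r.
- apply: continuous_in_subspaceT => u; rewrite mem_set_itv in_itv/= => /andP[_ u1]; exact: cf.
- split.
  + move=> u; rewrite in_itv/= => /andP[_ /ltW u1]; by have := dF u u1; case.
  + by apply: cvg_at_right_filter; apply: cF.
  + by apply: cvg_at_left_filter; apply: cF.
- move=> u; rewrite in_itv/= => /andP[_ /ltW u1]; rewrite derive1E.
  by have := dF u u1; case.
Qed.

(** In uniform coordinates the integrand is [1 / (1 - u / t)]. The point [x] is first moved down to
    a quantile with the same value of [F], because [F] may be flat to the left of [x]. *)
Lemma integral_inv_cdf x : 0 < F x ->
  (\int[mX]_(y in `]x, +oo[) ((F y)^-1)%:E = (- ln (F x))%:E)%E.
Proof.
move=> F0; have [Ux FU] := tail_timeK F0; have t1 := tail_time_gt1 F0.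
have t0 : 0 < tail_time x by exact: lt_trans t1.
have mF : measurable_fun setT F.
  by apply: continuous_measurable_fun => y; exact: F_cont.
have mf : measurable_fun setT (fun y => ((F y)^-1)%:E).
  apply/measurable_EFinP; exact: (measurableT_comp (@measurable_invr R) mF).
have f0 y : (0 <= ((F y)^-1)%:E)%E.
  by rewrite lee_fin invr_ge0 F_ge0//; exact: law_cdf_nd.
rewrite -(integral_tail_shift Ux FU mf f0) (integral_tail_law F_cont F_lt1 F_0 F_1 t1 mf f0).
have -> : (\int[leb]_(u in I01) ((F (U (tail_time x / u)))^-1)%:E =
    \int[leb]_(u in I01) ((1 - u / tail_time x)^-1)%:E)%E.
  by apply: eq_integral => u; rewrite mem_set_itv in_itv/= => uI; rewrite law_cdf_tail_quantile.
rewrite integral_hazard// -EFinM mulrN mulKf ?gt_eqF//; congr (- ln _)%:E.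
by rewrite /tail_time invrK subKr.
Qed.

End cumulative_hazard.

(** * The rate of the weight error *)

Section weight_error_rate.
Context {R : realType}.
Local Notation E := (R * R)%type.
Variable mu : {sigma_finite_measure set E -> \bar R}.
Variable mX : probability (measurableTypeR R) R.
Local Notation F := (law_cdf mX).
Hypothesis F_cont : continuous F.
Hypothesis F_lt1 : forall x, F x < 1.
Hypothesis F_0 : forall x, x <= 0 -> F x = 0.
Hypothesis F_1 : F x @[x --> +oo] --> (1 : R).
Variables (p : R) (K : R -> R).
Local Notation A := [set z : E | z.1 <= z.2].
Local Notation U := (tail_quantile F).
Local Notation I01 := (`](0 : R), 1[%classic).
Hypothesis p_gt0 : 0 < p.
Hypothesis muA : mu A = p%:E.
Hypothesis mu_fst : forall f : R -> \bar R, (forall x, 0 <= f x)%E -> measurable_fun setT f ->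
  (\int[mu]_(z in A) f z.1 = \int[mX]_x (f x * (K x)%:E))%E.
Hypothesis mu_risk : forall x, mu (A `&` [set z | z.1 <= x <= z.2]) = (F x * K x)%:E.
Hypothesis K_ni : forall x y, x <= y -> K y <= K x.
Hypothesis K_gt0 : forall x, 0 < K x.
Variables (m k : nat) (t C0 : R).
Hypotheses (m_gt0 : (0 < m)%N) (k_gt0 : (0 < k)%N) (t_ge2 : 2 <= t).
Local Notation s := (U t).
Local Notation n := (m.+1%:R : R).
Definition log_weight (a x : R) := 1 + ln (x / a).
Local Notation psi := (log_weight s).
Hypothesis envelope : (\int[@lebesgue_measure R]_(u in I01)
  ((tail_ratio U K t u)^-1 * (1 + log_excess U t u) ^+ 2)%:E <= C0%:E)%E.

Let t1 : 1 < t. Proof. by apply: lt_le_trans t_ge2; rewrite ltr1n. Qed.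
Let t0 : 0 < t. Proof. by apply: lt_trans t1. Qed.
Let s0 : 0 < s. Proof. exact: tail_quantile_gt0. Qed.
Let n0 : 0 < n. Proof. by []. Qed.

Let mK : measurable_fun setT K.
Proof. by apply: nonincreasing_in_measurable => // x y _ _; exact: K_ni. Qed.

Let mF : measurable_fun setT F.
Proof. by apply: continuous_measurable_fun => y; exact: F_cont. Qed.

Lemma measurable_log_weight (a : R) : measurable_fun setT (log_weight a).
Proof.
apply: measurable_funD => //; apply: (measurableT_comp (@measurable_ln R)).
exact: measurable_funM.
Qed.

Let mpsi : measurable_fun setT psi := @measurable_log_weight s.

Let F_half x : s < x -> 2^-1 <= F x.
Proof.
move=> sx; have := survival_tail_quantile F_cont F_0 F_1 t1; rewrite /survival => H.
have Fs : F s <= F x by apply: law_cdf_nd; exact: ltW.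
have : t^-1 <= 2^-1 by rewrite lef_pV2 ?posrE.
by lra.
Qed.

Let psi1 x : s < x -> 1 <= psi x.
Proof. by move=> sx; rewrite lerDl ln_ge0// ler_pdivlMr// mul1r ltW. Qed.

Let J0 x := psi x ^+ 2 / K x.

Let mJ0 : measurable_fun setT J0.
Proof.
apply: measurable_funM; first exact: measurable_funX.
exact: (measurableT_comp (@measurable_invr R)).
Qed.

Let J0_ge0 x : 0 <= J0 x.
Proof. by rewrite mulr_ge0 ?sqr_ge0// invr_ge0 ltW. Qed.

Let C0_ge0 : 0 <= C0.
Proof.
rewrite -lee_fin; apply: le_trans envelope; apply: integral_ge0 => u _.
by rewrite lee_fin mulr_ge0 ?sqr_ge0// invr_ge0 mulr_ge0 ?invr_ge0 ?ltW.
Qed.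

Let integral_J0 : (\int[mX]_(x in `]s, +oo[) (J0 x)%:E <= (C0 / (t * K s))%:E)%E.
Proof.
rewrite (integral_tail_law F_cont F_lt1 F_0 F_1 t1); last 2 first.
- exact/measurable_EFinP.
- by move=> x; rewrite lee_fin.
have -> : (\int[leb]_(u in I01) (J0 (U (t / u)))%:E =
   \int[leb]_(u in I01) ((K s)^-1%:E * ((tail_ratio U K t u)^-1 * (1 + log_excess U t u) ^+ 2)%:E))%E.
  apply: eq_integral => u _; rewrite /J0 /log_weight /tail_ratio /log_excess -EFinM; congr _%:E.
  by field; rewrite !gt_eqF.
have U_nd : forall x y, 1 < x -> x <= y -> U x <= U y.
  by move=> x y; apply: tail_quantile_nd => //; exact: law_cdf_nd.
have U_gt0 x : 1 < x -> 0 < U x by exact: tail_quantile_gt0.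
rewrite ge0_integralZl//; last 3 first.
- apply/measurable_EFinP; apply: measurable_funM.
    apply: (measurableT_comp (@measurable_invr R)); apply: measurable_funM => //.
    by apply: (measurableT_comp mK); exact: measurable_tail_quantile.
  apply: measurable_funX; apply: measurable_funD => //.
  exact: measurable_log_excess.
- move=> u _; rewrite lee_fin mulr_ge0 ?sqr_ge0// invr_ge0 mulr_ge0 ?invr_ge0 ?ltW//.
- by rewrite lee_fin invr_ge0 ltW.
rewrite muleA -EFinM invfM [C0 * _]mulrC [X in (_ <= X)%E]EFinM.
by apply: lee_wpmul2l => //; rewrite lee_fin mulr_ge0 ?invr_ge0 ?(ltW t0) ?(ltW (K_gt0 _)).
Qed.

Let integral_le_J0 (c : R) (f : R -> R) : 0 <= c -> measurable_fun setT f ->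
  (forall x, s < x -> 0 <= f x <= c * J0 x) ->
  (\int[mX]_(x in `]s, +oo[) (f x)%:E <= (c * (C0 / (t * K s)))%:E)%E.
Proof.
move=> c0 mf fJ.
apply: (@le_trans _ _ (\int[mX]_(x in `]s, +oo[) (c%:E * (J0 x)%:E))%E).
  apply: ge0_le_integral => //.
  - by move=> x /=; rewrite in_itv/= andbT lee_fin => /fJ/andP[].
  - by apply: measurable_funTS; exact/measurable_EFinP.
  - by apply: measurable_funTS; apply: measurable_funeM; exact/measurable_EFinP.
  - by move=> x /=; rewrite in_itv/= andbT -EFinM lee_fin => /fJ/andP[].
rewrite ge0_integralZl//; last 2 first.
- by apply: measurable_funTS; exact/measurable_EFinP.
- by move=> x _; rewrite lee_fin.
by rewrite EFinM lee_wpmul2l.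
Qed.

Let J0_K x : s < x -> 1 <= K s * J0 x /\ psi x <= K s * J0 x.
Proof.
move=> sx; have p1 := psi1 sx; have p0 : 0 < psi x by apply: lt_le_trans p1.
have KK : 1 <= K s / K x by rewrite ler_pdivlMr// mul1r K_ni// ltW.
have -> : K s * J0 x = K s / K x * psi x ^+ 2 by rewrite /J0; ring.
have p2 : psi x <= psi x ^+ 2 by rewrite expr2 ler_peMr// ltW.
have : psi x ^+ 2 <= K s / K x * psi x ^+ 2 by rewrite ler_peMl// sqr_ge0.
by split; lra.
Qed.

Definition hazard_bound := 4 * p / n * (C0 / (t * K s)).

(** A single term of the sum has mean [- ln (F x) / n] by the hazard identity, and its second moment
    is controlled by the envelope because [F] is at least 1/2 beyond [s]. *)
Lemma hazard_variance x : s < x ->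
  (iter_int mu A m (fun l => ((ln (F x) + \sum_(y <- l) (x < y.1)%R%:R * (risk p F K m y.1)^-1) ^+ 2)%:E)
   <= (p ^+ m * hazard_bound)%:E)%E.
Proof.
move=> sx; have F0 : 0 < F x by apply: lt_le_trans (F_half sx); rewrite invr_gt0.
have F1 : F x <= 1 by rewrite ltW.
pose f (y : R) : R := (x < y)%R%:R * (risk p F K m y)^-1.
have mA : measurable A.
  by apply: measurable_set_pred; apply: measurable_fun_ler; [exact: measurable_fst|exact: measurable_snd].
have mlV : measurable_fun setT (fun y => (risk p F K m y)^-1).
  apply: measurableT_comp; first exact: measurable_invr.
  by apply: measurable_funM => //; apply: measurable_funM => //; exact: measurable_funM.
have mf : measurable_fun setT f.
  apply: measurable_funM => //.
  have mb2R : measurable_fun setT (fun c : bool => c%:R : R) by [].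
  by apply: (measurableT_comp mb2R); exact: measurable_fun_ltr.
have F_ge0 y : 0 <= F y by apply: F_ge0 => //; exact: law_cdf_nd.
have f0 y : 0 <= f y.
  by rewrite mulr_ge0// invr_ge0 /risk !mulr_ge0 ?invr_ge0 ?(ltW (K_gt0 _)) ?(ltW p_gt0).
have toD (h : R -> R) : (\int[mX]_y ((x < y)%R%:R * h y)%:E = \int[mX]_(y in `]x, +oo[) (h y)%:E)%E.
  rewrite [RHS]integral_mkcond; apply: eq_integral => y _.
  by rewrite patchE mem_set_itv in_itv/= andbT; case: ifP => _; rewrite ?mul1r ?mul0r.
have I1 : (\int[mu]_(z in A) (f z.1)%:E = (p * (- ln (F x) / n))%:E)%E.
  rewrite (@mu_fst (fun y => (f y)%:E))//; last exact/measurable_EFinP.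
  transitivity (\int[mX]_y ((x < y)%R%:R * (p / n * (F y)^-1))%:E)%E.
    apply: eq_integral => y _; rewrite -EFinM /f /risk; congr _%:E.
    have [xy|_] := ltP x y; last by rewrite !mul0r.
    have Fy : 0 < F y by apply: lt_le_trans (F_half (lt_trans sx xy)); rewrite invr_gt0.
    by field; rewrite !gt_eqF.
  rewrite toD; under eq_integral do rewrite EFinM.
  rewrite ge0_integralZl//; last 3 first.
  - apply/measurable_EFinP; apply: measurable_funTS; exact: (measurableT_comp (@measurable_invr R)).
  - by move=> y _; rewrite lee_fin invr_ge0.
  - by rewrite lee_fin divr_ge0 ?(ltW p_gt0).
  rewrite (integral_inv_cdf F_cont F_lt1 F_0 F_1 F0) -EFinM; congr _%:E.
  by rewrite mulrA mulrAC.
have I2 : (\int[mu]_(z in A) (f z.1 ^+ 2)%:E <= (p / n * hazard_bound)%:E)%E.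
  rewrite (@mu_fst (fun y => (f y ^+ 2)%:E))//; last 2 first.
  - by move=> y; rewrite lee_fin sqr_ge0.
  - by apply/measurable_EFinP; exact: measurable_funX.
  pose h y := (x < y)%R%:R * (f y ^+ 2 * K y).
  have -> : (\int[mX]_y ((f y ^+ 2)%:E * (K y)%:E) = \int[mX]_(y in `]s, +oo[) (h y)%:E)%E.
    rewrite [RHS]integral_mkcond; apply: eq_integral => y _.
    rewrite -EFinM patchE mem_set_itv in_itv/= andbT /h /f.
    have [sy|ys] := ltP s y.
      by case: (x < y); rewrite ?mul1r// !mul0r expr0n mul0r.
    by rewrite ltNge (le_trans ys (ltW sx)) !mul0r expr0n mul0r.
  have -> : p / n * hazard_bound = (4 * p ^+ 2 / n ^+ 2) * (C0 / (t * K s)).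
    by rewrite /hazard_bound; field; rewrite !gt_eqF.
  apply: integral_le_J0.
  - by rewrite mulr_ge0 ?invr_ge0 ?exprn_ge0// mulr_ge0// sqr_ge0.
  - apply: measurable_funM; last by apply: measurable_funM => //; exact: measurable_funX.
    have mb2R : measurable_fun setT (fun c : bool => c%:R : R) by [].
    by apply: (measurableT_comp mb2R); exact: measurable_fun_ltr.
  - move=> y sy; rewrite /h; apply/andP; split.
      by rewrite mulr_ge0// mulr_ge0 ?sqr_ge0// ltW.
    have c0 : 0 <= 4 * p ^+ 2 / n ^+ 2 * J0 y.
      by rewrite mulr_ge0// mulr_ge0 ?invr_ge0 ?exprn_ge0// mulr_ge0// sqr_ge0.
    rewrite /f; have [xy|_] := ltP x y; last by rewrite mul0r.
    have Fy2 := F_half sy; have Fy : 0 < F y by apply: lt_le_trans Fy2; rewrite invr_gt0.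
    have Ky := K_gt0 y.
    rewrite !mul1r /risk /J0.
    have -> : (n * (F y * K y) / p) ^- 1 ^+ 2 * K y = p ^+ 2 / n ^+ 2 * (K y)^-1 * (F y) ^- 2.
      by field; rewrite !gt_eqF.
    have -> : 4 * p ^+ 2 / n ^+ 2 * (psi y ^+ 2 / K y) = p ^+ 2 / n ^+ 2 * (K y)^-1 * (4 * psi y ^+ 2) by ring.
    apply: ler_wpM2l.
      by rewrite mulr_ge0 ?invr_ge0 ?(ltW Ky)// mulr_ge0 ?sqr_ge0// invr_ge0 sqr_ge0.
    have F2 : (F y) ^- 2 <= 4.
      rewrite invf_ple ?posrE ?exprn_gt0//.
      by rewrite (_ : 4^-1 = (2^-1) ^+ 2) ?ler_sqr ?nnegrE ?invr_ge0 ?(ltW Fy)//; field.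
    have : 1 <= psi y ^+ 2 by rewrite exprn_ege1// psi1.
    lra.
have mf1 : measurable_fun setT (fun z : E => f z.1) by exact: (measurableT_comp mf measurable_fst).
have i1 : mu.-integrable A (EFin \o (fun z : E => f z.1)).
  apply/integrableP; split; first by apply/measurable_EFinP; exact: measurable_funTS.
  under eq_integral do rewrite /= ger0_norm//.
  by rewrite I1 ltry.
have i2 : mu.-integrable A (EFin \o (fun z : E => f z.1 ^+ 2)).
  apply/integrableP; split; first by apply/measurable_EFinP; apply: measurable_funTS; exact: measurable_funX.
  under eq_integral do rewrite /= ger0_norm ?sqr_ge0//.
  by rewrite (le_lt_trans I2) ?ltry.
have J1 : \int[mu]_(z in A) f z.1 = p * (- ln (F x) / n) by rewrite /Rintegral I1.
pose m2 := p^-1 * \int[mu]_(z in A) f z.1 ^+ 2.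
have J2 : \int[mu]_(z in A) f z.1 ^+ 2 = p * m2 by rewrite /m2 mulVKf// gt_eqF.
rewrite (@iter_int_sum_sqr _ _ _ mu A p mA muA (fun z => f z.1) _ _ m (ln (F x)) mf1 i1 i2 J1 J2).
rewrite lee_fin ler_pM2l ?exprn_gt0//.
have m2V : m2 <= n^-1 * hazard_bound.
  have : \int[mu]_(z in A) f z.1 ^+ 2 <= p / n * hazard_bound.
    rewrite /Rintegral -lee_fin fineK// ge0_fin_numE; last by apply: integral_ge0 => z _; rewrite lee_fin sqr_ge0.
    by rewrite (le_lt_trans I2) ?ltry.
  by rewrite J2 -mulrA ler_pM2l.
have hb0 : 0 <= hazard_bound.
  by rewrite mulr_ge0// divr_ge0 ?mulr_ge0 ?(ltW p_gt0) ?(ltW t0) ?(ltW (K_gt0 _)).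
have m1 : 1 <= m%:R :> R by rewrite ler1n.
have nE : n = m%:R + 1 by rewrite natr1.
(* Summing [m] terms of weight [1 / (m + 1)] leaves a centring error [la / n]; its square is
   absorbed by what the variance subtracts, as [m] is at least 1. *)
set la := ln (F x); rewrite (_ : _ + _ = m%:R * m2 + (1 - m%:R) * (la / n) ^+ 2); last first.
  by rewrite nE; field; rewrite -nE gt_eqF.
have : m%:R * m2 <= hazard_bound.
  have : m%:R * m2 <= m%:R * (n^-1 * hazard_bound) by rewrite ler_wpM2l.
  move=> /le_trans; apply; rewrite mulrA ler_piMl// ler_pdivrMr// mul1r nE lerDl //.
have H2 : (1 - m%:R) * (la / n) ^+ 2 <= 0 by rewrite mulr_le0_ge0 ?sqr_ge0 ?subr_le0.
by move=> H1; rewrite -[leRHS]addr0 lerD.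
Qed.

(** Multiplication by [n * K s / p] turns the deterministic weight [F / risk] into the score weight
    [K s / K]; the square root of [k] is the scale of the central limit theorem. *)
Definition risk_scale := n * K s / (p * Num.sqrt k%:R).

Lemma weight_error_rate :
  (iter_int mu A m.+1 (fun l => (weight_error p F K psi m s risk_scale l)%:E) <=
   (p ^+ m.+1 * (C0 * (2 * (n * K s / (p * k%:R * t)) + 4 * C0 + 16) / Num.sqrt t))%:E)%E.
Proof.
set N := risk_scale; set V := hazard_bound.
pose rk := Num.sqrt (k%:R : R); pose rt := Num.sqrt t.
have rk0 : 0 < rk by rewrite sqrtr_gt0 ltr0n.
have rk1 : 1 <= rk by rewrite -[1]sqrtr1 ler_wsqrtr// ler1n.
have rt0 : 0 < rt by rewrite sqrtr_gt0.
have rt1 : 1 <= rt by rewrite -[1]sqrtr1 ler_wsqrtr// ltW.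
have rkE : k%:R = rk ^+ 2 :> R by rewrite sqr_sqrtr.
have rtE : t = rt ^+ 2 by rewrite sqr_sqrtr// ltW.
(* The parameter of both AM-GM bounds; this value balances the leading terms in [sg] and in [sg^-1],
   which both become of order [1 / sqrt t]. *)
pose sg := (rk * rt)^-1.
have sg0 : 0 < sg by rewrite invr_gt0 mulr_gt0.
have Ks := K_gt0 s.
have N0 : 0 <= N by rewrite /N /risk_scale divr_ge0 ?mulr_ge0 ?sqrtr_ge0 ?(ltW p_gt0) ?(ltW Ks).
have F_pos x : s < x -> 0 < F x by move=> /F_half; apply: lt_le_trans; rewrite invr_gt0.
have psi0 x : s < x -> 0 <= psi x by move=> /psi1; apply: le_trans.
apply: le_trans (@weight_error_mean _ _ mX p F K psi p_gt0 muA mu_fst mu_risk mF mK mpsi m s N sg V sg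
  F_pos K_gt0 psi0 N0 sg0 sg0 hazard_variance) _.
have V0 : 0 <= V.
  by rewrite mulr_ge0// divr_ge0 ?mulr_ge0 ?(ltW p_gt0) ?(ltW t0) ?(ltW (K_gt0 _)).
pose b1 := N * sg / 2 + N * ((V / sg + sg) / 2) + 1.
pose b2 := N * (sg / 2 + sg^-1 + 2).
pose B := K s * (2 * p / n) * b1 + 4 * p ^+ 2 / n ^+ 2 * b2.
have b1_0 : 0 <= b1.
  have vs : 0 <= (V / sg + sg) / 2 by rewrite divr_ge0// addr_ge0 ?divr_ge0 ?(ltW sg0).
  by rewrite !addr_ge0// mulr_ge0// mulr_ge0// ltW.
have b2_0 : 0 <= b2.
  apply: mulr_ge0 => //; apply: addr_ge0 => //; apply: addr_ge0; last by rewrite invr_ge0 ltW.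
  by rewrite divr_ge0// ltW.
have c1_0 : 0 <= 2 * p / n by rewrite divr_ge0 ?mulr_ge0 ?(ltW p_gt0).
have c2_0 : 0 <= 4 * p ^+ 2 / n ^+ 2 by rewrite mulr_ge0 ?invr_ge0 ?exprn_ge0// mulr_ge0// sqr_ge0.
have B0 : 0 <= B.
  by apply: addr_ge0; [apply: mulr_ge0 => //; apply: mulr_ge0 => //; exact: ltW|exact: mulr_ge0].
have mwb : measurable_fun setT (weight_error_bound p F K psi m N sg V sg).
  have ml : measurable_fun setT (fun x => (risk p F K m x)^-1).
    apply: measurableT_comp; first exact: measurable_invr.
    by apply: measurable_funM => //; apply: measurable_funM => //; exact: measurable_funM.
  have ml2 : measurable_fun setT (fun x => (risk p F K m x) ^- 2).
    rewrite (_ : (fun x => _) = fun x => (risk p F K m x)^-1 ^+ 2); last by apply/funext => x; rewrite exprVn.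
    exact: measurable_funX.
  apply: measurable_funM; first exact: measurable_funM.
  apply: measurable_funD => //; apply: measurable_funD; last first.
    by apply: measurable_funM => //; exact: measurable_funM.
  apply: measurable_funD; apply: measurable_funM => //; last exact: measurable_funM.
  by apply: measurable_funD; exact: measurable_funM.
have I := integral_le_J0 B0 mwb.
apply: (@le_trans _ _ ((n * p ^+ m)%:E * (B * (C0 / (t * K s)))%:E)%E).
  apply: lee_wpmul2l; first by rewrite lee_fin mulr_ge0// exprn_ge0// ltW.
  apply: I => x sx; have Kx := K_gt0 x; have Fx := F_pos x sx.
  have l0 : 0 < risk p F K m x by rewrite divr_gt0// mulr_gt0// mulr_gt0.
  have lV : (risk p F K m x)^-1 <= 2 * p / n * (K x)^-1.
    have -> : (risk p F K m x)^-1 = p / n * (K x)^-1 * (F x)^-1 by rewrite /risk; field; rewrite !gt_eqF.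
    have -> : 2 * p / n * (K x)^-1 = p / n * (K x)^-1 * 2 by ring.
    apply: ler_wpM2l; first by rewrite mulr_ge0 ?invr_ge0 ?divr_ge0 ?(ltW Kx) ?(ltW p_gt0).
    by rewrite invf_ple ?posrE// F_half.
  have lV2 : (risk p F K m x) ^- 2 <= 4 * p ^+ 2 / n ^+ 2 * (K x) ^- 2.
    have -> : 4 * p ^+ 2 / n ^+ 2 * (K x) ^- 2 = (2 * p / n * (K x)^-1) ^+ 2 by field; rewrite !gt_eqF.
    by rewrite -exprVn ler_sqr ?nnegrE ?invr_ge0 ?(ltW l0)// mulr_ge0// invr_ge0 ltW.
  have ps := psi0 x sx; have ps1 := psi1 sx.
  rewrite /weight_error_bound; set li := (risk _ _ _ _ _)^-1 in lV *; set li2 := _ ^- 2 in lV2 *.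
  have li0 : 0 <= li by rewrite /li invr_ge0 ltW.
  have li20 : 0 <= li2 by rewrite /li2 -exprVn exprn_ge0 // invr_ge0 ltW.
  have -> : psi x * K x * (N * (sg / 2 * li + (sg / 2 + sg^-1) * li2) + N * (2 * li2) +
      N * (li * ((V / sg + sg) / 2)) + li) =
    psi x * (K x * li * b1) + psi x * (K x * li2 * b2) by rewrite /b1 /b2; ring.
  have Kx0 := ltW Kx.
  apply/andP; split; first by apply: addr_ge0; apply: mulr_ge0 => //; apply: mulr_ge0 => //; exact: mulr_ge0.
  rewrite /B [leRHS]mulrDl; apply: lerD.
    have P1 : K x * li <= 2 * p / n.
      apply: (@le_trans _ _ (K x * (2 * p / n * (K x)^-1))); first by rewrite ler_pM2l.
      by rewrite mulrCA divff ?mulr1// gt_eqF.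
    have -> : K s * (2 * p / n) * b1 * J0 x = (K s * J0 x) * (2 * p / n * b1) by ring.
    have [_ Q] := J0_K sx.
    apply: ler_pM => //; first by apply: mulr_ge0 => //; exact: mulr_ge0.
    by rewrite ler_wpM2r.
  have P2 : K x * li2 <= 4 * p ^+ 2 / n ^+ 2 * (K x)^-1.
    apply: (@le_trans _ _ (K x * (4 * p ^+ 2 / n ^+ 2 * (K x) ^- 2))); first by rewrite ler_pM2l.
    by rewrite le_eqVlt; apply/orP; left; apply/eqP; field; rewrite !gt_eqF.
  have -> : 4 * p ^+ 2 / n ^+ 2 * b2 * J0 x = psi x ^+ 2 * (4 * p ^+ 2 / n ^+ 2 * (K x)^-1 * b2).
    by rewrite /J0; ring.
  apply: ler_pM => //; first by apply: mulr_ge0 => //; exact: mulr_ge0.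
    by rewrite expr2 ler_peMr.
  by rewrite ler_wpM2r.
rewrite -EFinM lee_fin.
pose ri := rt^-1.
have ri0 : 0 < ri by rewrite invr_gt0.
have ri1 : ri <= 1 by rewrite invf_le1.
pose rki := rk^-1.
have rki0 : 0 < rki by rewrite invr_gt0.
have rki1 : rki <= 1 by rewrite invf_le1.
pose rho := n * K s / (p * k%:R * t).
have rho0 : 0 < rho by rewrite divr_gt0 ?mulr_gt0 ?ltr0n.
have -> : n * p ^+ m * (B * (C0 / (t * K s))) =
  p ^+ m.+1 * C0 * (2 * rho * ri + 4 * C0 * ri ^+ 3 + 2 * ri ^+ 2 + 2 * rki ^+ 2 * ri ^+ 3 + 4 * ri + 8 * rki * ri ^+ 2).
  rewrite /B /b1 /b2 /rho /V /hazard_bound /N /risk_scale -/rk rkE rtE /ri /rki /sg [p ^+ m.+1]exprS.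
  by field; rewrite !gt_eqF.
rewrite -!mulrA ler_pM2l ?exprn_gt0// ler_wpM2l// -/rho -/rt -/ri.
have r2 : ri ^+ 2 <= ri by rewrite expr2 ger_pMl.
have r3 : ri ^+ 3 <= ri by rewrite exprS ger_pMr// exprn_ile1// ltW.
have k2 : rki ^+ 2 * ri ^+ 3 <= ri.
  by apply: le_trans r3; rewrite ger_pMl ?exprn_gt0// exprn_ile1// ltW.
have k1 : rki * ri ^+ 2 <= ri.
  by apply: le_trans r2; rewrite ger_pMl ?exprn_gt0.
have c3 : C0 * ri ^+ 3 <= C0 * ri by rewrite ler_wpM2l.
lra.
Qed.

End weight_error_rate.

(** * The product law on the plane *)

Section borel_pair.
Variable R : realType.
(** The identity, used to transport the product measure between the two presentations of the Borel
    plane. *)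
Definition borel_pair (z : measurableTypeR R * measurableTypeR R) : R * R := z.
Lemma measurable_borel_pair : measurable_fun setT borel_pair.
Proof. by apply/measurable_fun_pairP; split; [exact: measurable_fst|exact: measurable_snd]. Qed.
HB.instance Definition _ := isMeasurableFun.Build _ _ _ _ borel_pair measurable_borel_pair.
Definition pair_law (mX mY : probability (measurableTypeR R) R) : probability (R * R)%type R :=
  distribution [the probability _ _ of (mX \x mY)%E] borel_pair.
Variables mX mY : probability (measurableTypeR R) R.
Local Notation mu := (pair_law mX mY).
Lemma pair_law_rect (B C : set R) : measurable B -> measurable C ->
  mu (B `*` C) = (mX B * mY C)%E.
Proof. by move=> mB mC; exact: (@product_measure1E _ _ _ _ _ mX mY). Qed.

Lemma pair_law_fubini (h : R * R -> \bar R) : measurable_fun setT h -> (forall z, 0 <= h z)%E ->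
  (\int[mu]_z h z = \int[mX]_x \int[mY]_y h (x, y))%E.
Proof.
move=> mh h0; rewrite ge0_integral_distribution//.
rewrite (@fubini_tonelli1 _ _ _ _ _ mX mY (h \o borel_pair))//.
Qed.
End borel_pair.

(** * The law of an observed pair *)

Section truncated_pair.
Context {R : realType}.
Local Notation E := (R * R)%type.
Variables mX mY : probability (measurableTypeR R) R.
Local Notation F := (law_cdf mX).
Local Notation K := (survival (law_cdf mY)).
Local Notation mu := (pair_law mX mY).
Local Notation A := [set z : E | z.1 <= z.2].
Local Notation U := (tail_quantile F).
Local Notation I01 := (`](0 : R), 1[%classic).
Hypothesis F_cont : continuous F.
Hypothesis F_lt1 : forall x, F x < 1.
Hypothesis F_0 : forall x, x <= 0 -> F x = 0.
Hypothesis F_1 : F x @[x --> +oo] --> (1 : R).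
Hypothesis G_cont : continuous (law_cdf mY).
Hypothesis K_gt0 : forall x, 0 < K x.

Lemma survival_law_ni x y : x <= y -> K y <= K x.
Proof. by move=> xy; rewrite lerB// law_cdf_nd. Qed.

Lemma measurable_survival : measurable_fun setT K.
Proof. by apply: nonincreasing_in_measurable => // x y _ _; exact: survival_law_ni. Qed.

Lemma measurable_observable : measurable (A : set E).
Proof.
by apply: measurable_set_pred; apply: measurable_fun_ler; [exact: measurable_fst|exact: measurable_snd].
Qed.

Lemma law_point (x : measurableTypeR R) : mY [set x] = 0%E.
Proof.
apply/eqP; rewrite eq_le measure_ge0 andbT; apply/lee_addgt0Pr => e e0; rewrite add0e.
have /cvgrPdist_le/(_ _ e0)/nbhs_ballP[dl /= dl0 H] := @G_cont x.
have dl2 : dl / 2 < dl by rewrite ltr_pdivrMr// mulr_natr mulr2n ltrDl.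
have d20 : 0 < dl / 2 by rewrite divr_gt0.
have := H (x - dl / 2); rewrite /ball/= opprB addrC subrK gtr0_norm// => /(_ dl2).
rewrite ler_norml => /andP[_ Hx].
have xd : x - dl / 2 <= x by rewrite gerBl ltW.
apply: (@le_trans _ _ (mY `]x - dl / 2, x]%classic)).
  apply: le_measure; rewrite ?inE//=.
  by move=> y ->; rewrite /= in_itv/= lexx gtrBl d20.
by rewrite measure_itv_oc// lee_fin.
Qed.

Lemma law_ray x : mY `[x, +oo[%classic = (K x)%:E.
Proof.
have -> : `[x, +oo[%classic = [set x] `|` `]x, +oo[%classic.
  apply/seteqP; split => y /=; rewrite !in_itv/= !andbT.
    by rewrite le_eqVlt => /predU1P[->|]; [left|right].
  by case=> [->//|/ltW].
rewrite (measureU mY) => //; last 1 first.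
- by apply/seteqP; split => y //=; rewrite in_itv/= andbT => -[->]; rewrite ltxx.
transitivity (0 + mY `]x, +oo[%classic)%E; last by rewrite add0e law_tail.
by congr (_ + _)%E; exact: law_point.
Qed.

(** Integrating out [Y] leaves the probability of the closed ray from [x], which is [K x] because
    the law of [Y] has no atom. *)
Lemma integral_observable_fst (f : R -> \bar R) : (forall x, 0 <= f x)%E -> measurable_fun setT f ->
  (\int[mu]_(z in A) f z.1 = \int[mX]_x (f x * (K x)%:E))%E.
Proof.
move=> f0 mf.
pose h (z : E) : \bar R := (f z.1 * (\1_A z)%:E)%E.
have h0 z : (0 <= h z)%E by rewrite mule_ge0// lee_fin.
have mh : measurable_fun setT h.
  apply: emeasurable_funM; first exact: (measurableT_comp mf measurable_fst).
  by apply/measurable_EFinP; apply: measurable_indic; exact: measurable_observable.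
rewrite integral_mkcond.
transitivity (\int[mu]_z h z)%E.
  apply: eq_integral => z _; rewrite patchE /h indicE.
  by case: ifP => _; rewrite ?mule1// mule0.
rewrite (pair_law_fubini mX mY mh h0); apply: eq_integral => x _.
rewrite /h/=; transitivity (\int[mY]_y (f x * (\1_(`[x, +oo[%classic) y)%:E))%E.
  apply: eq_integral => y _; congr (_ * _%:E)%E.
  by rewrite !indicE; congr (nat_of_bool _)%:R; apply/idP/idP; rewrite !inE/= in_itv/= andbT.
rewrite ge0_integralZl//; last by apply/measurable_EFinP; apply: measurable_indic; exact: measurable_itv.
have mi : measurable (`[x, +oo[%classic : set (measurableTypeR R)) by exact: measurable_itv.
rewrite integral_indic// setIT; congr (_ * _)%E; exact: law_ray.
Qed.

Lemma measure_at_risk x : mu (A `&` [set z | z.1 <= x <= z.2]) = (F x * K x)%:E.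
Proof.
have -> : A `&` [set z | z.1 <= x <= z.2] = `]-oo, x]%classic `*` `[x, +oo[%classic.
  apply/seteqP; split => z /=; rewrite !in_itv/= andbT.
    by move=> [_ /andP[]].
  by move=> [zx xz]; split; [exact: le_trans zx xz|rewrite zx].
rewrite pair_law_rect//; try exact: measurable_itv.
have -> : mY `[x, +oo[%classic = (K x)%:E by exact: law_ray.
by rewrite EFinM /law_cdf fineK// fin_num_measure.
Qed.

Definition observed_tail x : R := fine (mu (A `&` [set z | x < z.1])).
Definition observed_mass : R := fine (mu A).
Local Notation q := observed_tail.
Local Notation p := observed_mass.

Lemma measurable_observed_tail_set x : measurable (A `&` [set z : E | x < z.1]).
Proof.
apply: measurableI; first exact: measurable_observable.
by apply: measurable_set_pred; apply: measurable_fun_ltr => //; exact: measurable_fst.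
Qed.

Lemma measure_observed_tail x : mu (A `&` [set z | x < z.1]) = (q x)%:E.
Proof. by rewrite /q fineK// fin_num_measure//; exact: measurable_observed_tail_set. Qed.

Lemma measure_observed : mu A = p%:E.
Proof. by rewrite /p fineK// fin_num_measure//; exact: measurable_observable. Qed.

Lemma observed_tail_ge0 x : 0 <= q x. Proof. by rewrite fine_ge0. Qed.

Lemma observed_tail_integral x : (\int[mX]_(y in `]x, +oo[) (K y)%:E = (q x)%:E)%E.
Proof.
have mb2R : measurable_fun setT (fun c : bool => c%:R : R) by [].
have mi : measurable_fun setT (fun y : R => ((x < y)%R%:R : R)%:E).
  apply/measurable_EFinP; apply: (measurableT_comp mb2R); exact: measurable_fun_ltr.
have := @integral_observable_fst (fun y => ((x < y)%R%:R : R)%:E) _ mi.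
move=> /(_ _)/wrap[]; first by move=> y; rewrite lee_fin.
move=> H; transitivity (\int[mX]_y (((x < y)%R%:R)%:E * (K y)%:E))%E.
  rewrite integral_mkcond; apply: eq_integral => y _.
  rewrite patchE mem_set_itv in_itv/= andbT.
  by case: ifP => _; rewrite ?mul1e ?mul0e.
rewrite -H -measure_observed_tail setIC -integral_indic//; last 2 first.
- exact: measurable_observable.
- by apply: measurable_set_pred; apply: measurable_fun_ltr => //; exact: measurable_fst.
by apply: eq_integral => z _; rewrite indicE mem_setE.
Qed.

Lemma observed_tail_diff x y : x <= y -> 0 <= q x - q y <= F y - F x.
Proof.
move=> xy.
have S : mu (A `&` [set z | x < z.1]) = (mu (A `&` [set z | (x < z.1 <= y)%R]) + mu (A `&` [set z | (y < z.1)%R]))%E.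
  have -> : A `&` [set z | x < z.1] = (A `&` [set z | x < z.1 <= y]) `|` (A `&` [set z | y < z.1]).
    apply/seteqP; split => z /=.
      by move=> [Az xz]; have [zy|yz] := leP z.1 y; [left; rewrite xz|right].
    by case=> [[Az /andP[]]|[Az yz]] //; split => //; exact: le_lt_trans yz.
  apply: measureU.
  - apply: measurableI; first exact: measurable_observable.
    apply: measurable_set_pred; apply: measurable_and.
      by apply: measurable_fun_ltr => //; exact: measurable_fst.
    by apply: measurable_fun_ler => //; exact: measurable_fst.
  - exact: measurable_observed_tail_set.
  - by apply/seteqP; split => z //= -[[_ /andP[_ zy]] [_]]; rewrite ltNge zy.
have B : (mu (A `&` [set z | (x < z.1 <= y)%R]) <= (F y - F x)%:E)%E.
  rewrite -(measure_itv_oc mX xy) -[leRHS]mule1 -(probability_setT mY) -pair_law_rect//.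
  apply: le_measure; rewrite ?inE//=.
  - apply: measurableI; first exact: measurable_observable.
    apply: measurable_set_pred; apply: measurable_and.
      by apply: measurable_fun_ltr => //; exact: measurable_fst.
    by apply: measurable_fun_ler => //; exact: measurable_fst.
  - by apply: measurableX => //; exact: measurable_itv.
  - by move=> z [_ /= xz]; split => //=; rewrite in_itv.
have B0 : (0 <= mu (A `&` [set z | (x < z.1 <= y)%R]))%E by [].
move: S B B0; rewrite !measure_observed_tail; case: (mu _) => [r| |] //.
by rewrite -EFinD !lee_fin => -[->] rB r0; rewrite addrK r0.
Qed.

Lemma observed_tail_le x : q x <= 1 - F x.
Proof.
rewrite -lee_fin -measure_observed_tail -[X in (_ <= X)%E]/((survival F x)%:E) -law_tail.
rewrite -[leRHS]mule1 -(probability_setT mY) -pair_law_rect//.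
apply: le_measure; rewrite ?inE//=.
- exact: measurable_observed_tail_set.
- by apply: measurableX => //; exact: measurable_itv.
- by move=> z [_ /= xz]; split => //=; rewrite in_itv/= andbT.
Qed.

Lemma observed_tail_gt0 x : 0 < q x.
Proof.
have e0 : 0 < (1 - F x) / 2 by rewrite divr_gt0// subr_gt0.
have /cvgrPdist_le/(_ _ e0)[M [_ HM]] := F_1.
pose y := Num.max (M + 1) x.
have xy : x <= y by rewrite le_max lexx orbT.
have My : M < y by rewrite lt_max ltrDl ltr01.
have Fxy : F x < F y.
  by have := HM y My; rewrite ler_norml => /andP[_]; have := F_lt1 x; lra.
have H : ((F y - F x)%:E * (K y)%:E <= (q x)%:E)%E.
  rewrite -(measure_itv_oc mX xy).
  have <- : mY `[y, +oo[%classic = (K y)%:E by exact: law_ray.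
  rewrite -pair_law_rect//; try exact: measurable_itv.
  rewrite -measure_observed_tail.
  apply: le_measure; rewrite ?inE//=.
  - by apply: measurableX; exact: measurable_itv.
  - exact: measurable_observed_tail_set.
  - move=> z [/=]; rewrite !in_itv/= andbT => /andP[xz zy] yz; split => //.
    exact: le_trans yz.
by move: H; rewrite -EFinM lee_fin; apply: lt_le_trans; rewrite mulr_gt0// subr_gt0.
Qed.

Lemma measure_observed_nonpos : mu (A `&` [set z : E | z.1 <= 0]) = 0%E.
Proof.
apply/eqP; rewrite eq_le measure_ge0 andbT.
apply: (@le_trans _ _ (mu (`]-oo, 0]%classic `*` setT))).
  apply: le_measure; rewrite ?inE//=.
  - apply: measurableI; first exact: measurable_observable.
    by apply: measurable_set_pred; apply: measurable_fun_ler => //; exact: measurable_fst.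
  - by apply: measurableX => //; exact: measurable_itv.
  - by move=> z [_ /= z0]; split => //=; rewrite in_itv.
rewrite pair_law_rect// -[X in (X * _)%E]fineK ?fin_num_measure//.
by rewrite -/(law_cdf mX 0) F_0// mul0e.
Qed.

Lemma measure_observed_le x : mu (A `&` [set z | z.1 <= x]) = (p - q x)%:E.
Proof.
have S : mu A = (mu (A `&` [set z | (z.1 <= x)%R]) + mu (A `&` [set z | (x < z.1)%R]))%E.
  rewrite -measureU//.
  - congr (mu _); apply/seteqP; split => z /=; last by case=> -[].
    by move=> Az; have [zx|xz] := leP z.1 x; [left|right].
  - apply: measurableI; first exact: measurable_observable.
    by apply: measurable_set_pred; apply: measurable_fun_ler => //; exact: measurable_fst.
  - exact: measurable_observed_tail_set.
  - by apply/seteqP; split => z //= -[[_ zy] [_]]; rewrite ltNge zy.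
move: S; rewrite measure_observed measure_observed_tail.
by case: (mu _) => [r| |] //; rewrite -EFinD => -[->]; rewrite addrK.
Qed.

Lemma observed_tail_nonpos x : x <= 0 -> q x = p.
Proof.
move=> x0; have : mu (A `&` [set z | z.1 <= x]) = 0%E.
  apply/eqP; rewrite eq_le measure_ge0 andbT -measure_observed_nonpos.
  apply: le_measure; rewrite ?inE//=.
  - apply: measurableI; first exact: measurable_observable.
    by apply: measurable_set_pred; apply: measurable_fun_ler => //; exact: measurable_fst.
  - apply: measurableI; first exact: measurable_observable.
    by apply: measurable_set_pred; apply: measurable_fun_ler => //; exact: measurable_fst.
  - by move=> z [Az /= zx]; split => //; exact: le_trans zx x0.
by rewrite measure_observed_le => -[/eqP]; rewrite subr_eq0 eq_sym => /eqP.
Qed.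

Lemma observed_mass_gt0 : 0 < p.
Proof. by rewrite -(@observed_tail_nonpos 0)// observed_tail_gt0. Qed.

Lemma observed_mass_le1 : p <= 1.
Proof. by rewrite -(@observed_tail_nonpos 0)// (le_trans (observed_tail_le _))// F_0// subr0. Qed.

Definition observed_law_cdf x : R := 1 - q x / p.
Local Notation Fs := observed_law_cdf.

Lemma observed_law_cdf_diff x y : `|Fs x - Fs y| <= p^-1 * `|F x - F y|.
Proof.
wlog xy : x y / x <= y.
  by move=> H; have [/H//|/ltW/H] := leP x y; rewrite distrC [X in _ <= _ * X]distrC.
have /andP[q0 qF] := observed_tail_diff xy.
have -> : Fs x - Fs y = - (p^-1 * (q x - q y)) by rewrite /Fs; ring.
have pi0 : 0 < p^-1 by rewrite invr_gt0 observed_mass_gt0.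
rewrite normrN ger0_norm; last by rewrite mulr_ge0// ltW.
by rewrite ler_pM2l// distrC (le_trans qF)// ler_norm.
Qed.

Lemma observed_law_cdf_cont : continuous Fs.
Proof.
move=> x; apply/cvgrPdist_le => e e0.
have pe : 0 < p * e by rewrite mulr_gt0// observed_mass_gt0.
have /cvgrPdist_le/(_ _ pe) := @F_cont x; apply: filterS => y Hy.
rewrite (le_trans (observed_law_cdf_diff _ _))// mulrC ler_pdivrMr ?observed_mass_gt0//.
by rewrite mulrC.
Qed.

Lemma observed_law_cdf_0 x : x <= 0 -> Fs x = 0.
Proof. by move=> x0; rewrite /Fs observed_tail_nonpos// divff ?subrr// gt_eqF ?observed_mass_gt0. Qed.

Lemma observed_law_cdf_1 : Fs x @[x --> +oo] --> (1 : R).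
Proof.
have q0 : q x @[x --> +oo] --> (0 : R).
  apply: (lim_norm0 (g := fun x => 1 - F x)).
    by apply: filterE => x; rewrite ger0_norm ?observed_tail_ge0// observed_tail_le.
  by rewrite -(subrr (1 : R)); apply: cvgB => //; exact: cvg_cst.
rewrite -[X in _ --> X]subr0 -[X in _ --> _ - X](mul0r p^-1).
apply: cvgB; first exact: cvg_cst.
by apply: cvgM => //; exact: cvg_cst.
Qed.

Lemma observed_tail_quantile t : 1 < t ->
  q (U t) = t^-1 * K (U t) * \int[leb]_(u in I01) tail_ratio U K t u.
Proof.
move=> t1; have t0 : 0 < t by exact: lt_trans t1.
have I := observed_tail_integral (U t).
have mKE : measurable_fun setT (fun x => (K x)%:E) by apply/measurable_EFinP; exact: measurable_survival.
rewrite (integral_tail_law F_cont F_lt1 F_0 F_1 t1 mKE) in I; last first.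
  by move=> x; rewrite lee_fin ltW.
have mg : measurable_fun I01 (tail_ratio U K t).
  apply: measurable_funM => //; apply: (measurableT_comp measurable_survival).
  exact: measurable_tail_quantile.
have E1 : (\int[leb]_(u in I01) (K (U (t / u)))%:E = (K (U t))%:E * \int[leb]_(u in I01) (tail_ratio U K t u)%:E)%E.
  rewrite -ge0_integralZl//; last 3 first.
  - exact/measurable_EFinP.
  - by move=> u _; rewrite lee_fin divr_ge0 ?ltW.
  - by rewrite lee_fin ltW.
  by apply: eq_integral => u _; rewrite -EFinM /tail_ratio mulrCA divff ?mulr1// gt_eqF.
rewrite E1 in I.
(* Finiteness is read off the identity [I]: an infinite integral would make the observed tail
   infinite. *)
have fin : (\int[leb]_(u in I01) (tail_ratio U K t u)%:E)%E \is a fin_num.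
  apply/negPn/negP => nf; move: I.
  have -> : (\int[leb]_(u in I01) (tail_ratio U K t u)%:E = +oo)%E.
    move: nf; rewrite ge0_fin_numE; first by rewrite -leNgt leye_eq => /eqP.
    by apply: integral_ge0 => u _; rewrite lee_fin divr_ge0 ?ltW.
  by rewrite !gt0_muley// lte_fin// invr_gt0.
rewrite -[q _]/(fine (q (U t))%:E) -I muleA fineM//.
Qed.

End truncated_pair.

(** * The scores of exceedances and their central limit theorem *)

Section tail_sample.
Context {R : realType}.
Local Notation E := (R * R)%type.
Variables mX mY : probability (measurableTypeR R) R.
Local Notation F := (law_cdf mX).
Local Notation K := (survival (law_cdf mY)).
Local Notation mu := (pair_law mX mY).
Local Notation Obs := [set z : E | z.1 <= z.2].
Local Notation U := (tail_quantile F).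
Local Notation I01 := (`](0 : R), 1[%classic).
Local Notation q := (observed_tail mX mY).
Hypothesis F_cont : continuous F.
Hypothesis F_lt1 : forall x, F x < 1.
Hypothesis F_0 : forall x, x <= 0 -> F x = 0.
Hypothesis F_1 : F x @[x --> +oo] --> (1 : R).
Hypothesis G_cont : continuous (law_cdf mY).
Hypothesis K_gt0 : forall x, 0 < K x.
Variables (A : R -> R) (gamma tau alpha : R).
Hypotheses (tau_lt0 : tau < 0) (gamma_gt0 : 0 < gamma) (alpha_gt0 : 0 < alpha).
Hypothesis gamma_alpha : gamma * alpha < 1.
Hypothesis A0 : A t @[t --> +oo] --> (0 : R).
Hypothesis hU : second_order_condition U gamma tau A.
Hypothesis K_rv : regularly_varying K (- alpha).
Local Notation L := (log_excess U).
Local Notation g := (tail_ratio U K).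

Let U_gt0 t : 1 < t -> 0 < U t. Proof. exact: tail_quantile_gt0. Qed.
Let U_nd s t : 1 < s -> s <= t -> U s <= U t.
Proof. by apply: tail_quantile_nd => //; exact: law_cdf_nd. Qed.
Let Uoo : U t @[t --> +oo] --> +oo.
Proof. by apply: cvg_tail_quantile => //; exact: law_cdf_nd. Qed.
Let K_ni x y : x <= y -> K y <= K x. Proof. exact: survival_law_ni. Qed.
Let K_ge0 x : 0 <= K x. Proof. exact: ltW. Qed.
Let mK : measurable_fun setT K. Proof. exact: measurable_survival. Qed.
Let g_gt0 t u : 0 < g t u. Proof. exact: divr_gt0. Qed.

Definition tail_set (x : R) : set E := Obs `&` [set z | x < z.1].
Local Notation D := tail_set.

Lemma measurable_tail_set x : measurable (D x).
Proof. exact: measurable_observed_tail_set. Qed.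

Definition mean_ratio t : R := \int[leb]_(u in I01) g t u.
Local Notation kap := mean_ratio.

Lemma ge0_integral_tail_set t (f : R -> R) : 1 < t -> measurable_fun setT f ->
  (forall x, 0 <= f x) ->
  (\int[mu]_(z in D (U t)) (f z.1)%:E =
   (t^-1 * K (U t))%:E * \int[leb]_(u in I01) (g t u * f (U (t / u)))%:E)%E.
Proof.
move=> t1 mf f0; have t0 : 0 < t by exact: lt_trans t1.
have mb2R : measurable_fun setT (fun c : bool => c%:R : R) by [].
have mi : measurable_fun setT (fun y : R => (U t < y)%R%:R * f y).
  by apply: measurable_funM => //; apply: (measurableT_comp mb2R); exact: measurable_fun_ltr.
transitivity (\int[mu]_(z in Obs) ((U t < z.1)%R%:R * f z.1)%:E)%E.
  rewrite /tail_set integral_mkcondr; apply: eq_integral => z _.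
  rewrite patchE.
  have -> : (z \in [set z : E | U t < z.1]) = (U t < z.1) by apply/idP/idP; rewrite inE.
  by case: (U t < z.1); rewrite ?mul1r ?mul0r.
rewrite (integral_observable_fst mX G_cont (f := fun x => ((U t < x)%R%:R * f x)%:E)); last 2 first.
- by move=> x; rewrite lee_fin mulr_ge0.
- exact/measurable_EFinP.
transitivity (\int[mX]_(x in `]U t, +oo[) (f x * K x)%:E)%E.
  rewrite [RHS]integral_mkcond; apply: eq_integral => x _.
  rewrite patchE mem_set_itv in_itv/= andbT.
  by case: ifP => _; rewrite ?mul1r// mul0r mul0e.
rewrite (integral_tail_law F_cont F_lt1 F_0 F_1 t1); last 2 first.
- by apply/measurable_EFinP; exact: measurable_funM.
- by move=> x; rewrite lee_fin mulr_ge0.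
have mUq := @measurable_tail_quantile _ _ F_cont F_0 F_1 t t1.
rewrite [in RHS]EFinM -muleA; congr (_ * _)%E.
rewrite -ge0_integralZl//; last 3 first.
- apply/measurable_EFinP; apply: measurable_funM.
    by apply: measurable_funM => //; exact: (measurableT_comp mK mUq).
  exact: (measurableT_comp mf mUq).
- by move=> u _; rewrite lee_fin mulr_ge0// ltW.
- by rewrite lee_fin.
apply: eq_integral => u _; rewrite -EFinM; congr _%:E.
by rewrite /tail_ratio; field; rewrite gt_eqF.
Qed.

Lemma integral_tail_set t (f : R -> R) : 1 < t -> measurable_fun setT f ->
  leb.-integrable I01 (EFin \o (fun u => g t u * f (U (t / u)))) ->
  mu.-integrable (D (U t)) (EFin \o (fun z => f z.1)) /\
  \int[mu]_(z in D (U t)) f z.1 =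
  t^-1 * K (U t) * \int[leb]_(u in I01) (g t u * f (U (t / u))).
Proof.
move=> t1 mf ig; have t0 : 0 < t by exact: lt_trans t1.
have mf1 : measurable_fun setT (fun z : E => f z.1) by exact: (measurableT_comp mf measurable_fst).
have gM u (x : R) : g t u * Num.max x 0 = Num.max (g t u * x) 0.
  by rewrite maxr_pMr ?mulr0// ltW.
have nE u : `|g t u * f (U (t / u))| = g t u * `|f (U (t / u))|.
  by rewrite normrM gtr0_norm.
have mfa : measurable_fun setT (fun x => `|f x|) by exact: measurableT_comp.
have ifz : mu.-integrable (D (U t)) (EFin \o (fun z => f z.1)).
  apply/integrableP; split; first by apply/measurable_EFinP; exact: measurable_funTS.
  rewrite (_ : (\int[_]_(z in _) _ = \int[mu]_(z in D (U t)) (`|f z.1|)%:E)%E)//.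
  rewrite (@ge0_integral_tail_set t (fun x => `|f x|))//.
  rewrite lte_mul_pinfty ?lee_fin ?mulr_ge0 ?invr_ge0 ?(ltW t0)//.
  have /integrableP[_] := ig; apply: le_lt_trans.
  rewrite le_eqVlt; apply/orP; left; apply/eqP; apply: eq_integral => u _.
  by rewrite /= nE.
split => //.
have mp : measurable_fun setT (fun x => Num.max (f x) 0) by exact: measurable_maxr.
have mn : measurable_fun setT (fun x => Num.max (- f x) 0).
  by apply: measurable_maxr => //; exact: measurableT_comp.
have Ep : (\int[mu]_(z in D (U t)) ((EFin \o (fun z => f z.1))^\+ z) =
    (t^-1 * K (U t))%:E * \int[leb]_(u in I01) ((EFin \o (fun u => (g t u * f (U (t / u)))%R))^\+ u))%E.
  have -> : (\int[mu]_(z in D (U t)) ((EFin \o (fun z => f z.1))^\+ z) =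
     \int[mu]_(z in D (U t)) (Num.max (f z.1) 0)%:E)%E by apply: eq_integral => z _; rewrite funeposE EFin_max.
  rewrite (@ge0_integral_tail_set t (fun x => Num.max (f x) 0))//; last by move=> x; rewrite le_max lexx orbT.
  by congr (_ * _)%E; apply: eq_integral => u _; rewrite funeposE gM EFin_max.
have En : (\int[mu]_(z in D (U t)) ((EFin \o (fun z => f z.1))^\- z) =
    (t^-1 * K (U t))%:E * \int[leb]_(u in I01) ((EFin \o (fun u => (g t u * f (U (t / u)))%R))^\- u))%E.
  have -> : (\int[mu]_(z in D (U t)) ((EFin \o (fun z => f z.1))^\- z) =
     \int[mu]_(z in D (U t)) (Num.max (- f z.1) 0)%:E)%E by apply: eq_integral => z _; rewrite funenegE EFin_max.
  rewrite (@ge0_integral_tail_set t (fun x => Num.max (- f x) 0))//; last by move=> x; rewrite le_max lexx orbT.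
  by congr (_ * _)%E; apply: eq_integral => u _; rewrite funenegE gM EFin_max mulrN.
have fp : (\int[leb]_(u in I01) ((EFin \o (fun u => (g t u * f (U (t / u)))%R))^\+ u))%E \is a fin_num.
  by apply: integrable_fin_num => //; exact: integrable_funepos.
have fn : (\int[leb]_(u in I01) ((EFin \o (fun u => (g t u * f (U (t / u)))%R))^\- u))%E \is a fin_num.
  by apply: integrable_fin_num => //; exact: integrable_funeneg.
have key (a : R) (x y : \bar R) : x \is a fin_num -> y \is a fin_num ->
    fine (a%:E * x - a%:E * y)%E = a * fine (x - y)%E.
  by case: x y => [x| |] [y| |]//= _ _; rewrite mulrBr.
rewrite /Rintegral integralE Ep En [X in _ = _ * fine X]integralE; exact: key.
Qed.

Lemma Rintegral_tail_set t (f : R -> R) : 1 < t -> measurable_fun setT f ->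
  (forall x, 0 <= f x) ->
  \int[mu]_(z in D (U t)) f z.1 =
  t^-1 * K (U t) * \int[leb]_(u in I01) (g t u * f (U (t / u))).
Proof.
move=> t1 mf f0; rewrite /Rintegral ge0_integral_tail_set//.
have a0 : 0 < t^-1 * K (U t) by rewrite mulr_gt0// invr_gt0 (lt_trans _ t1).
case: (\int[_]_(_ in _) _)%E => [y| |]; first by rewrite -EFinM.
  by rewrite gt0_muley ?lte_fin//= mulr0.
by rewrite gt0_muleNy ?lte_fin//= mulr0.
Qed.

Lemma observed_tail_mean_ratio t : 1 < t -> q (U t) = t^-1 * K (U t) * kap t.
Proof. by move=> t1; rewrite (observed_tail_quantile F_cont F_lt1 F_0 F_1 G_cont K_gt0 t1). Qed.

Lemma ge0_mean_tail_set t (f : R -> R) : 1 < t -> measurable_fun setT f ->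
  (forall x, 0 <= f x) ->
  mean mu (D (U t)) (q (U t)) (fun z => f z.1) =
  (kap t)^-1 * \int[leb]_(u in I01) (g t u * f (U (t / u))).
Proof.
move=> t1 mf f0; have t0 : 0 < t by exact: lt_trans t1.
rewrite /mean Rintegral_tail_set// observed_tail_mean_ratio// !invfM invrK.
have Kt : K (U t) != 0 by rewrite gt_eqF.
set J := (\int[_]_(_ in _) _)%R.
set kv := (kap t)^-1; field; by rewrite Kt gt_eqF.
Qed.

Lemma mean_tail_set t (f : R -> R) : 1 < t -> measurable_fun setT f ->
  leb.-integrable I01 (EFin \o (fun u => g t u * f (U (t / u)))) ->
  mu.-integrable (D (U t)) (EFin \o (fun z => f z.1)) /\
  mean mu (D (U t)) (q (U t)) (fun z => f z.1) =
  (kap t)^-1 * \int[leb]_(u in I01) (g t u * f (U (t / u))).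
Proof.
move=> t1 mf ig; have t0 : 0 < t by exact: lt_trans t1.
have [i1 E1] := integral_tail_set t1 mf ig; split => //.
rewrite /mean E1 observed_tail_mean_ratio// !invfM invrK.
have Kt : K (U t) != 0 by rewrite gt_eqF.
set J := (\int[_]_(_ in _) _)%R.
set kv := (kap t)^-1; field; by rewrite Kt gt_eqF.
Qed.

(** The contribution of an exceedance [x] over the threshold [s] once the weights are deterministic;
    dividing by [K x] compensates for the truncation. *)
Definition tail_score (s th x : R) : R := K s / K x * (ln (x / s) - th).

Lemma measurable_tail_score s th : measurable_fun setT (tail_score s th).
Proof.
apply: measurable_funM.
  by apply: measurable_funM => //; exact: (measurableT_comp (@measurable_invr R)).
apply: measurable_funB => //; apply: (measurableT_comp (@measurable_ln R)).
exact: measurable_funM.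
Qed.

Lemma tail_score_quantile t th u :
  tail_score (U t) th (U (t / u)) = (g t u)^-1 * (L t u - th).
Proof. by rewrite /tail_score /tail_ratio invf_div. Qed.

Local Notation r := (gamma * alpha).

(** The limit of the variance of a score, a simplification of [(1 + r)] times [2 gamma^2 / (1 - r)^3
    - 2 gamma^2 / (1 - r)^2 + gamma^2 / (1 - r)]. *)
Definition score_variance : R := (1 + r) * gamma ^+ 2 * (1 + r ^+ 2) / (1 - r) ^+ 3.

Lemma score_variance_gt0 : 0 < score_variance.
Proof.
have r0 : 0 < r by exact: mulr_gt0.
by rewrite divr_gt0 ?exprn_gt0 ?subr_gt0// !mulr_gt0 ?addr_gt0 ?exprn_gt0.
Qed.

Let I (f : R -> R) : R := \int[leb]_(u in I01) f u.
Let integ (f : R -> R) := leb.-integrable I01 (EFin \o f).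
Let mI01 : measurable (I01 : set (measurableTypeR R)).
Proof. exact: measurable_itv. Qed.

Let IZ c f : integ f -> I (fun u => c * f u) = c * I f.
Proof. exact: RintegralZl. Qed.
Let ID f h : integ f -> integ h -> I (fun u => f u + h u) = I f + I h.
Proof. exact: RintegralD. Qed.
Let eqI f h : (forall u, 0 < u < 1 -> f u = h u) -> I f = I h.
Proof. by move=> fh; apply: eq_Rintegral => u; rewrite mem_set_itv in_itv/= => /fh. Qed.
Let eq_integ f h : (forall u, 0 < u < 1 -> f u = h u) -> integ f -> integ h.
Proof.
move=> fh; apply: eq_integrable => // u; rewrite mem_set_itv in_itv/= => /fh H.
by rewrite /= H.
Qed.

Let integ1 : integ (fun=> 1).
Proof.
apply/integrableP; split; first exact: measurable_cst.
rewrite (_ : (\int[_]_(_ in _) _ = leb I01)%E).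
  by rewrite lebesgue_measure_itv/= lte_fin ltr01 oppr0 adde0 ltry.
rewrite -[RHS]mul1e -integral_cst//; apply: eq_integral => u _; by rewrite /= normr1.
Qed.

Let I1 : I (fun=> 1) = 1.
Proof.
rewrite /I /Rintegral (_ : (\int[_]_(_ in _) _ = 1%:E * leb I01)%E); last by rewrite -integral_cst.
by rewrite lebesgue_measure_itv/= lte_fin ltr01 oppr0 adde0 mul1e.
Qed.

Let near_tail : \forall t \near +oo, [/\ 1 < t, 0 < kap t, integ (L t), integ (g t) &
  [/\ integ (fun u => (g t u)^-1), integ (fun u => (g t u)^-1 * L t u) &
      integ (fun u => (g t u)^-1 * L t u ^+ 2)]].
Proof.
have W j := integrable_weight tau_lt0 gamma_gt0 alpha_gt0 gamma_alpha U_gt0 U_nd Uoo A0 hU K_ni K_ge0 K_rv (j := j).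
have w0 := W 0%N isT; have w1 := W 1%N isT; have w2 := W 2%N isT.
have lx := integrable_log_excess tau_lt0 U_gt0 U_nd A0 hU.
near=> t.
have t1 : 1 < t by near: t; exact: near_pinfty_gt.
have ig : integ (g t).
  apply: (@integrable_le _ (measurableTypeR R) R leb _ _ (fun=> 1)) => //.
    exact: (measurable_tail_ratio U_nd K_ni K_ge0 K_rv).
  move=> u; rewrite /= in_itv/= => uI; rewrite gtr0_norm//.
  exact: (tail_ratio_le1 U_nd K_ni K_ge0 K_rv).
split => //.
- have q0 := observed_tail_gt0 F_lt1 F_1 G_cont K_gt0 (U t).
  rewrite observed_tail_mean_ratio// pmulr_rgt0// in q0.
  by rewrite mulr_gt0// invr_gt0 (lt_trans _ t1).
- by near: t; exact: lx.
- split.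
  + have H : integ (fun u => (g t u)^-1 * L t u ^+ 0) by near: t; exact: w0.
    by apply: eq_integ H => u _; rewrite expr0 mulr1.
  + have H : integ (fun u => (g t u)^-1 * L t u ^+ 1) by near: t; exact: w1.
    by apply: eq_integ H => u _; rewrite expr1.
  + by near: t; exact: w2.
Unshelve. all: by end_near. Qed.

(** In uniform coordinates an observed exceedance has density [g / kap], and [g] cancels the weight
    of the score; only the excess of the untruncated variable remains in the mean. *)
Definition score_mean t th : R := (kap t)^-1 * (I (L t) - th).
Definition score_var t th : R :=
  (kap t)^-1 * (I (fun u => (g t u)^-1 * L t u ^+ 2) +
    (- (2 * th) * I (fun u => (g t u)^-1 * L t u) + th ^+ 2 * I (fun u => (g t u)^-1)))
  - score_mean t th ^+ 2.

Let centered t th (x : R) := tail_score (U t) th x - score_mean t th.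

Let score_moments : \forall t \near +oo, forall th,
  [/\ mu.-integrable (D (U t)) (EFin \o (fun z => centered t th z.1)),
      mu.-integrable (D (U t)) (EFin \o (fun z => centered t th z.1 ^+ 2)),
      mean mu (D (U t)) (q (U t)) (fun z => centered t th z.1) = 0 &
      mean mu (D (U t)) (q (U t)) (fun z => centered t th z.1 ^+ 2) = score_var t th].
Proof.
apply: filterS near_tail => t [t1 k0 iL ig [i0 i1 i2]] th.
have kn : kap t != 0 by rewrite gt_eqF.
have mc : measurable_fun setT (centered t th) by apply: measurable_funB => //; exact: measurable_tail_score.
set m := score_mean t th.
pose f1 u := L t u + (- th * 1 + - m * g t u).
have E1 u : 0 < u < 1 -> f1 u = g t u * centered t th (U (t / u)).
  by move=> _; rewrite /centered tail_score_quantile /f1 -/m; field; rewrite gt_eqF.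
have if1 : integ f1.
  by apply: integrableDR => //; apply: integrableDR => //; exact: integrableZR.
have [J1 M1'] := @mean_tail_set t (centered t th) t1 mc (eq_integ E1 if1).
pose f2 u := (g t u)^-1 * L t u ^+ 2 + ((- (2 * th)) * ((g t u)^-1 * L t u) +
   (th ^+ 2 * (g t u)^-1 + ((- (2 * m)) * (L t u) + (2 * m * th * 1 + m ^+ 2 * g t u)))).
have E2 u : 0 < u < 1 -> f2 u = g t u * (fun x => centered t th x ^+ 2) (U (t / u)).
  by move=> _; rewrite /= /centered tail_score_quantile /f2 -/m; field; rewrite gt_eqF.
have j5 := integrableDR mI01 (integrableZR mI01 (2 * m * th) integ1) (integrableZR mI01 (m ^+ 2) ig).
have j4 := integrableDR mI01 (integrableZR mI01 (- (2 * m)) iL) j5.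
have j3 := integrableDR mI01 (integrableZR mI01 (th ^+ 2) i0) j4.
have j2 := integrableDR mI01 (integrableZR mI01 (- (2 * th)) i1) j3.
have if2 : integ f2 by exact: integrableDR.
have mc2 : measurable_fun setT (fun x => centered t th x ^+ 2) by exact: measurable_funX.
have [J2 M2'] := @mean_tail_set t (fun x => centered t th x ^+ 2) t1 mc2 (eq_integ E2 if2).
have EE1 : I f1 = I (L t) - th - m * kap t.
  have a2 := integrableDR mI01 (integrableZR mI01 (- th) integ1) (integrableZR mI01 (- m) ig).
  rewrite /f1 (ID iL a2) (ID (integrableZR mI01 (- th) integ1) (integrableZR mI01 (- m) ig)).
  by rewrite (IZ _ integ1) (IZ _ ig) I1 /mean_ratio -/(I _); ring.
have mE : m * kap t = I (L t) - th by rewrite /m /score_mean mulrAC mulVf// mul1r.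
split => //.
  by rewrite M1' -/(I _) -(eqI E1) EE1 mE subrr mulr0.
rewrite M2' -/(I _) -(eqI E2) /f2 (ID i2 j2).
rewrite (ID (integrableZR mI01 (- (2 * th)) i1) j3) (ID (integrableZR mI01 (th ^+ 2) i0) j4).
rewrite (ID (integrableZR mI01 (- (2 * m)) iL) j5).
rewrite (ID (integrableZR mI01 (2 * m * th) integ1) (integrableZR mI01 (m ^+ 2) ig)).
rewrite (IZ _ i1) (IZ _ i0) (IZ _ iL) (IZ _ integ1) (IZ _ ig) I1 -[I (g t)]/(kap t).
have IL : I (L t) = m * kap t + th by rewrite mE subrK.
by rewrite /score_var -/m IL; field.
Qed.

Section along_a_filter.
Context {J : Type} (FJ : set_system J) {FF : ProperFilter FJ}.
Variables (t : J -> R) (k : J -> nat) (th c : J -> R) (x lam c0 : R).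
Hypothesis too : t i @[i --> FJ] --> +oo.
Hypothesis koo : forall m, \forall i \near FJ, (m < k i)%N.
Hypothesis hth : Num.sqrt (k i)%:R * (th i - gamma) @[i --> FJ] --> x.
Hypothesis hlam : Num.sqrt (k i)%:R * A (t i) @[i --> FJ] --> lam.
Hypothesis hc : c i @[i --> FJ] --> c0.

Let along (f : R -> R) (l : R) : f s @[s --> +oo] --> l -> f (t i) @[i --> FJ] --> l.
Proof. by move=> fl; exact: cvg_comp too fl. Qed.

Let near_t (Q : R -> Prop) : (\forall s \near +oo, Q s) -> \forall i \near FJ, Q (t i).
Proof. by move=> H; exact: too. Qed.

Lemma sqrt_pinfty : Num.sqrt ((k i)%:R : R) @[i --> FJ] --> +oo.
Proof.
apply/cvgryPgt => M; have [m Hm] : exists m : nat, M ^+ 2 < m%:R.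
  by exists (Num.truncn (M ^+ 2)).+1; rewrite truncnS_gt.
apply: filterS (koo m) => i mi.
have H : M ^+ 2 < (k i)%:R by rewrite (lt_trans Hm)// ltr_nat.
rewrite (le_lt_trans (ler_norm M))// -sqrtr_sqr ltr_sqrt//.
by rewrite (le_lt_trans _ H)// sqr_ge0.
Qed.

Let rk0 : (Num.sqrt ((k i)%:R : R))^-1 @[i --> FJ] --> (0 : R).
Proof.
apply/cvgr0Pnorm_le => e e0; have /cvgryPgt/(_ e^-1) := sqrt_pinfty.
apply: filterS => i Hi; have e1 : 0 < e^-1 by rewrite invr_gt0.
have rk := lt_trans e1 Hi.
by rewrite normfV gtr0_norm// invf_ple ?posrE// ltW.
Qed.

Let near_rk : \forall i \near FJ, 0 < Num.sqrt ((k i)%:R : R).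
Proof. by apply: filterS (koo 0) => i ki; rewrite sqrtr_gt0 ltr0n. Qed.

Let cvg_th : th i @[i --> FJ] --> gamma.
Proof.
have /(_ _) H := lim_mul rk0 hth; rewrite mul0r in H.
have /(_ _ _) H2 := lim_add H (cvg_cst gamma); rewrite add0r in H2.
apply: lim_eq H2; apply: filterS near_rk => i ri; rewrite mulKf ?gt_eqF// subrK//.
Qed.

Let cvg_kap : kap (t i) @[i --> FJ] --> (1 + r)^-1.
Proof.
apply: (@along kap); exact: (@cvg_mean_ratio _ U A K gamma tau alpha).
Qed.

Let r1 : 0 < 1 + r. Proof. by rewrite addr_gt0// mulr_gt0. Qed.

Let cvg_kapV : (kap (t i))^-1 @[i --> FJ] --> 1 + r.
Proof.
have n0 : (1 + r)^-1 != 0 by rewrite gt_eqF// invr_gt0.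
by rewrite -[X in _ --> X]invrK; exact: (lim_inv n0 cvg_kap).
Qed.

Let cvg_sqrt_mean : Num.sqrt (k i)%:R * score_mean (t i) (th i) @[i --> FJ] -->
  (1 + r) * (lam * (1 - tau)^-1 - x).
Proof.
have B : (I (L (t i)) - gamma) / A (t i) @[i --> FJ] --> (1 - tau)^-1.
  exact: (along (cvg_bias tau_lt0 U_gt0 U_nd A0 hU)).
have /(_ _) H1 := lim_mul hlam B.
have /(_ _) H2 := lim_sub H1 hth.
have /(_ _) H3 := lim_mul cvg_kapV H2.
apply: lim_eq H3; apply: filterS (near_t (auxiliary_neq0 tau_lt0 hU)) => i Ai.
rewrite /score_mean; set kv := (kap _)^-1; set a := A (t i) in Ai *; set rk := Num.sqrt _.
by field.
Qed.

Let cvg_mean : score_mean (t i) (th i) @[i --> FJ] --> (0 : R).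
Proof.
have /(_ _) H := lim_mul rk0 cvg_sqrt_mean; rewrite mul0r in H.
by apply: lim_eq H; apply: filterS near_rk => i ri; rewrite mulKf ?gt_eqF.
Qed.

Let cvg_var : score_var (t i) (th i) @[i --> FJ] --> score_variance.
Proof.
have W0 : I (fun u => (g (t i) u)^-1) @[i --> FJ] --> (1 - r)^-1.
  exact: (along (cvg_weight0 tau_lt0 gamma_gt0 alpha_gt0 gamma_alpha U_gt0 U_nd Uoo A0 hU K_ni K_ge0 K_rv)).
have W1 : I (fun u => (g (t i) u)^-1 * L (t i) u) @[i --> FJ] --> gamma / (1 - r) ^+ 2.
  exact: (along (cvg_weight1 tau_lt0 gamma_gt0 alpha_gt0 gamma_alpha U_gt0 U_nd Uoo A0 hU K_ni K_ge0 K_rv)).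
have W2 : I (fun u => (g (t i) u)^-1 * L (t i) u ^+ 2) @[i --> FJ] --> 2 * gamma ^+ 2 / (1 - r) ^+ 3.
  exact: (along (cvg_weight2 tau_lt0 gamma_gt0 alpha_gt0 gamma_alpha U_gt0 U_nd Uoo A0 hU K_ni K_ge0 K_rv)).
have /(_ _) T2 := lim_mul cvg_th cvg_th.
have /(_ _) S1 := lim_mul T2 W0.
have /(_ _ _) S2 := lim_mul (lim_scale (-2) cvg_th) W1.
have /(_ _ _) S3 := lim_add W2 (lim_add S2 S1).
have /(_ _) S4 := lim_mul cvg_kapV S3.
have /(_ _ _) S5 := lim_sub S4 (lim_mul cvg_mean cvg_mean).
have -> : score_variance = (1 + r) * (2 * gamma ^+ 2 / (1 - r) ^+ 3 +
   (-2 * gamma * (gamma / (1 - r) ^+ 2) + gamma * gamma * (1 - r)^-1)) - 0 * 0.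
  by rewrite /score_variance; field; rewrite gt_eqF// subr_gt0.
apply: lim_eq S5; apply: filterE => i; rewrite /score_var; congr (_ * (_ + _) - _).
by congr (_ * _ + _ * _); ring.
Qed.

(** For the centred score [z] and the envelope [en], one has [g z^2 <= C1 en] and
    [|z| <= (2 + T) en]. The integrand is therefore at most [C1 en min(1, en / M)] up to
    normalisation, with [M] of order [sqrt k], and [weight_lindeberg] applies. *)
Lemma cvg_score_lindeberg :
  (k i)%:R * ((kap (t i))^-1 * I (fun u => g (t i) u *
    (((Num.sqrt (k i)%:R * Num.sqrt (score_var (t i) (th i)))^-1 * centered (t i) (th i) (U (t i / u))) ^+ 2 *
       Num.min 1 `|(Num.sqrt (k i)%:R * Num.sqrt (score_var (t i) (th i)))^-1 * centered (t i) (th i) (U (t i / u))|)))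
  @[i --> FJ] --> (0 : R).
Proof.
have [C [b [C0 b0 env lind]]] := weight_lindeberg tau_lt0 gamma_gt0 alpha_gt0 gamma_alpha U_gt0 U_nd Uoo A0 hU K_ni K_ge0 K_rv.
pose T := gamma + 1.
have T0 : 0 < T by rewrite addr_gt0.
pose C1 := 2 * ((1 + T) ^+ 2 + 1).
pose en u := C * u `^ (b - 1).
pose M i := Num.sqrt (k i)%:R * Num.sqrt (score_var (t i) (th i)) / (2 + T).
have Moo : M i @[i --> FJ] --> +oo.
  apply/cvgryPgt => B.
  pose w := Num.sqrt (score_variance / 2).
  have w0 : 0 < w by rewrite sqrtr_gt0 divr_gt0// score_variance_gt0.
  have /cvgryPgt/(_ (`|B| * (2 + T) / w)) H1 := sqrt_pinfty.
  have v2 : score_variance / 2 < score_variance by rewrite ltr_pdivrMr// mulr_natr mulr2n ltrDl score_variance_gt0.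
  have H2 : \forall i \near FJ, score_variance / 2 < score_var (t i) (th i).
    by move/cvgr_gt: cvg_var; exact.
  apply: filterS2 H1 H2 => i H1 H2.
  rewrite /M ltr_pdivlMr ?addr_gt0//.
  have Hw : w <= Num.sqrt (score_var (t i) (th i)) by rewrite ler_wsqrtr// ltW.
  apply: (@le_lt_trans _ _ (`|B| * (2 + T))).
    by rewrite ler_pM2r ?addr_gt0// ler_norm.
  move: H1; rewrite ltr_pdivrMr// => /lt_le_trans; apply.
  by rewrite ler_wpM2l// sqrtr_ge0.
have LM : I (fun u => en u * Num.min 1 (en u / M i)) @[i --> FJ] --> (0 : R) by exact: cvg_comp Moo lind.
have /(_ _) VV := lim_inv (lt0r_neq0 score_variance_gt0) cvg_var.
have /(_ _ _ _) B0 := lim_mul (lim_mul cvg_kapV VV) (lim_scale C1 LM).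
rewrite mulr0 mulr0 in B0.
apply: lim_norm0 B0.
have nth : \forall i \near FJ, `|th i| <= T.
  have g1 : 0 < (1 : R) by [].
  have /cvgrPdist_le/(_ _ g1) := cvg_th; apply: filterS => i Hi.
  rewrite -[th i](subKr gamma) (le_trans (ler_normB _ _))// lerD// gtr0_norm//.
have nm : \forall i \near FJ, `|score_mean (t i) (th i)| <= 1.
  have g1 : 0 < (1 : R) by [].
  by have /cvgr0Pnorm_le/(_ _ g1) := cvg_mean.
have nv : \forall i \near FJ, 0 < score_var (t i) (th i).
  by move/cvgr_gt: cvg_var; apply; exact: score_variance_gt0.
have Mp : \forall i \near FJ, 0 < M i by have /cvgryPgt/(_ 0) := Moo.
have nt1 := near_t (near_pinfty_gt (1 : R)).
have nkap : \forall s \near +oo, 0 < kap s by apply: filterS near_tail => s [].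
have nk := near_t nkap.
have nen : \forall s \near +oo, forall u, 0 < u < 1 -> (g s u)^-1 * (1 + L s u) ^+ 2 <= en u.
  by apply: filterS env => s [].
have ne := near_t nen.
near=> i.
have t1 : 1 < t i by near: i.
have k0 : 0 < kap (t i) by near: i; exact: nk.
have envi : forall u, 0 < u < 1 -> (g (t i) u)^-1 * (1 + L (t i) u) ^+ 2 <= en u.
  by near: i; exact: ne.
have thT : `|th i| <= T by near: i.
have m1 : `|score_mean (t i) (th i)| <= 1 by near: i.
have v0 : 0 < score_var (t i) (th i) by near: i.
have M0 : 0 < M i by near: i.
have rk1 : 0 < Num.sqrt ((k i)%:R : R) by near: i.
have ki0 : 0 <= (kap (t i))^-1 by rewrite invr_ge0 ltW.
have vi0 : 0 <= (score_var (t i) (th i))^-1 by rewrite invr_ge0 ltW.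
have c0' := mulr_ge0 ki0 vi0.
pose z u := centered (t i) (th i) (U (t i / u)).
pose w := Num.sqrt (k i)%:R * Num.sqrt (score_var (t i) (th i)).
have w0 : 0 < w by rewrite mulr_gt0// sqrtr_gt0.
have zE u : z u = (g (t i) u)^-1 * (L (t i) u - th i) - score_mean (t i) (th i).
  by rewrite /z /centered tail_score_quantile.
have pt u : 0 < u < 1 -> g (t i) u * z u ^+ 2 <= C1 * en u /\ `|z u| <= (2 + T) * en u.
  move=> uI; have ev := envi u uI; have gp := g_gt0 (t i) u.
  have g1 : g (t i) u <= 1 by exact: (tail_ratio_le1 U_nd K_ni K_ge0 K_rv).
  have L0 : 0 <= L (t i) u by exact: log_excess_ge0.
  have gi1 : 1 <= (g (t i) u)^-1 by rewrite invf_ge1.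
  have gi0 : 0 < (g (t i) u)^-1 by rewrite invr_gt0.
  set l := L (t i) u in ev L0 *; set gi := (g (t i) u)^-1 in ev gi1 gi0 *; set m := score_mean _ _ in m1 *.
  have a1 : `|l - th i| <= (1 + T) * (1 + l).
    rewrite (le_trans (ler_normB _ _))// (ger0_norm L0) (le_trans (lerD (lexx _) thT))//.
    by rewrite -subr_ge0 (_ : _ - _ = 1 + T * l) ?addr_ge0 ?mulr_ge0 ?(ltW T0)//; ring.
  have a2 : (l - th i) ^+ 2 <= (1 + T) ^+ 2 * (1 + l) ^+ 2.
    have c1 : 0 <= (1 + T) * (1 + l) by apply: mulr_ge0; apply: addr_ge0 => //; exact: ltW.
    by move: a1; rewrite -ler_sqr ?nnegrE// real_normK ?num_real// exprMn.
  have m2 : m ^+ 2 <= 1 by rewrite -[leLHS]real_normK ?num_real// exprn_ile1.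
  have l1 : 1 <= 1 + l by rewrite lerDl.
  have l2 : 1 + l <= (1 + l) ^+ 2 by rewrite expr2 ler_peMr// ?addr_ge0.
  have e1 : gi * (1 + l) <= en u by apply: le_trans ev; rewrite ler_pM2l.
  have e2 : 1 <= en u by apply: le_trans e1; rewrite -[leLHS]mulr1 ler_pM.
  split; rewrite zE -/l -/gi -/m.
    have -> : g (t i) u * (gi * (l - th i) - m) ^+ 2 <= C1 * en u = (g (t i) u * (gi * (l - th i) - m) ^+ 2 <= C1 * en u) by [].
    have h1 : g (t i) u * (gi * (l - th i) - m) ^+ 2 <= g (t i) u * (2 * (gi * (l - th i)) ^+ 2 + 2 * m ^+ 2).
      apply: ler_wpM2l; first exact: ltW.
      by rewrite -subr_ge0 (_ : _ - _ = (gi * (l - th i) + m) ^+ 2) ?sqr_ge0//; ring.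
    apply: (le_trans h1).
    have -> : g (t i) u * (2 * (gi * (l - th i)) ^+ 2 + 2 * m ^+ 2) =
       2 * (gi * (l - th i) ^+ 2) + 2 * (g (t i) u * m ^+ 2).
      by rewrite /gi; field; rewrite gt_eqF.
    have b1 : gi * (l - th i) ^+ 2 <= (1 + T) ^+ 2 * en u.
      apply: (@le_trans _ _ (gi * ((1 + T) ^+ 2 * (1 + l) ^+ 2))); first by rewrite ler_pM2l.
      by rewrite mulrCA ler_pM2l// exprn_gt0// addr_gt0.
    have b2 : g (t i) u * m ^+ 2 <= en u.
      by apply: le_trans e2; rewrite mulr_ile1// ?sqr_ge0 ?(ltW gp).
    by rewrite /C1; set TT := (1 + T) ^+ 2 in b1 *; nra.
  rewrite (le_trans (ler_normB _ _))// normrM (gtr0_norm gi0).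
  have b1 : gi * `|l - th i| <= (1 + T) * en u.
    apply: (@le_trans _ _ (gi * ((1 + T) * (1 + l)))); first by rewrite ler_pM2l.
    by rewrite mulrCA ler_pM2l// addr_gt0.
  have -> : (2 + T) * en u = (1 + T) * en u + en u by ring.
  by rewrite lerD// (le_trans m1).
pose lhs u := g (t i) u * (z u ^+ 2 * Num.min 1 `|w^-1 * z u|).
pose rhs u := C1 * (en u * Num.min 1 (en u / M i)).
have en0 u : 0 <= en u by rewrite mulr_ge0 ?powR_ge0// ltW.
have C10 : 0 < C1 by rewrite /C1 mulr_gt0// addr_gt0// exprn_gt0// addr_gt0.
have men : measurable_fun I01 en.
  by apply: measurable_funM => //; apply: measurable_funTS; exact: measurable_powR.
have ien : integ en by apply: integrableZR => //; exact: integrable_powR.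
have irhs : integ rhs.
  apply: integrableZR => //.
  apply: (@integrable_le _ (measurableTypeR R) R leb _ _ en) => //.
    by apply: measurable_funM => //; apply: measurable_minr => //; exact: measurable_funM.
  move=> u _; rewrite normrM (ger0_norm (en0 u)) ler_piMr// ger0_norm ?ge_min ?lexx//.
  by rewrite le_min ler01 divr_ge0// ltW.
have lr u : 0 < u < 1 -> 0 <= lhs u <= rhs u.
  move=> uI; have [p1 p2] := pt u uI.
  have mn0 : 0 <= Num.min 1 `|w^-1 * z u| by rewrite le_min ler01 normr_ge0.
  have g0 := ltW (g_gt0 (t i) u).
  apply/andP; split; first by apply: mulr_ge0 => //; apply: mulr_ge0 => //; exact: sqr_ge0.
  have -> : lhs u = (g (t i) u * z u ^+ 2) * Num.min 1 `|w^-1 * z u| by rewrite /lhs mulrA.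
  have -> : rhs u = (C1 * en u) * Num.min 1 (en u / M i) by rewrite /rhs mulrA.
  have gz0 : 0 <= g (t i) u * z u ^+ 2 by apply: mulr_ge0 => //; exact: sqr_ge0.
  apply: ler_pM => //.
  rewrite le_min ge_min lexx/= ge_min; apply/orP; right.
  have MV : (M i)^-1 = w^-1 * (2 + T) by rewrite /M -/w invf_div mulrC.
  rewrite normrM gtr0_norm ?invr_gt0// MV.
  have -> : en u * (w^-1 * (2 + T)) = w^-1 * ((2 + T) * en u) by ring.
  by rewrite ler_pM2l ?invr_gt0.
have mz : measurable_fun I01 z.
  apply: (measurableT_comp (f := centered (t i) (th i))).
    by apply: measurable_funB => //; exact: measurable_tail_score.
  exact: (@measurable_tail_quantile _ _ F_cont F_0 F_1 (t i) t1).
have mlhs : measurable_fun I01 lhs.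
  apply: measurable_funM; first exact: (measurable_tail_ratio U_nd K_ni K_ge0 K_rv).
  apply: measurable_funM; first exact: measurable_funX.
  apply: measurable_minr => //; apply: measurableT_comp => //; exact: measurable_funM.
have ilhs : integ lhs.
  apply: (@integrable_le _ (measurableTypeR R) R leb _ _ rhs) => //.
  by move=> u; rewrite /= in_itv/= => /lr/andP[l0 ?]; rewrite ger0_norm.
have il0 : 0 <= I lhs.
  by apply: Rintegral_ge0 => u; rewrite /= in_itv/= => /lr/andP[].
rewrite -/w.
have -> : I (fun u => g (t i) u * ((w^-1 * centered (t i) (th i) (U (t i / u))) ^+ 2 *
    Num.min 1 `|w^-1 * centered (t i) (th i) (U (t i / u))|)) = w ^- 2 * I lhs.
  rewrite -IZ//; apply: eqI => u _; rewrite /lhs -/(z u) exprMn exprVn; ring.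
have -> : (k i)%:R * ((kap (t i))^-1 * (w ^- 2 * I lhs)) =
    (kap (t i))^-1 * (score_var (t i) (th i))^-1 * I lhs.
  have -> : w ^+ 2 = (k i)%:R * score_var (t i) (th i) by rewrite exprMn !sqr_sqrtr// ltW.
  field; rewrite !gt_eqF//.
  by rewrite ltr0n lt0n; apply: contraTneq rk1 => ->; rewrite sqrtr0 ltxx.
rewrite ger0_norm ?mulr_ge0//.
apply: ler_wpM2l => //; rewrite -(IZ C1); last first.
  have : integ (fun u => C1^-1 * rhs u) by exact: integrableZR.
  by apply: eq_integ => u _; rewrite /rhs mulKf// gt_eqF.
apply: le_Rintegral => // u; rewrite /= in_itv/= => /lr/andP[] //.
Unshelve. all: by end_near. Qed.

(** After standardisation, [sqrt k] times the mean of a score tends to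
    [(1 + r) (lam / (1 - tau) - x)] and shifts the argument of the normal distribution function. The
    slack [c i * sqrt k] is there to absorb the weight error. *)
Theorem tail_clt :
  fine (iter_int mu (D (U (t i))) (k i) (fun l =>
    ((\sum_(z <- l) tail_score (U (t i)) (th i) z.1 <= c i * Num.sqrt (k i)%:R)%R%:R : R)%:E))
  / q (U (t i)) ^+ k i @[i --> FJ] -->
  normal_cdf ((c0 + (1 + r) * (x - lam / (1 - tau))) / Num.sqrt score_variance).
Proof.
pose sd i := Num.sqrt (score_var (t i) (th i)).
pose rk i : R := Num.sqrt (k i)%:R.
pose xi i (z : E) := (rk i * sd i)^-1 * centered (t i) (th i) z.1.
pose y i := (c i - rk i * score_mean (t i) (th i)) / sd i.
have csd : sd i @[i --> FJ] --> Num.sqrt score_variance.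
  by apply: continuous_cvg => //; exact: sqrt_continuous.
have sd0 : Num.sqrt score_variance != 0 by rewrite gt_eqF// sqrtr_gt0 score_variance_gt0.
have cy : y i @[i --> FJ] --> (c0 + (1 + r) * (x - lam / (1 - tau))) / Num.sqrt score_variance.
  have /(_ _ _) H := lim_div sd0 (lim_sub hc cvg_sqrt_mean) csd.
  have -> : c0 + (1 + r) * (x - lam / (1 - tau)) = c0 - (1 + r) * (lam * (1 - tau)^-1 - x) by ring.
  exact: H.
have nv : \forall i \near FJ, 0 < score_var (t i) (th i).
  by move/cvgr_gt: cvg_var; apply; exact: score_variance_gt0.
have mD i : measurable (D (U (t i))) by exact: measurable_tail_set.
have muD i : mu (D (U (t i))) = (q (U (t i)))%:E by exact: measure_observed_tail.
have mc i : measurable_fun setT (centered (t i) (th i)).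
  by apply: measurable_funB => //; exact: measurable_tail_score.
have mxi i : measurable_fun setT (xi i).
  by apply: measurable_funM => //; exact: (measurableT_comp (mc i) measurable_fst).
have nq : \forall i \near FJ, 0 < q (U (t i)) by apply: filterE => i; exact: observed_tail_gt0.
have nmom : \forall i \near FJ, [/\ mu.-integrable (D (U (t i))) (EFin \o xi i),
  mu.-integrable (D (U (t i))) (EFin \o (fun z => xi i z ^+ 2)),
  mean mu (D (U (t i))) (q (U (t i))) (xi i) = 0 &
  mean mu (D (U (t i))) (q (U (t i))) (fun z => xi i z ^+ 2) = (k i)%:R^-1].
  apply: filterS3 (near_t score_moments) nv near_rk => i /(_ (th i))[i1 i2 m1 m2] vi ri.
  have E2 z : xi i z ^+ 2 = (rk i * sd i) ^- 2 * centered (t i) (th i) z.1 ^+ 2 by rewrite /xi exprMn exprVn.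
  split.
  - by apply: integrableZR.
  - by under [X in _ \o X]funext do rewrite E2; exact: integrableZR.
  - by rewrite /mean RintegralZl// mulrCA -/(mean _ _ _ _) m1 mulr0.
  - rewrite /mean; under eq_Rintegral do rewrite E2.
    rewrite RintegralZl// mulrCA -/(mean _ _ _ _) m2 exprMn [sd i ^+ 2]sqr_sqrtr ?(ltW vi)//.
    by rewrite [rk i ^+ 2]sqr_sqrtr// invfM mulfVK// gt_eqF.
have nlin : (k i)%:R * mean mu (D (U (t i))) (q (U (t i))) (fun z => xi i z ^+ 2 * Num.min 1 `|xi i z|)
    @[i --> FJ] --> (0 : R).
  apply: lim_eq cvg_score_lindeberg.
  have nt1 := near_t (near_pinfty_gt (1 : R)).
  apply: filterS nt1 => i t1.
  rewrite (@ge0_mean_tail_set (t i) (fun x => ((rk i * sd i)^-1 * centered (t i) (th i) x) ^+ 2 *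
    Num.min 1 `|(rk i * sd i)^-1 * centered (t i) (th i) x|))//.
    have mw : measurable_fun setT (fun x => (rk i * sd i)^-1 * centered (t i) (th i) x).
      exact: measurable_funM.
    apply: measurable_funM; first exact: measurable_funX.
    by apply: measurable_minr => //; exact: measurableT_comp.
  by move=> v; rewrite mulr_ge0 ?sqr_ge0// le_min ler01 normr_ge0.
have := cvg_iter_int_cdf mD muD mxi nq koo nmom nlin cy.
move=> /(_ FF); apply: lim_eq; apply: filterS2 nv near_rk => i vi ri.
have sdi : 0 < sd i by rewrite sqrtr_gt0.
congr (fine _ / _); apply: eq_iter_int => l sl _; congr (_%:R)%:E.
have w0 : 0 < rk i * sd i by rewrite mulr_gt0.
rewrite /xi -mulr_sumr ler_pdivrMl//.
have -> : \sum_(z <- l) centered (t i) (th i) z.1 =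
    \sum_(z <- l) tail_score (U (t i)) (th i) z.1 - (k i)%:R * score_mean (t i) (th i).
  rewrite /centered big_split/=; congr (_ + _).
  by rewrite big_const_seq count_predT sl iter_addr_0 mulr_natl mulNrn.
rewrite lerBlDr; congr (_ <= _).
rewrite -/(rk i); have -> : (k i)%:R = rk i ^+ 2 by rewrite [RHS]sqr_sqrtr.
by rewrite /y -/(rk i); field; rewrite gt_eqF.
Qed.

End along_a_filter.
End tail_sample.

(** * A deterministic bound on the event for one sample *)

Section sample_bound.
Context {R : realType}.
Local Notation E := (R * R)%type.
Variable mY : probability (measurableTypeR R) R.
Local Notation K := (survival (law_cdf mY)).
Variables (F : R -> R) (p : R) (m k : nat) (th s1 sp sm eps dlt : R) (rng : R -> bool) (l : seq E).
Local Notation n := m.+1.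
Local Notation psi := (log_weight s1).
Local Notation rk := (Num.sqrt (k%:R : R)).
Local Notation N := (n%:R * K s1 / (p * rk)).
Local Notation W := (weight_error p F K psi m s1 N l).
Hypothesis p_gt0 : 0 < p.
Hypothesis F01 : forall x, s1 < x -> 0 < F x <= 1.
Hypothesis K_gt0 : forall x, 0 < K x.
Hypothesis s1_gt0 : 0 < s1.
Hypothesis eps_gt0 : 0 < eps.
Hypothesis dlt_gt0 : 0 < dlt.
Hypothesis k_lt : (0 < k < n)%N.
Hypothesis size_l : size l = n.
Hypothesis l_obs : all (fun z => z.1 <= z.2) l.
Hypothesis rng_gt : forall x, rng x -> s1 < x.
Hypothesis rngN : forall x, ~~ rng x -> x <= sp \/ sm <= x.

Let K_ni x y : x <= y -> K y <= K x. Proof. exact: survival_law_ni. Qed.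

Let rk_gt0 : 0 < rk. Proof. by rewrite sqrtr_gt0 ltr0n; case/andP: k_lt. Qed.

Let lam_gt0 x : s1 < x -> 0 < risk p F K m x.
Proof. by move=> /F01/andP[Fx _]; rewrite divr_gt0// mulr_gt0// mulr_gt0. Qed.

Let psi_ge1 x : s1 < x -> 1 <= psi x.
Proof. by move=> sx; rewrite lerDl ln_ge0// ler_pdivlMr// mul1r ltW. Qed.

Let N_ge0 : 0 <= N.
Proof. by rewrite divr_ge0 ?mulr_ge0 ?(ltW p_gt0) ?(ltW (K_gt0 _)) ?(ltW rk_gt0). Qed.

Let lam := risk p F K m.

Let weight_errorE : W = N * inv_risk_error lam psi s1 l + N * inv_risk_sqr psi s1 l +
  N * hazard_error F lam psi s1 l + inv_mean_risk lam psi s1 l.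
Proof.
rewrite /weight_error /inv_risk_error /inv_risk_sqr /hazard_error /inv_mean_risk !mulr_sumr -!big_split/=.
by apply: eq_bigr => z _; rewrite -/lam; ring.
Qed.

Let psi_ge0 x : s1 < x -> 0 <= psi x. Proof. by move=> /psi_ge1; apply: le_trans. Qed.

Let ire_ge0 : 0 <= inv_risk_error lam psi s1 l.
Proof. by apply: sumr_ge0 => z sz; rewrite mulr_ge0// psi_ge0. Qed.

Let irs_ge0 : 0 <= inv_risk_sqr psi s1 l.
Proof. by apply: sumr_ge0 => z sz; rewrite mulr_ge0 ?psi_ge0// invr_ge0 exprn_ge0// ler0n. Qed.

Let imr_ge0 : 0 <= inv_mean_risk lam psi s1 l.
Proof. by apply: sumr_ge0 => z sz; rewrite mulr_ge0 ?psi_ge0// invr_ge0 ltW ?lam_gt0. Qed.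

Let he_ge0 : 0 <= hazard_error F lam psi s1 l.
Proof. by apply: sumr_ge0 => z sz; rewrite mulr_ge0 ?psi_ge0// mulr_ge0// invr_ge0 ltW ?lam_gt0. Qed.

Lemma weight_error_ge0 : 0 <= W.
Proof. by rewrite weight_errorE !addr_ge0// mulr_ge0. Qed.

Let weights_close : N * (\sum_(z <- l | s1 < z.1) psi z.1 *
    `|F_n l z.1 * (1 - step_factor l z.1) - F z.1 / lam z.1|) <= W + W ^+ 2.
Proof.
have H := product_limit_weight_error F01 lam_gt0 psi_ge1 l_obs.
apply: le_trans (ler_wpM2l N_ge0 H) _.
rewrite weight_errorE; move: ire_ge0 irs_ge0 imr_ge0 he_ge0 N_ge0; rewrite -/lam.
set a := inv_risk_error _ _ _ _; set b := inv_risk_sqr _ _ _; set c := inv_mean_risk _ _ _ _.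
set h := hazard_error _ _ _ _ _; set M := N => a0 b0 c0 h0 M0.
have Ma := mulr_ge0 M0 a0; have Mb := mulr_ge0 M0 b0; have Mh := mulr_ge0 M0 h0.
set u := M * a in Ma *; set v := M * b in Mb *; set w := M * h in Mh *.
have -> : M * (b + a * (1 + c) + h) = v + u + w + u * c by rewrite /u /v /w; ring.
have H2 : u * c <= (u + v + w + c) ^+ 2.
  have h1 : u <= u + v + w + c by lra.
  have h2 : c <= u + v + w + c by lra.
  by rewrite expr2; apply: ler_pM.
lra.
Qed.

Definition score_shift : R := (1 + `|th|) * (dlt + dlt ^+ 2).

(** As functions of [a], both [K a] and [ln (z.1 / a)] decrease, so the error at [a] is at most the
    one at the level [s1]: a single variable [W] serves every possible threshold. *)
Let score_close a : s1 < a -> W <= dlt ->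
  `|n%:R * K a / p * (\sum_(z <- l | a < z.1) F_n l z.1 * (1 - step_factor l z.1) * (ln (z.1 / a) - th))
    - \sum_(z <- l | a < z.1) tail_score mY a th z.1| <= score_shift * rk.
Proof.
move=> sa Wd; have Ka := K_gt0 a; have Ks := K_gt0 s1; have a0 : 0 < a by apply: lt_trans sa.
have n0 : 0 < n%:R :> R by [].
have ca : 0 < n%:R * K a / p by rewrite divr_gt0// mulr_gt0.
rewrite mulr_sumr -sumrB.
apply: (@le_trans _ _ (\sum_(z <- l | s1 < z.1) n%:R * K s1 / p * (1 + `|th|) *
   (psi z.1 * `|F_n l z.1 * (1 - step_factor l z.1) - F z.1 / lam z.1|))); last first.
  rewrite -mulr_sumr.
  have W2 : W + W ^+ 2 <= dlt + dlt ^+ 2.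
    by rewrite lerD// ler_sqr ?nnegrE ?(ltW dlt_gt0)// weight_error_ge0.
  have := le_trans weights_close W2; set S := \sum_(z <- l | _) _ => H.
  have -> : n%:R * K s1 / p * (1 + `|th|) * S = (1 + `|th|) * rk * (N * S).
    by field; rewrite !gt_eqF.
  have -> : score_shift * rk = (1 + `|th|) * rk * (dlt + dlt ^+ 2) by rewrite /score_shift; ring.
  by apply: ler_wpM2l => //; rewrite mulr_ge0 ?(ltW rk_gt0)// addr_ge0.
rewrite (le_trans (ler_norm_sum _ _ _))//.
rewrite big_mkcond [leRHS]big_mkcond; apply: ler_sum => z _.
have [az|_] := ltP a z.1; last first.
  case: ifP => // sz; rewrite mulr_ge0//; last by rewrite mulr_ge0// psi_ge0.
  by rewrite mulr_ge0 ?addr_ge0// divr_ge0 ?mulr_ge0 ?(ltW Ks) ?(ltW p_gt0).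
have sz := lt_trans sa az; rewrite sz.
have /andP[Fz _] := F01 sz; have Kz := K_gt0 z.1.
set cz := F_n l z.1 * _.
have -> : n%:R * K a / p * (cz * (ln (z.1 / a) - th)) - tail_score mY a th z.1 =
    n%:R * K a / p * ((cz - F z.1 / lam z.1) * (ln (z.1 / a) - th)).
  by rewrite /tail_score /lam /risk; field; rewrite !gt_eqF.
rewrite normrM (gtr0_norm ca) normrM.
have L0 : 0 <= ln (z.1 / a) by rewrite ln_ge0// ler_pdivlMr// mul1r ltW.
have Lpsi : ln (z.1 / a) <= ln (z.1 / s1).
  have z0 : 0 < z.1 by apply: lt_trans az.
  by rewrite ler_ln ?posrE ?divr_gt0// ler_pM2l// lef_pV2// ltW.
have B1 : `|ln (z.1 / a) - th| <= (1 + `|th|) * psi z.1.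
  rewrite (le_trans (ler_normB _ _))// ger0_norm// /log_weight.
  have l1 : 0 <= ln (z.1 / s1) by apply: le_trans Lpsi.
  have t0 : 0 <= `|th| * ln (z.1 / s1) by rewrite mulr_ge0.
  by set y := ln (z.1 / s1) in Lpsi l1 t0 *; nra.
have B2 : n%:R * K a / p <= n%:R * K s1 / p.
  by rewrite ler_pM2r ?invr_gt0// ler_pM2l// K_ni// ltW.
set dz := `|cz - _|.
have -> : n%:R * K s1 / p * (1 + `|th|) * (psi z.1 * dz) = (n%:R * K s1 / p) * (dz * ((1 + `|th|) * psi z.1)) by ring.
apply: ler_pM => //; first exact: ltW.
  by rewrite mulr_ge0 // normr_ge0.
by rewrite ler_wpM2l // normr_ge0.
Qed.

(** This and the next two are real penalties, each at least 1 on an exceptional event, so that the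
    bound on the indicator can be integrated term by term. [excess_deviation] is Chebyshev's ratio
    for the number of points above [s]. *)
Definition tie_count : R := \sum_(z <- l) (1 < count (fun y => y.1 == z.1) l)%N%:R.
Definition negative_count : R := \sum_(z <- l) (z.1 < 0)%R%:R.
Definition excess_deviation (s c : R) : R :=
  ((- c + (count (fun z => s < z.1) l)%:R) / (eps * k%:R)) ^+ 2.
(** Summing over all the points that have exactly [k] others strictly above them replaces the random
    threshold by a sum to which Mecke's formula applies. *)
Definition threshold_sum (B : R -> seq E -> bool) : R :=
  \sum_(z <- l) (rng z.1 && (count (fun y => z.1 < y.1) l == k))%:R *
    (B z.1 [seq y <- l | z.1 < y.1])%:R.

(** [b] selects the event or its complement, and the sign of the slack enlarges either one: upper
    bounds on both will give the limit. *)
Definition score_event (b : bool) (a : R) (h : seq E) : bool :=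
  b == (\sum_(y <- h) tail_score mY a th y.1 <= ((if b then score_shift else - score_shift) * rk)).

(** If none of the first five terms reaches 1, the sample has no tie and no negative value, its
    weights are close to the deterministic ones and its threshold is in the range; when the event
    holds, the threshold then contributes 1 to the last sum. *)
Lemma sample_indicator_bound (b : bool) :
  ((b == (gamma1_hat l k <= th)%R)%:R : R) <=
  tie_count + negative_count + W / dlt + excess_deviation sp ((1 + eps) * k%:R) +
  excess_deviation sm ((1 - eps) * k%:R) + threshold_sum (score_event b).
Proof.
have ek0 : 0 < eps * k%:R :> R by rewrite mulr_gt0// ltr0n; case/andP: k_lt.
have T0 : 0 <= tie_count by exact: sumr_ge0.
have N0 : 0 <= negative_count by exact: sumr_ge0.
have W0 : 0 <= W / dlt by rewrite divr_ge0 ?weight_error_ge0// ltW.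
have P0 : 0 <= excess_deviation sp ((1 + eps) * k%:R) by rewrite sqr_ge0.
have M0 : 0 <= excess_deviation sm ((1 - eps) * k%:R) by rewrite sqr_ge0.
have S0 : 0 <= threshold_sum (score_event b) by apply: sumr_ge0 => z _; rewrite mulr_ge0.
have le1 (x : bool) : (x%:R : R) <= 1 by case: x.
have sum_ge1 (f : E -> R) z : z \in l -> (forall y, 0 <= f y) -> 1 <= f z ->
    1 <= \sum_(y <- l) f y.
  move=> zl f0 fz; rewrite (big_rem z)//= (le_trans fz)// lerDl; exact: sumr_ge0.
have [lu|lu] := boolP (uniq [seq z.1 | z <- l]); last first.
  have : 1 <= tie_count.
    have /hasP[z zl z1] : has (fun z => (1 < count (fun y => y.1 == z.1) l)%N) l.
      apply: contraNT lu; rewrite -all_predC => /allP H; apply: count_mem_uniq => x.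
      have cE : count_mem x [seq z.1 | z <- l] = count (fun y => y.1 == x) l by rewrite count_map.
      have [xl|xl] := boolP (x \in [seq z.1 | z <- l]); last by apply/count_memPn.
      have /mapP[z zl xz] := xl.
      apply/eqP; rewrite eqn_leq; apply/andP; split.
        by have := H z zl; rewrite /= -leqNgt -xz cE.
      by change (0 < count_mem x [seq z.1 | z <- l])%N; rewrite -has_count has_pred1.
    apply: (@sum_ge1 _ z zl) => //=; by rewrite z1.
  move: (le1 (b == (gamma1_hat l k <= th))) => H1 H2; lra.
have [lneg|] := boolP (all (fun z => 0 <= z.1) l); last first.
  rewrite -has_predC => /hasP[z zl /=]; rewrite -ltNge => z0.
  have : 1 <= negative_count by apply: (@sum_ge1 _ z zl) => //=; rewrite z0.
  move: (le1 (b == (gamma1_hat l k <= th))) => H1 H2; lra.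
have [Wd|Wd] := leP W dlt; last first.
  have : 1 <= W / dlt by rewrite ler_pdivlMr// mul1r ltW.
  move: (le1 (b == (gamma1_hat l k <= th))) => H1 H2; lra.
have ks : (0 < k < size l)%N by rewrite size_l.
have Hmem := order_stat_mem lu ks l_obs lneg; have Hcnt := count_gt_order_stat lu ks l_obs lneg.
have Hle := gamma1_hat_le lu ks l_obs lneg th.
set a := order_stat l (size l - k) in Hmem Hcnt Hle.
have [ra|/rngN[asp|sma]] := boolP (rng a); last 2 first.
- have : 1 <= excess_deviation sp ((1 + eps) * k%:R).
    (* A threshold at or below [sp] leaves at most [k] points above [sp], against the reference
       value [(1 + eps) * k]. *)
    have c : (count (fun z => (sp < z.1)%R) l <= k)%N.
      by rewrite -Hcnt; apply: sub_count => z /=; exact: le_lt_trans.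
    rewrite /excess_deviation -[leRHS]real_normK ?num_real// exprn_ege1//.
    rewrite normrM normfV (gtr0_norm ek0) ler_pdivlMr// mul1r -normrN.
    apply: le_trans (ler_norm _); rewrite -(ler_nat R) in c.
    by move: c; set x := (count _ _)%:R => c; lra.
  move: (le1 (b == (gamma1_hat l k <= th))) => H1 H2; lra.
- have : 1 <= excess_deviation sm ((1 - eps) * k%:R).
    have c : (k <= count (fun z => (sm < z.1)%R) l)%N.
      by rewrite -{1}Hcnt; apply: sub_count => z /=; exact: le_lt_trans.
    rewrite /excess_deviation -[leRHS]real_normK ?num_real// exprn_ege1//.
    rewrite normrM normfV (gtr0_norm ek0) ler_pdivlMr// mul1r.
    apply: le_trans (ler_norm _); rewrite -(ler_nat R) in c.
    by move: c; set x := (count _ _)%:R => c; lra.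
  move: (le1 (b == (gamma1_hat l k <= th))) => H1 H2; lra.
have [bE|bE] := eqVneq b (gamma1_hat l k <= th); last by rewrite !addr_ge0.
have /mapP[z zl az] := Hmem.
suff : 1 <= threshold_sum (score_event b) by move=> H; have := le1 true; lra.
apply: (@sum_ge1 _ z zl) => [y|]; first by rewrite mulr_ge0.
rewrite -az ra Hcnt eqxx mul1r.
suff -> : score_event b a [seq y <- l | a < y.1] by [].
have sa := rng_gt ra; have Ka := K_gt0 a.
have ca : 0 < n%:R * K a / p by rewrite divr_gt0// mulr_gt0.
have := score_close sa Wd; rewrite /score_event big_filter bE Hle.
set S := \sum_(y <- l | a < y.1) _; set w := \sum_(y <- l | a < y.1) _ => H.
have {}H := ler_normlP _ _ H; case: H => H1 H2.
have sh0 : 0 <= score_shift * rk.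
  by rewrite mulr_ge0 ?(ltW rk_gt0)// mulr_ge0 ?addr_ge0// ?exprn_ge0 ?ltW.
have [S0'|S0'] := leP S 0 => /=.
  apply/eqP/esym.
  have : n%:R * K a / p * S <= 0 by rewrite pmulr_rle0.
  by move: H1 H2; set v := _ * S => H1 H2 v0; lra.
apply/eqP/esym/negbTE; rewrite -ltNge.
have : 0 < n%:R * K a / p * S by rewrite mulr_gt0.
by move: H1 H2; set v := _ * S; rewrite mulNr => H1 H2 v0; lra.
Qed.

End sample_bound.

Lemma iter_binop_null (R : realFieldType) (p : R) f m j :
  iter m (binop p 0) f j = p ^+ m * f j.
Proof.
elim: m j => [|m IH] j; first by rewrite expr0 mul1r.
by rewrite iterS {1}/binop IH subr0 mul0r addr0 exprS mulrA.
Qed.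

(** * Uniqueness of the threshold outside ties *)

Section threshold_count.
Context {R : realType}.
Local Notation E := (R * R)%type.
Implicit Types l : seq E.

Lemma tie_countE l : ~~ uniq [seq z.1 | z <- l] -> (1 : R) <= tie_count l.
Proof.
move=> lu; have /hasP[z zl z1] : has (fun z => (1 < count (fun y => y.1 == z.1) l)%N) l.
  apply: contraNT lu; rewrite -all_predC => /allP H; apply: count_mem_uniq => x.
  have cE : count_mem x [seq z.1 | z <- l] = count (fun y => y.1 == x) l by rewrite count_map.
  have [xl|xl] := boolP (x \in [seq z.1 | z <- l]); last by apply/count_memPn.
  have /mapP[z zl xz] := xl.
  apply/eqP; rewrite eqn_leq; apply/andP; split.
    by have := H z zl; rewrite /= -leqNgt -xz cE.
  by change (0 < count_mem x [seq z.1 | z <- l])%N; rewrite -has_count has_pred1.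
rewrite /tie_count (big_rem z)//= z1 lerDl; exact: sumr_ge0.
Qed.

(** Without ties two such points would be strictly ordered, hence have different counts. With ties
    the trivial bound by the size is enough, since [tie_count] has mean 0. *)
Lemma threshold_count_le l k :
  \sum_(z <- l) ((count (fun y => z.1 < y.1) l == k)%:R : R) <= 1 + (size l)%:R * tie_count l.
Proof.
have cE : \sum_(z <- l) ((count (fun y => z.1 < y.1) l == k)%:R : R) =
    (count (fun z => count (fun y => (z.1 < y.1)%R) l == k) l)%:R.
  by rewrite -sum1_count natr_sum [RHS]big_mkcond; apply: eq_bigr => z _; case: eqP.
have T0 : 0 <= tie_count l :> R by exact: sumr_ge0.
have [lu|/tie_countE T1] := boolP (uniq [seq z.1 | z <- l]); last first.
  have : (count (fun z => count (fun y => (z.1 < y.1)%R) l == k) l)%:R <= (size l)%:R :> R.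
    by rewrite ler_nat count_size.
  have : (size l)%:R <= (size l)%:R * tie_count l :> R by rewrite ler_peMr.
  by rewrite cE => H1 H2; lra.
have : (count (fun z => count (fun y => (z.1 < y.1)%R) l == k) l)%:R <= 1 :> R.
  rewrite -[leRHS]/(1%:R) ler_nat -size_filter.
  set s := [seq z <- l | count _ l == k].
  have su : uniq [seq z.1 | z <- s] by rewrite (subseq_uniq _ lu)// map_subseq// filter_subseq.
  have key z z' : z \in s -> z' \in s -> ~~ (z.1 < z'.1).
    rewrite !mem_filter => /andP[/eqP zk zl] /andP[/eqP zk' zl']; apply/negP => zz.
    have : (count (fun y => (z'.1 < y.1)%R) l < count (fun y => (z.1 < y.1)%R) l)%N.
      rewrite -!size_filter; have sub : subseq [seq y <- l | z'.1 < y.1] [seq y <- l | z.1 < y.1].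
        rewrite (_ : [seq y <- l | z'.1 < y.1] = [seq y <- [seq y <- l | z.1 < y.1] | z'.1 < y.1]).
          exact: filter_subseq.
        rewrite -filter_predI; apply: eq_filter => y /=.
        by case: (ltP z'.1 y.1) => //= H; rewrite (lt_trans zz H).
      rewrite ltn_neqAle size_subseq ?andbT//; apply/negP => /eqP se.
      have := size_subseq_leqif sub => -[_ +]; rewrite se eqxx => /esym/eqP e.
      have : z' \in [seq y <- l | z.1 < y.1] by rewrite mem_filter zz.
      by rewrite -e mem_filter ltxx.
    by rewrite zk zk' ltnn.
  case: s su key => [|z [|z' s]] //= /andP[zs _] key.
  move: zs; rewrite inE negb_or => /andP[zz' _].
  have := key z z'; have := key z' z; rewrite !inE !eqxx !orbT => /(_ isT isT) h1 /(_ isT isT) h2.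
  by move: zz'; rewrite eq_le !leNgt h1 h2.
by rewrite cE => H; rewrite (le_trans H)// lerDl mulr_ge0.
Qed.

End threshold_count.

(** * Integrating the bound over the samples of size n *)

Section event_bound.
Context {R : realType}.
Local Notation E := (R * R)%type.
Variables mX mY : probability (measurableTypeR R) R.
Local Notation F := (law_cdf mX).
Local Notation K := (survival (law_cdf mY)).
Local Notation mu := (pair_law mX mY).
Local Notation Obs := [set z : E | z.1 <= z.2].
Local Notation U := (tail_quantile F).
Local Notation I01 := (`](0 : R), 1[%classic).
Local Notation q := (observed_tail mX mY).
Local Notation p := (observed_mass mX mY).
Local Notation D := tail_set.
Hypothesis F_cont : continuous F.
Hypothesis F_lt1 : forall x, F x < 1.
Hypothesis F_0 : forall x, x <= 0 -> F x = 0.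
Hypothesis F_1 : F x @[x --> +oo] --> (1 : R).
Hypothesis G_cont : continuous (law_cdf mY).
Hypothesis K_gt0 : forall x, 0 < K x.

Let p_gt0 : 0 < p. Proof. exact: observed_mass_gt0. Qed.
Let muA : mu Obs = p%:E. Proof. exact: measure_observed. Qed.
Let mA : measurable (Obs : set E). Proof. exact: measurable_observable. Qed.
Let muD x : mu (D x) = (q x)%:E. Proof. exact: measure_observed_tail. Qed.
Let iter1 x k : iter_int mu (D x) k (fun=> 1%E) = (q x ^+ k)%:E.
Proof.
have -> : iter_int mu (D x) k (fun=> 1%E) = (1 * mu (D x) ^+ k)%E.
  by apply: iter_int_cst => //; exact: measurable_tail_set.
by rewrite mul1e muD EFin_expe.
Qed.
Let mb2R : measurable_fun setT (fun c : bool => c%:R : R). Proof. by []. Qed.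
Let m1 : measurable_fun setT (fun z : E => z.1). Proof. exact: measurable_fst. Qed.

Lemma observed_tail_ni x y : x <= y -> q y <= q x.
Proof. by move=> /(@observed_tail_diff _ mX mY)/andP[]; rewrite subr_ge0. Qed.

Let q_le x : 0 <= q x <= p.
Proof.
rewrite observed_tail_ge0/= -lee_fin -muA -measure_observed_tail.
by apply: le_measure; rewrite ?inE//; exact: measurable_observed_tail_set.
Qed.

Lemma iter_int_null_has (b : pred E) m : measurable_fun setT b ->
  mu (Obs `&` [set z | b z]) = 0%E ->
  iter_int mu Obs m (fun l => ((0 < count b l)%N%:R : R)%:E) = 0%E.
Proof.
move=> mb b0.
have pq0 : (0 : R) <= 0 <= p by rewrite lexx ltW.
have f0 (i : nat) : 0 <= (0 < i)%N%:R :> R by [].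
have := @iter_int_count _ _ _ mu Obs p mA muA b 0 m (fun j => (0 < j)%N%:R) 0 mb b0 pq0 f0.
by rewrite iter_binop_null mulr0.
Qed.

Lemma measure_observed_point x : mu (Obs `&` [set z | z.1 == x]) = 0%E.
Proof.
apply/eqP; rewrite eq_le measure_ge0 andbT.
have mx : measurable ([set x] : set R) by [].
have mS : measurable ([set z : E | z.1 == x]).
  rewrite (_ : [set z | _] = fst @^-1` [set x]); last by apply/seteqP; split => z /= /eqP.
  by rewrite -[X in measurable X]setTI; exact: measurable_fst.
apply: (@le_trans _ _ (mu ([set x] `*` setT))).
  apply: le_measure; rewrite ?inE//=; [exact: measurableI|exact: measurableX|].
  by move=> z [_ /= /eqP ->]; split.
rewrite pair_law_rect//; have -> : mX [set x] = 0%E by exact: law_point.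
by rewrite mul0e.
Qed.

Let mties : lmeas (fun (z : E) l => ((1 < count (fun y => y.1 == z.1) (z :: l))%N%:R : R)%:E).
Proof.
move=> k; apply/measurable_EFinP.
apply: (@eq_measurable_fun _ _ _ _ setT (fun st : E * k.-tuple E =>
  ((0 < ((count (fun y => y.1 == st.1.1) st.2)%:R : R))%R%:R : R))).
  by move=> st _ /=; rewrite eqxx add1n ltnS ltr0n.
apply: (measurableT_comp mb2R); apply: measurable_fun_ltr => //.
apply: (@lmeas_count R _ _ _ _ (fun (z y : E) => y.1 == z.1)).
apply: measurable_fun_eqr; first exact: (measurableT_comp m1 measurable_snd).
exact: (measurableT_comp m1 measurable_fst).
Qed.

Let ties_perm (z : E) (l l' : seq E) : perm_eq l l' ->
  ((1 < count (fun y => y.1 == z.1) l)%N%:R : R) = (1 < count (fun y => y.1 == z.1) l')%N%:R.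
Proof. by move=> /permP ->. Qed.

Lemma lmeas_tie_count : lmeas1 (fun l : seq E => (tie_count l)%:E).
Proof. exact: (lmeas1_palm ties_perm mties). Qed.

Lemma iter_int_tie_count m : iter_int mu Obs m (fun l => (tie_count l)%:E) = 0%E.
Proof.
case: m => [|m]; first by rewrite /= /tie_count big_nil.
rewrite (@iter_int_palm _ _ _ mu Obs mA m _ (fun z l => ler0n _ _) ties_perm mties).
rewrite (eq_integral (fun=> 0%E)) ?integral0 ?mule0// => z _.
under eq_iter_int do rewrite /= eqxx add1n ltnS.
apply: iter_int_null_has; last exact: measure_observed_point.
exact: measurable_fun_eqr.
Qed.

Lemma iter_int_negative_count m : iter_int mu Obs m (fun l => (negative_count l)%:E) = 0%E.
Proof.
pose b (z : E) := z.1 < 0.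
have mb : measurable_fun setT b by exact: measurable_fun_ltr.
have b0 : mu (Obs `&` [set z | b z]) = 0%E.
  apply/eqP; rewrite eq_le measure_ge0 andbT -(measure_observed_nonpos mY F_0).
  apply: le_measure; rewrite ?inE//=.
  - by apply: measurableI => //; exact: measurable_set_pred.
  - by apply: measurableI => //; apply: measurable_set_pred; exact: measurable_fun_ler.
  - by move=> z [Az /= /ltW z0].
rewrite (@eq_iter_int _ _ _ mu Obs m _ (fun l => ((0 + count b l)%N%:R : R)%:E)); last first.
  move=> l _ _; rewrite add0n -sum1_count natr_sum [in RHS]big_mkcond /negative_count.
  by congr _%:E; apply: eq_bigr => z _; rewrite /b; case: (z.1 < 0).
rewrite (@iter_int_count _ _ _ mu Obs p mA muA b 0 m (fun j => j%:R) 0 mb b0) ?lexx ?(ltW p_gt0)//.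
by rewrite iter_binop_null mulr0.
Qed.

Lemma lmeas_negative_count : lmeas1 (fun l : seq E => (negative_count l)%:E).
Proof.
move=> k; apply/measurable_EFinP; apply: (lmeas1_rsum (f := fun z : E => (z.1 < 0)%R%:R)).
by apply: (measurableT_comp mb2R); exact: measurable_fun_ltr.
Qed.

Let mcount s : lmeas1 (fun l : seq E => (count (fun z => s < z.1) l)%:R : R).
Proof.
apply: (lmeas_count (S := unit) (b := fun _ (z : E) => s < z.1)).
by apply: measurable_fun_ltr => //; exact: (measurableT_comp m1 measurable_snd).
Qed.

Lemma lmeas_excess_deviation k eps s c : lmeas1 (fun l : seq E => (excess_deviation k eps l s c)%:E).
Proof.
move=> j; apply/measurable_EFinP; apply: measurable_funX; apply: measurable_funM => //.
by apply: measurable_funD => //; exact: mcount.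
Qed.

Lemma iter_int_excess_deviation k eps s c m : (0 < m)%N -> (0 < k)%N -> 0 < eps -> c = m%:R * (q s / p) ->
  (iter_int mu Obs m (fun l => (excess_deviation k eps l s c)%:E) <=
   (p ^+ m * (c / (eps * k%:R) ^+ 2))%:E)%E.
Proof.
move=> m0 k0 e0 cE; have ek0 : 0 < eps * k%:R :> R by rewrite mulr_gt0// ltr0n.
have mb : measurable_fun setT (fun z : E => s < z.1) by exact: measurable_fun_ltr.
rewrite (@iter_int_count _ _ _ mu Obs p mA muA (fun z => s < z.1) (q s) m
  (fun j => ((- c + j%:R) / (eps * k%:R)) ^+ 2) 0 mb (measure_observed_tail mX mY s) (q_le s)); last first.
  by move=> i; rewrite sqr_ge0.
rewrite lee_fin (@eq_iter_binop _ _ _ _ (fun j => (eps * k%:R) ^- 2 * (- c + j%:R) ^+ 2)); last first.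
  by move=> j; rewrite exprMn exprVn mulrC.
rewrite iter_binopZ iter_binop_sqr ?gt_eqF// addr0 cE addNr expr0n add0r.
rewrite mulrCA ler_pM2l ?exprn_gt0// mulrC ler_pM2r ?invr_gt0 ?exprn_gt0//.
have /andP[q0 qp] := q_le s.
have qp0 : 0 <= q s / p by rewrite divr_ge0// ltW.
by apply: ler_piMr; [exact: mulr_ge0|rewrite gerBl].
Qed.

Section range.
Variables (m k : nat) (eps : R).
Local Notation n := m.+1.
Hypotheses (k_gt0 : (0 < k)%N) (k_lt : (k < n)%N) (eps_gt0 : 0 < eps).

(** As [n * q x / p] is the expected number of observations above [x], these are the likely values
    of the threshold. *)
Definition in_range x : bool := `|n%:R * q x / (p * k%:R) - 1| <= eps.

Let k0 : 0 < k%:R :> R. Proof. by rewrite ltr0n. Qed.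
Let n0 : 0 < n%:R :> R. Proof. by []. Qed.

Let mq : measurable_fun setT q.
Proof. by apply: nonincreasing_in_measurable => // x y _ _; exact: observed_tail_ni. Qed.

Lemma measurable_in_range : measurable_fun setT in_range.
Proof.
apply: measurable_fun_ler => //; apply: measurableT_comp => //; apply: measurable_funB => //.
by apply: measurable_funM => //; exact: measurable_funM.
Qed.

(** The factor [1 + 2 * eps] puts [s1] strictly below the range, whose points have a ratio of at
    most [1 + eps]. *)
Lemma in_range_gt s1 x : q s1 = (1 + 2 * eps) * k%:R * p / n%:R -> in_range x -> s1 < x.
Proof.
move=> q1; rewrite /in_range ler_norml => /andP[_]; rewrite lerBlDr => H.
rewrite ltNge; apply/negP => /observed_tail_ni; rewrite q1 => H2.
move: H; rewrite ler_pdivrMr ?mulr_gt0// => H.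
have : n%:R * ((1 + 2 * eps) * k%:R * p / n%:R) <= (eps + 1) * (p * k%:R).
  by apply: le_trans H; rewrite ler_pM2l.
have -> : n%:R * ((1 + 2 * eps) * k%:R * p / n%:R) = (1 + 2 * eps) * (p * k%:R).
  by field; rewrite !gt_eqF.
by rewrite ler_pM2r ?mulr_gt0//; move: eps_gt0; lra.
Qed.

Lemma in_rangeN sp sm x : q sp = (1 + eps) * k%:R * p / n%:R -> q sm = (1 - eps) * k%:R * p / n%:R ->
  ~~ in_range x -> x <= sp \/ sm <= x.
Proof.
move=> qsp qsm; rewrite /in_range -ltNge ltr_normr => /orP[H|H]; [left|right].
  rewrite leNgt; apply/negP => /ltW/observed_tail_ni; rewrite qsp => H2.
  move: H; rewrite ltrBrDr ltr_pdivlMr ?mulr_gt0// => H.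
  have : (eps + 1) * (p * k%:R) < n%:R * ((1 + eps) * k%:R * p / n%:R).
    by apply: lt_le_trans H _; rewrite ler_pM2l.
  have -> : n%:R * ((1 + eps) * k%:R * p / n%:R) = (eps + 1) * (p * k%:R) by field; rewrite !gt_eqF.
  by rewrite ltxx.
rewrite leNgt; apply/negP => /ltW/observed_tail_ni; rewrite qsm => H2.
move: H; rewrite opprB ltrBrDr addrC -ltrBrDr ltr_pdivrMr ?mulr_gt0// => H.
have : n%:R * ((1 - eps) * k%:R * p / n%:R) < (1 - eps) * (p * k%:R).
  by apply: le_lt_trans H; rewrite ler_pM2l.
have -> : n%:R * ((1 - eps) * k%:R * p / n%:R) = (1 - eps) * (p * k%:R) by field; rewrite !gt_eqF.
by rewrite ltxx.
Qed.

Variable B : R -> seq E -> bool.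
Hypothesis mB : lmeas (fun x l => ((B x l)%:R : R)).

Let G (z : E) (l : seq E) : R := (in_range z.1 && (count (fun y => z.1 < y.1) l == k))%:R *
  (B z.1 [seq y <- l | z.1 < y.1])%:R.

Hypothesis B_perm : forall x l l', perm_eq l l' -> B x l = B x l'.

Let G_perm z l l' : perm_eq l l' -> G z l = G z l'.
Proof.
move=> ll'; rewrite /G (permP ll'); congr (_ * _%:R); rewrite (@B_perm _ _ [seq y <- l' | z.1 < y.1])//.
exact: perm_filter.
Qed.

Let G_cons z l : G z (z :: l) = G z l. Proof. by rewrite /G /= ltxx. Qed.

Let mcountx : lmeas (fun (x : R) (l : seq E) => (count (fun y => x < y.1) l)%:R : R).
Proof.
apply: (@lmeas_count R _ _ _ _ (fun (x : R) (y : E) => x < y.1)).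
apply: measurable_fun_ltr; first exact: measurable_fst.
exact: (measurableT_comp m1 measurable_snd).
Qed.

Let mGx : lmeas (fun (x : R) (l : seq E) =>
  ((in_range x && (count (fun y => x < y.1) l == k))%:R *
   (B x [seq y <- l | x < y.1])%:R : R)).
Proof.
move=> j; apply: measurable_funM.
  apply: (measurableT_comp mb2R); apply: measurable_and.
    exact: (measurableT_comp measurable_in_range measurable_fst).
  apply: (@eq_measurable_fun _ _ _ _ setT (fun st : R * j.-tuple E =>
    ((count (fun y => st.1 < y.1) st.2)%:R == k%:R :> R))).
    by move=> st _ /=; rewrite eqr_nat.
  by apply: measurable_fun_eqr => //; exact: mcountx.
apply: (@lmeas_filter _ E _ R _ R (fun x (y : E) => x < y.1) (fun x l => ((B x l)%:R : R))) => //.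
apply: measurable_fun_ltr; first exact: measurable_fst.
exact: (measurableT_comp m1 measurable_snd).
Qed.

Let mG : lmeas (fun z l => (G z (z :: l))%:E).
Proof.
move=> j; apply/measurable_EFinP.
apply: (@eq_measurable_fun _ _ _ _ setT (fun st : E * j.-tuple E => G st.1 st.2)).
  by move=> st _ /=; rewrite G_cons.
exact: (lmeas_param mGx m1).
Qed.

Lemma lmeas_threshold_sum : lmeas1 (fun l : seq E => (threshold_sum k in_range l B)%:E).
Proof. exact: (lmeas1_palm G_perm mG). Qed.

Definition threshold_mean (x : R) : R := (in_range x)%:R *
  fine (iter_int mu Obs m (fun l => ((count (fun y => x < y.1) l == k)%:R *
    (B x [seq y <- l | x < y.1])%:R : R)%:E)).

(** Exactly [k] of the [m] other points fall above [x]: this gives a binomial factor that depends on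
    [x] only, times the law of [k] independent points above [x]. *)
Let thinned x :
  iter_int mu Obs m (fun l => ((count (fun y => x < y.1) l == k)%:R *
    (B x [seq y <- l | x < y.1])%:R : R)%:E) =
  (('C(m, k)%:R * (p - q x) ^+ (m - k))%:E * iter_int mu (D x) k (fun l => ((B x l)%:R : R)%:E))%E.
Proof.
have mb : measurable_fun setT (fun y : E => x < y.1) by exact: measurable_fun_ltr.
have muN : mu (Obs `&` [set y | ~~ (x < y.1)]) = (p - q x)%:E.
  rewrite -measure_observed_le; congr (mu (_ `&` _)); apply/seteqP; split => y /=; by rewrite -leNgt.
have mBx : lmeas1 (fun l => (B x l)%:R : R) by exact: (lmeas_at x mB).
have msz : lmeas1 (fun l : seq E => ((size l == k)%:R : R)).
  move=> j; apply: (@eq_measurable_fun _ _ _ _ setT (fun=> ((j == k)%:R : R))) => //.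
  by move=> st _ /=; rewrite size_tuple.
pose f (l : seq E) := ((size l == k)%:R * (B x l)%:R : R)%:E.
have f0 l : (0 <= f l)%E by rewrite lee_fin mulr_ge0.
have mf : lmeas1 f by move=> j; apply/measurable_EFinP; apply: measurable_funM; [exact: msz|exact: mBx].
rewrite (@eq_iter_int _ _ _ mu Obs m _ (fun l => f [seq y <- l | x < y.1])); last first.
  by move=> l _ _; rewrite /f size_filter.
rewrite (@iter_int_filter _ _ _ mu Obs (fun y => x < y.1) m f (p - q x) mA mb muN f0 mf).
have km : (k < m.+1)%N := k_lt.
rewrite big_mkord (bigD1 (Ordinal km))//= big1 ?adde0; last first.
  move=> j jk; rewrite (@eq_iter_int _ _ _ mu _ j _ (fun=> 0%E)); last first.
    move=> l sl _; rewrite /f sl; have -> : (j == k :> nat) = false.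
      by apply/negbTE; apply: contraNneq jk => e; apply/eqP/val_inj.
    by rewrite mul0r.
  rewrite iter_int_cst ?mul0e ?mule0//.
  by apply: measurableI => //; exact: measurable_set_pred.
congr (_ * _)%E; apply: eq_iter_int => l sl _; by rewrite /f sl eqxx mul1r.
Qed.

Lemma threshold_meanE x : threshold_mean x = (in_range x)%:R *
  ('C(m, k)%:R * (p - q x) ^+ (m - k) * fine (iter_int mu (D x) k (fun l => ((B x l)%:R : R)%:E))).
Proof.
rewrite /threshold_mean thinned; congr (_ * _).
have : iter_int mu (D x) k (fun l => ((B x l)%:R : R)%:E) \is a fin_num.
  have mDx : measurable (D x) by exact: measurable_tail_set.
  have mBx : lmeas1 (fun l => ((B x l)%:R : R)%:E).
    by move=> j; apply/measurable_EFinP; exact: (lmeas_at x mB).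
  rewrite ge0_fin_numE; last by apply: iter_int_ge0 => l; rewrite lee_fin.
  apply: (@le_lt_trans _ _ (iter_int mu (D x) k (fun=> 1%E))).
    apply: le_iter_int => //.
    by move=> l _ _; rewrite lee_fin; case: (B x l).
  by rewrite iter1 ltry.
by case: (iter_int _ _ _ _) => // r _.
Qed.

Lemma threshold_mean_ge0 x : 0 <= threshold_mean x.
Proof.
by rewrite mulr_ge0// fine_ge0//; apply: iter_int_ge0 => l; rewrite lee_fin mulr_ge0.
Qed.

Lemma measurable_threshold_mean : measurable_fun setT threshold_mean.
Proof.
apply: measurable_funM; first by apply: (measurableT_comp mb2R); exact: measurable_in_range.
apply: measurableT_comp; first exact: fine_measurable.
apply: (@measurable_iter_int _ _ _ mu _ R Obs m (fun x l => ((count (fun y => x < y.1) l == k)%:R *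
    (B x [seq y <- l | x < y.1])%:R : R)%:E)) => //.
move=> j; apply/measurable_EFinP; apply: measurable_funM.
  apply: (measurableT_comp mb2R).
  apply: (@eq_measurable_fun _ _ _ _ setT (fun st : R * j.-tuple E =>
    ((count (fun y => st.1 < y.1) st.2)%:R == k%:R :> R))).
    by move=> st _ /=; rewrite eqr_nat.
  by apply: measurable_fun_eqr => //; exact: mcountx.
apply: (@lmeas_filter _ E _ R _ R (fun x (y : E) => x < y.1) (fun x l => ((B x l)%:R : R))) => //.
apply: measurable_fun_ltr; first exact: measurable_fst.
exact: (measurableT_comp m1 measurable_snd).
Qed.

Lemma iter_int_threshold_palm s : (forall x, in_range x -> s < x) ->
  iter_int mu Obs n (fun l => (threshold_sum k in_range l B)%:E) =
  (n%:R%:E * \int[mu]_(z in D s) (threshold_mean z.1)%:E)%E.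
Proof.
move=> sx; have G0 z l : 0 <= G z l by rewrite mulr_ge0.
rewrite (@iter_int_palm _ _ _ mu Obs mA m G G0 G_perm mG); congr (_ * _)%E.
rewrite [RHS]integral_mkcondr; apply: eq_integral => z _; rewrite patchE.
under eq_iter_int do rewrite G_cons.
have -> : (z \in [set z : E | s < z.1]) = (s < z.1) by apply/idP/idP; rewrite inE.
have [sz|zs] := ltP s z.1; last first.
  have nr : in_range z.1 = false by apply/negbTE/negP => /sx; rewrite ltNge zs.
  rewrite (@eq_iter_int _ _ _ mu Obs m _ (fun=> 0%E)) ?iter_int_cst ?mul0e//.
  by move=> l _ _; rewrite /G nr mul0r.
rewrite threshold_meanE.
case rz : (in_range z.1); last first.
  rewrite mul0r (@eq_iter_int _ _ _ mu Obs m _ (fun=> 0%E)) ?iter_int_cst ?mul0e//.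
  by move=> l _ _; rewrite /G rz mul0r.
transitivity (iter_int mu Obs m (fun l => ((count (fun y => z.1 < y.1) l == k)%:R *
    (B z.1 [seq y <- l | z.1 < y.1])%:R : R)%:E)).
  by apply: eq_iter_int => l _ _; rewrite /G rz.
rewrite thinned mul1r [in RHS]EFinM fineK// ge0_fin_numE; last by apply: iter_int_ge0 => l; rewrite lee_fin.
have mDx : measurable (D z.1) by exact: measurable_tail_set.
apply: (@le_lt_trans _ _ (iter_int mu (D z.1) k (fun=> 1%E))).
  apply: le_iter_int => //.
  - by move=> j; apply/measurable_EFinP; exact: (lmeas_at z.1 mB).
  - by move=> l _ _; rewrite lee_fin; case: (B z.1 l).
by rewrite iter1 ltry.
Qed.

End range.

Section threshold_bound.
Variables (m k : nat) (eps t1 Phi : R) (B : R -> seq E -> bool).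
Local Notation n := m.+1.
Local Notation rng := (in_range m k eps).
Hypotheses (k_gt0 : (0 < k)%N) (k_lt : (k < n)%N) (eps_gt0 : 0 < eps).
Hypotheses (t1_gt1 : 1 < t1) (q_s1 : q (U t1) = (1 + 2 * eps) * k%:R * p / n%:R).
Hypothesis mB : lmeas (fun x l => ((B x l)%:R : R)).
Hypothesis B_perm : forall x l l', perm_eq l l' -> B x l = B x l'.
Hypothesis Phi_ge0 : 0 <= Phi.
Hypothesis B_le : forall t, 1 < t -> rng (U t) ->
  fine (iter_int mu (D (U t)) k (fun l => ((B (U t) l)%:R : R)%:E)) <= Phi * q (U t) ^+ k.

Let T (x : R) (l : seq E) := true.
Let mT : lmeas (fun x l => ((T x l)%:R : R)). Proof. by move=> j; exact: measurable_cst. Qed.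
Let T_perm x l l' : perm_eq l l' -> T x l = T x l'. Proof. by []. Qed.

(** The density of the threshold is never computed. The bound [B_le] is uniform over the range, so
    the sum is at most [Phi] times the same sum for the event that always holds, and
    [threshold_count_le] bounds the mean of the latter. *)
Lemma iter_int_threshold_sum :
  (iter_int mu Obs n (fun l => (threshold_sum k rng l B)%:E) <= (Phi * p ^+ n)%:E)%E.
Proof.
have gt x : rng x -> U t1 < x by exact: in_range_gt.
have t0 : 0 < t1 by exact: lt_trans t1_gt1.
have mtmB : measurable_fun setT (threshold_mean m k eps B) by exact: measurable_threshold_mean.
have mtmT : measurable_fun setT (threshold_mean m k eps T) by exact: measurable_threshold_mean.
have B0 x : 0 <= threshold_mean m k eps B x by exact: threshold_mean_ge0.
have T0 x : 0 <= threshold_mean m k eps T x by exact: threshold_mean_ge0.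
have mU := @measurable_tail_quantile _ _ F_cont F_0 F_1 t1 t1_gt1.
have mK : measurable_fun setT K by exact: measurable_survival.
have mg : measurable_fun I01 (tail_ratio U K t1).
  by apply: measurable_funM => //; exact: (measurableT_comp mK mU).
have K0 x : 0 <= K x by exact: ltW.
apply: (@le_trans _ _ (Phi%:E * iter_int mu Obs n (fun l => (threshold_sum k rng l T)%:E))%E).
  have -> : iter_int mu Obs n (fun l => (threshold_sum k rng l B)%:E) =
    (n%:R%:E * \int[mu]_(z in D (U t1)) (threshold_mean m k eps B z.1)%:E)%E.
    by apply: iter_int_threshold_palm.
  have -> : iter_int mu Obs n (fun l => (threshold_sum k rng l T)%:E) =
    (n%:R%:E * \int[mu]_(z in D (U t1)) (threshold_mean m k eps T z.1)%:E)%E.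
    by apply: iter_int_threshold_palm.
  rewrite muleCA; apply: lee_wpmul2l => //.
  rewrite (ge0_integral_tail_set F_cont F_lt1 F_0 F_1 G_cont K_gt0 t1_gt1 mtmB B0).
  rewrite (ge0_integral_tail_set F_cont F_lt1 F_0 F_1 G_cont K_gt0 t1_gt1 mtmT T0).
  rewrite muleCA; apply: lee_wpmul2l; first by rewrite lee_fin mulr_ge0// invr_ge0 ltW.
  rewrite -ge0_integralZl//; last 2 first.
  - by apply/measurable_EFinP; apply: measurable_funM => //; exact: (measurableT_comp mtmT mU).
  - by move=> u _; rewrite lee_fin mulr_ge0// divr_ge0.
  apply: ge0_le_integral => //.
  - by move=> u _; rewrite lee_fin mulr_ge0// divr_ge0.
  - by apply/measurable_EFinP; apply: measurable_funM => //; exact: (measurableT_comp mtmB mU).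
  - apply: measurable_funeM; apply/measurable_EFinP.
    by apply: measurable_funM => //; exact: (measurableT_comp mtmT mU).
  - move=> u /=; rewrite in_itv/= => /andP[u0 u1].
    rewrite -EFinM lee_fin [leRHS]mulrCA; apply: ler_wpM2l; first by rewrite divr_ge0.
    have tu : 1 < t1 / u by rewrite ltr_pdivlMr// mul1r (lt_trans u1).
    have -> : threshold_mean m k eps B (U (t1 / u)) = (rng (U (t1 / u)))%:R *
      ('C(m, k)%:R * (p - q (U (t1 / u))) ^+ (m - k) *
       fine (iter_int mu (D (U (t1 / u))) k (fun l => ((B (U (t1 / u)) l)%:R : R)%:E))).
      by apply: threshold_meanE.
    have -> : threshold_mean m k eps T (U (t1 / u)) = (rng (U (t1 / u)))%:R *
      ('C(m, k)%:R * (p - q (U (t1 / u))) ^+ (m - k) *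
       fine (iter_int mu (D (U (t1 / u))) k (fun l => ((T (U (t1 / u)) l)%:R : R)%:E))).
      by apply: threshold_meanE.
    case rU : (rng (U (t1 / u))); last by rewrite !mul0r mulr0.
    have /andP[q0 qp] := q_le (U (t1 / u)).
    rewrite !mul1r mulrCA; apply: ler_wpM2l; first by rewrite mulr_ge0// exprn_ge0// subr_ge0.
    apply: le_trans (B_le tu rU) _; rewrite le_eqVlt; apply/orP; left; apply/eqP; congr (_ * _).
    by rewrite (_ : iter_int _ _ _ _ = (q (U (t1 / u)) ^+ k)%:E)//; exact: iter1.
have mties' := lmeas_tie_count.
apply: (@le_trans _ _ (Phi%:E * iter_int mu Obs n (fun l => 1%E + (n%:R)%:E * (tie_count l)%:E))%E).
  apply: lee_wpmul2l => //.
  have tc0 (l : seq E) : 0 <= tie_count l by exact: sumr_ge0.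
  apply: le_iter_int => //.
  - by move=> l; rewrite lee_fin; apply: sumr_ge0 => z _; rewrite mulr_ge0.
  - by move=> l; rewrite -EFinM -EFinD lee_fin addr_ge0// mulr_ge0.
  - exact: lmeas_threshold_sum.
  - by move=> j; apply: emeasurable_funD => //; apply: measurable_funeM; exact: mties'.
  - move=> l sl _; rewrite -EFinM -EFinD lee_fin -sl.
    apply: le_trans (threshold_count_le l k).
    apply: ler_sum => z _; rewrite mulr1 ler_nat; by case: (rng z.1).
have tc0 (l : seq E) : (0 <= (tie_count l)%:E)%E by rewrite lee_fin; exact: sumr_ge0.
rewrite iter_intD//; last 2 first.
- by move=> l; rewrite mule_ge0.
- by move=> j; apply: measurable_funeM; exact: mties'.
have -> : iter_int mu Obs n (fun=> 1%E) = (p ^+ n)%:E.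
  have -> : iter_int mu Obs n (fun=> 1%E) = (1 * mu Obs ^+ n)%E by exact: iter_int_cst.
  by rewrite mul1e muA EFin_expe.
by rewrite iter_intZ// iter_int_tie_count mule0 adde0 -EFinM.
Qed.

End threshold_bound.

Section tail_event.
Variables (m k : nat) (th t1 sp sm eps dlt C0 Phi : R) (b : bool).
Local Notation n := m.+1.
Local Notation rng := (in_range m k eps).
Local Notation rk := (Num.sqrt (k%:R : R)).
Hypotheses (k_gt0 : (0 < k)%N) (k_lt : (k < n)%N) (m_gt0 : (0 < m)%N).
Hypotheses (eps_gt0 : 0 < eps) (dlt_gt0 : 0 < dlt).
Hypotheses (t1_ge2 : 2 <= t1) (q_s1 : q (U t1) = (1 + 2 * eps) * k%:R * p / n%:R).
Hypotheses (q_sp : q sp = (1 + eps) * k%:R * p / n%:R) (q_sm : q sm = (1 - eps) * k%:R * p / n%:R).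
Hypothesis envelope : (\int[@lebesgue_measure R]_(u in I01)
  ((tail_ratio U K t1 u)^-1 * (1 + log_excess U t1 u) ^+ 2)%:E <= C0%:E)%E.
Hypothesis Phi_ge0 : 0 <= Phi.
Local Notation ev := (score_event mY k th dlt b).
Hypothesis ev_le : forall t, 1 < t -> rng (U t) ->
  fine (iter_int mu (D (U t)) k (fun l => ((ev (U t) l)%:R : R)%:E)) <= Phi * q (U t) ^+ k.

Let mK : measurable_fun setT K. Proof. exact: measurable_survival. Qed.
Let mF : measurable_fun setT F.
Proof. by apply: continuous_measurable_fun => y; exact: F_cont. Qed.

Let mev : lmeas (fun x l => ((ev x l)%:R : R)).
Proof.
move=> j.
have mS : measurable_fun [set: R * j.-tuple E] (fun st => \sum_(y <- st.2) tail_score mY st.1 th y.1).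
  apply: (@lmeas_rsum _ E R _ R (fun x y => tail_score mY x th y.1)).
  have mx : measurable_fun [set: R * E] (fun sx => sx.1) by exact: measurable_fst.
  have my : measurable_fun [set: R * E] (fun sx => sx.2.1) by exact: (measurableT_comp m1 measurable_snd).
  have mi := measurableT_comp (@measurable_invr R) mx.
  apply: measurable_funM.
    apply: measurable_funM; first exact: (measurableT_comp mK mx).
    exact: (measurableT_comp (measurableT_comp (@measurable_invr R) mK) my).
  apply: measurable_funB => //; apply: (measurableT_comp (@measurable_ln R)).
  exact: measurable_funM.
case: b; rewrite /score_event; last first.
  apply: (@eq_measurable_fun _ _ _ _ setT (fun st : R * j.-tuple E =>
    ((- score_shift th dlt * rk < \sum_(y <- st.2) tail_score mY st.1 th y.1)%R%:R : R))).
    by move=> st _ /=; rewrite ltNge; case: (_ <= _).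
  by apply: (measurableT_comp mb2R); exact: measurable_fun_ltr.
apply: (@eq_measurable_fun _ _ _ _ setT (fun st : R * j.-tuple E =>
    ((\sum_(y <- st.2) tail_score mY st.1 th y.1 <= score_shift th dlt * rk)%R%:R : R))).
  by move=> st _ /=; case: (_ <= _).
by apply: (measurableT_comp mb2R); exact: measurable_fun_ler.
Qed.

Let ev_perm x l l' : perm_eq l l' -> ev x l = ev x l'.
Proof. by move=> ll'; rewrite /score_event (perm_big _ ll'). Qed.

Let W l := weight_error p F K (log_weight (U t1)) m (U t1) (n%:R * K (U t1) / (p * rk)) l.

(** Ties and negative values have mean 0, the weight error is handled by Markov's inequality at
    level [dlt], and the two Chebyshev terms add up to [2 / (eps ^+ 2 * k)]. The function [f] has to
    agree with the indicator only on lists of size [n]. *)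
Theorem iter_int_tail_event (f : seq E -> R) : (forall l, 0 <= f l) -> lmeas1 (fun l => (f l)%:E) ->
  (forall l, size l = n -> f l = (b == (gamma1_hat l k <= th)%R)%:R) ->
  (iter_int mu Obs n (fun l => (f l)%:E) <= (p ^+ n *
   (C0 * (2 * (n%:R * K (U t1) / (p * k%:R * t1)) + 4 * C0 + 16) / Num.sqrt t1 / dlt +
    2 / (eps ^+ 2 * k%:R) + Phi))%:E)%E.
Proof.
move=> f0 mf fE.
have t1_gt1 : 1 < t1 by apply: lt_le_trans t1_ge2; rewrite ltr1n.
have t1_gt0 : 0 < t1 by apply: lt_trans t1_gt1.
have s0 : 0 < U t1 by exact: tail_quantile_gt0.
have k0 : 0 < k%:R :> R by rewrite ltr0n.
have F01 x : U t1 < x -> 0 < F x <= 1.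
  move=> sx; rewrite (ltW (F_lt1 x)) andbT.
  have := survival_tail_quantile F_cont F_0 F_1 t1_gt1; rewrite /survival => H.
  apply: (@lt_le_trans _ _ (F (U t1))); last by apply: law_cdf_nd; exact: ltW.
  have : t1^-1 < 1 by rewrite invf_lt1.
  by lra.
pose bnd (h : seq E -> R) (a : R) := [/\ forall l, 0 <= h l, lmeas1 (fun l => (h l)%:E) &
  (iter_int mu Obs n (fun l => (h l)%:E) <= (p ^+ n * a)%:E)%E].
have bndD g h a c : bnd g a -> bnd h c -> bnd (fun l => g l + h l) (a + c).
  move=> [g0 mg Jg] [h0 mh Jh]; split.
  - by move=> l; rewrite addr_ge0.
  - by move=> j; apply/measurable_EFinP; apply: measurable_funD; apply/measurable_EFinP; [exact: mg|exact: mh].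
  - under eq_iter_int do rewrite EFinD.
    by rewrite iter_intD// mulrDr EFinD leeD.
have bT : bnd (fun l => tie_count l) 0.
  split; [by move=> l; exact: sumr_ge0|exact: lmeas_tie_count|].
  by rewrite iter_int_tie_count mulr0.
have bN : bnd (fun l => negative_count l) 0.
  split; [by move=> l; exact: sumr_ge0|exact: lmeas_negative_count|].
  by rewrite iter_int_negative_count mulr0.
have W0 l : 0 <= W l by apply: weight_error_ge0 => //; rewrite k_gt0.
have mW : lmeas1 (fun l => (W l)%:E).
  by apply: lmeas_weight_error => //; exact: measurable_log_weight.
have bW : bnd (fun l => W l / dlt)
    (C0 * (2 * (n%:R * K (U t1) / (p * k%:R * t1)) + 4 * C0 + 16) / Num.sqrt t1 / dlt).
  split.
  - by move=> l; rewrite divr_ge0// ltW.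
  - by move=> j; apply/measurable_EFinP; apply: measurable_funM => //; apply/measurable_EFinP; exact: mW.
  - under eq_iter_int do rewrite mulrC EFinM.
    rewrite iter_intZ//; last by rewrite lee_fin invr_ge0 ltW.
    set cc := C0 * _ / Num.sqrt t1.
    have -> : p ^+ n * (cc / dlt) = dlt^-1 * (p ^+ n * cc) by ring.
    rewrite [X in (_ <= X)%E]EFinM; apply: lee_wpmul2l; first by rewrite lee_fin invr_ge0 ltW.
    apply: (@weight_error_rate R mu mX F_cont F_lt1 F_0 F_1 p K p_gt0 muA) => //.
    + by move=> g g0 mg; exact: integral_observable_fst.
    + by move=> x; exact: measure_at_risk.
    + by move=> x y; exact: survival_law_ni.
have bQ s c : c = n%:R * (q s / p) -> bnd (fun l => excess_deviation k eps l s c) (c / (eps * k%:R) ^+ 2).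
  move=> cE; split.
  - by move=> l; exact: sqr_ge0.
  - exact: lmeas_excess_deviation.
  - exact: iter_int_excess_deviation.
have nn0 : n%:R != 0 :> R by [].
have pn0 : p != 0 by rewrite gt_eqF.
have canc (x u v : R) : u != 0 -> v != 0 -> x = u * (x * v / u / v).
  by move=> u0 v0; rewrite [_ / u / v]mulrAC mulfK// mulrC divfK.
have bP : bnd (fun l => excess_deviation k eps l sp ((1 + eps) * k%:R)) ((1 + eps) * k%:R / (eps * k%:R) ^+ 2).
  by apply: bQ; rewrite q_sp; exact: canc.
have bM : bnd (fun l => excess_deviation k eps l sm ((1 - eps) * k%:R)) ((1 - eps) * k%:R / (eps * k%:R) ^+ 2).
  by apply: bQ; rewrite q_sm; exact: canc.
have bS : bnd (fun l => threshold_sum k rng l ev) Phi.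
  split.
  - by move=> l; apply: sumr_ge0 => z _; rewrite mulr_ge0.
  - exact: lmeas_threshold_sum.
  - by rewrite mulrC; exact: (iter_int_threshold_sum k_gt0 k_lt eps_gt0 t1_gt1 q_s1 mev ev_perm).
have [tot0 mtot Jtot] := bndD _ _ _ _ (bndD _ _ _ _ (bndD _ _ _ _ (bndD _ _ _ _ (bndD _ _ _ _ bT bN) bW) bP) bM) bS.
apply: (@le_trans _ _ (iter_int mu Obs n (fun l => (tie_count l + negative_count l + W l / dlt +
  excess_deviation k eps l sp ((1 + eps) * k%:R) + excess_deviation k eps l sm ((1 - eps) * k%:R) +
  threshold_sum k rng l ev)%:E))).
  apply: le_iter_int => // l sl lO; rewrite lee_fin (fE l sl).
  apply: sample_indicator_bound => //.
  - by rewrite k_gt0.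
  - by apply/allP => z zl; have := allP lO z zl; rewrite inE.
  - by move=> x; apply: in_range_gt.
  - by move=> x; apply: in_rangeN.
apply: le_trans Jtot _; rewrite lee_fin ler_pM2l ?exprn_gt0// !add0r lerD2r -addrA lerD2l.
rewrite -mulrDl -mulrDl (_ : (1 + eps + (1 - eps)) = 2); last by ring.
rewrite le_eqVlt; apply/orP; left; apply/eqP; field; by rewrite !gt_eqF.
Qed.

End tail_event.

End event_bound.

(** * An event and its complement *)

Section event_probability.
Context d (E : measurableType d) (R : realType) (mu : probability E R).

Lemma iter_int_compl (D : set E) (c : R) n (b : seq E -> bool) :
  measurable D -> mu D = c%:E -> lmeas1 (fun l => (b l)%:R : R) ->
  [/\ iter_int mu D n (fun l => ((b l)%:R : R)%:E) =
        (fine (iter_int mu D n (fun l => ((b l)%:R : R)%:E)))%:E,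
      iter_int mu D n (fun l => ((~~ b l)%:R : R)%:E) =
        (fine (iter_int mu D n (fun l => ((~~ b l)%:R : R)%:E)))%:E &
      fine (iter_int mu D n (fun l => ((~~ b l)%:R : R)%:E)) =
      c ^+ n - fine (iter_int mu D n (fun l => ((b l)%:R : R)%:E))].
Proof.
move=> mD Dc mb.
have mbE : lmeas1 (fun l => ((b l)%:R : R)%:E) by move=> j; apply/measurable_EFinP; exact: mb.
have mnE : lmeas1 (fun l => ((~~ b l)%:R : R)%:E).
  move=> j; apply/measurable_EFinP.
  apply: (@eq_measurable_fun _ _ _ _ setT (fun st : unit * j.-tuple E => 1 - ((b st.2)%:R : R))).
    by move=> st _ /=; case: (b _); rewrite ?subrr ?subr0.
  by apply: measurable_funB => //; exact: mb.
have f0 l : (0 <= ((b l)%:R : R)%:E)%E by rewrite lee_fin.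
have g0 l : (0 <= ((~~ b l)%:R : R)%:E)%E by rewrite lee_fin.
have H : (iter_int mu D n (fun l => ((b l)%:R : R)%:E) +
    iter_int mu D n (fun l => ((~~ b l)%:R : R)%:E) = (c ^+ n)%:E)%E.
  rewrite -iter_intD//; transitivity (iter_int mu D n (fun=> 1%E)).
    by apply: eq_iter_int => l _ _; case: (b l); rewrite -EFinD ?addr0 ?add0r.
  by rewrite iter_int_cst// mul1e EFin_expe -Dc.
have p1 := iter_int_ge0 mu D n f0; have p2 := iter_int_ge0 mu D n g0.
move: H p1 p2; case: (iter_int _ _ _ _) => [a| |]; case: (iter_int _ _ _ _) => [a'| |] //= [<-] _ _.
by split=> //; lra.
Qed.

End event_probability.

(** * The limit along a filter of sample sizes *)

Section limit_along_sizes.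
Context {R : realType}.
Local Notation E := (R * R)%type.
Variables mX mY : probability (measurableTypeR R) R.
Local Notation F := (law_cdf mX).
Local Notation K := (survival (law_cdf mY)).
Local Notation mu := (pair_law mX mY).
Local Notation Obs := [set z : E | z.1 <= z.2].
Local Notation U := (tail_quantile F).
Local Notation I01 := (`](0 : R), 1[%classic).
Local Notation q := (observed_tail mX mY).
Local Notation p := (observed_mass mX mY).
Local Notation Fs := (observed_law_cdf mX mY).
Local Notation D := tail_set.
Hypothesis F_cont : continuous F.
Hypothesis F_lt1 : forall x, F x < 1.
Hypothesis F_0 : forall x, x <= 0 -> F x = 0.
Hypothesis F_1 : F x @[x --> +oo] --> (1 : R).
Hypothesis G_cont : continuous (law_cdf mY).
Hypothesis K_gt0 : forall x, 0 < K x.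
Variables (A : R -> R) (gamma tau alpha : R).
Hypotheses (tau_lt0 : tau < 0) (gamma_gt0 : 0 < gamma) (alpha_gt0 : 0 < alpha).
Hypothesis gamma_alpha : gamma * alpha < 1.
Hypothesis A0 : A t @[t --> +oo] --> (0 : R).
Hypothesis hU : second_order_condition U gamma tau A.
Hypothesis K_rv : regularly_varying K (- alpha).
Local Notation kap := (mean_ratio mX mY).
Local Notation r := (gamma * alpha).

Let U_gt0 t : 1 < t -> 0 < U t. Proof. exact: tail_quantile_gt0. Qed.
Let U_nd s t : 1 < s -> s <= t -> U s <= U t.
Proof. by apply: tail_quantile_nd => //; exact: law_cdf_nd. Qed.
Let Uoo : U t @[t --> +oo] --> +oo.
Proof. by apply: cvg_tail_quantile => //; exact: law_cdf_nd. Qed.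
Let K_ni x y : x <= y -> K y <= K x. Proof. exact: survival_law_ni. Qed.
Let K_ge0 x : 0 <= K x. Proof. exact: ltW. Qed.
Let p_gt0 : 0 < p. Proof. exact: observed_mass_gt0. Qed.
Let q_gt0 x : 0 < q x. Proof. exact: observed_tail_gt0. Qed.

(** Converts a level of the observed law into a level of the untruncated one; it is the argument at
    which the theorem evaluates the auxiliary function. *)
Definition observed_time (y : R) : R := (survival F (tail_quantile Fs y))^-1.
Local Notation otime := observed_time.

Lemma observed_quantile y : 1 < y -> q (tail_quantile Fs y) = p / y.
Proof.
move=> y1; have Fs_cont : continuous Fs by exact: observed_law_cdf_cont.
have Fs_0 x : x <= 0 -> Fs x = 0 by exact: observed_law_cdf_0.
have Fs_1 : Fs x @[x --> +oo] --> (1 : R) by exact: observed_law_cdf_1.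
have := survival_tail_quantile Fs_cont Fs_0 Fs_1 y1.
rewrite /survival /observed_law_cdf subKr => H.
by rewrite -H mulrC divfK// gt_eqF.
Qed.

Let near_one (y d : R) : y <= 1 + d -> 1 - d <= y -> `|1 - y| <= d.
Proof. by move=> h1 h2; rewrite ler_norml; apply/andP; split; lra. Qed.

Let eq_of_diff (a b x y : R) : x = y -> 0 <= a - b <= y - x -> a = b.
Proof. by move=> ->; rewrite subrr -eq_le eq_sym subr_eq0 => /eqP. Qed.

(** Where [F] is flat, [U (otime y)] may lie below the observed quantile; the observed tail is the
    same at both, its increments being bounded by those of [F]. *)
Lemma observed_timeK y : 1 < y -> 1 < otime y /\ q (U (otime y)) = p / y.
Proof.
move=> y1; set w := tail_quantile Fs y; have y0 : 0 < y by apply: lt_trans y1.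
have qw : q w = p / y by exact: observed_quantile.
have Fw : 0 < F w.
  rewrite ltNge; apply/negP => Fw0.
  have w0 : F w = 0.
    by apply/eqP; rewrite eq_le Fw0/=; apply: F_ge0 => //; exact: law_cdf_nd.
  have : q w = p.
    have [w1|w1] := leP w 0; first exact: observed_tail_nonpos.
    have F00 : F 0 = F w by rewrite w0 F_0.
    rewrite -(eq_of_diff F00 (observed_tail_diff mX mY (ltW w1))).
    exact: observed_tail_nonpos.
  rewrite qw => /eqP; rewrite eq_sym -[X in X == _]mulr1 (inj_eq (mulfI (lt0r_neq0 p_gt0))).
  by rewrite eq_sym invr_eq1 => /eqP yE; rewrite yE ltxx in y1.
have tE : otime y = tail_time mX w by rewrite /otime /survival /tail_time.
have [Uw FU] := tail_timeK F_cont F_lt1 F_0 F_1 Fw.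
rewrite tE; split; first exact: tail_time_gt1.
by rewrite (eq_of_diff FU (observed_tail_diff mX mY Uw)).
Qed.

Lemma cvg_observed_time : otime y @[y --> +oo] --> +oo.
Proof.
apply/cvgryPgt => M; pose T := Num.max M 2.
have T1 : 1 < T by rewrite lt_max ltr1n orbT.
near=> y; have y1 : 1 < y by near: y; exact: near_pinfty_gt.
have [ot1 qo] := observed_timeK y1.
rewrite ltNge; apply/negP => oM.
have oT : otime y <= T by rewrite le_max oM.
have := observed_tail_ni mX mY (U_nd ot1 oT); rewrite qo leNgt => /negP; apply.
rewrite ltr_pdivrMr ?(lt_trans _ y1)// -ltr_pdivrMl//.
by near: y; exact: near_pinfty_gt.
Unshelve. all: by end_near. Qed.

Let cvg_kap : kap t @[t --> +oo] --> (1 + r)^-1.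
Proof. exact: (@cvg_mean_ratio _ U A K gamma tau alpha). Qed.

(** As [kap] converges and [K] is nonincreasing, multiplying the level by [c] multiplies the
    observed tail by little more than [c^-1] at most. This lets close tails imply close levels. *)
Lemma observed_tail_drop c : 1 < c -> exists rho, 0 < rho < 1 /\
  \forall t \near +oo, q (U (c * t)) <= rho * q (U t).
Proof.
move=> c1; have c0 : 0 < c by apply: lt_trans c1.
have r0 : 0 < 1 + r by rewrite addr_gt0// mulr_gt0.
have kn : (1 + r)^-1 != 0 by rewrite gt_eqF// invr_gt0.
have kc : kap (c * t) @[t --> +oo] --> (1 + r)^-1.
  have H : c * t @[t --> +oo] --> +oo.
    by under eq_fun do rewrite mulrC; exact: cvg_mulr_pinfty.
  exact: cvg_comp H cvg_kap.
have /(_ _) H := lim_div kn kc cvg_kap.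
have /(_ _ _) H2 := lim_scale c^-1 H.
rewrite divff// mulr1 in H2.
pose rho := (c^-1 + 1) / 2.
have ci : 0 < c^-1 < 1 by rewrite invr_gt0 c0 invf_lt1.
have cr : c^-1 < rho by move: ci => /andP[_]; rewrite /rho; lra.
exists rho; split; first by move: ci => /andP[]; rewrite /rho; lra.
have near1 : \forall t \near +oo, c^-1 * (kap (c * t) / kap t) < rho by move/cvgr_lt: H2; exact.
near=> t; have t1 : 1 < t by near: t; exact: near_pinfty_gt.
have t0 : 0 < t by apply: lt_trans t1.
have ct1 : 1 < c * t by rewrite (lt_trans t1)// ltr_pMl.
have idc (x v w z : R) : x != 0 -> v != 0 ->
    (c * x)^-1 * w * z = (c^-1 * (z / v)) * (x^-1 * w * v).
  by move=> x0 v0; field; rewrite x0 v0 gt_eqF.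
have HE := observed_tail_mean_ratio F_cont F_lt1 F_0 F_1 G_cont K_gt0.
have k0 s : 1 < s -> 0 < kap s.
  move=> s1; have := q_gt0 (U s); rewrite HE// pmulr_rgt0//.
  by rewrite mulr_gt0// invr_gt0 (lt_trans _ s1).
have kt := k0 t t1; have kct := k0 _ ct1.
rewrite (HE _ ct1) (HE _ t1).
have B : c^-1 * (kap (c * t) / kap t) < rho by near: t; exact: near1.
have KU : K (U (c * t)) <= K (U t) by apply: K_ni; apply: U_nd => //; rewrite ler_peMl ?ltW.
apply: (@le_trans _ _ ((c * t)^-1 * K (U t) * kap (c * t))).
  by rewrite ler_pM2r// ler_pM2l// invr_gt0 mulr_gt0.
rewrite (idc t (kap t) (K (U t)) (kap (c * t)) (lt0r_neq0 t0) (lt0r_neq0 kt)).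
have ti0 : 0 < t^-1 by rewrite invr_gt0.
have pos := mulr_gt0 (mulr_gt0 ti0 (K_gt0 (U t))) kt.
exact: ler_wpM2r (ltW pos) _ _ (ltW B).
Unshelve. all: by end_near. Qed.

Section sizes.
Context (FN : set_system nat) {FF : ProperFilter FN}.
Variable k : nat -> nat.
Hypothesis k_lt : forall n, (2 < n)%N -> (1 < k n < n)%N.
Hypothesis koo : forall m, \forall n \near FN, (m < k n)%N.
Hypothesis kn0 : (k n)%:R / n%:R @[n --> FN] --> (0 : R).

Lemma sizes_pinfty : \forall n \near FN, (2 < n)%N.
Proof.
(* A size of at most 2 would make [k n] one of three fixed values. *)
apply: filterS (koo (k 0 + (k 1 + k 2))) => n H; rewrite ltnNge; apply/negP.
by case: n H => [|[|[|n]]] //; lia.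
Qed.

Let near_k : \forall n \near FN, (1 < k n < n)%N.
Proof. by apply: filterS sizes_pinfty => n /k_lt. Qed.

Let sizes_gt0 n : (1 < k n < n)%N -> 0 < n%:R :> R /\ 0 < (k n)%:R :> R.
Proof.
by move=> /andP[k1 kn]; rewrite !ltr0n (ltn_trans (ltn_trans (ltn0Sn 0) k1) kn) (ltn_trans (ltn0Sn 0) k1).
Qed.

Lemma cvg_size_ratio (c : R) : 0 < c -> n%:R / (c * (k n)%:R) @[n --> FN] --> (+oo : set_system R).
Proof.
move=> c0; apply/cvgryPgt => M.
pose e := (c * (`|M| + 1))^-1.
have m0 : 0 < `|M| + 1 by rewrite ltr_wpDl.
have e0 : 0 < e by rewrite invr_gt0 mulr_gt0.
have /cvgr0Pnorm_lt/(_ _ e0) := kn0; apply: filterS2 near_k => n /sizes_gt0[n0 k0].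
rewrite gtr0_norm ?divr_gt0// => H.
rewrite (le_lt_trans (ler_norm M))// (@lt_trans _ _ (`|M| + 1)) ?ltrDl//.
rewrite ltr_pdivlMr ?mulr_gt0//.
move: H; rewrite ltr_pdivrMr// /e mulrC ltr_pdivlMr ?mulr_gt0//.
by congr (_ < _); ring.
Qed.

Definition size_time n : R := otime (n%:R / (k n)%:R).

Lemma cvg_time_scaled (c : R) : 0 < c -> otime (n%:R / (c * (k n)%:R)) @[n --> FN] --> +oo.
Proof. by move=> c0; exact: cvg_comp (cvg_size_ratio c0) cvg_observed_time. Qed.

Lemma cvg_size_time : size_time n @[n --> FN] --> +oo.
Proof.
have := @cvg_time_scaled 1 ltr01; rewrite (_ : (fun n => _) = size_time)//.
by apply/funext => n; rewrite mul1r.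
Qed.

Lemma near_time_scaled (c : R) : 0 < c -> \forall n \near FN,
  1 < n%:R / (c * (k n)%:R) /\ q (U (otime (n%:R / (c * (k n)%:R)))) = c * (k n)%:R * p / n%:R.
Proof.
move=> c0; have /cvgryPgt/(_ 1) := cvg_size_ratio c0.
apply: filterS => n H; split => //; have [_ ->] := observed_timeK H.
by rewrite invf_div mulrC mulrAC.
Qed.

(** A limit along this filter is a limit in the size, uniform over the levels whose quantile is a
    likely threshold, for ranges that are narrow enough. The bound on [e] keeps [1 - e] positive and
    the constants of the weight error under control. *)
Definition size_pairs : set_system (nat * R) := [set S | exists V, FN V /\ exists e : R,
  [/\ 0 < e, e <= 4^-1 & forall n t, V n -> 1 < t -> in_range mX mY n.-1 (k n) e (U t) -> S (n, t)]].

Let near_n : \forall n \near FN, (0 < n)%N /\ n.-1.+1 = n.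
Proof. by apply: filterS sizes_pinfty => n; lia. Qed.

Let near_Q : \forall n \near FN, [/\ (1 < k n < n)%N, n.-1.+1 = n, 1 < size_time n &
  q (U (size_time n)) = (k n)%:R * p / n%:R].
Proof.
have ratio : n%:R / (k n)%:R @[n --> FN] --> (+oo : set_system R).
  have := @cvg_size_ratio 1 ltr01; rewrite (_ : (fun n => _) = fun n => n%:R / (k n)%:R)//.
  by apply/funext => n; rewrite mul1r.
have /cvgryPgt/(_ 1) := ratio; apply: filterS3 near_k near_n => n kn [_ nE] y1.
have [t1 qo] := observed_timeK y1; split => //.
by rewrite [LHS]qo invf_div mulrC mulrAC.
Qed.

Lemma size_pairs_filter : ProperFilter size_pairs.
Proof.
split; last split.
- move=> [V [FV [e [e0 _ H]]]].
  have [n [Vn [k1 nE t1 qo]]] := filter_ex (filterI FV near_Q).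
  (* The level [size_time n] is in every range: the expected number of observations above its
     quantile is exactly [k n]. *)
  apply: (H n (size_time n) Vn t1); rewrite /in_range nE qo.
  have [/lt0r_neq0 n0 /lt0r_neq0 k0] := sizes_gt0 k1.
  have pn : p != 0 by rewrite gt_eqF.
  have -> : n%:R * ((k n)%:R * p / n%:R) / (p * (k n)%:R) = 1.
    by field; rewrite ?n0 ?k0 ?pn.
  by rewrite subrr normr0 ltW.
- exists setT; split; first exact: filterT.
  by exists 4^-1; split => //; rewrite invr_gt0.
- move=> S S' [V [FV [e [e0 e4 H]]]] [V' [FV' [e' [e0' e4' H']]]].
  exists (V `&` V'); split; first exact: filterI.
  exists (Num.min e e'); split; [by rewrite lt_min e0|by rewrite ge_min e4|].
  move=> n t [Vn Vn'] t1; rewrite /in_range le_min => /andP[h h'].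
  by split; [exact: H|exact: H'].
- move=> S S' SS' [V [FV [e [e0 e4 H]]]]; exists V; split => //.
  by exists e; split => // n t Vn t1 h; apply: SS'; exact: H.
Qed.

#[local] Existing Instance size_pairs_filter.

Lemma size_pairs_lift (S : nat -> Prop) : (\forall n \near FN, S n) ->
  \forall i \near size_pairs, S i.1.
Proof.
move=> FS; exists [set n | S n]; split => //; exists 4^-1; split => //.
Qed.

Lemma size_pairs_range (e : R) : 0 < e -> \forall i \near size_pairs, 1 < i.2 /\
  in_range mX mY i.1.-1 (k i.1) e (U i.2).
Proof.
move=> e0; exists setT; split; first exact: filterT.
exists (Num.min e 4^-1); split; [by rewrite lt_min e0/= invr_gt0|by rewrite ge_min lexx orbT|].
by move=> n t _ t1; rewrite /in_range le_min => /andP[].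
Qed.

Let range_bounds n e x : (1 < k n < n)%N -> n.-1.+1 = n -> in_range mX mY n.-1 (k n) e x ->
  (1 - e) * ((k n)%:R * p / n%:R) <= q x <= (1 + e) * ((k n)%:R * p / n%:R).
Proof.
move=> kn nE; rewrite /in_range nE.
have [n0 k0] := sizes_gt0 kn.
set X := n%:R * q x / (p * (k n)%:R).
have -> : q x = X * ((k n)%:R * p / n%:R) by rewrite /X; field; rewrite !gt_eqF.
have c0 : 0 < (k n)%:R * p / n%:R by rewrite divr_gt0// mulr_gt0.
by rewrite ler_norml !(ler_pM2r c0) => /andP[h1 h2]; apply/andP; split; lra.
Qed.

Lemma size_pairs_pinfty M : \forall i \near size_pairs, M < i.2.
Proof.
pose T := Num.max M 2.
have T1 : 1 < T by rewrite lt_max ltr1n orbT.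
have c0 : 0 < q (U T) / (2 * p) by rewrite divr_gt0// mulr_gt0.
have /cvgr0Pnorm_lt/(_ _ c0)/size_pairs_lift small := kn0.
have nQ := size_pairs_lift near_Q.
apply: filterS3 small nQ (size_pairs_range ltr01) => -[n t] /= sm [kn nE _ _] [t1 rg].
have [n0 k0] := sizes_gt0 kn.
rewrite ltNge; apply/negP => tM.
have tT : t <= T by rewrite le_max tM.
have := observed_tail_ni mX mY (U_nd t1 tT).
have /andP[_ H] := range_bounds kn nE rg.
move: sm; rewrite gtr0_norm ?divr_gt0// ltr_pdivlMr ?mulr_gt0// => sm.
have : (1 + 1) * ((k n)%:R * p / n%:R) = (k n)%:R / n%:R * (2 * p) by ring.
by move=> E1 h; rewrite E1 in H; have := le_lt_trans (le_trans h H) sm; rewrite ltxx.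
Qed.

(** If one level exceeded the other by more than the factor [1 + d], their tails would differ by the
    factor [rho], which the range excludes for [e = (1 - rho) / 2]. *)
Lemma size_pairs_ratio : i.2 / size_time i.1 @[i --> size_pairs] --> (1 : R).
Proof.
apply/cvgrPdist_le => d d0; pose c := 1 + d.
have c1 : 1 < c by rewrite ltrDl.
have c0 : 0 < c by apply: lt_trans c1.
have [rho [/andP[rho0 rho1] [M [_ drop]]]] := observed_tail_drop c1.
pose e := (1 - rho) / 2.
have e0 : 0 < e by rewrite divr_gt0// subr_gt0.
have rg := size_pairs_range e0; have nQ := size_pairs_lift near_Q.
have tn0 : \forall n \near FN, M < size_time n by have /cvgryPgt/(_ M) := cvg_size_time.
have tn := size_pairs_lift tn0.
have erho : rho < 1 - e by rewrite /e; lra.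
have erho2 : rho * (1 + e) < 1 by rewrite /e; nra.
apply: filterS3 (filterI rg nQ) tn (size_pairs_pinfty M) => -[n t] /= [[t1 rgt] [kn nE s1 qs]] sM tM.
have /andP[lo hi] := range_bounds kn nE rgt.
rewrite -qs in lo hi; set s := size_time n in s1 sM qs lo hi *.
have s0 : 0 < s by apply: lt_trans s1.
have t0 : 0 < t by apply: lt_trans t1.
have qs0 := q_gt0 (U s).
have up : t <= c * s.
  rewrite leNgt; apply/negP => H.
  have cs1 : 1 < c * s by rewrite (lt_trans s1)// ltr_pMl.
  have h1 := observed_tail_ni mX mY (U_nd cs1 (ltW H)); have h2 := drop s sM.
  have := le_trans lo (le_trans h1 h2).
  by rewrite (ler_pM2r qs0) leNgt erho.
have dn : s <= c * t.
  rewrite leNgt; apply/negP => H.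
  have ct1 : 1 < c * t by rewrite (lt_trans t1)// ltr_pMl.
  have h1 := observed_tail_ni mX mY (U_nd ct1 (ltW H)); have h2 := drop t tM.
  have := le_trans h1 (le_trans h2 (ler_wpM2l (ltW rho0) hi)).
  by rewrite mulrA -[leLHS]mul1r (ler_pM2r qs0) leNgt erho2.
apply: near_one; first by rewrite ler_pdivrMr.
rewrite ler_pdivlMr//.
have : (1 - d) * s <= (1 - d) * (c * t) \/ 1 - d <= 0.
  by have [h|h] := leP (1 - d) 0; [right|left; rewrite ler_pM2l].
have dt : (1 - d) * (c * t) <= t.
  have -> : (1 - d) * (c * t) = t - d ^+ 2 * t by rewrite /c; ring.
  by rewrite gerBl mulr_ge0 ?sqr_ge0 ?(ltW t0).
by case=> h; [exact: le_trans h dt|rewrite (le_trans _ (ltW t0))// mulr_le0_ge0// ltW].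
Qed.

Lemma envelope_integral : exists C0, 0 <= C0 /\ \forall t \near +oo,
  (\int[@lebesgue_measure R]_(u in I01)
    ((tail_ratio U K t u)^-1 * (1 + log_excess U t u) ^+ 2)%:E <= C0%:E)%E.
Proof.
have [C [b [C0 b0 env]]] := weight_envelope tau_lt0 gamma_gt0 alpha_gt0 gamma_alpha U_gt0 U_nd Uoo A0 hU K_ni K_ge0 K_rv.
have ib := integrable_powR b0.
exists (C * b^-1); split; first by rewrite mulr_ge0 ?invr_ge0 ?ltW.
apply: filterS env => t [t1 H].
have mK : measurable_fun setT K by exact: measurable_survival.
have mU := @measurable_tail_quantile _ _ F_cont F_0 F_1 t t1.
apply: (@le_trans _ _ (\int[leb]_(u in I01) (C%:E * (u `^ (b - 1))%:E))%E).
  apply: ge0_le_integral => //.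
  - by move=> u _; rewrite lee_fin mulr_ge0 ?sqr_ge0// invr_ge0 divr_ge0.
  - apply/measurable_EFinP; apply: measurable_funM.
      apply: (measurableT_comp (@measurable_invr R)); apply: measurable_funM => //.
      exact: (measurableT_comp mK mU).
    by apply: measurable_funX; apply: measurable_funD => //; exact: measurable_log_excess.
  - apply: measurable_funeM; apply/measurable_EFinP; apply: measurable_funTS; exact: measurable_powR.
rewrite ge0_integralZl//; last 3 first.
- by apply/measurable_EFinP; apply: measurable_funTS; exact: measurable_powR.
- by move=> u _; rewrite lee_fin powR_ge0.
- by rewrite lee_fin ltW.
rewrite EFinM; apply: lee_wpmul2l; first by rewrite lee_fin ltW.
rewrite -(Rintegral_powR b0) /Rintegral fineK//.
by apply: integrable_fin_num.
Qed.

Local Notation v := (score_variance gamma alpha).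
Variables (x lam : R).
Hypothesis hlam : Num.sqrt (k n)%:R * A (size_time n) @[n --> FN] --> lam.
Let th n : R := gamma + x / Num.sqrt (k n)%:R.
Let L e : R := normal_cdf ((e + (1 + r) * (x - lam / (1 - tau))) / Num.sqrt v).

Let v_gt0 : 0 < Num.sqrt v. Proof. by rewrite sqrtr_gt0 score_variance_gt0. Qed.

Let L_lip e : 0 <= e -> L e <= L 0 + e / Num.sqrt v /\ L 0 - e / Num.sqrt v <= L (- e).
Proof.
move=> e0; set y := (1 + r) * (x - lam / (1 - tau)).
have h1 : (0 + y) / Num.sqrt v <= (e + y) / Num.sqrt v by rewrite ler_pM2r ?invr_gt0// lerD2r.
have h2 : (- e + y) / Num.sqrt v <= (0 + y) / Num.sqrt v by rewrite ler_pM2r ?invr_gt0// lerD2r oppr_le0.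
have /andP[_ n1] := normal_cdf_lipschitz h1; have /andP[_ n2] := normal_cdf_lipschitz h2.
move: n1 n2; rewrite -/y -/(L e) -/(L 0) -/(L (- e)) !mulrDl => n1 n2.
by split; lra.
Qed.

Let near_sqrt : \forall n \near FN, 0 < Num.sqrt ((k n)%:R : R).
Proof. by apply: filterS (koo 0) => n kn; rewrite sqrtr_gt0 ltr0n. Qed.

Let hth : Num.sqrt (k n)%:R * (th n - gamma) @[n --> FN] --> x.
Proof.
apply: lim_eq (cvg_cst x); apply: filterS near_sqrt => n sn.
by rewrite /th addrC addKr mulrC divfK// gt_eqF.
Qed.

Let cvg_th : th n @[n --> FN] --> gamma.
Proof.
have s0 : (Num.sqrt ((k n)%:R : R))^-1 @[n --> FN] --> (0 : R).
  have sp : Num.sqrt ((k n)%:R : R) @[n --> FN] --> +oo by apply: sqrt_pinfty; exact: koo.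
  apply/cvgr0Pnorm_le => e e0; move/cvgryPgt: sp => /(_ e^-1).
  apply: filterS => n Hn; have e1 : 0 < e^-1 by rewrite invr_gt0.
  have rk := lt_trans e1 Hn.
  by rewrite normfV gtr0_norm// invf_ple ?posrE// ltW.
have /(_ _ _) H := lim_add (cvg_cst gamma) (lim_scale x s0).
by rewrite mulr0 addr0 in H; exact: H.
Qed.

Let lift_cvg (f : nat -> R) (l : R) : f n @[n --> FN] --> l -> f i.1 @[i --> size_pairs] --> l.
Proof.
move=> /cvgrPdist_le H; apply/cvgrPdist_le => e e0.
exact: (size_pairs_lift (H e e0)).
Qed.

(** [tail_clt] along [size_pairs]. The assumption on [sqrt k] times [A] is known at [size_time n]
    only; [auxiliary_continuity] moves it to the other levels of the range. *)
Let clt (sgn dlt : R) :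
  fine (iter_int mu (D (U i.2)) (k i.1) (fun l =>
    ((\sum_(z <- l) tail_score mY (U i.2) (th i.1) z.1 <= (sgn * score_shift (th i.1) dlt) * Num.sqrt (k i.1)%:R)%R%:R : R)%:E))
  / q (U i.2) ^+ k i.1 @[i --> size_pairs] --> L (sgn * score_shift gamma dlt).
Proof.
have too : i.2 @[i --> size_pairs] --> +oo.
  by apply/cvgryPgt => M; exact: size_pairs_pinfty.
have koo' m : \forall i \near size_pairs, (m < k i.1)%N by exact: (size_pairs_lift (koo m)).
have hth' := lift_cvg hth.
have sh n : score_shift (th n) dlt = (1 + `|th n|) * (dlt + dlt ^+ 2) by [].
have hc0 : sgn * score_shift (th n) dlt @[n --> FN] --> sgn * score_shift gamma dlt.
  have H1 : 1 + `|th n| @[n --> FN] --> 1 + `|gamma| by apply: lim_add; [exact: cvg_cst|exact: lim_abs].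
  have H : sgn * ((1 + `|th n|) * (dlt + dlt ^+ 2)) @[n --> FN] --> sgn * ((1 + `|gamma|) * (dlt + dlt ^+ 2)).
    by apply: lim_scale; apply: lim_mul => //; exact: cvg_cst.
  exact: H.
have hc : sgn * score_shift (th i.1) dlt @[i --> size_pairs] --> sgn * score_shift gamma dlt := lift_cvg hc0.
have tn : size_time i.1 @[i --> size_pairs] --> +oo.
  apply/cvgryPgt => M; have tn0 : \forall n \near FN, M < size_time n by have /cvgryPgt/(_ M) := cvg_size_time.
  exact: (size_pairs_lift tn0).
have /(_ _) AA := auxiliary_continuity tau_lt0 U_gt0 U_nd A0 hU tn size_pairs_ratio.
have hl : Num.sqrt (k i.1)%:R * A i.2 @[i --> size_pairs] --> lam.
  have hlam' := lift_cvg hlam.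
  have /(_ _) H := lim_mul hlam' AA; rewrite mulr1 in H.
  apply: lim_eq H; have An : \forall i \near size_pairs, A (size_time i.1) != 0 := tn _ (auxiliary_neq0 tau_lt0 hU).
  by apply: filterS An => i /= Ai; rewrite -mulrA [A (size_time _) * _]mulrC divfK.
exact: (@tail_clt R mX mY F_cont F_lt1 F_0 F_1 G_cont K_gt0 A gamma tau alpha tau_lt0 gamma_gt0
  alpha_gt0 gamma_alpha A0 hU K_rv _ size_pairs _ snd (fun i => k i.1) (fun i => th i.1)
  (fun i => sgn * score_shift (th i.1) dlt) x lam _ too koo' hth' hl hc).
Qed.

Let mevent s u c : lmeas1 (fun l : seq E => ((\sum_(z <- l) tail_score mY s u z.1 <= c)%R%:R : R)).
Proof.
have mt : measurable_fun setT (tail_score mY s u) by exact: measurable_tail_score.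
have mb2R : measurable_fun setT (fun c : bool => c%:R : R) by [].
move=> j; have mS : measurable_fun [set: unit * j.-tuple E] (fun st => \sum_(z <- st.2) tail_score mY s u z.1).
  apply: (@lmeas_rsum _ E R _ unit (fun _ z => tail_score mY s u z.1)).
  by apply: (measurableT_comp mt); apply: (measurableT_comp measurable_fst); exact: measurable_snd.
by apply: (measurableT_comp mb2R); exact: measurable_fun_ler.
Qed.

Definition estimator_event (l : seq E) : bool :=
  Num.sqrt (k (size l))%:R * (gamma1_hat l (k (size l)) - gamma) <= x.

Lemma lmeas_gamma1_hat : lmeas1 (fun l : seq E => gamma1_hat l (k (size l))).
Proof.
rewrite (_ : (fun _ => _) = (fun l : seq E => gamma1_hat_formula (k (size l)) l)).
  exact: lmeas_gamma1_hat_formula.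
by apply/funext => l; rewrite gamma1_hatE.
Qed.

Lemma lmeas_estimator_event : lmeas1 (fun l => (estimator_event l)%:R : R).
Proof.
have mb2R : measurable_fun setT (fun c : bool => c%:R : R) by [].
move=> j; apply: (measurableT_comp mb2R); apply: measurable_fun_ler => //.
have mg := @lmeas_gamma1_hat j.
apply: (@eq_measurable_fun _ _ _ _ setT (fun st : unit * j.-tuple E =>
   Num.sqrt (k j)%:R * (gamma1_hat st.2 (k (size st.2)) - gamma))).
  by move=> st _ /=; rewrite size_tuple.
by apply: measurable_funM => //; apply: measurable_funB.
Qed.

Let estimator_eventE n l : 0 < Num.sqrt ((k n)%:R : R) -> size l = n ->
  estimator_event l = (gamma1_hat l (k n) <= th n).
Proof.
move=> s0 ln; rewrite /estimator_event ln /th -lerBlDl ler_pdivlMr//.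
by rewrite mulrC.
Qed.

Let cdf01 y : 0 <= normal_cdf (y : R) <= 1.
Proof.
have := @normal_prob_scale R 0 1 y ltr01; rewrite subr0 divr1 => H.
by rewrite -!lee_fin -H measure_ge0 probability_le1.
Qed.

(** Fixes the tolerance on the weights so that the slack moves the normal distribution function by
    at most [e]. *)
Let shift_small e : 0 < e -> exists dlt, 0 < dlt /\ 0 <= score_shift gamma dlt / Num.sqrt v <= e.
Proof.
move=> e0; pose c := 2 * (1 + `|gamma|).
have c0 : 0 < c by rewrite mulr_gt0// ltr_wpDr.
pose dlt := Num.min 1 (e * Num.sqrt v / c).
have d0 : 0 < dlt by rewrite lt_min ltr01/= divr_gt0// mulr_gt0.
have d1 : dlt <= 1 by rewrite ge_min lexx.
have d2 : dlt <= e * Num.sqrt v / c by rewrite ge_min lexx orbT.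
exists dlt; split=> //; apply/andP; split.
  by rewrite divr_ge0 ?(ltW v_gt0)// mulr_ge0 ?addr_ge0 ?sqr_ge0 ?(ltW d0).
rewrite ler_pdivrMr//; move: d2; rewrite ler_pdivlMr// => d2.
apply: le_trans d2; rewrite /score_shift.
have -> : dlt * c = (1 + `|gamma|) * (dlt + dlt) by rewrite /c; ring.
rewrite ler_wpM2l ?addr_ge0// lerD2l expr2 -[leRHS]mulr1.
by rewrite ler_wpM2l// ltW.
Qed.

Let error_small (C e dlt : R) : 0 <= C -> 0 < e -> 0 < dlt ->
  \forall t \near +oo, C / Num.sqrt t / dlt <= e.
Proof.
move=> C0 e0 d0; near=> t.
have B0 : 0 <= C / (e * dlt) by rewrite divr_ge0// mulr_ge0 ?ltW.
have t0 : 0 < t by near: t; exact: near_pinfty_gt.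
have Bt : (C / (e * dlt)) ^+ 2 < t by near: t; exact: near_pinfty_gt.
have st : 0 < Num.sqrt t by rewrite sqrtr_gt0.
have : C / (e * dlt) <= Num.sqrt t.
  by rewrite -(ger0_norm B0) -sqrtr_sqr ler_wsqrtr// ltW.
rewrite ler_pdivrMr ?mulr_gt0// => H.
rewrite ler_pdivrMr// ler_pdivrMr//; apply: le_trans H _.
by rewrite mulrC.
Unshelve. all: by end_near. Qed.

Let near_kap : \forall t \near +oo, (2 * (1 + r))^-1 < kap t.
Proof.
have r0 : 0 < 1 + r by rewrite addr_gt0// mulr_gt0.
have : (2 * (1 + r))^-1 < (1 + r)^-1 by rewrite ltf_pV2 ?posrE ?mulr_gt0// ltr_pMl// ltr1n.
by move: (cvg_kap) => /cvgr_gt; exact.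
Qed.

(** By [observed_tail_mean_ratio] the quantity equals [(1 + 2 * e) / kap t], and [kap] has a
    positive limit. *)
Let rate_bound n t e : (1 < k n < n)%N -> 1 < t -> 0 < e <= 4^-1 -> (2 * (1 + r))^-1 < kap t ->
  q (U t) = (1 + 2 * e) * (k n)%:R * p / n%:R ->
  0 <= n%:R * K (U t) / (p * (k n)%:R * t) <= 4 * (1 + r).
Proof.
move=> kn t1 /andP[e0 e4] kt qU; have [n0 k0] := sizes_gt0 kn.
have t0 : 0 < t by apply: lt_trans t1.
have r0 : 0 < 1 + r by rewrite addr_gt0// mulr_gt0.
have r2 : 0 < 2 * (1 + r) by rewrite mulr_gt0.
have kt0 : 0 < kap t by apply: lt_trans kt; rewrite invr_gt0.
have HE := observed_tail_mean_ratio F_cont F_lt1 F_0 F_1 G_cont K_gt0 t1.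
have idR (N a p' k' t' c : R) : N != 0 -> p' != 0 -> k' != 0 -> t' != 0 -> c != 0 ->
    N * a / (p' * k' * t') = (N * (t'^-1 * a * c) / (p' * k')) / c.
  by move=> h1 h2 h3 h4 h5; field; rewrite ?h1 ?h2 ?h3 ?h4 ?h5.
have idQ (N p' k' c : R) : N != 0 -> p' != 0 -> k' != 0 -> N * (c * k' * p' / N) / (p' * k') = c.
  by move=> h1 h2 h3; field; rewrite ?h1 ?h2 ?h3.
rewrite (@idR _ _ p (k n)%:R t (kap t)) ?gt_eqF// -HE qU idQ ?gt_eqF//.
rewrite divr_ge0 ?(ltW kt0)//=; last by rewrite addr_ge0// mulr_ge0// ltW.
rewrite ler_pdivrMr//.
have : 1 < kap t * (2 * (1 + r)) by rewrite -ltr_pdivrMr// div1r.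
have -> : 4 * (1 + r) * kap t = 2 * (kap t * (2 * (1 + r))) by ring.
lra.
Qed.

(** The order of the choices matters: [dlt] from the continuity of the normal law, then the width
    [e] of the range from the central limit theorem along [size_pairs], and only then the sizes, for
    which the weight error at [dlt] and the Chebyshev terms at [e] are small. The error [eta] is
    shared by these two, the central limit theorem and the slack. *)
Theorem cvg_iter_int_estimator :
  fine (iter_int mu Obs n (fun l => ((estimator_event l)%:R : R)%:E)) / p ^+ n @[n --> FN] -->
  normal_cdf ((1 + r) * (x - lam / (1 - tau)) / Num.sqrt v).
Proof.
have -> : normal_cdf ((1 + r) * (x - lam / (1 - tau)) / Num.sqrt v) = L 0 by rewrite /L add0r.
have mA : measurable (Obs : set E) by exact: measurable_observable.
have muA : mu Obs = p%:E by exact: measure_observed.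
have mD y : measurable (D y : set E) by exact: measurable_observed_tail_set.
have muD y : mu (D y) = (q y)%:E by exact: measure_observed_tail.
apply/cvgrPdist_le => eta eta0; pose h := eta / 4.
have h0 : 0 < h by rewrite divr_gt0.
have [dlt [d0 /andP[sh0 sh1]]] := shift_small h0.
have ss0 : 0 <= score_shift gamma dlt.
  by rewrite /score_shift mulr_ge0 ?addr_ge0 ?sqr_ge0 ?(ltW d0).
have [Lp Lm] := L_lip ss0; set e0 := score_shift gamma dlt in sh0 sh1 ss0 Lp Lm.
have /cvgrPdist_le/(_ _ h0) C1 := @clt 1 dlt.
have /cvgrPdist_le/(_ _ h0) C2 := @clt (- 1) dlt.
have [V [FV [e [e_gt0 e_le HV]]]] : size_pairs _ := filterI C1 C2.
have [C0 [C0_ge0 env]] := envelope_integral.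
have r0 : 0 < 1 + r by rewrite addr_gt0// mulr_gt0.
pose M := C0 * (2 * (4 * (1 + r)) + 4 * C0 + 16).
have M0 : 0 <= M by rewrite mulr_ge0// !addr_ge0// !mulr_ge0// ltW.
have /(_ _ _ _) good := filterI (filterI (nbhs_pinfty_gt (num_real (2 : R))) near_kap)
  (filterI env (error_small M0 h0 d0)).
have c1 : 0 < 1 + 2 * e by rewrite addr_gt0// mulr_gt0.
have c2 : 0 < 1 + e by rewrite addr_gt0.
have c3 : 0 < 1 - e by move: e_le; rewrite subr_gt0; lra.
pose G t := [/\ 2 < t, (2 * (1 + r))^-1 < kap t,
  (\int[@lebesgue_measure R]_(u in I01)
    ((tail_ratio U K t u)^-1 * (1 + log_excess U t u) ^+ 2)%:E <= C0%:E)%E &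
  M / Num.sqrt t / dlt <= h].
have goodG : \forall t \near +oo, G t by apply: filterS good => t [[? ?] [? ?]]; split.
have N0 : \forall n \near FN, G (otime (n%:R / ((1 + 2 * e) * (k n)%:R))) := cvg_time_scaled c1 goodG.
have NV : \forall n \near FN, V n /\ G (otime (n%:R / ((1 + 2 * e) * (k n)%:R))) by apply: filterI.
have N4 : \forall n \near FN, 2 / (e ^+ 2 * (k n)%:R) <= h.
  have [m Hm] : exists m : nat, 2 / (e ^+ 2 * h) < m%:R.
    by exists (Num.truncn (2 / (e ^+ 2 * h))).+1; rewrite truncnS_gt.
  apply: filterS (koo m) => n mn; have kk : m%:R < (k n)%:R :> R by rewrite ltr_nat.
  have k0 : 0 < (k n)%:R :> R by rewrite ltr0n (leq_ltn_trans _ mn).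
  have ee : 0 < e ^+ 2 by rewrite exprn_gt0.
  rewrite ler_pdivrMr ?mulr_gt0//.
  have := lt_trans Hm kk; rewrite ltr_pdivrMr ?mulr_gt0// => /ltW H.
  apply: le_trans H _.
  by have -> : h * (e ^+ 2 * (k n)%:R) = (k n)%:R * (e ^+ 2 * h) by ring.
have N5 : \forall n \near FN, 2 / (e ^+ 2 * (k n)%:R) <= h /\ (1 < k n < n)%N /\ 0 < Num.sqrt ((k n)%:R : R).
  by apply: filterS3 N4 near_k near_sqrt => n.
apply: filterS3 (filterI NV N5) (near_time_scaled c1) (filterI (near_time_scaled c2) (near_time_scaled c3)).
case=> [|m] [[Vn Gm] [errk [kn sk]]]; first by move: kn => /andP[].
move=> [y1 q1] [[_ q2] [_ q3]]; move: Gm; rewrite /G.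
set t1 := otime _ in q1 *; move=> [t2 kt envt err].
set sp := U _ in q2; set sm := U _ in q3.
have t1_gt1 : 1 < t1 by apply: lt_trans t2; rewrite ltr1n.
have /andP[rb0 rb] := @rate_bound m.+1 t1 e kn t1_gt1 (introT andP (conj e_gt0 e_le)) kt q1.
have k0 : (0 < k m.+1)%N by move: kn => /andP[/ltnW].
have klt : (k m.+1 < m.+1)%N by move: kn => /andP[].
have m0 : (0 < m)%N by move: kn => /andP[h1 h2]; exact: leq_trans (leq_trans (ltnW h1) (ltnSE h2)).
have t2' : 2 <= t1 := ltW t2.
have pn : 0 < p ^+ m.+1 by rewrite exprn_gt0.
(* Used for the event with [b = true] and for its complement with [b = false]; the second upper
   bound is the lower bound on the event. *)
have key (b : bool) (f : seq E -> R) (Phi : R) : 0 <= Phi ->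
    (forall t, 1 < t -> in_range mX mY m (k m.+1) e (U t) ->
      fine (iter_int mu (D (U t)) (k m.+1) (fun l =>
        ((score_event mY (k m.+1) (th m.+1) dlt b (U t) l)%:R : R)%:E)) <= Phi * q (U t) ^+ k m.+1) ->
    (forall l, 0 <= f l) -> lmeas1 (fun l => (f l)%:E) ->
    (forall l, size l = m.+1 -> f l = (b == (gamma1_hat l (k m.+1) <= th m.+1)%R)%:R) ->
    (iter_int mu Obs m.+1 (fun l => (f l)%:E) <= (p ^+ m.+1 * (h + h + Phi))%:E)%E.
  move=> Phi0 ev f0 mf fE.
  apply: (@le_trans _ _ (p ^+ m.+1 *
    (C0 * (2 * (m.+1%:R * K (U t1) / (p * (k m.+1)%:R * t1)) + 4 * C0 + 16) / Num.sqrt t1 / dlt +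
    2 / (e ^+ 2 * (k m.+1)%:R) + Phi))%:E).
    exact: (@iter_int_tail_event R mX mY F_cont F_lt1 F_0 F_1 G_cont K_gt0 m (k m.+1) (th m.+1)
      t1 sp sm e dlt C0 Phi b k0 klt m0 e_gt0 d0 t2' q1 q2 q3 envt Phi0 ev f f0 mf fE).
  rewrite lee_fin (ler_pM2l pn) lerD2r lerD//; apply: le_trans err.
  rewrite ler_pM2r ?invr_gt0// ler_pM2r ?invr_gt0 ?sqrtr_gt0 ?(lt_trans _ t1_gt1)//.
  by rewrite ler_wpM2l// !lerD2r ler_pM2l.
have [iE iNE iN] := iter_int_compl m.+1 mA muA lmeas_estimator_event.
have /andP[L01 L02] := cdf01 ((e0 + (1 + r) * (x - lam / (1 - tau))) / Num.sqrt v).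
have /andP[L03 L04] := cdf01 ((- e0 + (1 + r) * (x - lam / (1 - tau))) / Num.sqrt v).
rewrite -/(L e0) in L01 L02; rewrite -/(L (- e0)) in L03 L04.
have mE : lmeas1 (fun l => ((estimator_event l)%:R : R)%:E).
  by move=> j; apply/measurable_EFinP; exact: lmeas_estimator_event.
have mN : lmeas1 (fun l => ((~~ estimator_event l)%:R : R)%:E).
  move=> j; apply/measurable_EFinP.
  apply: (@eq_measurable_fun _ _ _ _ setT (fun st : unit * j.-tuple E => 1 - ((estimator_event st.2)%:R : R))).
    by move=> st _ /=; case: (estimator_event _); rewrite ?subrr ?subr0.
  by apply: measurable_funB => //; exact: lmeas_estimator_event.
have P1 : 0 <= L e0 + h by rewrite addr_ge0// ltW.
have P2 : 0 <= 1 - L (- e0) + h by rewrite addr_ge0 ?subr_ge0// ltW.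
have U1 := key true _ _ P1 _ (fun l => ler0n R (estimator_event l)) mE _.
have U2 := key false _ _ P2 _ (fun l => ler0n R (~~ estimator_event l)) mN _.
have {}U1 : fine (iter_int mu Obs m.+1 (fun l => ((estimator_event l)%:R : R)%:E)) <= p ^+ m.+1 * (h + h + (L e0 + h)).
  rewrite -lee_fin -iE; apply: U1.
  - move=> t tt1 rg; have [+ _] := HV _ _ Vn tt1 rg; rewrite /= mul1r -/e0 => H.
    rewrite -ler_pdivrMr ?exprn_gt0//; move: H; rewrite ler_distlC => /andP[_ H].
    have {1}-> : score_event mY (k m.+1) (th m.+1) dlt true (U t) = fun l =>
      (\sum_(z <- l) tail_score mY (U t) (th m.+1) z.1 <= 1 * score_shift (th m.+1) dlt * Num.sqrt (k m.+1)%:R).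
      by apply/funext => l; rewrite /score_event mul1r eq_sym eqb_id.
    exact: H.
  - by move=> l ln; rewrite (estimator_eventE sk ln) eq_sym eqb_id.
have {}U2 : p ^+ m.+1 - fine (iter_int mu Obs m.+1 (fun l => ((estimator_event l)%:R : R)%:E)) <= p ^+ m.+1 * (h + h + (1 - L (- e0) + h)).
  rewrite -iN -lee_fin -iNE; apply: U2.
  - move=> t tt1 rg; have [_ +] := HV _ _ Vn tt1 rg; rewrite /= mulN1r -/e0 => H.
    have qk : 0 < q (U t) ^+ k m.+1 by rewrite exprn_gt0.
    move: H; rewrite ler_distlC => /andP[H _].
    have -> : score_event mY (k m.+1) (th m.+1) dlt false (U t) = fun l =>
      ~~ (\sum_(z <- l) tail_score mY (U t) (th m.+1) z.1 <= -1 * score_shift (th m.+1) dlt * Num.sqrt (k m.+1)%:R).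
      by apply/funext => l; rewrite /score_event mulN1r eq_sym eqbF_neg.
    have [_ _ ->] := iter_int_compl (k m.+1) (mD (U t)) (muD (U t))
      (mevent (U t) (th m.+1) (-1 * score_shift (th m.+1) dlt * Num.sqrt (k m.+1)%:R)).
    have idA (a b c : R) : (1 - a + b) * c = c - (a - b) * c by ring.
    by rewrite idA lerB// -ler_pdivlMr.
  - by move=> l ln; rewrite (estimator_eventE sk ln) eq_sym eqbF_neg.
rewrite ler_distlC; set W := fine _ in U1 U2 *.
rewrite ler_pdivrMr// ler_pdivlMr//.
have eE : eta = 4 * h by rewrite /h mulrC divfK.
have b1 : h + h + (L e0 + h) <= L 0 + eta by rewrite eE; lra.
have b2 : h + h + (1 - L (- e0) + h) <= 1 - (L 0 - eta) by rewrite eE; lra.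
have B1 := le_trans U1 (ler_wpM2l (ltW pn) b1).
have B2 := le_trans U2 (ler_wpM2l (ltW pn) b2).
rewrite [_ * p ^+ _]mulrC [(L 0 + _) * _]mulrC B1 andbT.
by move: B2; rewrite mulrBr mulr1 lerD2l lerN2.
Qed.

End sizes.
End limit_along_sizes.

(** * Laws of the random variables of the model *)

Section laws_of_random_variables.
Context d (T : measurableType d) (R : realType) (P : probability T R).

Definition borel_rv (X : {RV P >-> R}) : T -> measurableTypeR R := X.
Lemma measurable_borel_rv X : measurable_fun setT (borel_rv X).
Proof. exact: (@measurable_funPT _ _ _ _ X). Qed.
HB.instance Definition _ X := isMeasurableFun.Build _ _ _ _ (borel_rv X) (@measurable_borel_rv X).
Definition rv_law X : probability (measurableTypeR R) R := distribution P (borel_rv X).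

Definition borel_rv_pair (X Y : {RV P >-> R}) (w : T) : measurableTypeR R * measurableTypeR R :=
  (borel_rv X w, borel_rv Y w).
Lemma measurable_borel_rv_pair X Y : measurable_fun setT (borel_rv_pair X Y).
Proof. by apply: measurable_fun_pair; exact: measurable_borel_rv. Qed.
HB.instance Definition _ X Y :=
  isMeasurableFun.Build _ _ _ _ (borel_rv_pair X Y) (@measurable_borel_rv_pair X Y).

Lemma joint_law (X Y : {RV P >-> R}) (B : set (R * R)) : independent_RV X Y -> measurable B ->
  P ((fun w => (X w, Y w)) @^-1` B) = pair_law (rv_law X) (rv_law Y) B.
Proof.
move=> indep mB.
have mB' : measurable (@borel_pair R @^-1` B).
  by have := @measurable_borel_pair R measurableT _ mB; rewrite setTI.
have H := @product_measure_unique _ _ _ _ R (rv_law X) (rv_law Y)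
  (distribution P (borel_rv_pair X Y)) _ _ mB'.
by symmetry; apply: H => A C mA mC; exact: indep.
Qed.

(** Below 0 the event is empty, and continuity excludes an atom at 0. *)
Lemma real_cdf_nonneg (X : {RV P >-> R}) : (forall w, 0 <= X w) -> continuous (real_cdf X) ->
  forall x, x <= 0 -> real_cdf X x = 0.
Proof.
move=> X0 cX.
have neg x : x < 0 -> real_cdf X x = 0.
  move=> x0; rewrite /real_cdf /cdf /distribution /pushforward.
  rewrite (_ : _ @^-1` _ = set0) ?measure0//.
  apply/seteqP; split=> // w /=; rewrite in_itv/= => H.
  by have := le_lt_trans (X0 w) (le_lt_trans H x0); rewrite ltxx.
move=> x; rewrite le_eqVlt => /predU1P[->|/neg//].
have F0 : 0 <= real_cdf X 0 by rewrite fine_ge0.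
apply/eqP; rewrite eq_le F0 andbT leNgt; apply/negP => e0.
have /cvgrPdist_lt/(_ _ e0)/nbhs_ballP[dl /= dl0 H] := @cX 0.
have dl2 : 0 < dl / 2 by rewrite divr_gt0.
have := H (- (dl / 2)); rewrite /ball/= sub0r opprK gtr0_norm// ltr_pdivrMr// ltr_pMr// ltr1n.
move=> /(_ isT); rewrite (neg (- (dl / 2))) ?oppr_lt0// subr0 gtr0_norm//.
by rewrite ltxx.
Qed.

Lemma cvg_real_cdf (X : {RV P >-> R}) : real_cdf X x @[x --> +oo] --> (1 : R).
Proof. by have /fine_cvgP[_] := cvg_cdfy1 X. Qed.

Lemma survival_real_cdf_ge0 (X : {RV P >-> R}) x : 0 <= survival (real_cdf X) x.
Proof.
rewrite subr_ge0 -lee_fin fineK ?probability_le1// fin_num_measure//.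
Qed.

End laws_of_random_variables.

(** * From deterministic sizes to the random number of observations *)

Section binomial_mixture.
Context {R : realType}.
Variable p : R.
Hypotheses (p_gt0 : 0 < p) (p_le1 : p <= 1).

Definition binomial_weight N n : R := 'C(N, n)%:R * (1 - p) ^+ (N - n) * p ^+ n.
Local Notation w := binomial_weight.

Lemma binomial_weight_ge0 N n : 0 <= w N n.
Proof. by rewrite !mulr_ge0 ?exprn_ge0// ?subr_ge0// ltW. Qed.

Lemma sum_binomial_weight N : \sum_(0 <= n < N.+1) w N n = 1.
Proof.
have := exprDn (1 - p) p N; rewrite subrK expr1n => ->.
rewrite big_mkord; apply: eq_bigr => i _.
by rewrite /w -mulrA mulr_natl.
Qed.

(** For a function of the random size, convergence in probability becomes plain convergence along
    this filter, so the assumptions on [k] can be used as if the size were deterministic. *)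
Definition binomial_sizes : set_system nat :=
  [set V | \sum_(0 <= n < N.+1) w N n * (~~ `[< V n >])%:R @[N --> \oo] --> (0 : R)].

Let mass_ge0 (c : nat -> bool) N : 0 <= \sum_(0 <= n < N.+1) w N n * (c n)%:R.
Proof. by apply: sumr_ge0 => n _; rewrite mulr_ge0// binomial_weight_ge0. Qed.

Let squeeze0 (f g : nat -> R) : (forall N, 0 <= f N <= g N) ->
  g N @[N --> \oo] --> (0 : R) -> f N @[N --> \oo] --> (0 : R).
Proof.
move=> fg g0; apply: (@squeeze_cvgr _ \oo _ R (fun=> 0) g f) => //; last exact: cvg_cst.
by apply: nearW => N; exact: fg.
Qed.

Lemma binomial_sizes_filter : ProperFilter binomial_sizes.
Proof.
split; last split.
- rewrite /binomial_sizes/= => H.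
  have : (fun=> 1 : R) N @[N --> \oo] --> (0 : R).
    apply: cvg_trans H; apply: near_eq_cvg; apply: nearW => N.
    rewrite -[RHS](sum_binomial_weight N); apply: eq_bigr => n _.
    by rewrite (_ : `[< _ >] = false) ?mulr1//; apply/asboolP.
  move=> /cvgrPdist_lt/(_ _ (@ltr01 R))/filter_ex[N].
  by rewrite sub0r normrN normr1 ltxx.
- rewrite /binomial_sizes/=; apply: lim_eq (cvg_cst (0 : R)).
  apply: nearW => N; rewrite big1// => n _.
  by rewrite (_ : `[< _ >] = true) ?mulr0//; apply/asboolP.
- move=> V V' HV HV'.
  have /(_ _ _) H := lim_add HV HV'; rewrite addr0 in H.
  apply: squeeze0 H => N; rewrite mass_ge0 -big_split/=.
  apply: ler_sum => n _; rewrite -mulrDr ler_wpM2l ?binomial_weight_ge0// asbool_and.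
  by case: `[< V n >]; case: `[< V' n >] => /=; lra.
- move=> V V' VV' HV; apply: squeeze0 HV => N; rewrite mass_ge0.
  apply: ler_sum => n _; rewrite ler_wpM2l ?binomial_weight_ge0//.
  case: (asboolP (V n)) => [/VV' h|_] /=; last by rewrite ler_nat leq_b1.
  by rewrite (_ : `[< V' n >] = true)//; apply/asboolP.
Qed.

#[local] Existing Instance binomial_sizes_filter.

(** On the exceptional sizes the distance is only bounded by 1, but their binomial mass vanishes. *)
Lemma cvg_binomial_mixture (g : nat -> R) (l : R) : (forall n, `|g n - l| <= 1) ->
  g n @[n --> binomial_sizes] --> l -> \sum_(0 <= n < N.+1) w N n * g n @[N --> \oo] --> l.
Proof.
move=> g1 gl; apply/cvgrPdist_le => e e0.
have e2 : 0 < e / 2 by rewrite divr_gt0.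
have V0 : binomial_sizes [set n | `|l - g n| <= e / 2] by move/cvgrPdist_le: gl => /(_ _ e2).
move: V0 => /cvgr0Pnorm_le/(_ _ e2); apply: filterS => N.
set B := \sum_(_ <= _ < _) _ => HB.
have -> : l = \sum_(0 <= n < N.+1) w N n * l by rewrite -big_distrl/= sum_binomial_weight mul1r.
rewrite -sumrB; under eq_bigr do rewrite -mulrBr.
apply: le_trans (ler_norm_sum _ _ _) _.
apply: (@le_trans _ _ (\sum_(0 <= n < N.+1) (w N n * (e / 2) + w N n * (~~ `[< `|l - g n| <= e / 2 >])%:R))).
  apply: ler_sum => n _; rewrite normrM (ger0_norm (binomial_weight_ge0 _ _)) -mulrDr.
  rewrite ler_wpM2l ?binomial_weight_ge0//.
  case: asboolP => [h|_] /=; first by rewrite addr0.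
  by rewrite distrC (le_trans (g1 n))// lerDr ltW.
rewrite big_split/= -big_distrl/= sum_binomial_weight mul1r.
by rewrite [leRHS](splitr e) lerD2l (le_trans _ HB)// ler_norm.
Qed.

End binomial_mixture.

(** * The observed sample as a thinned i.i.d. sample *)

Section observed_samples.
Context d (T : measurableType d) (R : realType) (P : probability T R).
Local Notation E := (R * R)%type.
Variables (X Y : {RV P >-> R}) (Xs Ys : nat -> {RV P >-> R}).
Hypothesis model : truncation_model X Y Xs Ys.
Local Notation mX := (rv_law X).
Local Notation mY := (rv_law Y).
Local Notation mu := (pair_law mX mY).
Local Notation Obs := [set z : E | z.1 <= z.2].
Local Notation p := (observed_mass mX mY).
Hypotheses (p_gt0 : 0 < p) (p_le1 : p <= 1).
Let Z i w : E := (Xs i w, Ys i w).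

Let mZ i : measurable_fun setT (Z i).
Proof. by apply: measurable_fun_pair; exact: measurable_funPT. Qed.

Let indepXY : independent_RV X Y. Proof. by case: model. Qed.

Let lawZ i (B : set E) : measurable B -> P (Z i @^-1` B) = mu B.
Proof.
by move=> mB; case: model => _ _ _ _ /(_ i B mB) ->; exact: joint_law.
Qed.

Let observed_sampleE N w :
  observed_sample Xs Ys N w = [seq z <- [seq Z i w | i <- iota 0 N] | z.1 <= z.2].
Proof. by rewrite filter_map. Qed.

Let mobs : measurable_fun setT (fun z : E => z.1 <= z.2).
Proof. by apply: measurable_fun_ler; [exact: measurable_fst|exact: measurable_snd]. Qed.

Let unobserved : mu (setT `&` [set z : E | ~~ (z.1 <= z.2)]) = (1 - p)%:E.
Proof.
rewrite setTI (_ : [set z : E | ~~ _] = ~` Obs); last by apply/seteqP; split=> z /= /negP.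
rewrite probability_setC; last exact: measurable_observable.
by rewrite measure_observed.
Qed.

Lemma measurable_observed_sample dU (U : measurableType dU) (f : seq E -> U) N :
  lmeas1 f -> measurable_fun setT (fun w => f (observed_sample Xs Ys N w)).
Proof.
move=> mf; have mff := @lmeas1_filter _ E _ U (fun z => z.1 <= z.2) f mobs mf N.
pose V (w : T) : N.-tuple E := map_tuple (Z^~ w) (iota_tuple N 0).
have mV : measurable_fun setT V.
  apply/measurable_fun_tnthP => i; rewrite (_ : _ \o _ = Z i); first exact: mZ.
  by apply/funext => w /=; rewrite tnth_map (tnth_nth 0%N)/= nth_iota.
have mtV : measurable_fun setT (fun w => (tt, V w)) by apply: measurable_fun_pair.
rewrite (_ : (fun w => _) = (fun st : unit * N.-tuple E => f [seq z <- st.2 | z.1 <= z.2]) \o (fun w => (tt, V w))).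
  exact: (measurableT_comp mff mtV).
by apply/funext => w /=; rewrite observed_sampleE.
Qed.

(** The full sample is i.i.d. and observation is a thinning; dividing by [p ^+ n] exhibits the
    conditional probability given the size, mixed with the binomial law of the size. *)
Lemma prob_observed_sample (b : seq E -> bool) N : lmeas1 (fun l => (b l)%:R : R) ->
  P [set w | b (observed_sample Xs Ys N w)] =
  (\sum_(0 <= n < N.+1) binomial_weight p N n *
     (fine (iter_int mu Obs n (fun l => ((b l)%:R : R)%:E)) / p ^+ n))%:E.
Proof.
move=> mb.
have mbE : lmeas1 (fun l => ((b l)%:R : R)%:E) by move=> j; apply/measurable_EFinP; exact: mb.
have mA : measurable [set w | b (observed_sample Xs Ys N w)].
  have := measurable_observed_sample N mb measurableT (measurable_set1 (1 : R)); rewrite setTI.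
  rewrite (_ : _ @^-1` _ = [set w | b (observed_sample Xs Ys N w)])//.
  apply/seteqP; split=> w /=; case: (b _) => // /eqP; rewrite eq_sym oner_eq0//.
have muA : mu Obs = p%:E by exact: measure_observed.
have mObs : measurable (Obs : set E) by exact: measurable_observable.
transitivity (\int[P]_w (\1_[set w | b (observed_sample Xs Ys N w)] w)%:E)%E.
  by rewrite integral_indic// setIT.
transitivity (\int[P]_w ((b [seq z <- [seq Z i w | i <- iota 0 N] | z.1 <= z.2])%:R : R)%:E)%E.
  by apply: eq_integral => w _; rewrite -observed_sampleE indicE mem_setE.
have f0 l : (0 <= ((b l)%:R : R)%:E)%E by rewrite lee_fin.
have indepZ : mutually_independent P Z by case: model.
have mff := @lmeas1_filter _ E _ _ (fun z => z.1 <= z.2) _ mobs mbE.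
rewrite (integral_sample mZ indepZ lawZ 0 N (fun l => f0 [seq z <- l | z.1 <= z.2]) mff).
rewrite (iter_int_filter N measurableT mobs unobserved f0 mbE) -sumEFin.
apply: eq_bigr => n _; have [iE _ _] := iter_int_compl n mObs muA mb.
rewrite setTI iE -EFinM /binomial_weight; congr (_%:E).
have pn : p ^+ n != 0 by rewrite expf_neq0// gt_eqF.
by rewrite -[RHS]mulrA [p ^+ n * _]mulrC divfK.
Qed.

Lemma iter_int_size (b : nat -> bool) n :
  fine (iter_int mu Obs n (fun l => ((b (size l))%:R : R)%:E)) / p ^+ n = (b n)%:R.
Proof.
have mObs : measurable (Obs : set E) by exact: measurable_observable.
have -> : iter_int mu Obs n (fun l => ((b (size l))%:R : R)%:E) =
    iter_int mu Obs n (fun=> ((b n)%:R : R)%:E) by apply: eq_iter_int => l ->.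
have muA := measure_observed mX mY.
rewrite iter_int_cst// ?lee_fin// [X in (X ^+ n)%E](_ : _ = p%:E)// -EFin_expe -EFinM/=.
by rewrite mulfK// expf_neq0// gt_eqF.
Qed.

(** For an event that depends on the size only, the conditional probability is an indicator, so its
    probability is the binomial mass that defines the filter. *)
Lemma near_observed_size (b : nat -> bool) :
  P [set w | b (observed_size Xs Ys N w)] @[N --> \oo] --> 0%E ->
  \forall n \near binomial_sizes p, ~~ b n.
Proof.
have mb : lmeas1 (fun l : seq E => (b (size l))%:R : R).
  move=> j; apply: (@eq_measurable_fun _ _ _ _ setT (fun _ : unit * j.-tuple E => (b j)%:R : R)) => //.
  by move=> st _ /=; rewrite size_tuple.
move=> /fine_cvgP[_] H; rewrite /prop_near1 /nbhs /= /binomial_sizes /=.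
apply: cvg_trans H; apply: near_eq_cvg; apply: nearW => N /=.
rewrite (prob_observed_sample N mb)/=; apply: eq_bigr => n _; rewrite iter_int_size.
by congr (_ * _%:R); case: asboolP => [/negbTE ->|/negP/negPn ->].
Qed.

Lemma observed_cdfE : observed_cdf X Y = observed_law_cdf mX mY.
Proof.
apply/funext => x; rewrite /observed_cdf /observed_law_cdf.
have mObs : measurable (Obs : set E) by exact: measurable_observable.
have mx : measurable [set z : E | z.1 <= x].
  by apply: measurable_set_pred; apply: measurable_fun_ler => //; exact: measurable_fst.
have mI : measurable (Obs `&` [set z : E | z.1 <= x]) by exact: measurableI.
have -> : [set w | X w <= x /\ X w <= Y w] = (fun w => (X w, Y w)) @^-1` (Obs `&` [set z : E | z.1 <= x]).
  by apply/seteqP; split=> w /= [].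
rewrite (joint_law indepXY mI) measure_observed_le.
rewrite -[X in P X]/((fun w => (X w, Y w)) @^-1` Obs) (joint_law indepXY mObs) measure_observed/=.
by rewrite mulrBl divff// gt_eqF.
Qed.

End observed_samples.

(** * Asymptotic normality of the estimator under random truncation *)

Theorem corollary3p1 (R : realType) (d : measure_display)
  (T : measurableType d) (P : probability T R)
  (X Y : {RV P >-> R}) (Xs Ys : nat -> {RV P >-> R})
  (hmodel : truncation_model X Y Xs Ys)
  (gamma1 gamma2 : R) (hg1 : 0 < gamma1) (hg2 : 0 < gamma2)
  (hFbar : regularly_varying (survival (real_cdf X)) (- 1 / gamma1))
  (hGbar : regularly_varying (survival (real_cdf Y)) (- 1 / gamma2))
  (hg12 : gamma1 < gamma2)
  (k : nat -> nat)
  (hk : forall n, (2 < n)%N -> (1 < k n < n)%N)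
  (hkoo : dvg_in_probability P (fun N w => k (observed_size Xs Ys N w)))
  (hkn : cvg_in_probability P
    (fun N w => (k (observed_size Xs Ys N w))%:R
                / (observed_size Xs Ys N w)%:R) 0)
  (tau1 tau2 : R) (htau1 : tau1 < 0) (htau2 : tau2 < 0)
  (AF AG : R -> R)
  (hAF : second_order_auxiliary AF tau1)
  (hAG : second_order_auxiliary AG tau2)
  (hUF : second_order_condition (tail_quantile (real_cdf X)) gamma1 tau1 AF)
  (hUG : second_order_condition (tail_quantile (real_cdf Y)) gamma2 tau2 AG) :
  let gamma := gamma1 * gamma2 / (gamma1 + gamma2) in
  let sigma2 := gamma ^+ 2 * (1 + gamma1 / gamma2)
                * (1 + (gamma1 / gamma2) ^+ 2) / (1 - gamma1 / gamma2) ^+ 3 in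
  exists A0 : R -> R,
    asymp_equiv A0 (fun t =>
      AF (1 / survival (real_cdf X) (tail_quantile (observed_cdf X Y) t)))
    /\
    forall lambda : R,
      cvg_in_probability P
        (fun N w => let n := observed_size Xs Ys N w in
           Num.sqrt (k n)%:R * A0 (n%:R / (k n)%:R)) lambda ->
      cvg_in_distribution P
        (fun N w => let n := observed_size Xs Ys N w in
           Num.sqrt (k n)%:R
           * (gamma1_hat (observed_sample Xs Ys N w) (k n) - gamma1))
        (normal_prob (lambda / (1 - tau1)) (Num.sqrt sigma2)).
Proof.
have [[X0 Y0] indep [cX cY] _ _] := hmodel.
move=> g sigma2; pose mX := rv_law X; pose mY := rv_law Y.
pose alpha := gamma2^-1; pose r := gamma1 * alpha.
have alpha0 : 0 < alpha by rewrite invr_gt0.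
have r_lt1 : gamma1 * alpha < 1 by rewrite ltr_pdivrMr// mul1r.
have r0 : 0 < 1 + r by rewrite addr_gt0// mulr_gt0.
have K_rv : regularly_varying (survival (law_cdf mY)) (- alpha).
  by move: hGbar; rewrite mulN1r.
have F_rv : regularly_varying (survival (law_cdf mX)) (- gamma1^-1).
  by move: hFbar; rewrite mulN1r.
have ni (V : {RV P >-> R}) x y : x <= y -> survival (real_cdf V) y <= survival (real_cdf V) x.
  by move=> xy; rewrite lerB//; exact: (law_cdf_nd (rv_law V)).
have K_gt0 x : 0 < survival (law_cdf mY) x.
  exact: (regularly_varying_gt0 (ni Y) (@survival_real_cdf_ge0 _ _ _ P Y) K_rv).
have F_gt0 x : 0 < survival (law_cdf mX) x.
  exact: (regularly_varying_gt0 (ni X) (@survival_real_cdf_ge0 _ _ _ P X) F_rv).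
have F_lt1 x : law_cdf mX x < 1 by rewrite -subr_gt0; exact: F_gt0.
have F_0 x : x <= 0 -> law_cdf mX x = 0 by exact: (real_cdf_nonneg X0 cX).
have F_1 : law_cdf mX x @[x --> +oo] --> (1 : R) := cvg_real_cdf X.
have F_cont : continuous (law_cdf mX) := cX.
have G_cont : continuous (law_cdf mY) := cY.
have p_gt0 := observed_mass_gt0 F_lt1 F_0 F_1 G_cont K_gt0.
have p_le1 : observed_mass mX mY <= 1 by exact: observed_mass_le1.
have [AF0 _ _] := hAF.
set p := observed_mass mX mY in p_gt0 p_le1.
have FF : ProperFilter (binomial_sizes p) := binomial_sizes_filter p_gt0 p_le1.
have Ff : Filter (binomial_sizes p) := @filter_filter _ _ FF.
have FS (V V' : nat -> Prop) : (forall n, V n -> V' n) -> (\forall n \near binomial_sizes p, V n) ->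
    \forall n \near binomial_sizes p, V' n.
  by move=> VV'; apply: (@filterS _ _ Ff).
(* The function to which [A0] must be equivalent is taken for [A0] itself; equivalence then amounts
   to its being eventually nonzero. *)
pose A0 t := AF (observed_time mX mY t).
have A0E : A0 = fun t => AF (1 / survival (real_cdf X) (tail_quantile (observed_cdf X Y) t)).
  by apply/funext => t; rewrite /A0 /observed_time div1r (observed_cdfE hmodel p_gt0).
exists A0; split.
  rewrite -A0E /asymp_equiv.
  have An : \forall t \near +oo, A0 t != 0.
    exact: (cvg_observed_time F_cont F_lt1 F_0 F_1 G_cont K_gt0 (auxiliary_neq0 htau1 hUF)).
  apply: lim_eq (cvg_cst (1 : R)).
  by apply: filterS An => t At; rewrite divff.
move=> lambda hlam.
have koo m : \forall n \near binomial_sizes p, (m < k n)%N.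
  have : \forall n \near binomial_sizes p, ~~ (k n <= m)%N :=
    @near_observed_size _ _ _ _ _ _ _ _ hmodel p_gt0 (fun n => (k n <= m)%N) (hkoo m).
  by apply: FS => n; rewrite -ltnNge.
have kn0 : (k n)%:R / n%:R @[n --> binomial_sizes p] --> (0 : R).
  apply/cvgrPdist_lt => e e0.
  have : \forall n \near binomial_sizes p, ~~ (e <= `|(k n)%:R / n%:R - 0|) :=
    @near_observed_size _ _ _ _ _ _ _ _ hmodel p_gt0 (fun n => e <= `|(k n)%:R / n%:R - 0|) (hkn e e0).
  by apply: FS => n; rewrite -ltNge distrC.
have hlam' : Num.sqrt (k n)%:R * AF (size_time mX mY k n) @[n --> binomial_sizes p] --> lambda.
  apply/cvgrPdist_lt => e e0.
  have : \forall n \near binomial_sizes p, ~~ (e <= `|Num.sqrt (k n)%:R * A0 (n%:R / (k n)%:R) - lambda|) :=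
    @near_observed_size _ _ _ _ _ _ _ _ hmodel p_gt0
    (fun n => e <= `|Num.sqrt (k n)%:R * A0 (n%:R / (k n)%:R) - lambda|) (hlam e e0).
  by apply: FS => n; rewrite -ltNge distrC.
split.
  move=> N; have mg : lmeas1 (fun l : seq (R * R) =>
      Num.sqrt (k (size l))%:R * (gamma1_hat l (k (size l)) - gamma1)).
    move=> j; apply: (@eq_measurable_fun _ _ _ _ setT (fun st : unit * j.-tuple (R * R)%type =>
      Num.sqrt (k j)%:R * (gamma1_hat st.2 (k (size st.2)) - gamma1))).
      by move=> st _ /=; rewrite size_tuple.
    have mh := @lmeas_gamma1_hat R k j.
    by apply: measurable_funM => //; apply: measurable_funB.
  exact: (measurable_observed_sample Xs Ys N mg).
move=> x _.
have v0 := score_variance_gt0 hg1 alpha0 r_lt1; set v := score_variance gamma1 alpha in v0.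
(* Solving for the estimator divides the standard deviation of a score by [1 + r], the slope of its
   mean in [th] up to sign; this accounts for the difference between [score_variance] and
   [sigma2]. *)
have sE : Num.sqrt sigma2 = Num.sqrt v / (1 + r).
  have gE : g = gamma1 / (1 + r).
    rewrite /g /r /alpha; field.
    by rewrite !gt_eqF ?addr_gt0.
  have idv (a b c e : R) : b != 0 -> (a / b) ^+ 2 * b * c * e = b * a ^+ 2 * c * e / b ^+ 2.
    by move=> b0; field.
  have -> : sigma2 = v / (1 + r) ^+ 2.
    by rewrite /sigma2 gE; exact: (idv _ _ _ _ (lt0r_neq0 r0)).
  rewrite sqrtrM ?(ltW v0)// sqrtrV ?sqr_ge0// sqrtr_sqr gtr0_norm//.
have s0 : 0 < Num.sqrt sigma2 by rewrite sE divr_gt0// sqrtr_gt0.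
rewrite normal_prob_scale// sE.
pose m := lambda / (1 - tau1).
have -> : (x - m) / (Num.sqrt v / (1 + r)) = (1 + r) * (x - m) / Num.sqrt v.
  by rewrite invf_div mulrA [(x - m) * _]mulrC.
set l := normal_cdf _.
pose S n := fine (iter_int (pair_law mX mY) [set z | z.1 <= z.2] n
  (fun s => ((estimator_event gamma1 k x s)%:R : R)%:E)) / p ^+ n.
have mev : lmeas1 (fun s : seq (R * R) => (estimator_event gamma1 k x s)%:R : R).
  exact: lmeas_estimator_event.
have Sl : S n @[n --> binomial_sizes p] --> l.
  exact: (@cvg_iter_int_estimator R mX mY F_cont F_lt1 F_0 F_1 G_cont K_gt0 AF gamma1 tau1 alpha
    htau1 hg1 alpha0 r_lt1 AF0 hUF K_rv _ FF k hk koo kn0 x lambda hlam').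
have l01 : 0 <= l <= 1.
  have := @normal_prob_scale R 0 1 ((1 + r) * (x - m) / Num.sqrt v) ltr01.
  by rewrite subr0 divr1 -/l => H; rewrite -!lee_fin -H measure_ge0 probability_le1.
have S01 n : 0 <= S n <= 1.
  have mObs : measurable ([set z | z.1 <= z.2] : set (R * R)) by exact: measurable_observable.
  have [_ _ H] := iter_int_compl n mObs (measure_observed mX mY) mev.
  have pn : 0 < p ^+ n by rewrite exprn_gt0.
  rewrite /S divr_ge0 ?(ltW pn)//=; last by apply: fine_ge0; apply: iter_int_ge0 => s; rewrite lee_fin.
  rewrite ler_pdivrMr// mul1r -subr_ge0 -H.
  by apply: fine_ge0; apply: iter_int_ge0 => s; rewrite lee_fin.
have Sd n : `|S n - l| <= 1.
  by move: (S01 n) l01 => /andP[a b] /andP[c e]; rewrite ler_norml; apply/andP; split; lra.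
have H := cvg_binomial_mixture p_gt0 p_le1 Sd Sl.
rewrite (_ : (fun N => P _) = (fun N => (\sum_(0 <= n < N.+1) binomial_weight p N n * S n)%:E)); last first.
  by apply/funext => N; exact: (prob_observed_sample hmodel p_gt0 N mev).
by apply/fine_cvgP; split; [exact: nearW|exact: H].
Qed.
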